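(* Let $(\mathcal N,D_0)$ be an odd unbounded $\theta$-summable Breuer-Fredholm module for the Banach $*$-algebra $\mathcal A$. For any $\epsilon>0$ define a one-form $\alpha^\epsilon$ on $\mathcal M_0=D_0+\mathcal N_{sa}$ by $$\alpha^\epsilon(X)=\sqrt{\frac\epsilon\pi}\,\tau\big(Xe^{-\epsilon D^2}\big)$$ for $D\in\mathcal M_0$ and $X\in T_D(\mathcal M_0)=\mathcal N_{sa}$. Then the integral of $\alpha^\epsilon$ is independent of the piecewise $C^1$ path in $\mathcal M_0$, and if $\{D_t\}_{t\in[a,b]}$ is any piecewise $C^1$ path in $\mathcal M_0$ then $$sf(D_a,D_b)=\sqrt{\frac\epsilon\pi}\int_a^b\tau\big(D_t'\,e^{-\epsilon D_t^2}\big)dt+\tfrac12\eta_\epsilon(D_b)-\tfrac12\eta_\epsilon(D_a)+\tfrac12\tau\big([\ker(D_b)]-[\ker(D_a)]\big).$$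
   Context: $\mathcal N$ is a semifinite von Neumann algebra (separable predual) with faithful normal semifinite trace $\tau$; $\mathcal N_{sa}$ is its self-adjoint part with the operator norm, and $C^1$ paths $D_t=D_0+A_t$ in $\mathcal M_0$ mean $t\mapsto A_t$ is $C^1$ in operator norm, $D_t'=A_t'$. An odd unbounded $\theta$-summable Breuer-Fredholm module $(\mathcal N,D_0)$ for $\mathcal A$: $\mathcal A$ is continuously represented in $\mathcal N$, $D_0$ is an unbounded self-adjoint operator affiliated with $\mathcal N$, $[D_0,a]\in\mathcal N$ for a dense set of $a\in\mathcal A$, and $\tau(e^{-tD_0^2})<\infty$ for all $t>0$ (equivalently, $\mu_t((1+D_0^2)^{-1})=o(1/\log t)$ as $t\to\infty$, where $\mu_t$ are the generalized singular values with respect to $\tau$). $\eta_\epsilon(D)=\frac1{\sqrt\pi}\int_\epsilon^\infty\tau(De^{-tD^2})t^{-1/2}dt$ (convergent for $D\in\mathcal M_0$). $[\ker(D)]$ is the projection onto $\ker D$. Spectral flow: $sf(D_a,D_b)$ is the spectral flow of the path $F_{D_t}=D_t(1+D_t^2)^{-1/2}$, a norm-continuous path of self-adjoint Breuer-Fredholm operators lying in $F_{D_0}+\mathcal K_{\mathcal N}$ ($\mathcal K_{\mathcal N}$ = norm-closed two-sided ideal generated by the elements of finite trace). For such a path, with $P_t=\chi_{[0,\infty)}(F_{D_t})$, it equals $\operatorname{ind}(P_aP_b)=\tau([\operatorname{ran}P_b\cap\ker P_a])-\tau([\ker P_b\cap\operatorname{ran}P_a])$, the index of $P_aP_b:\operatorname{ran}P_b\to\operatorname{ran}P_a$.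 *)

(* Defs.v *)
(* MathComp-Analysis; real-closed's R[i] for the complex numbers, and the
   Hermitian forms {dot H for conjC} of algebra/sesquilinear.v, which are linear
   in the first argument and conjugate-linear in the second. *)
From HB Require Import structures.
From mathcomp Require Import all_boot all_order all_algebra.
From mathcomp Require Import sesquilinear complex.
From mathcomp Require Import all_classical all_reals all_analysis.
Set Implicit Arguments.
Unset Strict Implicit.
Unset Printing Implicit Defensive.
Import Order.TTheory GRing.Theory Num.Theory.
Import numFieldNormedType.Exports.

Local Open Scope classical_set_scope.
Local Open Scope complex_scope.
Local Open Scope ring_scope.

Section ComplexIntegral.
Variable R : realType.
Implicit Types (I : set R) (f : R -> R[i]).

Definition cintegrable I f : Prop :=
  lebesgue_measure.-integrable I (EFin \o (fun t => complex.Re (f t))) /\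
  lebesgue_measure.-integrable I (EFin \o (fun t => complex.Im (f t))).

Definition cint I f : R[i] :=
  (\int[lebesgue_measure]_(t in I) complex.Re (f t)) +i*
  (\int[lebesgue_measure]_(t in I) complex.Im (f t)).

End ComplexIntegral.

(* Operators are plain functions H -> H, with their pointwise sums and
   multiples. *)
Section HilbertSpace.
Variables (R : realType) (H : completeNormedModType R[i]).
Variable dot : {dot H for Num.conj}.
Implicit Types (S T P : H -> H) (N : set (H -> H)) (c : R).

Definition hilbert_space : Prop := forall x, `|x| ^+ 2 = dot x x.

(* the operator norm of T is at most c *)
Definition opnorm_le T c : Prop :=
  0 <= c /\ forall x, `|T x| <= c%:C * `|x|.

Definition bounded_op T : Prop := linear T /\ exists c, opnorm_le T c.

Definition is_adjoint T S : Prop := forall x y, dot (T x) y = dot x (S y).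

Definition unitary T : Prop :=
  bounded_op T /\
  exists S, [/\ bounded_op S, is_adjoint T S, T \o S = id & S \o T = id].

Definition is_projection P : Prop :=
  [/\ bounded_op P, P \o P = P & is_adjoint P P].

(* [V], the orthogonal projection onto the closed subspace V *)
Definition proj_on (V : set H) : H -> H :=
  xget 0 [set P | is_projection P /\ range P = V].

Definition op_ker T : set H := T @^-1` [set 0].

Definition op_le S T : Prop := forall x, dot (S x) x <= dot (T x) x.

Definition commutant N : set (H -> H) :=
  [set T | bounded_op T /\ forall S, N S -> T \o S = S \o T].

Definition von_neumann_algebra N : Prop :=
  [/\ N `<=` bounded_op,
      forall T, N T -> exists2 S, N S & is_adjoint T S &
      commutant (commutant N) = N].

Definition self_adjoint_part N : set (H -> H) :=
  [set T | N T /\ is_adjoint T T].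

Definition positive_part N : set (H -> H) := [set T | N T /\ op_le 0 T].

(* N_* as the norm closure, in the dual of N, of the finite sums of vector
   functionals; only the values on N are relevant *)
Definition predual N : set ((H -> H) -> R[i]) :=
  [set f | forall e : R, 0 < e -> exists n (x y : 'I_n -> H),
    forall T c, N T -> opnorm_le T c ->
      `|f T - \sum_(i < n) dot (T (x i)) (y i)| <= (e * c)%:C].

Definition separable_predual N : Prop :=
  exists F : nat -> (H -> H) -> R[i],
    (forall n, predual N (F n)) /\
    forall f, predual N f -> forall e : R, 0 < e ->
      exists n, forall T c, N T -> opnorm_le T c ->
        `|f T - F n T| <= (e * c)%:C.

Definition op_lub N (F : set (H -> H)) T : Prop :=
  [/\ positive_part N T, forall S, F S -> op_le S T &
      forall U, positive_part N U -> (forall S, F S -> op_le S U) ->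
        op_le T U].

Definition directed (F : set (H -> H)) : Prop :=
  F !=set0 /\
  forall S T, F S -> F T -> exists U, [/\ F U, op_le S U & op_le T U].

(* tau is a weight on the positive part of N; its values elsewhere are
   unspecified and never used *)
Record fns_trace N (tau : (H -> H) -> \bar R) : Prop := FnsTrace {
  trace_ge0 : forall T, positive_part N T -> (0 <= tau T)%E ;
  trace_add : forall S T, positive_part N S -> positive_part N T ->
    tau (S + T) = (tau S + tau T)%E ;
  trace_scale : forall c T, 0 <= c -> positive_part N T ->
    tau (c%:C *: T) = (c%:E * tau T)%E ;
  trace_comm : forall T S, N T -> N S -> is_adjoint T S ->
    tau (S \o T) = tau (T \o S) ;
  trace_faithful : forall T, positive_part N T -> tau T = 0%E -> T = 0 ;
  trace_normal : forall F T, F `<=` positive_part N -> directed F ->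
    op_lub N F T -> tau T = ereal_sup (tau @` F) ;
  trace_semifinite : forall T, positive_part N T -> T <> 0 ->
    exists S, [/\ positive_part N S, S <> 0, op_le S T & (tau S < +oo)%E] }.

(* A self-adjoint operator D is given by its domain and by a total function
   whose values outside of the domain are irrelevant. *)
Record operator := Operator { op_dom : set H ; op_fun :> H -> H }.
Implicit Type D : operator.

Definition everywhere T : operator := Operator setT T.

(* D + A, for a bounded operator A *)
Definition perturb D (A : H -> H) : operator :=
  Operator (op_dom D) (op_fun D + A).

Definition self_adjoint D : Prop :=
  [/\ forall (k : R[i]) x y, op_dom D x -> op_dom D y -> op_dom D (k *: x + y),
      closure (op_dom D) = setT &
      forall y z, (forall x, op_dom D x -> dot (D x) y = dot x z) <->
                  (op_dom D y /\ D y = z)].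

Definition affiliated N D : Prop :=
  forall u, commutant N u -> unitary u ->
    forall x, op_dom D x -> op_dom D (u x) /\ D (u x) = u (D x).

Definition ker_proj D : H -> H :=
  proj_on [set x | op_dom D x /\ D x = 0].

(* E is a projection-valued Borel measure on R, with the scalar measures
   mu x = <E(.) x, x> *)
Definition is_pvm (E : set R -> H -> H)
    (mu : H -> {measure set R -> \bar R}) : Prop :=
  [/\ forall B : set R, measurable B -> is_projection (E B),
      E setT = id,
      forall B C : set R, measurable B -> measurable C ->
        E (B `&` C) = E B \o E C &
      forall x (B : set R), measurable B ->
        mu x B = (complex.Re (dot (E B x) x))%:E].

(* D is the integral of the identity function against E *)
Definition spectral_resolution D E mu : Prop :=
  [/\ is_pvm E mu,
      op_dom D = [set x | (\int[mu x]_l (l ^+ 2)%:E < +oo)%E] &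
      forall x, op_dom D x -> dot (D x) x = (\int[mu x]_l l)%:C].

(* f(D), for a self-adjoint D and a bounded Borel function f *)
Definition funcalc D (f : R -> R) : H -> H :=
  xget 0 [set T | bounded_op T /\
    exists E mu, spectral_resolution D E mu /\
      forall x, dot (T x) x = (\int[mu x]_l f l)%:C].

(* exp(- t D^2) *)
Definition heat t D : H -> H := funcalc D (fun l => expR (- t * l ^+ 2)).

(* D exp(- t D^2) *)
Definition dheat t D : H -> H := funcalc D (fun l => l * expR (- t * l ^+ 2)).

(* F_D = D (1 + D^2)^(-1/2) *)
Definition bounded_transform D : H -> H :=
  funcalc D (fun l => l / Num.sqrt (1 + l ^+ 2)).

(* the spectral projection of T for [0, +oo) *)
Definition nonneg_proj T : H -> H :=
  funcalc (everywhere T) (fun l => if 0 <= l then 1 else 0).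

Definition is_op_deriv (I : set R) (A : R -> H -> H) (t : R) (B : H -> H) :=
  forall e : R, 0 < e -> \forall s \near within I (nbhs t),
    opnorm_le (A s - A t - (s - t)%:C *: B) (e * `|s - t|).

Definition op_continuous (I : set R) (A : R -> H -> H) : Prop :=
  forall t, I t -> forall e : R, 0 < e ->
    \forall s \near within I (nbhs t), opnorm_le (A s - A t) e.

Definition op_C1 (I : set R) (A : R -> H -> H) : Prop :=
  exists B : R -> H -> H,
    (forall t, I t -> is_op_deriv I A t (B t)) /\ op_continuous I B.

(* C^1 up to the end points on each interval of some partition of [a, b] *)
Definition piecewise_C1 (a b : R) (A : R -> H -> H) : Prop :=
  exists s, itv_partition a b s /\
    forall i, (i < size s)%N ->
      op_C1 `[nth b (a :: s) i, nth b (a :: s) i.+1]%classic A.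

(* the derivative in operator norm, or 0 at the points where there is none *)
Definition op_deriv (A : R -> H -> H) (t : R) : H -> H :=
  xget 0 [set B | is_op_deriv setT A t B].

Section Trace.
Variables (N : set (H -> H)) (tau : (H -> H) -> \bar R).

Definition finite_positive T : Prop := positive_part N T /\ (tau T < +oo)%E.

(* the linear extension of tau to the span of the positive elements of finite
   trace *)
Definition is_trace T (z : R[i]) : Prop :=
  exists T1 T2 T3 T4,
    [/\ finite_positive T1, finite_positive T2, finite_positive T3 &
        finite_positive T4] /\
    T = T1 - T2 + (0 +i* 1) *: (T3 - T4) /\
    z = (fine (tau T1) - fine (tau T2)) +i* (fine (tau T3) - fine (tau T4)).

Definition trace_class T : Prop := exists z, is_trace T z.

Definition op_trace T : R[i] := xget 0 (is_trace T).

Definition closed_ideal (J : set (H -> H)) : Prop :=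
  [/\ J `<=` N, J 0, (forall S T, J S -> J T -> J (S + T)),
      (forall S T, N S -> J T -> J (S \o T) /\ J (T \o S)) &
      forall T, N T ->
        (forall e : R, 0 < e -> exists2 S, J S & opnorm_le (T - S) e) -> J T].

(* the norm-closed two-sided ideal generated by the elements of finite trace *)
Definition compact_ideal : set (H -> H) :=
  [set T | forall J, closed_ideal J -> trace_class `<=` J -> J T].

Definition breuer_fredholm T : Prop :=
  N T /\ exists S, [/\ N S, compact_ideal (id - (S \o T)) &
                       compact_ideal (id - (T \o S))].

(* the norm of T in N / compact_ideal is smaller than c *)
Definition quotient_norm_lt T c : Prop :=
  exists2 K, compact_ideal K & exists2 d, d < c & opnorm_le (T - K) d.

(* the index of P Q : ran Q -> ran P *)
Definition codim_index P Q : R :=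
  fine (tau (proj_on (range Q `&` op_ker P))) -
  fine (tau (proj_on (op_ker Q `&` range P))).

(* Phillips' definition: the partition is so fine that P_t varies by less than
   1/2 modulo compact_ideal on each of its intervals, and the essential
   codimensions ind(P_{t_i} P_{t_{i+1}}) are summed. *)
Definition is_spectral_flow (a b : R) (F : R -> H -> H) (r : R) : Prop :=
  let P t := nonneg_proj (F t) in
  (forall t, t \in `[a, b] -> self_adjoint_part N (F t) /\
                              breuer_fredholm (F t)) /\
  op_continuous `[a, b]%classic F /\
  exists s, [/\ itv_partition a b s,
    forall i, (i < size s)%N ->
      let J := `[nth b (a :: s) i, nth b (a :: s) i.+1] in
      forall t u, t \in J -> u \in J -> quotient_norm_lt (P t - P u) 2^-1 &
    r = \sum_(0 <= i < size s)
          codim_index (P (nth b (a :: s) i)) (P (nth b (a :: s) i.+1))].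

Definition spectral_flow (a b : R) (F : R -> H -> H) : R :=
  xget 0 (is_spectral_flow a b F).

Definition trunc_eta_integrand D (t : R) : R[i] :=
  op_trace (dheat t D) * ((Num.sqrt t)^-1)%:C.

Definition trunc_eta_convergent (e : R) D : Prop :=
  (forall t, e <= t -> trace_class (dheat t D)) /\
  cintegrable `[e, +oo[%classic (trunc_eta_integrand D).

Definition trunc_eta (e : R) D : R[i] :=
  ((Num.sqrt pi)^-1)%:C * cint `[e, +oo[%classic (trunc_eta_integrand D).

(* the one-form alpha^e, at the point D of D0 + N_sa *)
Definition alpha_form (e : R) D (X : H -> H) : R[i] :=
  (Num.sqrt (e / pi))%:C * op_trace (X \o heat e D).

Definition alpha_along (e : R) D0 (A : R -> H -> H) (t : R) : R[i] :=
  alpha_form e (perturb D0 (A t)) (op_deriv A t).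

(* t |-> D0 + A t is a piecewise C^1 path in D0 + N_sa *)
Definition piecewise_C1_path (a b : R) (A : R -> H -> H) : Prop :=
  [/\ a < b, forall t, t \in `[a, b] -> self_adjoint_part N (A t) &
      piecewise_C1 a b A].

Section BreuerFredholmModule.
Variables (B : completeNormedModType R[i]) (mul : B -> B -> B) (star : B -> B).

Record banach_star_algebra : Prop := BanachStarAlgebra {
  bsa_mulA : associative mul ;
  bsa_mulDl : forall y, linear (mul^~ y) ;
  bsa_mulDr : forall x, linear (mul x) ;
  bsa_normM : forall x y, `|mul x y| <= `|x| * `|y| ;
  bsa_star_antilinear : forall (k : R[i]) x y,
    star (k *: x + y) = Num.conj k *: star x + star y ;
  bsa_starM : forall x y, star (mul x y) = mul (star y) (star x) ;
  bsa_starK : involutive star ;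
  bsa_norm_star : forall x, `|star x| = `|x| }.

Record continuous_star_rep (rho : B -> H -> H) : Prop := ContinuousStarRep {
  rep_in : forall x, N (rho x) ;
  rep_linear : linear rho ;
  rep_mul : forall x y, rho (mul x y) = rho x \o rho y ;
  rep_star : forall x, is_adjoint (rho x) (rho (star x)) ;
  rep_continuous : exists c,
    forall x v, `|rho x v| <= c%:C * `|x| * `|v| }.

(* [D, T] extends to an element of N *)
Definition commutator_in D T : Prop :=
  exists C, N C /\ forall v, op_dom D v ->
    op_dom D (T v) /\ D (T v) - T (D v) = C v.

Record theta_summable_module (rho : B -> H -> H) D : Prop :=
  ThetaSummableModule {
  module_rep : continuous_star_rep rho ;
  module_self_adjoint : self_adjoint D ;
  module_affiliated : affiliated N D ;
  module_commutators :
    closure [set x | commutator_in D (rho x)] = setT ;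
  module_theta : forall t : R, 0 < t -> (tau (heat t D) < +oo)%E }.

End BreuerFredholmModule.
End Trace.
End HilbertSpace.

(* Main.v *)
(* Let h be the Gaussian antiderivative with limits -1/2 and 1/2 at infinity, E_n
   spectral projections of D increasing to 1, and J_n(T) = tau(E_n h(D + E_n T E_n)).
   Klein's inequality gives the derivative of J_n; in the limit the integral of
   alpha^epsilon is a difference of values of a potential, hence depends only on the
   end points. For k = chi_[0,oo) - 1/2 - h one has
   tau(k(D)) = eta_epsilon(D)/2 + tau([ker D])/2, so the formula compares the
   potential with tau(P_b - P_a), which for projections with trace class difference
   is the index of P_a P_b. The index of pairs with compact difference is stable
   under norm limits, which reduces the formula to the compressions E_n T E_n; the
   norm convergence of their spectral projections needs a gap of the spectrum at 0,
   opened by first moving from D to D + sgn(D). *)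
Require Import Defs.
From HB Require Import structures.
From mathcomp Require Import all_boot all_order all_algebra.
From mathcomp Require Import sesquilinear complex.
From mathcomp Require Import all_classical all_reals all_analysis.
From mathcomp Require Import measurable_realfun ring lra zify.
Set Implicit Arguments.
Unset Strict Implicit.
Unset Printing Implicit Defensive.
Import Order.TTheory GRing.Theory Num.Theory.
Import numFieldNormedType.Exports.

Local Open Scope classical_set_scope.
Local Open Scope complex_scope.
Local Open Scope ring_scope.

(** The difference [h(D + T) - h(D)] is not known to be trace class, so the potential cannot be
    written down as its trace; it exists only as the limit of [JJ n T - JJ n 0], each term of which
    lives on a corner of finite trace. There [D + E_n T E_n] agrees with a bounded operator, and the
    double sum over pairs of spectral values behind Klein's inequality has nonnegative weights,
    whence a quadratic remainder. The limit meets the obstacle that [E_n T E_n] need not tend to [T]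
    in norm. Between resolvents it does, so [(1 + D^2)^-1], [D (1 + D^2)^-1] and the Gaussians
    approximated by them converge in norm, while heat traces stay bounded uniformly over
    perturbations of bounded norm. Discontinuous functions need other tools: spectral projections
    are compared through a Sylvester equation for phases, and the index is read off from the trace
    of [(Q - P) bump(Q - P)^2], which ignores the spectrum of [Q - P] near 0 and is therefore finite
    and norm continuous. The spectral gap is also what dominates the eta integrand at infinity,
    uniformly in [n]. *)

Record hilb (R : realType) := Hilb {
 hsp :> completeNormedModType R[i] ;
 hdot : {dot hsp for Num.conj} ;
 hdotP : hilbert_space hdot }.

(** * Hilbert space geometry through the real inner product *)

Section InnerProduct.
Variables (R : realType) (K : hilb R).
Implicit Types (x y z : K) (c : R).

(** All identities and estimates are carried by the real part: it is symmetric and real bilinear,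
    and [dotE] recovers the complex form from it. Complex linearity then has to be checked only for
    multiplication by ['i]. *)
Definition ip x y : R := complex.Re (hdot K x y).
Definition nm x : R := complex.Re `|x|.
Definition rs (c : R) (x : K) : K := c%:C *: x.

Lemma ReD (a b : R[i]) : complex.Re (a + b) = complex.Re a + complex.Re b.
Proof. by case: a b=> ? ? []. Qed.
Lemma ReN (a : R[i]) : complex.Re (- a) = - complex.Re a.
Proof. by case: a. Qed.
Lemma ReZ (c : R) (a : R[i]) : complex.Re (c%:C * a) = c * complex.Re a.
Proof. by case: a=> a b /=; ring. Qed.
Lemma ImZ (c : R) (a : R[i]) : complex.Im (c%:C * a) = c * complex.Im a.
Proof. by case: a=> a b /=; ring. Qed.
Lemma conjE (a : R[i]) : Num.conj a = (complex.Re a) -i* (complex.Im a).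
Proof. by case: a. Qed.

Lemma normE x : `|x| = (nm x)%:C.
Proof. by rewrite /nm; have /ger0_Im := normr_ge0 x; case: `|x| => a b /= ->. Qed.
Lemma nm_ge0 x : 0 <= nm x.
Proof. by rewrite -(ler0c (nm x)) -normE. Qed.

Lemma dotC x y : hdot K x y = Num.conj (hdot K y x).
Proof. by rewrite hermC expr0 mul1r. Qed.
Lemma ipC x y : ip x y = ip y x.
Proof. by rewrite /ip dotC conjE. Qed.
Lemma ipDl x y z : ip (x + y) z = ip x z + ip y z.
Proof. by rewrite /ip linearDl ReD. Qed.
Lemma ipDr x y z : ip x (y + z) = ip x y + ip x z.
Proof. by rewrite ipC ipDl !(ipC x). Qed.
Lemma ipZl c x y : ip (rs c x) y = c * ip x y.
Proof. by rewrite /ip linearZl_LR ReZ. Qed.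
Lemma ipZr c x y : ip x (rs c y) = c * ip x y.
Proof. by rewrite ipC ipZl ipC. Qed.
Lemma ipNl x y : ip (- x) y = - ip x y.
Proof. by rewrite /ip linearNl ReN. Qed.
Lemma ipNr x y : ip x (- y) = - ip x y.
Proof. by rewrite ipC ipNl ipC. Qed.
Lemma ipBl x y z : ip (x - y) z = ip x z - ip y z.
Proof. by rewrite ipDl ipNl. Qed.
Lemma ipBr x y z : ip x (y - z) = ip x y - ip x z.
Proof. by rewrite ipDr ipNr. Qed.
Lemma ip0l x : ip 0 x = 0.
Proof. by rewrite -(subrr x) ipBl subrr. Qed.
Lemma ip0r x : ip x 0 = 0.
Proof. by rewrite ipC ip0l. Qed.
Definition ipE := (ipDl, ipDr, ipBl, ipBr, ipZl, ipZr, ipNl, ipNr, ip0l, ip0r).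

Lemma nmsq x : nm x ^+ 2 = ip x x.
Proof.
have := hdotP x; rewrite normE /ip=> <-.
by rewrite -rmorphXn.
Qed.
Lemma ip_ge0 x : 0 <= ip x x.
Proof. by rewrite -nmsq sqr_ge0. Qed.
Lemma nm0 : nm 0 = 0. Proof. by rewrite /nm normr0. Qed.
Lemma nm_eq0 x : nm x = 0 -> x = 0.
Proof. by move=> h; apply/normr0_eq0; rewrite normE h. Qed.
Lemma ipxx_eq0 x : ip x x = 0 -> x = 0.
Proof. by rewrite -nmsq=> /eqP; rewrite sqrf_eq0=> /eqP /nm_eq0. Qed.
Lemma nmD x y : nm (x + y) <= nm x + nm y.
Proof. by have := ler_normD x y; rewrite !normE -rmorphD lecR. Qed.
Lemma nmN x : nm (- x) = nm x. Proof. by rewrite /nm normrN. Qed.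
Lemma nmB x y : nm (x - y) <= nm x + nm y.
Proof. by rewrite -(nmN y) nmD. Qed.
Lemma nmBC x y : nm (x - y) = nm (y - x). Proof. by rewrite -nmN opprB. Qed.
Lemma nmCZ (a : R[i]) x : nm (a *: x) = complex.Re `|a| * nm x.
Proof. by rewrite {1}/nm normrZ normE (normc_def a) -rmorphM /=. Qed.
Lemma nmZ c x : nm (rs c x) = `|c| * nm x.
Proof. by rewrite nmCZ normc_def /= expr0n /= addr0 sqrtr_sqr. Qed.

Lemma CS x y : ip x y ^+ 2 <= ip x x * ip y y.
Proof.
have [y0|ny] := eqVneq (ip y y) 0.
 by rewrite (ipxx_eq0 y0) !ipE expr0n mulr0.
have yp : 0 < ip y y by rewrite lt_def ny ip_ge0.
have := ip_ge0 (x - rs (ip x y / ip y y) y).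
rewrite !ipE (ipC y x) => h.
rewrite -subr_ge0 -(pmulr_rge0 _ (_ : 0 < (ip y y)^-1)) ?invr_gt0 //.
by move: h; congr (_ <= _); field.
Qed.
Lemma CSn x y : `|ip x y| <= nm x * nm y.
Proof.
rewrite -(@ler_pXn2r _ 2) ?nnegrE ?mulr_ge0 ?nm_ge0 //.
by rewrite exprMn !nmsq -normrX ger0_norm ?sqr_ge0 ?CS.
Qed.
Lemma ip_le x y : ip x y <= nm x * nm y.
Proof. exact: le_trans (ler_norm _) (CSn x y). Qed.
Lemma ip_ext x y : (forall z, ip x z = ip y z) -> x = y.
Proof. by move=> h; apply/subr0_eq/ipxx_eq0; rewrite ipBl h subrr. Qed.
Lemma nm_le x c : 0 <= c -> ip x x <= c ^+ 2 -> nm x <= c.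
Proof. by move=> c0; rewrite -nmsq ler_pXn2r ?nnegrE ?nm_ge0. Qed.

Lemma ip_i x y : ip ('i *: x) y = - ip x ('i *: y).
Proof.
rewrite /ip linearZl_LR linearZr_LR /=.
by rewrite conjE; case: (hdot K x y) => a b /=; ring.
Qed.
Lemma ip_ii x y : ip ('i *: x) ('i *: y) = ip x y.
Proof. by rewrite ip_i scalerA -expr2 sqr_i scaleN1r ipNr opprK. Qed.
(** The form is conjugate-linear in its second argument, and [-i (a + ib)] has real part [b]. *)
Lemma dotE x y : hdot K x y = (ip x y) +i* (ip x ('i *: y)).
Proof.
apply/eqP; rewrite eq_complex /= eqxx /= /ip linearZr_LR /= conjE.
by case: (hdot K x y) => a b /=; apply/eqP; ring.
Qed.
Lemma rsD c x y : rs c (x + y) = rs c x + rs c y. Proof. exact: scalerDr. Qed.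
Lemma rs1 x : rs 1 x = x. Proof. exact: scale1r. Qed.
Lemma rs_rs c d x : rs c (rs d x) = rs (c * d) x.
Proof. by rewrite /rs scalerA -rmorphM. Qed.

Definition cv (u : nat -> K) x := nm (u n - x) @[n --> \oo] --> (0 : R).

Lemma cvP u x : cv u x <-> forall e, 0 < e -> exists n0, forall n, (n0 <= n)%N -> nm (u n - x) < e.
Proof.
split.
 move=> /cvgrPdist_lt h e e0; have [n0 _ hn] := h e e0.
 by exists n0=> n /hn /=; rewrite sub0r normrN ger0_norm ?nm_ge0.
move=> h; apply/cvgrPdist_lt=> e /h [n0 hn]; exists n0=> // n /= /hn.
by rewrite sub0r normrN ger0_norm ?nm_ge0.
Qed.

Lemma cv_complete (u : nat -> K) :
 (forall e, 0 < e -> exists n0, forall n m, (n0 <= n)%N -> (n0 <= m)%N -> nm (u n - u m) < e) ->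
 exists x, cv u x.
Proof.
move=> hu.
have hc : cauchy (u @ \oo).
 apply/cauchy_ballP=> e e0.
 (* Radii are elements of [R[i]]; positivity forces the imaginary part to vanish, so the real part
    is a real radius. *)
 have [e1 e1p he] : exists2 e1 : R, 0 < e1 & e1%:C <= e.
  move: e0; rewrite ltcE=> /andP[/eqP ei er]; exists (complex.Re e) => //.
  by case: e ei {er}=> a b /= ->.
 have [n0 h] := hu _ e1p.
 exists ([set u n | n in [set n | (n0 <= n)%N]], [set u n | n in [set n | (n0 <= n)%N]]).
  by split; exists n0=> // n /= hn; exists n.
 case=> /= _ _ [[n hn <-] [m hm <-]]; rewrite -ball_normE /ball_ /=.
 by apply: lt_le_trans he; rewrite normE ltcR h.
exists (lim (u @ \oo)); apply/cvP=> e e0.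
have hl : u @ \oo --> lim (u @ \oo) by apply: cauchy_cvg.
have h := (@cvgrPdist_lt _ _ _ _ _ _ _).1 hl.
have [|n0 _ hn] := h _ e%:C; first by rewrite ltcR.
exists n0=> n /hn /=.
by rewrite normE ltcR nmBC.
Qed.

Lemma cv_const x : cv (fun=> x) x.
Proof. by apply/cvP=> e e0; exists 0%N=> n _; rewrite subrr nm0. Qed.

Lemma squeeze0 (f g : nat -> R) : (forall n, 0 <= f n <= g n) -> g @ \oo --> (0 : R) ->
 f @ \oo --> (0 : R).
Proof.
by move=> h hg; apply: (squeeze_cvgr _ (cvg_cst 0) hg); near=> n; apply: h.
Unshelve. all: by end_near. Qed.

Lemma cv_le u x (g : nat -> R) : (forall n, nm (u n - x) <= g n) -> g @ \oo --> (0 : R) -> cv u x.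
Proof. by move=> h; apply: squeeze0=> n; rewrite nm_ge0 h. Qed.

Lemma cv_uniq u x y : cv u x -> cv u y -> x = y.
Proof.
move=> /cvP ux /cvP uy; apply/subr0_eq/nm_eq0/eqP; rewrite eq_le nm_ge0 andbT.
apply/ler_addgt0Pl=> e e0; have e2 : 0 < e / 2 by lra.
have [n hn] := ux _ e2; have [m hm] := uy _ e2.
have := hn _ (leq_maxl n m); have := hm _ (leq_maxr n m).
rewrite (nmBC _ x) => h1 h2; have := nmD (x - u (maxn n m)) (u (maxn n m) - y).
by rewrite addrA subrK; lra.
Qed.

Lemma cvD u v x y : cv u x -> cv v y -> cv (fun n => u n + v n) (x + y).
Proof.
move=> ux vy; apply: (@cv_le _ _ (fun n => nm (u n - x) + nm (v n - y))).
 by move=> n; rewrite opprD addrACA nmD.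
by have h := cvgD ux vy; rewrite addr0 in h; exact: h.
Qed.
Lemma cvZ (a : R[i]) u x : cv u x -> cv (fun n => a *: u n) (a *: x).
Proof.
move=> ux; rewrite /cv; under eq_fun do rewrite -scalerBr nmCZ.
by have h := cvgM (cvg_cst (complex.Re `|a|)) ux; rewrite mulr0 in h; exact: h.
Qed.
Lemma cvN u x : cv u x -> cv (fun n => - u n) (- x).
Proof. by move=> h; rewrite /cv; under eq_fun do rewrite -opprD nmN. Qed.
Lemma cvB u v x y : cv u x -> cv v y -> cv (fun n => u n - v n) (x - y).
Proof. by move=> hu hv; apply: cvD=> //; apply: cvN. Qed.

Lemma cv_nm u x : cv u x -> nm (u n) @[n --> \oo] --> nm x.
Proof.
move=> ux; apply/cvgrPdist_le=> e e0; have [n0 hn] := (cvP _ _).1 ux e e0.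
exists n0=> // n /= /hn h.
have h1 := nmD (u n - x) x; have h2 := nmD (x - u n) (u n).
rewrite !subrK in h1 h2; rewrite (nmBC x) in h2.
by rewrite ler_norml; lra.
Qed.
Lemma cv_ip u v x y : cv u x -> cv v y -> ip (u n) (v n) @[n --> \oo] --> ip x y.
Proof.
move=> ux vy.
(* Polarization reduces the claim to continuity of the norm. *)
have -> : (fun n => ip (u n) (v n)) =
 (fun n => (nm (u n + v n) * nm (u n + v n) - nm (u n - v n) * nm (u n - v n)) / 4) by apply/funext=> n; rewrite -!expr2 !nmsq !ipE (ipC (v n)); field.
have -> : ip x y = (nm (x + y) * nm (x + y) - nm (x - y) * nm (x - y)) / 4 by rewrite -!expr2 !nmsq !ipE (ipC y); field.
apply: cvgMl; apply: cvgB; apply: cvgM; apply: cv_nm; by [apply: cvD | apply: cvB].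
Qed.

End InnerProduct.
Arguments cv {R K}.

(** * The algebra of bounded operators and its norm *)

Section BoundedOperators.
Variables (R : realType) (K : hilb R).
Implicit Types (x y z : K) (c : R).

(** The side condition is a boolean, hence proof irrelevant: operators with equal functions are
    equal, and the ring and module structures can be declared on the bundle. *)
Record bop := Bop { bfun :> K -> K ; _ : `[< bounded_op bfun >] }.

Lemma bounded_opE (T : K -> K) : bounded_op T <->
 linear T /\ exists2 c, 0 <= c & forall x, nm (T x) <= c * nm x.
Proof.
split=> [[l [c [c0 h]]]|[l [c c0 h]]]; split=> //; exists c.
 exact: c0. by move=> x; have := h x; rewrite !normE -rmorphM lecR.
by split=> // x; rewrite !normE -rmorphM lecR.
Qed.

Definition mkbop (T : K -> K) (h : bounded_op T) : bop := Bop (asboolT h).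
Lemma bopP (T : bop) : bounded_op T. Proof. by apply/asboolP; case: T. Qed.
Lemma bop_linear (T : bop) : linear T. Proof. by case: (bopP T). Qed.
HB.instance Definition _ (T : bop) :=
 GRing.isLinear.Build R[i] K K *:%R (bfun T) (bop_linear T).
Lemma bop_bd (T : bop) : exists2 c, 0 <= c & forall x, nm (T x) <= c * nm x.
Proof. by have /bounded_opE[] := bopP T. Qed.
Lemma bop_ext (S T : bop) : (forall x, S x = T x) -> S = T.
Proof.
case: S T=> [S hS] [T hT] /= /funext h; rewrite h in hS *.
by rewrite (bool_irrelevance hS hT).
Qed.

Lemma bounded_lin (T : K -> K) c : linear T -> (forall x, nm (T x) <= c * nm x) -> bounded_op T.
Proof.
move=> l h; apply/bounded_opE; split=> //; exists `|c|; first by [].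
by move=> x; apply: le_trans (h x) _; rewrite ler_wpM2r ?nm_ge0 ?ler_norm.
Qed.

Fact bounded0 : bounded_op (fun=> 0 : K).
Proof.
apply: (@bounded_lin _ 0); first by move=> k x y; rewrite scaler0 addr0.
by move=> x; rewrite nm0 mul0r.
Qed.
Fact bounded1 : bounded_op (@id K).
Proof. by apply: (@bounded_lin _ 1) => // x; rewrite mul1r. Qed.
Fact boundedD (S T : bop) : bounded_op (fun x => S x + T x).
Proof.
have [c c0 hc] := bop_bd S; have [d d0 hd] := bop_bd T.
apply: (@bounded_lin _ (c + d)) => [k x y|x].
 by rewrite !linearP scalerDr addrACA.
by rewrite mulrDl (le_trans (nmD _ _)) // lerD.
Qed.
Fact boundedZ (k : R[i]) (T : bop) : bounded_op (fun x => k *: T x).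
Proof.
have [c c0 hc] := bop_bd T.
apply: (@bounded_lin _ (complex.Re `|k| * c)) => [l x y|x].
 by rewrite linearP scalerDr !scalerA mulrC.
by rewrite nmCZ -mulrA ler_wpM2l // normc_def /= sqrtr_ge0.
Qed.
Fact boundedN (T : bop) : bounded_op (fun x => - T x).
Proof.
have [c c0 hc] := bop_bd T; apply: (@bounded_lin _ c) => [k x y|x].
 by rewrite linearP opprD scalerN.
by rewrite nmN.
Qed.
Fact boundedM (S T : bop) : bounded_op (S \o T).
Proof.
have [c c0 hc] := bop_bd S; have [d d0 hd] := bop_bd T.
apply: (@bounded_lin _ (c * d)) => [k x y|x] /=; first by rewrite !linearP.
by rewrite -mulrA (le_trans (hc _)) // ler_wpM2l.
Qed.

Definition bop0 := mkbop bounded0.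
Definition bop1 := mkbop bounded1.
Definition bopD S T := mkbop (boundedD S T).
Definition bopN T := mkbop (boundedN T).
Definition bopM S T := mkbop (boundedM S T).
Definition bopZ k T := mkbop (boundedZ k T).

HB.instance Definition _ := gen_eqMixin bop.
HB.instance Definition _ := gen_choiceMixin bop.
Fact bopDA : associative bopD. Proof. by move=> A B C; apply: bop_ext=> x; rewrite /= /bfun /= addrA. Qed.
Fact bopDC : commutative bopD. Proof. by move=> A B; apply: bop_ext=> x; rewrite /= /bfun /= addrC. Qed.
Fact bop0D : left_id bop0 bopD. Proof. by move=> A; apply: bop_ext=> x; rewrite /= /bfun /= add0r. Qed.
Fact bopND : left_inverse bop0 bopN bopD. Proof. by move=> A; apply: bop_ext=> x; rewrite /= /bfun /= addNr. Qed.
HB.instance Definition _ := GRing.isZmodule.Build bop bopDA bopDC bop0D bopND.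
Fact bopMA : associative bopM. Proof. by move=> A B C; apply: bop_ext. Qed.
Fact bop1M : left_id bop1 bopM. Proof. by move=> A; apply: bop_ext. Qed.
Fact bopM1 : right_id bop1 bopM. Proof. by move=> A; apply: bop_ext. Qed.
Fact bopMDl : left_distributive bopM +%R. Proof. by move=> A B C; apply: bop_ext. Qed.
Fact bopMDr : right_distributive bopM +%R.
Proof. by move=> A B C; apply: bop_ext=> x; rewrite /= linearD. Qed.
HB.instance Definition _ := GRing.Zmodule_isPzRing.Build bop bopMA bop1M bopM1 bopMDl bopMDr.
Fact bopZA a b (T : bop) : bopZ a (bopZ b T) = bopZ (a * b) T.
Proof. by apply: bop_ext=> x; rewrite /= scalerA. Qed.
Fact bop1Z : left_id 1 bopZ. Proof. by move=> T; apply: bop_ext=> x; rewrite /= scale1r. Qed.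
Fact bopZDr : right_distributive bopZ +%R.
Proof. by move=> a S T; apply: bop_ext=> x; rewrite /= scalerDr. Qed.
Fact bopZDl (T : bop) : {morph bopZ^~ T : a b / a + b}.
Proof. by move=> a b; apply: bop_ext=> x; rewrite /= scalerDl. Qed.
HB.instance Definition _ := GRing.Zmodule_isLmodule.Build R[i] bop bopZA bop1Z bopZDr bopZDl.

Lemma opD (S T : bop) x : (S + T) x = S x + T x. Proof. by []. Qed.
Lemma opN (T : bop) x : (- T) x = - T x. Proof. by []. Qed.
Lemma opB (S T : bop) x : (S - T) x = S x - T x. Proof. by []. Qed.
Lemma opM (S T : bop) x : (S * T) x = S (T x). Proof. by []. Qed.
Lemma op1 x : (1 : bop) x = x. Proof. by []. Qed.
Lemma op0 x : (0 : bop) x = 0. Proof. by []. Qed.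
Lemma opZ k (T : bop) x : (k *: T) x = k *: T x. Proof. by []. Qed.
Definition opE := (opD, opN, opB, opM, op1, op0, opZ).
Lemma op_sum I (r : seq I) (P : pred I) (F : I -> bop) x :
 (\sum_(i <- r | P i) F i) x = \sum_(i <- r | P i) F i x.
Proof. by elim/big_rec2: _=> [|i y T _ <-]; rewrite ?op0 ?opD. Qed.
Lemma bZAl k (S T : bop) : k *: (S * T) = (k *: S) * T. Proof. exact: bop_ext. Qed.
Lemma bZAr k (S T : bop) : k *: (S * T) = S * (k *: T).
Proof. by apply: bop_ext=> x; rewrite !opE linearZ. Qed.
Definition rso (c : R) (T : bop) : bop := c%:C *: T.
Lemma opR c T x : (rso c T) x = rs c (T x). Proof. by []. Qed.
Lemma op_rs (T : bop) c x : T (rs c x) = rs c (T x). Proof. by rewrite /rs linearZ. Qed.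
Lemma op_cz (T : bop) k x : T (k *: x) = k *: T x. Proof. exact: linearZ. Qed.
Lemma op_add (T : bop) x y : T (x + y) = T x + T y. Proof. exact: linearD. Qed.
Lemma op_sub (T : bop) x y : T (x - y) = T x - T y. Proof. exact: linearB. Qed.
Lemma op_opp (T : bop) x : T (- x) = - T x. Proof. exact: linearN. Qed.
Lemma op_zero (T : bop) : T 0 = 0. Proof. exact: linear0. Qed.
Definition opX := (op_add, op_sub, op_opp, op_zero, op_rs, op_cz).

Implicit Types (S T : bop).
(** An infimum of admissible constants rather than a supremum over unit vectors, so that the zero
    space needs no separate treatment. *)
Definition opn T : R := inf [set c | 0 <= c /\ forall x, nm (T x) <= c * nm x].
Lemma opn_has_inf T : has_inf [set c | 0 <= c /\ forall x, nm (T x) <= c * nm x].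
Proof. by split; [have [c] := bop_bd T; exists c | exists 0=> c []]. Qed.
Lemma opn_ge0 T : 0 <= opn T.
Proof. by apply: lb_le_inf; [case: (opn_has_inf T) | move=> c []]. Qed.
Lemma opn_le T c : 0 <= c -> (forall x, nm (T x) <= c * nm x) -> opn T <= c.
Proof. by move=> c0 h; apply: ge_inf; [case: (opn_has_inf T)|split]. Qed.
Lemma opnP T x : nm (T x) <= opn T * nm x.
Proof.
apply/ler_addgt0Pl=> e e0.
have d0 : 0 < e / (nm x + 1) by rewrite divr_gt0 // ltr_wpDl // nm_ge0.
have [c [c0 hc] lc] := inf_adherent d0 (opn_has_inf T).
apply: le_trans (hc x) _; apply: le_trans (_ : (opn T + e / (nm x + 1)) * nm x <= _).
 by rewrite ler_wpM2r ?nm_ge0 // ltW.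
rewrite mulrDl addrC lerD2r mulrAC ler_pdivrMr ?ltr_wpDl ?nm_ge0 //.
by rewrite ler_pM2l // lerDl.
Qed.
Lemma opn_leP T c : 0 <= c -> (opn T <= c) <-> (forall x, nm (T x) <= c * nm x).
Proof.
move=> c0; split=> [h x|]; last exact: opn_le.
by apply: le_trans (opnP T x) _; rewrite ler_wpM2r ?nm_ge0.
Qed.
Lemma opnD S T : opn (S + T) <= opn S + opn T.
Proof.
apply: opn_le; first by rewrite addr_ge0 ?opn_ge0.
by move=> x; rewrite opE (le_trans (nmD _ _)) // mulrDl lerD ?opnP.
Qed.
Lemma opnM S T : opn (S * T) <= opn S * opn T.
Proof.
apply: opn_le; first by rewrite mulr_ge0 ?opn_ge0.
move=> x; rewrite opE (le_trans (opnP _ _)) // -mulrA ler_wpM2l ?opn_ge0 //.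
exact: opnP.
Qed.
Lemma opnM_le S T c : opn S * opn T <= c -> opn (S * T) <= c.
Proof. exact: le_trans (opnM _ _). Qed.
Lemma opnN T : opn (- T) = opn T.
Proof. by congr inf; apply/seteqP; split=> c [c0 h]; split=> // x; have := h x; rewrite opE nmN. Qed.
Lemma opnB S T : opn (S - T) <= opn S + opn T.
Proof. by rewrite -(opnN T) opnD. Qed.
Lemma opn_bc S T : opn (S - T) = opn (T - S). Proof. by rewrite -opnN opprB. Qed.
Lemma opn0 : opn 0 = 0.
Proof.
apply/eqP; rewrite eq_le opn_ge0 andbT; apply: opn_le=> // x.
by rewrite opE nm0 mul0r.
Qed.
Lemma opnR c T : opn (rso c T) <= `|c| * opn T.
Proof.
apply: opn_le; first by rewrite mulr_ge0 ?opn_ge0.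
by move=> x; rewrite opR nmZ -mulrA ler_wpM2l // opnP.
Qed.
Lemma opn_eq0 T : opn T = 0 -> T = 0.
Proof.
move=> h; apply: bop_ext=> x; apply: nm_eq0; apply/eqP; rewrite eq_le nm_ge0 andbT.
by have := opnP T x; rewrite h mul0r.
Qed.
Lemma opn_leE (T : bop) c : opnorm_le T c <-> 0 <= c /\ opn T <= c.
Proof.
split=> -[c0 h]; split=> //.
 by apply: opn_le=> // x; have := h x; rewrite !normE -rmorphM lecR.
by move=> x; rewrite !normE -rmorphM lecR; move: x; apply/opn_leP.
Qed.
End BoundedOperators.
Arguments bop {R}.

(** * Orthogonal projection, Riesz representation, adjoints *)

Section Projection.
Variables (R : realType) (K : hilb R).
Implicit Types (x y z : K) (c : R) (V : set K).

Definition subspace V := [/\ V 0, (forall x y, V x -> V y -> V (x + y)) &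
 (forall c x, V x -> V (rs c x))].
Definition seq_closed V := forall u x, (forall n, V (u n)) -> cv u x -> V x.

(** The parallelogram law for [x - a] and [x - b]. It makes minimizing sequences Cauchy, because the
    midpoint of [a] and [b] cannot beat the infimum. *)
Lemma ip_half a b x : ip (a - b) (a - b) = 2 * ip (x - a) (x - a) + 2 * ip (x - b) (x - b)
 - 4 * ip (x - rs 2^-1 (a + b)) (x - rs 2^-1 (a + b)).
Proof. by rewrite !ipE (ipC a x) (ipC b x) (ipC b a); field. Qed.

(** Moving [p] along [v] by the optimal step [<x - p, v> / <v, v>] would lower the squared distance
    by [<x - p, v>^2 / <v, v>], which minimality forbids unless it vanishes. *)
Lemma min_orth x p V (d : R) : subspace V -> V p -> ip (x - p) (x - p) <= d ->
 (forall v, V v -> d <= ip (x - v) (x - v)) -> forall v, V v -> ip (x - p) v = 0.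
Proof.
move=> [V0 VD VZ] Vp hd hm v Vv.
have [v0|nv] := eqVneq (ip v v) 0; first by rewrite (ipxx_eq0 v0) ip0r.
have vp : 0 < ip v v by rewrite lt_def nv ip_ge0.
set t := ip (x - p) v / ip v v.
have := hm (p + rs t v) (VD _ _ Vp (VZ _ _ Vv)).
have -> : x - (p + rs t v) = (x - p) - rs t v by rewrite opprD addrA.
rewrite (ipBl (x - p)) !(ipBr _ _ (rs t v)) !ipZl !ipZr (ipC v) => h.
have e : t * ip v v = ip (x - p) v by rewrite /t divfK.
have {h} : ip (x - p) v * t <= 0 by move: h; rewrite e; lra.
rewrite /t mulrA -expr2 pmulr_lle0 ?invr_gt0 // => h2.
by apply/eqP; rewrite -sqrf_eq0 eq_le h2 sqr_ge0.
Qed.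

(** Only a real subspace is asked for, so that the kernel of a real functional qualifies in
    [riesz]. *)
Lemma projection_thm V x : subspace V -> seq_closed V ->
 exists2 p, V p & forall v, V v -> ip (x - p) v = 0.
Proof.
move=> sV cV; have [V0 VD VZ] := sV.
set S := [set ip (x - v) (x - v) | v in V].
have hS : has_inf S by split; [exists (ip (x - 0) (x - 0)); exists 0 | exists 0=> _ [v _ <-]; apply: ip_ge0].
have hm v : V v -> inf S <= ip (x - v) (x - v) by move=> Vv; apply: ge_inf; [case: hS|exists v].
have hex n : {v | V v /\ ip (x - v) (x - v) < inf S + n.+1%:R^-1}.
 apply/cid; have n0 : 0 < n.+1%:R^-1 :> R by [].
 by have [_ [v Vv <-] h] := inf_adherent n0 hS; exists v.
pose u n := sval (hex n).
have Vu n : V (u n) by rewrite /u; case: (hex n) => v [].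
have hu n : ip (x - u n) (x - u n) < inf S + n.+1%:R^-1 by rewrite /u; case: (hex n) => v [].
have [|p up] := @cv_complete _ _ u.
 move=> e e0.
 have e4 : 0 < e ^+ 2 / 4 by rewrite divr_gt0 // exprn_gt0.
 have [n0 hn0] : exists n0, n0.+1%:R^-1 < e ^+ 2 / 4.
  have := near_infty_natSinv_lt (PosNum e4) => -[n0 _ h]; exists n0; exact: (h n0 (leqnn n0)).
 have hle n : (n0 <= n)%N -> ip (x - u n) (x - u n) < inf S + e ^+ 2 / 4.
  move=> hn; apply: lt_trans (hu n) _; rewrite ltrD2l; apply: le_lt_trans hn0.
  by rewrite lef_pV2 ?posrE // ler_nat.
 exists n0=> n m hn hk.
 rewrite -(@ltr_pXn2r _ 2) ?nnegrE ?nm_ge0 ?ltW // nmsq (ip_half _ _ x).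
 have := hm _ (VZ 2^-1 _ (VD _ _ (Vu n) (Vu m))).
 by have := hle _ hn; have := hle _ hk; lra.
exists p; first exact: cV up.
apply: (min_orth sV _ _ hm); first exact: cV up.
have h1 : ip (x - u n) (x - u n) @[n --> \oo] --> ip (x - p) (x - p) by apply: cv_ip; (apply: cvB; [exact: cv_const|]).
have h2 : inf S + n.+1%:R^-1 @[n --> \oo] --> inf S.
 have h := cvgD (cvg_cst (inf S)) (@cvg_harmonic R); rewrite addr0 in h; exact: h.
apply: (ler_cvg_to h1 h2); near=> n; exact: ltW.
Unshelve. all: by end_near. Qed.

Lemma riesz (f : K -> R) c : (forall x y, f (x + y) = f x + f y) ->
 (forall c x, f (rs c x) = c * f x) -> (forall x, `|f x| <= c * nm x) ->
 exists z, forall x, f x = ip x z.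
Proof.
move=> fD fZ fc.
have f0 : f 0 = 0 by rewrite -(scale0r (0 : K)) (_ : 0 *: 0 = rs 0 0) // fZ mul0r.
have fB x y : f (x - y) = f x - f y by rewrite -[- y]scaleN1r (_ : -1 *: y = rs (-1) y) ?fD ?fZ ?mulN1r // /rs rmorphN.
have [h|] := pselect (forall x, f x = 0); first by exists 0=> x; rewrite h ipE.
move=> /existsNP[x0 /eqP fx0].
have [||p fp hp] := @projection_thm [set x | f x = 0] x0.
- by split=> //= [x y hx hy|d x hx]; rewrite ?fD ?fZ hx ?hy ?addr0 ?mulr0.
- move=> u x hu ux /=; apply/eqP; rewrite -normr_eq0 eq_le normr_ge0 andbT.
 have h : c * nm (u n - x) @[n --> \oo] --> (0 : R) by have h := cvgM (cvg_cst c) ux; rewrite mulr0 in h; exact: h.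
 have h2 : `|f x| @[n --> \oo] --> `|f x| by exact: cvg_cst.
 apply: (ler_cvg_to h2 h); near=> n.
 by apply: le_trans (fc _); rewrite fB hu sub0r normrN.
(* [w] spans the orthogonal complement of the kernel; the representing vector is the multiple of [w]
   whose product with [w] is [f w]. *)
set w := x0 - p in hp; have fw : f w = f x0 by rewrite fB fp subr0.
have nw : ip w w != 0 by apply/eqP=> /ipxx_eq0 w0; move: fx0; rewrite -fw w0 f0 eqxx.
exists (rs (f w / ip w w) w) => x; rewrite ipZr.
have nfw : f w != 0 by rewrite fw.
have := hp (x - rs (f x / f w) w); rewrite ipBr ipZr (ipC w x) /= fB fZ divfK // subrr=> /(_ erefl) h.
have -> : ip x w = f x / f w * ip w w by lra.
by field; rewrite nfw nw.
Unshelve. all: by end_near. Qed.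

Lemma complex_split (k : R[i]) x : k *: x = rs (complex.Re k) x + 'i *: rs (complex.Im k) x.
Proof. by rewrite {1}(complexE k) scalerDl -scalerA. Qed.

Lemma real_linear (T : K -> K) : (forall x y, T (x + y) = T x + T y) ->
 (forall c x, T (rs c x) = rs c (T x)) -> (forall x, T ('i *: x) = 'i *: T x) -> linear T.
Proof. by move=> TD TZ Ti k x y; rewrite TD !(complex_split k) TD Ti !TZ. Qed.

Lemma adj_ex (T : bop K) : exists S : bop K, forall x y, ip (T x) y = ip x (S y).
Proof.
have h y : {z | forall x, ip (T x) y = ip x z}.
 apply/cid; apply: (@riesz _ (opn T * nm y)) => [a b|c a|a]; rewrite ?linearD ?op_rs ?ipE //.
 apply: le_trans (CSn _ _) _; rewrite -mulrA (mulrC (nm y)) mulrA ler_wpM2r ?nm_ge0 //.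
 exact: opnP.
pose S y := sval (h y); have SE x y : ip (T x) y = ip x (S y) by rewrite /S; case: (h y).
have lS : linear S.
 apply: real_linear=> [a b|c a|a]; apply: ip_ext=> z; rewrite !(ipC _ z) ?ipE -!SE ?ipE //.
 by rewrite -[RHS]opprK -ip_i -SE linearZ ip_i opprK.
have bS : bounded_op S.
 apply: (@bounded_lin _ _ _ (opn T)) => // y.
 have [->|n0] := eqVneq (nm (S y)) 0; first by rewrite mulr_ge0 ?opn_ge0 ?nm_ge0.
 have p0 : 0 < nm (S y) by rewrite lt_def n0 nm_ge0.
 rewrite -(ler_pM2l p0) -expr2 nmsq -SE (le_trans (ip_le _ _)) //.
 by rewrite mulrA (mulrC (nm (S y))) ler_wpM2r ?nm_ge0 // opnP.
by exists (mkbop bS).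
Qed.

Definition adj (T : bop K) : bop K := sval (cid (adj_ex T)).
Lemma adjE (T : bop K) x y : ip (T x) y = ip x (adj T y).
Proof. by rewrite /adj; case: cid=> S /= ->. Qed.
Lemma adjEl (T : bop K) x y : ip (adj T x) y = ip x (T y).
Proof. by rewrite ipC -adjE ipC. Qed.
Lemma adj_uniq (S T : bop K) : (forall x y, ip (T x) y = ip x (S y)) -> adj T = S.
Proof.
by move=> h; apply: bop_ext=> y; apply: ip_ext=> z; rewrite !(ipC _ z) -adjE h.
Qed.
Lemma adjK : involutive adj.
Proof. by move=> T; apply: adj_uniq=> x y; rewrite adjEl. Qed.
Lemma adjD S T : adj (S + T) = adj S + adj T.
Proof. by apply: adj_uniq=> x y; rewrite !opE !ipE !adjE. Qed.
Lemma adjN T : adj (- T) = - adj T.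
Proof. by apply: adj_uniq=> x y; rewrite !opE !ipE !adjE. Qed.
Lemma adjB S T : adj (S - T) = adj S - adj T.
Proof. by rewrite adjD adjN. Qed.
Lemma adjM S T : adj (S * T) = adj T * adj S.
Proof. by apply: adj_uniq=> x y; rewrite !opE !adjE. Qed.
Lemma adj1 : adj 1 = 1. Proof. exact: adj_uniq. Qed.
Lemma adj0 : adj 0 = 0. Proof. by apply: adj_uniq=> x y; rewrite !opE !ipE. Qed.
Lemma adjR c T : adj (rso c T) = rso c (adj T).
Proof. by apply: adj_uniq=> x y; rewrite !opR !ipE adjE. Qed.
Lemma adji T : adj ('i *: T) = - ('i *: adj T).
Proof. by apply: adj_uniq=> x y; rewrite !opE ip_i adjE linearZ ipNr. Qed.
Lemma adjX T n : adj (T ^+ n) = adj T ^+ n.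
Proof. by elim: n=> [|n IH]; rewrite ?expr0 ?adj1 // exprS adjM IH exprSr. Qed.
Lemma opn_adj T : opn (adj T) = opn T.
Proof.
suff h S : opn (adj S) <= opn S by apply/eqP; rewrite eq_le h -{1}(adjK T) h.
apply: opn_le; first exact: opn_ge0.
move=> y; have [->|n0] := eqVneq (nm (adj S y)) 0; first by rewrite mulr_ge0 ?opn_ge0 ?nm_ge0.
have p0 : 0 < nm (adj S y) by rewrite lt_def n0 nm_ge0.
rewrite -(ler_pM2l p0) -expr2 nmsq -adjE (le_trans (ip_le _ _)) //.
by rewrite mulrA (mulrC (nm (adj S y))) ler_wpM2r ?nm_ge0 // opnP.
Qed.
Lemma is_adjointE (S T : bop K) : is_adjoint (hdot K) T S <-> adj T = S.
Proof.
split=> [h|<-].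
 by apply: adj_uniq=> x y; rewrite /ip h.
by move=> x y; rewrite !dotE !adjE linearZ.
Qed.
End Projection.

(** * Positive operators, monotone limits, square roots, projections *)

Section Positive.
Variables (R : realType) (K : hilb R).
Implicit Types (x y z : K) (c m : R) (S T U : bop K).

Definition sa T := adj T = T.
Lemma saE T x y : sa T -> ip (T x) y = ip x (T y). Proof. by move=> h; rewrite adjE h. Qed.
Lemma saP T : (forall x y, ip (T x) y = ip x (T y)) -> sa T. Proof. exact: adj_uniq. Qed.
Lemma saD S T : sa S -> sa T -> sa (S + T). Proof. by rewrite /sa adjD=> -> ->. Qed.
Lemma saB S T : sa S -> sa T -> sa (S - T). Proof. by rewrite /sa adjB=> -> ->. Qed.
Lemma saR c T : sa T -> sa (rso c T). Proof. by rewrite /sa adjR=> ->. Qed.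
Lemma sa1 : sa 1. Proof. by rewrite /sa adj1. Qed.
Lemma sa0 : sa 0. Proof. by rewrite /sa adj0. Qed.
Lemma saM S T : sa S -> sa T -> S * T = T * S -> sa (S * T).
Proof. by rewrite /sa adjM=> -> -> ->. Qed.
Lemma saX T n : sa T -> sa (T ^+ n). Proof. by rewrite /sa adjX=> ->. Qed.
Lemma sa_conj S T : sa T -> sa (adj S * T * S).
Proof. by rewrite /sa !adjM adjK mulrA=> ->. Qed.

Lemma sa_ext S T : sa S -> sa T -> (forall x, ip (S x) x = ip (T x) x) -> S = T.
Proof.
move=> hS hT h; apply: bop_ext=> x; apply: ip_ext=> y.
have := h (x + y); rewrite !opX !ipE (h x) (h y).
by rewrite (saE y x hS) (saE y x hT) !(ipC y); lra.
Qed.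

Definition pos T := sa T /\ forall x, 0 <= ip (T x) x.
Definition lo S T := pos (T - S).

Lemma loP S T : sa S -> sa T -> (forall x, ip (S x) x <= ip (T x) x) -> lo S T.
Proof. by move=> hS hT h; split; [exact: saB|move=> x; rewrite opE ipBl subr_ge0]. Qed.
Lemma loE S T x : lo S T -> ip (S x) x <= ip (T x) x.
Proof. by case=> _ /(_ x); rewrite opE ipBl subr_ge0. Qed.
Lemma pos0 : pos 0. Proof. by split=> [|x]; [exact: sa0|rewrite opE ipE]. Qed.
Lemma pos1 : pos 1. Proof. by split=> [|x]; [exact: sa1|exact: ip_ge0]. Qed.
Lemma posD S T : pos S -> pos T -> pos (S + T).
Proof. by case=> a b [c d]; split=> [|x]; [exact: saD|rewrite opE ipE addr_ge0]. Qed.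
Lemma posR c T : 0 <= c -> pos T -> pos (rso c T).
Proof. by move=> c0 [a b]; split=> [|x]; [exact: saR|rewrite opR ipE mulr_ge0]. Qed.
Lemma pos_conj S T : pos T -> pos (adj S * T * S).
Proof.
by case=> a b; split=> [|x]; [exact: sa_conj|rewrite !opE adjEl].
Qed.
Lemma pos_sq S : pos (adj S * S).
Proof. by have := pos_conj S pos1; rewrite mulr1. Qed.
Lemma pos_sa_sq T : sa T -> pos (T * T).
Proof. by move=> h; have := pos_sq T; rewrite h. Qed.
Lemma lo_refl T : lo T T. Proof. by rewrite /lo subrr; exact: pos0. Qed.
Lemma lo_trans S T U : lo S T -> lo T U -> lo S U.
Proof. by move=> h1 h2; have := posD h2 h1; rewrite /lo addrA subrK. Qed.
Lemma lo_opn T : sa T -> lo T (rso (opn T) 1).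
Proof.
move=> h; apply: loP=> //; first by apply: saR; exact: sa1.
move=> x; rewrite opR ipE op1 (le_trans (ip_le _ _)) // -nmsq expr2 mulrA.
by rewrite ler_wpM2r ?nm_ge0 ?opnP.
Qed.
Lemma sa_abs_le T x : `|ip (T x) x| <= opn T * ip x x.
Proof.
rewrite (le_trans (CSn _ _)) // -nmsq expr2 mulrA.
by rewrite ler_wpM2r ?nm_ge0 ?opnP.
Qed.

(** The quadratic polynomial [t -> <T (x + t y), x + t y>] is nonnegative, so its discriminant is
    not positive. *)
Lemma pos_CS T x y : pos T -> ip (T x) y ^+ 2 <= ip (T x) x * ip (T y) y.
Proof.
case=> hs hT; set a := ip (T x) x; set b := ip (T x) y; set d := ip (T y) y.
have q t : 0 <= a + t * (2 * b) + t * t * d.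
 have := hT (x + rs t y); rewrite !opX !ipE (saE y x hs) (ipC y) -/a -/b -/d.
 by congr (_ <= _); ring.
have a0 : 0 <= a by exact: hT. have d0 : 0 <= d by exact: hT.
have [d1|d1] := eqVneq d 0.
 (* When the leading coefficient vanishes the polynomial is affine; at this [t] it would take the
    value -1 if its slope were nonzero. *)
 rewrite d1 mulr0; have := q (- (a + 1) / (2 * b)); rewrite d1 mulr0 addr0.
 have [->|nb] := eqVneq b 0; first by rewrite expr0n.
 by rewrite divfK ?mulf_neq0 // => h; exfalso; lra.
have dp : 0 < d by rewrite lt_def d1.
have := q (- b / d) => h.
rewrite -subr_ge0 -(pmulr_rge0 _ (_ : 0 < d^-1)) ?invr_gt0 //.
by move: h; congr (_ <= _); field.
Qed.

(** [pos_CS] with [y = T x], in which [<T T x, T x>] is at most [m] times the squared norm of [T x].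
    It upgrades convergence of quadratic forms to strong convergence. *)
Lemma pos_nm T x m : 0 <= m -> pos T -> lo T (rso m 1) -> nm (T x) ^+ 2 <= m * ip (T x) x.
Proof.
move=> m0 pT lT; have [n0|n0] := eqVneq (nm (T x) ^+ 2) 0.
 by rewrite n0 mulr_ge0 //; case: pT.
have p0 : 0 < nm (T x) ^+ 2 by rewrite lt_def n0 sqr_ge0.
rewrite -(ler_pM2l p0).
have := pos_CS x (T x) pT; have := loE (T x) lT; rewrite opR ipE op1 -nmsq -expr2=> h1 h2.
by have h3 := ler_wpM2l (pT.2 x) h1; move: h2; rewrite expr2; lra.
Qed.
Lemma pos_ker T x : pos T -> ip (T x) x = 0 -> T x = 0.
Proof.
move=> pT h; apply: ipxx_eq0; have := pos_CS x (T x) pT; rewrite h mul0r=> h2.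
by apply/eqP; rewrite -sqrf_eq0 eq_le h2 sqr_ge0.
Qed.
Lemma pos_opn T m : 0 <= m -> pos T -> lo T (rso m 1) -> opn T <= m.
Proof.
move=> m0 pT lT; apply: opn_le=> // x.
apply: nm_le; first by rewrite mulr_ge0 ?nm_ge0.
rewrite -nmsq (le_trans (pos_nm x m0 pT lT)) // exprMn expr2 -mulrA ler_wpM2l // nmsq.
by have := loE x lT; rewrite opR ipE op1.
Qed.
Lemma sa_opn T m : 0 <= m -> sa T -> (forall x, `|ip (T x) x| <= m * ip x x) -> opn T <= m.
Proof.
move=> m0 sT h.
have q x y : 4 * ip (T x) y = ip (T (x + y)) (x + y) - ip (T (x - y)) (x - y) by rewrite !opX !ipE (saE y x sT) (ipC y); ring.
have b x y : 4 * ip (T x) y <= 2 * m * (ip x x + ip y y).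
 rewrite q (le_trans (ler_norm _)) // (le_trans (ler_normB _ _)) //.
 apply: le_trans (lerD (h _) (h _)) _; rewrite !ipE (ipC y); lra.
apply: opn_le=> // x; have [->|nx] := eqVneq x 0; first by rewrite opX nm0 mulr0.
have [->|nT] := eqVneq (T x) 0; first by rewrite nm0 mulr_ge0 ?nm_ge0.
have px : 0 < nm x by rewrite lt_def nm_ge0 andbT; apply: contra_neq nx=> /nm_eq0.
have pT : 0 < nm (T x) by rewrite lt_def nm_ge0 andbT; apply: contra_neq nT=> /nm_eq0.
(* Rescaling gives both vectors the same norm, so that the polarized estimate loses no constant. *)
have := b (rs (nm (T x)) x) (rs (nm x) (T x)).
rewrite !opX !ipE -!nmsq=> hb.
have {hb} : (nm (T x) * nm x * nm (T x)) * nm (T x) <= (nm (T x) * nm x * nm (T x)) * (m * nm x) by move: hb; rewrite !expr2; lra.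
by rewrite ler_pM2l // !mulr_gt0.
Qed.

Section Monotone.
Variables (T : nat -> bop K) (m : R).
Hypotheses (Tsa : forall n, sa (T n)) (Tmono : forall n, lo (T n) (T n.+1))
 (Tm : forall n, lo (T n) (rso m 1)).

Lemma mono_le n k : (n <= k)%N -> lo (T n) (T k).
Proof.
move=> /subnK <-; elim: (k - n)%N=> [|j IH]; first exact: lo_refl.
by apply: lo_trans IH _; rewrite addSn.
Qed.

(** The forms [<T n x, x>] are increasing and bounded, hence Cauchy; [pos_nm] applied to the
    positive differences [T k - T n] turns this into Cauchyness of the vectors [T n x]. *)
Lemma vigier : exists S, [/\ sa S, forall x, cv (fun n => T n x) (S x),
 forall n, lo (T n) S & forall U, sa U -> (forall n, lo (T n) U) -> lo S U].
Proof.
set M := opn (T 0) + `|m| + 1.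
have M0 : 0 <= M by have := opn_ge0 (T 0); have := normr_ge0 m; rewrite /M; lra.
have bd n k : (n <= k)%N -> lo (T k - T n) (rso M 1).
 move=> nk; apply: loP; [exact: saB|by apply: saR; exact: sa1|move=> x].
 rewrite opE ipBl opR ipE op1.
 have h1 := loE x (Tm k); have h2 := loE x (mono_le (leq0n n)).
 have := sa_abs_le (T 0) x; rewrite opR ipE op1 in h1.
 rewrite ler_norml=> /andP[h3 _]; have h4 := ip_ge0 x.
 have : m * ip x x <= `|m| * ip x x by rewrite ler_wpM2r // ler_norm.
 by rewrite /M; lra.
have est x n k : (n <= k)%N -> nm (T k x - T n x) ^+ 2 <= M * (ip (T k x) x - ip (T n x) x) by move=> nk; have := pos_nm x M0 (mono_le nk) (bd _ _ nk); rewrite opE ipBl.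
pose a x n := ip (T n x) x.
have cva x : cvgn (a x).
 apply: nondecreasing_is_cvgn.
  by apply/nondecreasing_seqP=> n; exact: loE.
 by exists (m * ip x x) => _ [n _ <-]; have := loE x (Tm n); rewrite opR ipE.
have hcv x : exists y, cv (fun n => T n x) y.
 apply: cv_complete=> e e0.
 have e1 : 0 < e ^+ 2 / (2 * (M + 1)) by rewrite divr_gt0 ?exprn_gt0 //; lra.
 have /cvgrPdist_lt /(_ _ e1) [n0 _ hn] := cva x.
 have key n k : (n0 <= n)%N -> (n <= k)%N -> nm (T k x - T n x) < e.
  move=> h1 h2; rewrite -(@ltr_pXn2r _ 2) ?nnegrE ?nm_ge0 ?ltW //.
  apply: le_lt_trans (est x _ _ h2) _.
  have := hn n h1; have := hn k (leq_trans h1 h2); rewrite /a /= => A B.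
  have : ip (T k x) x - ip (T n x) x < 2 * (e ^+ 2 / (2 * (M + 1))).
   move: A B; rewrite !ltr_norml=> /andP[A1 A2] /andP[B1 B2]; lra.
  move=> C; apply: le_lt_trans (_ : M * (2 * (e ^+ 2 / (2 * (M + 1)))) < _).
   by rewrite ler_wpM2l // ltW.
  have -> : M * (2 * (e ^+ 2 / (2 * (M + 1)))) = e ^+ 2 * (M / (M + 1)) by field; apply/eqP; lra.
  have M1 : 0 < M + 1 by lra.
  by rewrite gtr_pMr ?exprn_gt0 // ltr_pdivrMr //; lra.
 exists n0=> n k hn1 hk1; case: (leqP n k) => [h|/ltnW h]; last exact: key.
 by rewrite nmBC; exact: key.
pose s x := sval (cid (hcv x)).
have hs x : cv (fun n => T n x) (s x) by rewrite /s; case: cid.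
have ls : linear s.
 move=> k x y; apply: (cv_uniq (hs _)).
 under eq_fun do rewrite op_add op_cz.
 by apply: cvD=> //; exact: cvZ.
have cvip x y : ip (T n x) y @[n --> \oo] --> ip (s x) y by apply: cv_ip=> //; exact: cv_const.
have bT n : opn (T n) <= opn (T 0) + M.
 have := opnD (T 0) (T n - T 0); rewrite addrCA subrr addr0=> h.
 by apply: le_trans h _; rewrite lerD2l; apply: pos_opn=> //; [exact: mono_le|exact: bd].
have bs : bounded_op s.
 apply: (@bounded_lin _ _ _ (opn (T 0) + M)) => // x.
 apply: (ler_cvg_to (cv_nm (hs x)) (cvg_cst ((opn (T 0) + M) * nm x))).
 near=> n; apply: le_trans (opnP _ _) _.
 by rewrite ler_wpM2r ?nm_ge0.
pose S := mkbop bs.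
have sS : sa S.
 apply: saP=> x y; apply: (cvg_unique _ (cvip x y)) => //=.
 under eq_fun do rewrite (saE _ _ (Tsa _)) ipC.
 by rewrite ipC; exact: cvip.
exists S; split=> // [n|U sU hU].
 apply: loP=> // x; apply: (ler_cvg_to (cvg_cst (ip (T n x) x)) (cvip x x)).
 by near=> k; apply/loE/mono_le; near: k; exists n.
apply: loP=> // x; apply: (ler_cvg_to (cvip x x) (cvg_cst (ip (U x) x))).
by near=> k; apply: loE.
Unshelve. all: by end_near. Qed.
End Monotone.

Lemma cv_bop (T : bop K) u x : cv u x -> cv (fun n => T (u n)) (T x).
Proof.
move=> ux; apply: (@cv_le _ _ _ _ (fun n => opn T * nm (u n - x))) => [n|].
 by rewrite -op_sub opnP.
by have h := cvgM (cvg_cst (opn T)) ux; rewrite mulr0 in h; exact: h.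
Qed.

Definition scv (T : nat -> bop K) S := forall x, cv (fun n => T n x) (S x).
Lemma scvD (S T : nat -> bop K) S' T' : scv S S' -> scv T T' -> scv (fun n => S n + T n) (S' + T').
Proof. by move=> h1 h2 x; exact: cvD. Qed.
Lemma scvR c (T : nat -> bop K) T' : scv T T' -> scv (fun n => rso c (T n)) (rso c T').
Proof. by move=> h1 x; exact: cvZ. Qed.
Lemma scv_cst T : scv (fun=> T) T. Proof. by move=> x; exact: cv_const. Qed.
(** Multiplication is not jointly strongly continuous; the uniform bound on the left factors absorbs
    [S n (T n x - T' x)]. *)
Lemma scvM (S T : nat -> bop K) S' T' m : (forall n, opn (S n) <= m) ->
 scv S S' -> scv T T' -> scv (fun n => S n * T n) (S' * T').
Proof.
move=> hm h1 h2 x; rewrite opM.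
apply: (@cv_le _ _ _ _ (fun n => m * nm (T n x - T' x) + nm (S n (T' x) - S' (T' x)))) => [n|].
 rewrite opM -[X in nm (X - _)](subrK (S n (T' x))) -addrA -op_sub (le_trans (nmD _ _)) // lerD2r.
 by rewrite (le_trans (opnP _ _)) // ler_wpM2r ?nm_ge0.
have h := cvgD (cvgM (cvg_cst m) (h2 x)) (h1 (T' x)); rewrite mulr0 addr0 in h; exact: h.
Qed.
Lemma scv_uniq (T : nat -> bop K) S S' : scv T S -> scv T S' -> S = S'.
Proof. by move=> h h'; apply: bop_ext=> x; exact: (cv_uniq (h x) (h' x)). Qed.
Lemma scv_sa (T : nat -> bop K) S : (forall n, sa (T n)) -> scv T S -> sa S.
Proof.
move=> hs hT; apply: saP=> x y.
have h1 : ip (T n x) y @[n --> \oo] --> ip (S x) y by apply: cv_ip=> //; exact: cv_const.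
have h2 : ip (T n x) y @[n --> \oo] --> ip x (S y) by under eq_fun do rewrite (saE _ _ (hs _)); apply: cv_ip => //; exact: cv_const.
exact: (cvg_unique _ h1 h2).
Qed.
Lemma scv_comm (T : nat -> bop K) S U : (forall n, U * T n = T n * U) -> scv T S -> U * S = S * U.
Proof.
move=> h hT; apply: bop_ext=> x; rewrite !opM; apply: cv_uniq (hT (U x)).
under eq_fun do rewrite -opM -h opM.
exact: cv_bop.
Qed.
Lemma scv_lo_le (T : nat -> bop K) S x c : scv T S -> (forall n, ip (T n x) x <= c) -> ip (S x) x <= c.
Proof.
move=> hT h; have h1 : ip (T n x) x @[n --> \oo] --> ip (S x) x.
 by apply: cv_ip=> //; exact: cv_const.
by apply: (ler_cvg_to h1 (cvg_cst c)); near=> n.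
Unshelve. all: by end_near. Qed.

Section SquareRoot.
(** The polynomials in [A] with nonnegative coefficients. This cone is closed under products and
    consists of positive operators when [A] is positive, although products of positive operators
    need not be positive in general. *)
Inductive nnp (A : bop K) : bop K -> Prop :=
| nnp_pow n : nnp A (A ^+ n)
| nnp_add S T : nnp A S -> nnp A T -> nnp A (S + T)
| nnp_scale c S : 0 <= c -> nnp A S -> nnp A (rso c S).

Lemma rsoMl c S T : rso c S * T = rso c (S * T). Proof. by rewrite /rso bZAl. Qed.
Lemma rsoMr c S T : S * rso c T = rso c (S * T). Proof. by rewrite /rso bZAr. Qed.
Lemma rsoD c S T : rso c (S + T) = rso c S + rso c T. Proof. exact: scalerDr. Qed.
Lemma rsoDl c d T : rso (c + d) T = rso c T + rso d T. Proof. by rewrite /rso rmorphD scalerDl. Qed.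
Lemma rsoN c T : rso c (- T) = - rso c T. Proof. exact: scalerN. Qed.
Lemma rsoNl c T : rso (- c) T = - rso c T. Proof. by rewrite /rso rmorphN scaleNr. Qed.
Lemma rsoA c d T : rso c (rso d T) = rso (c * d) T. Proof. by rewrite /rso scalerA -rmorphM. Qed.
Lemma rso1 T : rso 1 T = T. Proof. exact: scale1r. Qed.
Lemma rso0 T : rso 0 T = 0. Proof. exact: scale0r. Qed.

Lemma nnp_comm A S U : U * A = A * U -> nnp A S -> U * S = S * U.
Proof.
move=> h; elim=> [n|S1 S2 _ h1 _ h2|c S1 _ _ h1].
- by elim: n=> [|n IH]; rewrite ?expr0 ?mulr1 ?mul1r // exprS mulrA h -mulrA IH mulrA.
- by rewrite mulrDr mulrDl h1 h2.
- by rewrite rsoMl rsoMr h1.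
Qed.
Lemma nnp_mul A S T : nnp A S -> nnp A T -> nnp A (S * T).
Proof.
move=> hS hT; elim: hS=> [n|S1 S2 _ h1 _ h2|c S1 c0 _ h1].
- elim: hT=> [k|T1 T2 _ h1 _ h2|c T1 c0 _ h1].
 + by rewrite -exprD; exact: nnp_pow.
 + by rewrite mulrDr; exact: nnp_add.
 + by rewrite rsoMr; exact: nnp_scale.
- by rewrite mulrDl; exact: nnp_add.
- by rewrite rsoMl; exact: nnp_scale.
Qed.
Lemma nnp_pos A S : pos A -> nnp A S -> pos S.
Proof.
move=> hA; elim=> [n|S1 S2 _ h1 _ h2|c S1 c0 _ h1]; last 2 first.
- exact: posD.
- exact: posR.
split; first by apply: saX; exact: hA.1.
have sX k : sa (A ^+ k) by apply: saX; exact: hA.1.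
move=> x; rewrite -(odd_double_half n) -addnn; case: (odd n).
 have -> : A ^+ (true + (n./2 + n./2)) = A ^+ n./2 * (A * A ^+ n./2) by rewrite -exprS -exprD addnS.
 by rewrite opM saE // opM; exact: hA.2.
by rewrite add0n exprD opM saE //; exact: ip_ge0.
Qed.

(** With [A = 1 - T], the iteration [Y -> (A + Y^2) / 2] started at 0 has increments in the cone
    [nnp A]: each is half the product of the previous difference and the previous sum. Its monotone
    limit [Z] solves [2 Z = A + Z^2], that is [(1 - Z)^2 = T]. *)
Lemma sqrt_small T : pos T -> lo T 1 -> exists S, [/\ pos S, S * S = T &
 forall U, U * T = T * U -> U * S = S * U].
Proof.
move=> pT lT; set A := 1 - T; have pA : pos A := lT.
pose fix Y n := if n is n'.+1 then rso 2^-1 (A + Y n' * Y n') else 0.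
have nY n : nnp A (Y n).
 elim: n=> [|n IH] /=; first by rewrite -(rso0 (A ^+ 0)); apply: nnp_scale=> //; exact: nnp_pow.
 apply: nnp_scale; first by rewrite invr_ge0.
 by apply: nnp_add; [exact: (nnp_pow A 1)|exact: nnp_mul].
have cY S n : S * A = A * S -> S * Y n = Y n * S by move=> h; exact: nnp_comm (nY n).
have cYY n k : Y n * Y k = Y k * Y n by apply: (cY _ k); apply/esym/(cY A n).
have dY n : nnp A (Y n.+1 - Y n).
 elim: n=> [|n IH]; first by rewrite subr0; exact: nY.
 have -> : Y n.+2 - Y n.+1 = rso 2^-1 ((Y n.+1 - Y n) * (Y n.+1 + Y n)).
  rewrite {1}/Y -/Y {2}/Y -/Y /rso -scalerBr; congr (_ *: _).
  rewrite mulrDr !mulrBl (cYY n) addrA subrK opprD addrACA subrr add0r.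
  by [].
 by apply: nnp_scale; [rewrite invr_ge0|apply: nnp_mul=> //; exact: nnp_add].
have oA : opn A <= 1.
 apply: pos_opn=> //; rewrite rso1 /lo /A opprB addrCA subrr addr0; exact: pT.
have oY n : opn (Y n) <= 1.
 elim: n=> [|n IH]; first by rewrite opn0.
 have h2 : opn (Y n * Y n) <= 1 by apply: opnM_le; rewrite mulr_ile1 ?opn_ge0.
 apply: le_trans (opnR _ _) _; rewrite ger0_norm ?invr_ge0 //.
 by have := opnD A (Y n * Y n); lra.
have sY n : sa (Y n) by have [] := nnp_pos pA (nY n).
have lY n : lo (Y n) (rso 1 1).
 apply: lo_trans (lo_opn (sY n)) _; rewrite /lo /rso -scalerBl -rmorphB.
 by apply: posR pos1; rewrite subr_ge0.
have [|Z [sZ cZ lZ uZ]] := vigier sY _ lY; first by move=> n; apply: nnp_pos (dY n).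
have eZ : Z = rso 2^-1 (A + Z * Z).
 apply: (@scv_uniq (fun n => Y n.+1)).
  move=> x; apply/cvP=> e e0; have [n0 h] := (cvP _ _).1 (cZ x) e e0.
  by exists n0=> n hn; apply: h; exact: leqW.
 apply: scvR; apply: scvD; first exact: scv_cst.
 exact: (scvM oY).
exists (1 - Z); split.
- by have := uZ 1 sa1; apply; move=> n; have := lY n; rewrite rso1.
- have e2 : Z + Z = A + Z * Z.
  rewrite {1 2}eZ -rsoDl (_ : 2^-1 + 2^-1 = 1) ?rso1 //; lra.
 rewrite mulrBl mul1r mulrBr mulr1 opprB addrA addrAC.
 have -> : 1 - Z - Z + Z * Z = 1 - (Z + Z) + Z * Z by rewrite opprD addrA.
 by rewrite e2 opprD addrA subrK /A opprB addrCA subrr addr0.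
- move=> U hU; rewrite mulrBr mulrBl mulr1 mul1r; congr (_ - _).
 apply: (scv_comm _ cZ) => n; apply: cY.
 by rewrite /A mulrBr mulrBl mulr1 mul1r hU.
Qed.

Lemma sqrt_ex T : pos T -> exists S, [/\ pos S, S * S = T &
 forall U, U * T = T * U -> U * S = S * U].
Proof.
move=> pT; set c := opn T + 1; have c0 : 0 < c by have := opn_ge0 T; rewrite /c; lra.
have [||S [pS eS hS]] := @sqrt_small (rso c^-1 T).
- by apply: posR pT; rewrite invr_ge0 ltW.
- apply: loP; [by apply: saR; exact: pT.1|exact: sa1|move=> x].
 rewrite opR ipE op1 mulrC ler_pdivrMr //.
 have := loE x (lo_opn pT.1); rewrite opR ipE op1 /c=> h; have := ip_ge0 x; lra.
exists (rso (Num.sqrt c) S); split; first by apply: posR; rewrite ?sqrtr_ge0.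
 by rewrite rsoMl rsoMr eS !rsoA -expr2 sqr_sqrtr ?ltW // mulfV ?rso1 ?gt_eqF.
by move=> U hU; rewrite rsoMr rsoMl hS // rsoMr rsoMl hU.
Qed.
End SquareRoot.

Definition proj P := sa P /\ P * P = P.
Lemma proj_idem P x : proj P -> P (P x) = P x. Proof. by move=> [_ h]; rewrite -opM h. Qed.
Lemma proj_ip P x : proj P -> ip (P x) x = nm (P x) ^+ 2.
Proof. by move=> h; rewrite nmsq [RHS](saE _ _ h.1) proj_idem // ipC. Qed.
Lemma proj_ip2 P x : proj P -> ip (P x) x = ip (P x) (P x).
Proof. by move=> h; rewrite proj_ip // nmsq. Qed.
Lemma proj_pos P : proj P -> pos P.
Proof. by move=> h; split=> [|x]; [case: h|rewrite proj_ip // sqr_ge0]. Qed.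
Lemma projC P : proj P -> proj (1 - P).
Proof.
move=> [h1 h2]; split; first by apply: saB h1; exact: sa1.
by rewrite mulrBl mul1r mulrBr mulr1 h2 subrr subr0.
Qed.
Lemma proj_lo1 P : proj P -> lo P 1. Proof. by move/projC/proj_pos. Qed.
Lemma proj0 : proj 0. Proof. by split; [exact: sa0|rewrite mulr0]. Qed.
Lemma proj1 : proj 1. Proof. by split; [exact: sa1|rewrite mulr1]. Qed.
Lemma proj_opn P : proj P -> opn P <= 1.
Proof. by move=> h; apply: pos_opn=> //; [exact: proj_pos|rewrite rso1; exact: proj_lo1]. Qed.
Lemma proj_nm P x : proj P -> nm (P x) <= nm x.
Proof. by move=> /proj_opn /(opn_leP _ ler01) /(_ x); rewrite mul1r. Qed.
Lemma proj_pyth P x : proj P -> nm x ^+ 2 = nm (P x) ^+ 2 + nm ((1 - P) x) ^+ 2.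
Proof.
by move=> h; rewrite -!proj_ip //; [rewrite opE op1 nmsq ipBl addrC subrK|exact: projC].
Qed.
Lemma projM P Q : proj P -> proj Q -> P * Q = Q * P -> proj (P * Q).
Proof.
move=> [h1 h2] [h3 h4] h; split; first exact: saM.
by rewrite mulrA -(mulrA P) -h mulrA h2 -mulrA h4.
Qed.
Lemma proj_lo P Q : proj P -> proj Q -> lo P Q <-> Q * P = P.
Proof.
move=> hP hQ; split=> [h|h].
 apply: bop_ext=> x; rewrite opM; have := proj_pyth (P x) hQ.
 have := loE (P x) h; rewrite !proj_ip // proj_idem // => h1 h2.
 have : nm ((1 - Q) (P x)) ^+ 2 <= 0 by lra.
 rewrite expr2 opB op1=> h3; apply/esym/subr0_eq/nm_eq0; apply/eqP.
 by rewrite -sqrf_eq0 eq_le sqr_ge0 expr2 h3.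
have h' : P * Q = P by move: (congr1 (@adj _ _) h); rewrite adjM hP.1 hQ.1.
apply: loP; [exact: hP.1|exact: hQ.1|move=> x].
rewrite !proj_ip // -h' opM -(@ler_pXn2r _ 2) ?nnegrE ?sqr_ge0 //.
by rewrite !ler_pXn2r ?nnegrE ?sqr_ge0 ?nm_ge0 //; exact: proj_nm.
Qed.
Lemma proj_orth P Q : proj P -> proj Q -> lo (P + Q) 1 -> P * Q = 0.
Proof.
move=> hP hQ h; apply: bop_ext=> x; rewrite opM op0.
have := loE (Q x) h; rewrite opE op1 ipDl !proj_ip // proj_idem // -nmsq=> h2.
apply: nm_eq0; apply/eqP; rewrite -sqrf_eq0 eq_le sqr_ge0 andbT; lra.
Qed.
Lemma proj_ext P Q : proj P -> proj Q -> (forall x, P x = x <-> Q x = x) -> P = Q.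
Proof.
move=> hP hQ h; have hQP : Q * P = P.
 by apply: bop_ext=> x; rewrite opM; apply/h; rewrite proj_idem.
have hPQ : P * Q = Q by apply: bop_ext=> x; rewrite opM; apply/h; rewrite proj_idem.
by move: (congr1 (@adj _ _) hQP); rewrite adjM hP.1 hQ.1 hPQ.
Qed.

Lemma proj_ex (V : set K) : subspace V -> seq_closed V -> (forall x, V x -> V ('i *: x)) ->
 exists P, proj P /\ forall x, V x <-> P x = x.
Proof.
move=> sV cV iV; have [V0 VD VZ] := sV.
have h x : {p | V p /\ forall v, V v -> ip (x - p) v = 0} by apply/cid; have [p] := projection_thm x sV cV; exists p.
pose p x := sval (h x).
have Vp x : V (p x) by rewrite /p; case: (h x) => ? [].
have op x v : V v -> ip (x - p x) v = 0 by rewrite /p; case: (h x) => q [a hq] /=; exact: hq.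
have uniq x q : V q -> (forall v, V v -> ip (x - q) v = 0) -> p x = q.
 move=> Vq hq; have VB : V (p x - q).
  by apply: VD=> //; have := VZ (-1) _ Vq; rewrite /rs rmorphN scaleN1r.
 apply/subr0_eq/ipxx_eq0; have := hq _ VB; have := op x _ VB.
 by rewrite !(ipBl x) !(ipBl (p x)); lra.
have lp : linear p.
 apply: real_linear=> [x y|c x|x]; apply: uniq=> [|v Vv].
 - exact: VD.
 - by rewrite opprD addrACA ipDl !op ?addr0.
 - exact: VZ.
 - by rewrite !ipE -mulrBr -ipBl op // mulr0.
 - exact: iV.
 - by rewrite -scalerBr ip_i op ?oppr0 //; exact: iV.
have bp : bounded_op p.
 apply: (@bounded_lin _ _ _ 1) => // x; rewrite mul1r -(@ler_pXn2r _ 2) ?nnegrE ?nm_ge0 // !nmsq.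
 have := op x _ (Vp x); have := ip_ge0 (x - p x); rewrite !ipE (ipC (p x) x); lra.
exists (mkbop bp); split; first split.
- apply: saP=> x y /=; have := op x _ (Vp y); have := op y _ (Vp x).
 by rewrite !ipBl (ipC (p y) (p x)) (ipC y); lra.
- by apply: bop_ext=> x /=; apply: uniq=> // v Vv; rewrite subrr ip0l.
- move=> x; split=> [Vx|<-]; last exact: Vp.
 by apply: uniq=> // v Vv; rewrite subrr ip0l.
Qed.

(** If [U] commutes with [T] it preserves the kernel, so [P U P = U P]; the same for the adjoint of
    [U], after taking adjoints, gives [P U P = P U]. *)
Lemma ker_proj_ex T : exists P, [/\ proj P, forall x, T x = 0 <-> P x = x &
 forall U, U * T = T * U -> adj U * T = T * adj U -> U * P = P * U].
Proof.
have [|||P [pP hP]] := @proj_ex [set x | T x = 0].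
- by split=> /= [|x y hx hy|c x hx]; rewrite !opX ?hx ?hy ?addr0 // /rs scaler0.
- move=> u x hu ux /=; apply: (cv_uniq (cv_bop T ux)).
 by under eq_fun do rewrite hu; exact: cv_const.
- by move=> x /= hx; rewrite op_cz hx scaler0.
exists P; split=> // U h1 h2.
have hU S : S * T = T * S -> P * S * P = S * P.
 move=> hS; apply: bop_ext=> x; rewrite !opM; apply/hP=> /=.
 by rewrite -opM -hS opM ((hP (P x)).2 (proj_idem x pP)) opX.
have := congr1 (@adj _ _) (hU _ h2); rewrite !adjM adjK pP.1=> <-.
by rewrite mulrA; rewrite hU.
Qed.

Lemma sa_comm_adj T U : sa T -> U * T = T * U -> adj U * T = T * adj U.
Proof. by move=> hT h; have := congr1 (@adj _ _) h; rewrite !adjM hT. Qed.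

(** [E] projects onto the kernel of [|G| + G]. The kernel of [G] is thereby counted on the
    nonpositive side, so the form is strictly positive on the complement; this asymmetry will give
    right continuity of spectral families. *)
Lemma neg_proj G : sa G -> exists E, [/\ proj E,
 forall U, U * G = G * U -> U * E = E * U,
 forall x, E x = x -> ip (G x) x <= 0 & forall x, E x = 0 -> 0 <= ip (G x) x /\ (ip (G x) x = 0 -> x = 0)].
Proof.
move=> sG; have [A [pA eA cA]] := sqrt_ex (pos_sa_sq sG).
have cAG : G * A = A * G by apply: cA; rewrite mulrA.
have [E [pE kE cE]] := ker_proj_ex (A + G).
have cU U : U * G = G * U -> U * E = E * U.
 move=> h; apply: cE.
  by rewrite mulrDl mulrDr h cA // mulrA h -mulrA h mulrA.
 have h' := sa_comm_adj sG h.
 by rewrite mulrDl mulrDr h' cA // mulrA h' -mulrA h' mulrA.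
have EG : E * G = G * E by apply/esym/cU.
have EA : E * A = A * E by apply: cA; rewrite mulrA EG -mulrA EG mulrA.
have EB : E * (A - G) = A - G.
 apply: bop_ext=> x; rewrite opM; apply/kE; rewrite -opM mulrDl !mulrBr eA cAG.
 by rewrite addrA subrK subrr.
exists E; split=> // x hx.
 have /kE := hx; rewrite opD=> /eqP; rewrite addrC addr_eq0=> /eqP ->.
 by rewrite ipNl oppr_le0; exact: pA.2.
have GA : G x = A x.
 have : (A - G) x = 0 by rewrite -EB mulrBr EA EG -mulrBl opM hx opX.
 by rewrite opB=> /subr0_eq.
rewrite GA; split; first exact: pA.2.
move=> /(pos_ker pA) h; have /kE : (A + G) x = 0 by rewrite opD GA h addr0.
by rewrite hx.
Qed.
End Positive.

(** * Integrals of bounded measurable functions and dyadic approximation *)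

Section RealIntegrals.
Context {R : realType} {d : measure_display} {T : measurableType d}.
Implicit Types (mu : {measure set T -> \bar R}) (D : set T) (f g : T -> R).

Lemma Rdct mu D (f_ : nat -> T -> R) f g : measurable D ->
 (forall n, measurable_fun D (f_ n)) -> measurable_fun D f ->
 (forall x, D x -> f_ n x @[n --> \oo] --> f x) ->
 mu.-integrable D (EFin \o g) -> (forall n x, D x -> `|f_ n x| <= g x) ->
 mu.-integrable D (EFin \o f) /\
 \int[mu]_(x in D) f_ n x @[n --> \oo] --> \int[mu]_(x in D) f x.
Proof.
move=> mD mf_ mf cf ig fg.
have [] := @dominated_convergence _ _ _ mu D mD (fun n => EFin \o f_ n) (EFin \o f) (EFin \o g).
- by move=> n; apply/measurable_EFinP.
- exact/measurable_EFinP.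
- by apply: aeW=> x Dx; apply/cvg_EFin; [near=> n|exact: cf].
- exact: ig.
- by apply: aeW=> x n Dx; rewrite /= lee_fin; exact: fg.
move=> intf _ h; split=> //.
have ff : (\int[mu]_(x in D) (f x)%:E)%E \is a fin_num by exact: integrable_fin_num.
by apply: fine_cvg; rewrite fineK.
Unshelve. all: by end_near. Qed.

Definition bm f := measurable_fun setT f /\ exists c, forall x, `|f x| <= c.

Lemma bm_cst (c : R) : bm (fun=> c).
Proof. by split; [exact: measurable_cst|exists `|c|]. Qed.
Lemma bmD f g : bm f -> bm g -> bm (fun x => f x + g x).
Proof.
move=> [mf [c hc]] [mg [e he]]; split; first exact: measurable_funD.
by exists (c + e) => x; rewrite (le_trans (ler_normD _ _)) // lerD.
Qed.
Lemma bmM f g : bm f -> bm g -> bm (fun x => f x * g x).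
Proof.
move=> [mf [c hc]] [mg [e he]]; split; first exact: measurable_funM.
by exists (c * e) => x; rewrite normrM ler_pM.
Qed.
Lemma bmZ (c : R) f : bm f -> bm (fun x => c * f x).
Proof. by apply: bmM; exact: bm_cst. Qed.
Lemma bmN f : bm f -> bm (fun x => - f x).
Proof. by move=> h; under eq_fun do rewrite -mulN1r; exact: bmZ. Qed.
Lemma bmB f g : bm f -> bm g -> bm (fun x => f x - g x).
Proof. by move=> hf hg; apply: bmD=> //; exact: bmN. Qed.
Lemma bm_ind (A : set T) : measurable A -> bm (\1_A : T -> R).
Proof.
move=> mA; split; first exact: measurable_indic.
by exists 1=> x; rewrite indicE; case: (_ \in _); rewrite ?normr1 ?normr0.
Qed.
Lemma bm_sum I (r : seq I) (F : I -> T -> R) : (forall i, bm (F i)) ->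
 bm (fun x => \sum_(i <- r) F i x).
Proof.
move=> h; elim: r=> [|i r IH]; first by under eq_fun do rewrite big_nil; exact: bm_cst.
by under eq_fun do rewrite big_cons; exact: bmD.
Qed.

Section Finite.
Variable mu : {measure set T -> \bar R}.
Hypothesis muT : (mu setT < +oo)%E.
Lemma bm_int f : bm f -> mu.-integrable setT (EFin \o f).
Proof.
move=> [mf [c hc]]; apply: measurable_bounded_integrable=> //.
exists c; split; first exact: num_real.
by move=> x cx y _; apply: le_trans (hc y) _; exact: ltW.
Qed.
Lemma bint_D f g : bm f -> bm g ->
 \int[mu]_x (f x + g x) = \int[mu]_x f x + \int[mu]_x g x.
Proof. by move=> hf hg; apply: RintegralD=> //; exact: bm_int. Qed.
Lemma bint_B f g : bm f -> bm g ->
 \int[mu]_x (f x - g x) = \int[mu]_x f x - \int[mu]_x g x.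
Proof. by move=> hf hg; apply: RintegralB=> //; exact: bm_int. Qed.
Lemma bint_Z (c : R) f : bm f -> \int[mu]_x (c * f x) = c * \int[mu]_x f x.
Proof. by move=> hf; apply: RintegralZl=> //; exact: bm_int. Qed.
Lemma bint_le f g : bm f -> bm g -> (forall x, f x <= g x) ->
 \int[mu]_x f x <= \int[mu]_x g x.
Proof. by move=> hf hg h; apply: le_Rintegral=> //; exact: bm_int. Qed.
Lemma bint_cst (c : R) : \int[mu]_x c = c * fine (mu setT).
Proof. exact: Rintegral_cst. Qed.
Lemma bint_ind (A : set T) : measurable A -> \int[mu]_x (\1_A x : R) = fine (mu A).
Proof. by move=> mA; rewrite /Rintegral integral_indic // setIT. Qed.
Lemma bint_dct (f_ : nat -> T -> R) f (c : R) : (forall n, measurable_fun setT (f_ n)) ->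
 measurable_fun setT f ->
 (forall x, f_ n x @[n --> \oo] --> f x) -> (forall n x, `|f_ n x| <= c) ->
 \int[mu]_x f_ n x @[n --> \oo] --> \int[mu]_x f x.
Proof.
move=> mf_ mf cf hc; apply: (@Rdct mu setT f_ f (fun=> c) _ _ _ _ _ _).2=> //.
by apply: bm_int; exact: bm_cst.
Qed.
End Finite.

(* the binary digits of a function with values in [0, 1] *)
Section Digits.
Variable f : T -> R.
Fixpoint dg n (x : T) : R :=
 if n is n'.+1 then 2 * dg n' x - (if 2^-1 < dg n' x then 1 else 0) else f x.
Definition dset n : set T := [set x | 2^-1 < dg n x].
Hypothesis mf : measurable_fun setT f.

Lemma dg_ind n x : (if 2^-1 < dg n x then 1 else 0) = \1_(dset n) x :> R.
Proof. by rewrite indicE; case: ifPn=> h; [rewrite mem_set | rewrite memNset //; exact/negP]. Qed.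
Lemma mdg n : measurable_fun setT (dg n) /\ measurable (dset n).
Proof.
have md k : measurable_fun setT (dg k) -> measurable (dset k).
 move=> h; rewrite /dset -[X in measurable X]setTI.
 have -> : [set x | 2^-1 < dg k x] = dg k @^-1` `]2^-1, +oo[%classic by apply/seteqP; split=> x /=; rewrite in_itv /= andbT.
 exact: h.
elim: n=> [|n [IH1 IH2]]; first by split=> //; exact: md.
have h : measurable_fun setT (dg n.+1).
 rewrite /=; under eq_fun do rewrite dg_ind.
 apply: measurable_funB; last exact: measurable_indic.
 by apply: measurable_funM=> //; exact: measurable_cst.
by split=> //; exact: md.
Qed.
Hypothesis f01 : forall x, 0 <= f x <= 1.
Lemma dg01 n x : 0 <= dg n x <= 1.
Proof. by elim: n=> [|n IH] //=; move: IH; case: ifPn; rewrite -?leNgt; lra. Qed.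
Lemma dg_sum n x : f x = \sum_(k < n) 2^-1 ^+ k.+1 * \1_(dset k) x + 2^-1 ^+ n * dg n x.
Proof.
elim: n=> [|n IH]; first by rewrite big_ord0 expr0 add0r mul1r.
rewrite IH big_ord_recr /= -dg_ind -addrA; congr (_ + _).
rewrite exprSr /=; set a := 2^-1 ^+ n; set b := if _ then _ else _; lra.
Qed.
(** Truncated binary expansions: step functions that increase to [f] with uniform error [2^-n].
    Their increments are positive multiples of indicators, which is what monotone limits of
    operators require. *)
Definition dsum n x : R := \sum_(k < n) 2^-1 ^+ k.+1 * \1_(dset k) x.
Lemma bm_dsum n : bm (dsum n).
Proof. by apply: bm_sum=> k; apply: bmZ; apply: bm_ind; case: (mdg k). Qed.
Lemma dsum_bd n x : 0 <= f x - dsum n x <= 2^-1 ^+ n.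
Proof.
rewrite (dg_sum n) -/(dsum n x) addrAC subrr add0r.
have /andP[a b] := dg01 n x; have p : 0 <= 2^-1 ^+ n :> R by rewrite exprn_ge0 // invr_ge0.
by rewrite mulr_ge0 //= ler_piMr.
Qed.
Lemma half_cvg : 2^-1 ^+ n @[n --> \oo] --> (0 : R).
Proof. by apply: cvg_expr; rewrite ger0_norm ?invr_ge0 // invf_lt1 // ltr1n. Qed.
Lemma dsum_cvg x : dsum n x @[n --> \oo] --> f x.
Proof.
apply/cvgrPdist_lt=> e e0.
have /cvgrPdist_lt /(_ e e0) [n0 _ hn] := half_cvg.
exists n0=> // n /hn /=; rewrite sub0r normrN; apply: le_lt_trans.
have /andP[a b] := dsum_bd n x; rewrite ger0_norm //.
by rewrite ger0_norm ?exprn_ge0 ?invr_ge0.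
Qed.
Lemma dsum01 n x : 0 <= dsum n x <= 1.
Proof.
apply/andP; split.
 apply: sumr_ge0=> k _; rewrite mulr_ge0 ?exprn_ge0 ?invr_ge0 //.
by have := dsum_bd n x; have := f01 x; lra.
Qed.
End Digits.
End RealIntegrals.

Lemma nat_gt (R : realType) (r : R) : exists n : nat, r < n%:R.
Proof. by exists (Num.bound `|r|); rewrite (le_lt_trans (ler_norm _)) // archi_boundP. Qed.
Lemma ind_oc (R : realType) (a b l : R) : \1_(`]a, b]%classic) l = if a < l <= b then 1 else 0 :> R.
Proof. by rewrite indicE mem_setE in_itv /=; case: ifP. Qed.
Lemma indM (R : realType) T (A B : set T) l : \1_A l * \1_B l = \1_(A `&` B) l :> R.
Proof. by rewrite indicI. Qed.

Lemma dist_half (R : realType) (L p q r : R) : `|L - q| < r / 2 -> `|L - p| < r / 2 -> q - p < r.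
Proof. by rewrite !ltr_norml=> /andP[A1 A2] /andP[B1 B2]; lra. Qed.

(** * Bounded functional calculus of a projection-valued measure *)

Section PVM.
Variables (R : realType) (K : hilb R).
Implicit Types (x y z : K) (c : R) (S T U : bop K) (f g : R -> R) (B C : set R).

Record pvm (P : set R -> bop K) (mu : K -> {measure set R -> \bar R}) : Prop := Pvm {
 pvm_proj : forall B, measurable B -> proj (P B) ;
 pvmT : P setT = 1 ;
 pvmI : forall B C, measurable B -> measurable C -> P (B `&` C) = P B * P C ;
 pvm_mu : forall x B, measurable B -> mu x B = (ip (P B x) x)%:E }.

Variables (P : set R -> bop K) (mu : K -> {measure set R -> \bar R}).
Hypothesis hP : pvm P mu.

Lemma mu_fin x : (mu x setT < +oo)%E.
Proof. by rewrite (pvm_mu hP) // ltry. Qed.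
Lemma mu_setT x : fine (mu x setT) = ip x x.
Proof. by rewrite (pvm_mu hP) //= (pvmT hP). Qed.
Lemma pvm_comm B C : measurable B -> measurable C -> P B * P C = P C * P B.
Proof. by move=> mB mC; rewrite -!(pvmI hP) // setIC. Qed.

(** Only real functions are integrated, so the operator is self-adjoint and is determined by its
    quadratic form through [sa_ext]. *)
Definition is_fc f T := sa T /\ forall x, ip (T x) x = \int[mu x]_l f l.
Lemma is_fc_uniq f S T : is_fc f S -> is_fc f T -> S = T.
Proof. by move=> [a b] [c d]; apply: sa_ext=> // x; rewrite b d. Qed.
Lemma is_fc_ind B : measurable B -> is_fc \1_B (P B).
Proof.
move=> mB; split; first by case: (pvm_proj hP mB).
by move=> x; rewrite bint_ind // (pvm_mu hP).
Qed.
Lemma is_fcD f g S T : bm f -> bm g -> is_fc f S -> is_fc g T -> is_fc (fun l => f l + g l) (S + T).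
Proof.
move=> bf bg [a b] [c d]; split; first exact: saD.
by move=> x; rewrite opE ipE b d bint_D //; exact: mu_fin.
Qed.
Lemma is_fcZ c f T : bm f -> is_fc f T -> is_fc (fun l => c * f l) (rso c T).
Proof.
move=> bf [a b]; split; first exact: saR.
by move=> x; rewrite opR ipE b bint_Z //; exact: mu_fin.
Qed.
Lemma is_fc_cst c : is_fc (fun=> c) (rso c 1).
Proof.
split; first by apply: saR; exact: sa1.
by move=> x; rewrite opR ipE op1 bint_cst // mu_setT.
Qed.
Definition dop f n : bop K := \sum_(k < n) rso (2^-1 ^+ k.+1) (P (dset f k)).
Lemma is_fc_dop f n : measurable_fun setT f -> is_fc (dsum f n) (dop f n).
Proof.
move=> mf; have md k := (mdg mf k).2.
elim: n=> [|n IH].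
 rewrite /dop big_ord0 /dsum; under eq_fun do rewrite big_ord0.
 by rewrite -(rso0 1); exact: is_fc_cst.
rewrite /dop big_ord_recr /dsum /=; under eq_fun do rewrite big_ord_recr.
apply: is_fcD=> //; [exact: bm_dsum|by apply: bmZ; exact: bm_ind|].
by apply: is_fcZ; [exact: bm_ind|exact: is_fc_ind].
Qed.
Lemma is_fc_lo f g S T : bm f -> bm g -> is_fc f S -> is_fc g T -> (forall l, f l <= g l) -> lo S T.
Proof.
move=> bf bg [a b] [c d] h; apply: loP=> // x; rewrite b d; apply: bint_le=> //.
exact: mu_fin.
Qed.
Lemma is_fc_cvg f (f_ : nat -> R -> R) c T (S : nat -> bop K) :
 (forall n, measurable_fun setT (f_ n)) -> measurable_fun setT f ->
 (forall l, f_ n l @[n --> \oo] --> f l) -> (forall n l, `|f_ n l| <= c) ->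
 (forall n, is_fc (f_ n) (S n)) -> scv S T -> is_fc f T.
Proof.
move=> mf_ mf cf hc hS cS; split; first by apply: scv_sa cS=> n; case: (hS n).
move=> x; have h1 : ip (S n x) x @[n --> \oo] --> ip (T x) x by apply: cv_ip=> //; exact: cv_const.
apply: (cvg_unique _ h1) => //=; under eq_fun do rewrite (hS _).2.
exact: (bint_dct (mu_fin x) mf_ mf cf hc).
Qed.
(** The operators of the dyadic sums increase and stay below 1, so their strong limit exists by
    [vigier]; dominated convergence identifies its quadratic form. *)
Lemma fc01 f : measurable_fun setT f -> (forall l, 0 <= f l <= 1) ->
 exists T, is_fc f T /\ scv (dop f) T.
Proof.
move=> mf f01; have md k := (mdg mf k).2.
have [|||T [sT cT _ _]] := @vigier _ _ (dop f) 1.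
- by move=> n; case: (is_fc_dop n mf).
- move=> n; apply: (is_fc_lo (bm_dsum mf n) (bm_dsum mf n.+1) (is_fc_dop n mf) (is_fc_dop n.+1 mf)) => l.
 by rewrite /dsum big_ord_recr /= lerDl mulr_ge0 ?exprn_ge0 ?invr_ge0.
- move=> n; apply: (is_fc_lo (bm_dsum mf n) (bm_cst 1) (is_fc_dop n mf) (is_fc_cst 1)) => l.
 by have /andP[] := dsum01 f01 n l.
exists T; split=> //; apply: (@is_fc_cvg f (dsum f) 1 T (dop f)) => //.
- by move=> n; case: (bm_dsum mf n).
- by move=> l; exact: dsum_cvg.
- by move=> n l; have /andP[a b] := dsum01 f01 n l; rewrite ger0_norm.
- by move=> n; exact: is_fc_dop.
Qed.
Lemma is_fc_comm01 f T U : measurable_fun setT f -> (forall l, 0 <= f l <= 1) -> is_fc f T ->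
 (forall B, measurable B -> U * P B = P B * U) -> U * T = T * U.
Proof.
move=> mf f01 hT hU; have [T' [hT' cT]] := fc01 mf f01.
rewrite (is_fc_uniq hT hT'); apply: (scv_comm _ cT) => n.
rewrite /dop mulr_sumr mulr_suml; apply: eq_bigr=> k _.
by rewrite rsoMl rsoMr hU //; exact: (mdg mf k).2.
Qed.

(** Reduces statements about bounded functions to values in [[0, 1]]. The constant is larger than
    the bound of [f], hence positive even for [f = 0]. *)
Lemma bm_affine f : bm f -> exists g c, [/\ 0 < c, measurable_fun setT g, (forall l, 0 <= g l <= 1) &
 f = fun l => (- c) + (2 * c) * g l].
Proof.
move=> [mf [c hc]]; set e := `|c| + 1; have e0 : 0 < e by rewrite /e ltr_wpDl.
have he l : `|f l| <= e by have := hc l; have := ler_norm c; rewrite /e; lra.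
exists (fun l => (2 * e)^-1 * (f l + e)), e; split=> //.
- apply: measurable_funM; first exact: measurable_cst.
 by apply: measurable_funD=> //; exact: measurable_cst.
- move=> l; have := he l; rewrite ler_norml=> /andP[a b].
 rewrite mulr_ge0 ?invr_ge0 //=; try lra.
 by rewrite mulrC ler_pdivrMr; lra.
- by apply/funext=> l; field; rewrite gt_eqF.
Qed.

Lemma fc_ex f : bm f -> exists T, is_fc f T.
Proof.
move=> /bm_affine[g [c [c0 mg g01 ->]]]; have [T [hT _]] := fc01 mg g01.
have bg : bm g by split=> //; exists 1=> l; have /andP[a b] := g01 l; rewrite ger0_norm.
exists (rso (- c) 1 + rso (2 * c) T); apply: is_fcD=> //; [exact: bm_cst|exact: bmZ|exact: is_fc_cst|exact: is_fcZ].
Qed.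
Definition fc f : bop K := xget 0 (is_fc f).
Lemma fcP f : bm f -> is_fc f (fc f).
Proof. by move=> /fc_ex[T hT]; apply: (xgetPex 0 (P := is_fc f)); exists T. Qed.
Lemma fc_uniq f T : is_fc f T -> fc f = T.
Proof. by move=> h; apply: (is_fc_uniq _ h); apply: (xgetPex 0 (P := is_fc f)); exists T. Qed.
Lemma fcq f x : bm f -> ip (fc f x) x = \int[mu x]_l f l.
Proof. by move=> /fcP[]. Qed.
Lemma fc_sa f : bm f -> sa (fc f). Proof. by move=> /fcP[]. Qed.
Lemma fc_ind B : measurable B -> fc \1_B = P B.
Proof. by move=> mB; apply: fc_uniq; exact: is_fc_ind. Qed.
Lemma fcD f g : bm f -> bm g -> fc (fun l => f l + g l) = fc f + fc g.
Proof. by move=> bf bg; apply/fc_uniq/is_fcD=> //; exact: fcP. Qed.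
Lemma fcZ c f : bm f -> fc (fun l => c * f l) = rso c (fc f).
Proof. by move=> bf; apply/fc_uniq/is_fcZ=> //; exact: fcP. Qed.
Lemma fcN f : bm f -> fc (fun l => - f l) = - fc f.
Proof.
move=> bf; have -> : - fc f = rso (-1) (fc f) by rewrite rsoNl rso1.
by rewrite -fcZ //; congr fc; apply/funext=> l; rewrite mulN1r.
Qed.
Lemma fcB f g : bm f -> bm g -> fc (fun l => f l - g l) = fc f - fc g.
Proof. by move=> bf bg; rewrite fcD ?fcN //; exact: bmN. Qed.
Lemma fc_cst c : fc (fun=> c) = rso c 1. Proof. exact/fc_uniq/is_fc_cst. Qed.
Lemma fc_comm f U : bm f -> (forall B, measurable B -> U * P B = P B * U) -> U * fc f = fc f * U.
Proof.
move=> /bm_affine[g [c [c0 mg g01 ->]]] hU.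
have bg : bm g by split=> //; exists 1=> l; have /andP[a b] := g01 l; rewrite ger0_norm.
rewrite fcD ?fc_cst ?fcZ //; [|exact: bm_cst|exact: bmZ].
move: (2 * c) => e.
by rewrite mulrDl mulrDr !rsoMl !rsoMr mul1r mulr1 (is_fc_comm01 mg g01 (fcP bg) hU).
Qed.
Lemma fc_lo f g : bm f -> bm g -> (forall l, f l <= g l) -> lo (fc f) (fc g).
Proof. by move=> bf bg; apply: is_fc_lo=> //; exact: fcP. Qed.
Lemma fc_pos f : bm f -> (forall l, 0 <= f l) -> pos (fc f).
Proof.
move=> bf h; have := fc_lo (bm_cst 0) bf h; rewrite fc_cst rso0 /lo subr0; exact.
Qed.

(** Multiplicativity starts from [P (B]&[C) = P B * P C], passes to dyadic sums by linearity and to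
    [f] by strong limits. [fcM] repeats the argument in the other factor. *)
Lemma fc_mul_ind f B : bm f -> measurable B -> fc f * P B = fc (fun l => f l * \1_B l).
Proof.
move=> bf mB; have h01 g : measurable_fun setT g -> (forall l, 0 <= g l <= 1) ->
  fc g * P B = fc (fun l => g l * \1_B l).
 move=> mg g01; have bg : bm g by split=> //; exists 1=> l; have /andP[a b] := g01 l; rewrite ger0_norm.
 have [T [hT cT]] := fc01 mg g01; rewrite (fc_uniq hT); apply/esym/fc_uniq.
 apply: (@is_fc_cvg _ (fun n l => dsum g n l * \1_B l) 1 _ (fun n => dop g n * P B)).
 - by move=> n; case: (bmM (bm_dsum mg n) (bm_ind mB)).
 - by case: (bmM bg (bm_ind mB)).
 - move=> l; apply: cvgM; [exact: dsum_cvg|exact: cvg_cst].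
 - move=> n l; rewrite normrM mulr_ile1 // ?normr_ge0 //.
   by have /andP[a b] := dsum01 g01 n l; rewrite ger0_norm.
  by rewrite indicE; case: (_ \in _); rewrite ?normr1 ?normr0.
 - move=> n; elim: n=> [|n IH].
   rewrite /dop big_ord0 mul0r /dsum; under eq_fun do rewrite big_ord0 mul0r.
   by rewrite -(rso0 1); exact: is_fc_cst.
  have md := (mdg mg n).2.
  have mI : measurable (dset g n `&` B) by exact: measurableI.
  have -> : (fun l => dsum g n.+1 l * \1_B l) =
    fun l => dsum g n l * \1_B l + 2^-1 ^+ n.+1 * \1_(dset g n `&` B) l by apply/funext=> l; rewrite /dsum big_ord_recr /= mulrDl indicI -mulrA.
  rewrite /dop big_ord_recr /= mulrDl rsoMl -(pvmI hP) //.
  apply: is_fcD=> //; [by apply: bmM; [exact: bm_dsum|exact: bm_ind]|by apply: bmZ; exact: bm_ind|].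
  by apply: is_fcZ; [exact: bm_ind|exact: is_fc_ind].
 - apply: (@scvM _ _ _ _ _ _ 1) => //; last exact: scv_cst.
  move=> n; apply: pos_opn=> //.
   by have := is_fc_lo (bm_cst 0) (bm_dsum mg n) (is_fc_cst 0) (is_fc_dop n mg);
    rewrite rso0 /lo subr0; apply=> l; have /andP[] := dsum01 g01 n l.
  apply: (is_fc_lo (bm_dsum mg n) (bm_cst 1) (is_fc_dop n mg) (is_fc_cst 1)) => l.
  by have /andP[] := dsum01 g01 n l.
have [g [c [c0 mg g01 ->]]] := bm_affine bf.
have bg : bm g by split=> //; exists 1=> l; have /andP[a b] := g01 l; rewrite ger0_norm.
rewrite fcD ?fc_cst ?fcZ //; [|exact: bm_cst|exact: bmZ].
move: (2 * c) => e.
rewrite mulrDl !rsoMl mul1r h01 // -fc_ind //.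
rewrite -!fcZ -?fcD; try by [exact: bm_ind|apply: bmM=> //; exact: bm_ind|apply: bmZ; exact: bm_ind|apply: bmZ; apply: bmM=> //; exact: bm_ind].
by congr fc; apply/funext=> l; ring.
Qed.

Lemma fcM f g : bm f -> bm g -> fc f * fc g = fc (fun l => f l * g l).
Proof.
move=> bf bg; have h01 (h : R -> R) : measurable_fun setT h -> (forall l, 0 <= h l <= 1) ->
  fc f * fc h = fc (fun l => f l * h l).
 move=> mh h01; have bh : bm h by split=> //; exists 1=> l; have /andP[a b] := h01 l; rewrite ger0_norm.
 have [T [hT cT]] := fc01 mh h01; rewrite (fc_uniq hT); apply/esym/fc_uniq.
 have [_ [c hc]] := bf.
 apply: (@is_fc_cvg _ (fun n l => f l * dsum h n l) c _ (fun n => fc f * dop h n)).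
 - by move=> n; case: (bmM bf (bm_dsum mh n)).
 - by case: (bmM bf bh).
 - move=> l; apply: cvgM; [exact: cvg_cst|exact: dsum_cvg].
 - move=> n l; rewrite normrM -[c]mulr1 ler_pM //.
  by have /andP[a b] := dsum01 h01 n l; rewrite ger0_norm.
 - move=> n; elim: n=> [|n IH].
   rewrite /dop big_ord0 mulr0 /dsum; under eq_fun do rewrite big_ord0 mulr0.
   by rewrite -(rso0 1); exact: is_fc_cst.
  have md := (mdg mh n).2; have bi : bm (\1_(dset h n) : R -> R) by exact: bm_ind.
  have -> : (fun l => f l * dsum h n.+1 l) =
    fun l => f l * dsum h n l + 2^-1 ^+ n.+1 * (f l * \1_(dset h n) l) by apply/funext=> l; rewrite /dsum big_ord_recr /= mulrDr; ring.
  rewrite /dop big_ord_recr /= mulrDr rsoMr fc_mul_ind //.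
  apply: is_fcD=> //; [by apply: bmM=> //; exact: bm_dsum|by apply: bmZ; exact: bmM|].
  by apply: is_fcZ; [exact: bmM|apply: fcP; exact: bmM].
 - by apply: (@scvM _ _ _ _ _ _ (opn (fc f))) => //; exact: scv_cst.
have [h [c [c0 mh h01' ->]]] := bm_affine bg.
have bh : bm h by split=> //; exists 1=> l; have /andP[a b] := h01' l; rewrite ger0_norm.
rewrite fcD ?fc_cst ?fcZ //; [|exact: bm_cst|exact: bmZ].
move: (2 * c) => e.
rewrite mulrDr !rsoMr mulr1 h01 //.
have bfh : bm (fun l => f l * h l) by exact: bmM.
rewrite -!fcZ // -fcD; try exact: bmZ.
by congr fc; apply/funext=> l; ring.
Qed.

Lemma fc_nm f x : bm f -> nm (fc f x) ^+ 2 = \int[mu x]_l (f l ^+ 2).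
Proof.
move=> bf; rewrite nmsq (saE _ _ (fc_sa bf)) ipC -opM fcM // fcq //; exact: bmM.
Qed.
Lemma fc_opn f c : 0 <= c -> bm f -> (forall l, `|f l| <= c) -> opn (fc f) <= c.
Proof.
move=> c0 bf h; apply: opn_le=> // x; apply: nm_le; first by rewrite mulr_ge0 ?nm_ge0.
rewrite -nmsq fc_nm // exprMn nmsq -mu_setT -bint_cst; apply: bint_le.
- exact: mu_fin.
- exact: bmM.
- exact: bm_cst.
by move=> l; rewrite -[f l ^+ 2]ger0_norm ?sqr_ge0 // normrX ler_pXn2r ?nnegrE.
Qed.
Lemma fc_commute f g : bm f -> bm g -> fc f * fc g = fc g * fc f.
Proof. by move=> bf bg; rewrite !fcM //; congr fc; apply/funext=> l; rewrite mulrC. Qed.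
(** The squared norm of the difference at [x] is the integral of [(f_ n - f)^2] against [mu x], to
    which dominated convergence applies. *)
Lemma fc_scv f (f_ : nat -> R -> R) c : (forall n, measurable_fun setT (f_ n)) ->
 measurable_fun setT f -> (forall l, f_ n l @[n --> \oo] --> f l) -> (forall n l, `|f_ n l| <= c) ->
 scv (fun n => fc (f_ n)) (fc f).
Proof.
move=> mf_ mf cf hc x.
have bf_ n : bm (f_ n) by split=> //; exists c.
have bf : bm f.
 split=> //; exists c=> l; apply: (ler_cvg_to (cvg_norm (cf l)) (cvg_cst c)).
 by near=> n.
have h : nm ((fc (f_ n) - fc f) x) ^+ 2 @[n --> \oo] --> (0 : R).
 have E n : nm ((fc (f_ n) - fc f) x) ^+ 2 = \int[mu x]_l ((f_ n l - f l) ^+ 2) by rewrite -fcB // fc_nm //; exact: bmB.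
 under eq_fun do rewrite E.
 have H0 : \int[mu x]_l (0 : R) = 0 by rewrite bint_cst ?mul0r.
 rewrite -H0; apply: (@bint_dct _ _ _ _ (mu_fin x) _ _ ((c + c) ^+ 2)).
 - by move=> n; case: (bmM (bmB (bf_ n) bf) (bmB (bf_ n) bf)).
 - exact: measurable_cst.
 - move=> l; rewrite -[X in _ --> X](mulr0 0).
  by apply: cvgM; apply/subr_cvg0; exact: cf.
 - move=> n l; have c0 : 0 <= c + c by have := le_trans (normr_ge0 _) (hc n l); lra.
  rewrite normrX ler_pXn2r ?nnegrE //; rewrite (le_trans (ler_normB _ _)) // lerD //.
  apply: (ler_cvg_to (cvg_norm (cf l)) (cvg_cst c)); near=> k; exact: hc.
rewrite /cv; under eq_fun do rewrite -opB.
apply/cvgrPdist_lt=> e e0; have e2 : 0 < e ^+ 2 by rewrite exprn_gt0.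
move/cvgrPdist_lt: h=> /(_ _ e2) [n0 _ hn]; exists n0=> // n /hn /=.
rewrite !sub0r !normrN normrX ger0_norm ?nm_ge0 // ltr_pXn2r ?nnegrE ?nm_ge0 //; exact: ltW.
Unshelve. all: by end_near. Qed.
(** The identity cut off to a half-open interval, the kind of set on which the measures of a
    spectral family are known. The supports are nested, so squared norms of differences are
    differences of squared norms ([tn_sub]). *)
Definition tn n (l : R) : R := l * \1_(`](- n.+1%:R), n.+1%:R]%classic) l.
Lemma ltNn n : - n.+1%:R < n.+1%:R :> R.
Proof. by rewrite (lt_trans (_ : _ < 0)) ?oppr_lt0. Qed.
Lemma bm_itv (a b : R) c : bm (fun l : R => (l - c) * \1_(`]a, b]%classic) l).
Proof.
split.
 apply: measurable_funM; last exact: measurable_indic.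
 by apply: measurable_funB; [exact: measurable_id|exact: measurable_cst].
exists (`|a| + `|b| + `|c|) => l; rewrite normrM ind_oc.
case: ifPn=> [/andP[al lb]|_]; last by rewrite normr0 mulr0 !addr_ge0.
rewrite normr1 mulr1 (le_trans (ler_normB _ _)) // lerD2r ler_norml.
have := ler_norm b; have := ler_norm (- a); rewrite normrN.
have := normr_ge0 a; have := normr_ge0 b; lra.
Qed.
Lemma bm_itv0 (a b : R) : bm (fun l : R => l * \1_(`]a, b]%classic) l).
Proof. by have := bm_itv a b 0; under eq_fun do rewrite subr0. Qed.
Lemma bm_tn n : bm (tn n). Proof. exact: bm_itv0. Qed.
Lemma tn_cv l : tn n l @[n --> \oo] --> l.
Proof.
apply: cvg_near_cst; exists (Num.bound `|l|) => // n /= hn; rewrite /tn ind_oc.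
suff -> : - n.+1%:R < l <= n.+1%:R by rewrite mulr1.
have : `|l| < n.+1%:R.
 apply: lt_le_trans (_ : (Num.bound `|l|)%:R <= _); last by rewrite ler_nat leqW.
 by have := archi_boundP (normr_ge0 l).
by rewrite ltr_norml=> /andP[-> /ltW ->].
Qed.
Lemma tn_le n l : `|tn n l| <= `|l|.
Proof. by rewrite /tn normrM indicE; case: (_ \in _); rewrite ?normr1 ?mulr1 // normr0 mulr0. Qed.
Lemma tn_sq n l : tn n l ^+ 2 <= l ^+ 2.
Proof.
by rewrite /tn exprMn indicE; case: (_ \in _); rewrite ?expr1n ?mulr1 // expr0n mulr0 sqr_ge0.
Qed.
Lemma tn_sub n m l : (n <= m)%N -> (tn m l - tn n l) ^+ 2 = tn m l ^+ 2 - tn n l ^+ 2.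
Proof.
move=> nm; rewrite /tn !exprMn !ind_oc.
have nmR : n.+1%:R <= m.+1%:R :> R by rewrite ler_nat ltnS.
case: ifPn=> [_|h1]; case: ifPn=> [/andP[r1 r2]|_]; try ring.
by case/negP: h1; rewrite (le_lt_trans _ r1) ?lerN2 // (le_trans r2 nmR).
Qed.

Section SecondMoment.
Variable x : K.
Let bm2 n : bm (fun l => tn n l ^+ 2) := bmM (bm_tn n) (bm_tn n).
Let a n := nm (fc (tn n) x) ^+ 2.
Let aE n : a n = \int[mu x]_l (tn n l ^+ 2). Proof. exact: (fc_nm _ (bm_tn n)). Qed.
Let aS n m : (n <= m)%N -> nm (fc (tn m) x - fc (tn n) x) ^+ 2 = a m - a n.
Proof.
move=> nm; rewrite -opB -(fcB (bm_tn m) (bm_tn n)) (fc_nm _ (bmB (bm_tn m) (bm_tn n))) !aE.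
by rewrite -(bint_B (mu_fin x) (bm2 m) (bm2 n)); apply: eq_Rintegral=> l _; exact: tn_sub.
Qed.
Let aI n : (\int[mu x]_l (tn n l ^+ 2)%:E = (a n)%:E)%E.
Proof.
rewrite aE /Rintegral fineK //; apply: integrable_fin_num=> //.
exact: (bm_int (mu_fin x) (bm2 n)).
Qed.
Let m2 : measurable_fun setT (fun l : R => (l ^+ 2)%:E).
Proof. by apply/measurable_EFinP; apply: measurable_funX; exact: measurable_id. Qed.
Let acv : ((a n)%:E @[n --> \oo] --> \int[mu x]_l (l ^+ 2)%:E)%E.
Proof.
under eq_fun do rewrite -aI.
have -> : (\int[mu x]_l (l ^+ 2)%:E = \int[mu x]_l (limn (fun n => (tn n l ^+ 2)%:E)))%E.
 apply: eq_integral=> l _; apply/esym/cvg_lim=> //.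
 apply/cvg_EFin; first by near=> n.
 by rewrite expr2; apply: cvgM; exact: tn_cv.
apply: cvg_monotone_convergence=> //.
- by move=> n; apply/measurable_EFinP; case: (bm2 n).
- by move=> n l _; rewrite lee_fin sqr_ge0.
- by move=> l _ n m nm; rewrite lee_fin -subr_ge0 -tn_sub // sqr_ge0.
Unshelve. all: by end_near. Qed.
Let amono : nondecreasing_seq a.
Proof. by move=> n m nm; rewrite -subr_ge0 -aS // sqr_ge0. Qed.

(** The squared norms of the truncations at [x] are the integrals of [tn n ^+ 2], which increase to
    the second moment by monotone convergence. *)
Lemma moment_bd : (\int[mu x]_l (l ^+ 2)%:E < +oo)%E <->
 exists c, forall n, nm (fc (tn n) x) <= c.
Proof.
split=> [h|[c hc]].
 have If : (\int[mu x]_l (l ^+ 2)%:E)%E \is a fin_num by rewrite ge0_fin_numE // integral_ge0 // => l _; rewrite lee_fin sqr_ge0.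
 exists (Num.sqrt (fine (\int[mu x]_l (l ^+ 2)%:E)%E)) => n.
 rewrite -[X in X <= _]ger0_norm ?nm_ge0 // -sqrtr_sqr ler_wsqrtr // -lee_fin fineK // -/(a n) -aI.
 apply: ge0_le_integral=> //; try (by move=> l _; rewrite lee_fin ?sqr_ge0 ?tn_sq).
 by apply/measurable_EFinP; case: (bm2 n).
apply: le_lt_trans (_ : (c ^+ 2)%:E < _)%E; last exact: ltry.
apply: (@cvge_le _ _ _ _ _ _ _ _ acv); near=> n.
by rewrite lee_fin /a ler_pXn2r ?nnegrE ?nm_ge0 //; exact: le_trans (nm_ge0 _) (hc n).
Unshelve. all: by end_near. Qed.

Lemma moment_cv c : (forall n, nm (fc (tn n) x) <= c) -> exists y, cv (fun n => fc (tn n) x) y.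
Proof.
move=> hc; have ca : cvgn a.
 apply: nondecreasing_is_cvgn=> //; exists (c ^+ 2) => _ [n _ <-].
 by rewrite /a ler_pXn2r ?nnegrE ?nm_ge0 //; exact: le_trans (nm_ge0 _) (hc n).
apply: cv_complete=> e e0; have e2 : 0 < e ^+ 2 / 2 by rewrite divr_gt0 ?exprn_gt0.
have /cvgrPdist_lt /(_ _ e2) [n0 _ hn] := ca.
have key n m : (n0 <= n)%N -> (n <= m)%N -> nm (fc (tn m) x - fc (tn n) x) < e.
 move=> h1 h2; rewrite -(@ltr_pXn2r _ 2) ?nnegrE ?nm_ge0 ?ltW // aS //.
 have := hn n h1; have := hn m (leq_trans h1 h2).
 exact: dist_half.
exists n0=> n m hn1 hm1; case: (leqP n m) => [h|/ltnW h]; last exact: key.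
by rewrite nmBC; exact: key.
Qed.

Lemma moment1 : (\int[mu x]_l (l ^+ 2)%:E < +oo)%E ->
 ip (fc (tn n) x) x @[n --> \oo] --> \int[mu x]_l l.
Proof.
move=> h; have e n : ip (fc (tn n) x) x = \int[mu x]_l tn n l by rewrite (fcq _ (bm_tn n)).
under eq_fun do rewrite e.
(* [1 + l^2] dominates [|l|] and is integrable because the measure is finite with finite second
   moment. *)
apply: (@Rdct _ _ _ (mu x) setT tn (fun l => l) (fun l => 1 + l ^+ 2) _ _ _ _ _ _).2=> //.
- by move=> n; case: (bm_tn n).
- by move=> l _; exact: tn_cv.
- have -> : EFin \o (fun l : R => 1 + l ^+ 2) = (fun l => (1%:E + (l ^+ 2)%:E)%E) by [].
 apply: integrableD=> //; first exact: (bm_int (mu_fin x) (bm_cst 1)).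
 apply/integrableP; split=> //.
 by under eq_integral do rewrite gee0_abs ?lee_fin ?sqr_ge0 //.
- move=> n l _; apply: le_trans (tn_le n l) _.
 rewrite ler_norml; have := sqr_ge0 (l - 1); have := sqr_ge0 (l + 1).
 by have := sqr_ge0 l; rewrite !expr2; lra.
Qed.
End SecondMoment.
End PVM.

Section MeasureOnReals.
Variables (R : realType) (m : {measure set (measurableTypeR R) -> \bar R}).
(* the Borel sets of R are registered under two displays *)
Definition measure_toR : set R -> \bar R := m.
Let toR0 : measure_toR set0 = 0%E. Proof. exact: (@measure0 _ _ _ m). Qed.
Let toR_ge0 A : (0 <= measure_toR A)%E. Proof. exact: (@measure_ge0 _ _ _ m). Qed.
Let toR_sigma : semi_sigma_additive measure_toR.
Proof. exact: (@measure_semi_sigma_additive _ _ _ m). Qed.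
HB.instance Definition _ := isMeasure.Build _ R R measure_toR toR0 toR_ge0 toR_sigma.
End MeasureOnReals.

(** * From spectral families to projection-valued measures *)

Section SpectralFamily.
Variables (R : realType) (K : hilb R).
Implicit Types (x y z : K) (c : R) (S T U P : bop K) (B C : set R).

Record specfam (E : R -> bop K) : Prop := Specfam {
 sf_proj : forall a, proj (E a) ;
 sf_mono : forall a b, a <= b -> E b * E a = E a ;
 sf_rc : forall a, scv (fun n => E (a + n.+1%:R^-1)) (E a) ;
 sf_ny : scv (fun n => E (- n%:R)) 0 ;
 sf_y : scv (fun n => E n%:R) 1 }.

Variable E : R -> bop K.
Hypothesis hE : specfam E.

Lemma sf_lo a b : a <= b -> lo (E a) (E b).
Proof. by move=> ab; apply/(proj_lo (sf_proj hE _) (sf_proj hE _))/(sf_mono hE). Qed.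

Lemma sf_measure x : exists m : {measure set R -> \bar R},
 forall a b, a <= b -> m `]a, b]%classic = (ip (E b x) x - ip (E a x) x)%:E.
Proof.
pose F a := ip (E a x) x.
have nd : nondecreasing F by move=> a b ab; exact: loE (sf_lo ab).
have rc : right_continuous F.
 move=> a; apply/cvgrPdist_lt=> e e0.
 have h : F (a + n.+1%:R^-1) @[n --> \oo] --> F a by apply: cv_ip; [exact: sf_rc|exact: cv_const].
 move/cvgrPdist_lt: h=> /(_ e e0) [n0 _ /(_ n0 (leqnn n0)) /= hn].
 near=> b.
 have ab : a < b by near: b; exact: nbhs_right_gt.
 have b1 : b <= a + n0.+1%:R^-1 by near: b; apply: nbhs_right_le; rewrite ltrDl.
 have h1 := nd _ _ (ltW ab); have h2 := nd _ _ b1.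
 rewrite distrC ger0_norm ?subr_ge0 //.
 rewrite distrC ger0_norm ?subr_ge0 // in hn; last exact: le_trans h1 h2.
 by apply: le_lt_trans hn; rewrite lerD2r.
pose f : cumulative R R := HB.pack F (isCumulative.Build R _ R F nd rc).
exists (measure_toR (lebesgue_stieltjes_measure f)) => a b ab.
rewrite -[LHS]/(lebesgue_stieltjes_measure f `]a, b]%classic).
rewrite /lebesgue_stieltjes_measure /measure_extension measurable_mu_extE /=; last exact: is_ocitv.
by rewrite wlength_itv_bnd.
Unshelve. all: by end_near. Qed.

Let mu x := sval (cid (sf_measure x)).
Let mu_ocitv x a b : a <= b -> mu x `]a, b]%classic = (ip (E b x) x - ip (E a x) x)%:E.
Proof. by rewrite /mu; case: cid=> m hm /= ab; exact: hm. Qed.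
Let mu_T x : mu x setT = (ip x x)%:E.
Proof.
rewrite -(bigcup_itvT false false).
pose I n : set R := `]- (n%:R), n%:R]%classic.
have h1 : (mu x \o I) n @[n --> \oo] --> (ip x x)%:E.
 have -> : mu x \o I = (fun n => (ip (E n%:R x) x - ip (E (- n%:R) x) x)%:E) by apply/funext=> n; rewrite /= /I mu_ocitv // ge0_cp.
 apply/cvg_EFin; first by near=> n.
 have h : ip (E n%:R x) x - ip (E (- n%:R) x) x @[n --> \oo] --> ip ((1 : bop K) x) x - ip ((0 : bop K) x) x.
  apply: cvgB; apply: cv_ip; try exact: cv_const; [exact: sf_y|exact: sf_ny].
 by rewrite op1 op0 ip0l subr0 in h; exact: h.
have h2 : (mu x \o I) n @[n --> \oo] --> mu x (\bigcup_n I n).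
 apply: nondecreasing_cvg_mu; rewrite /I //; first exact: bigcup_measurable.
 by move=> *; apply/subsetPset/subset_itv; rewrite leBSide/= ?lerN2 ler_nat.
exact: (cvg_unique _ h2 h1).
Unshelve. all: by end_near. Qed.

(** One projection must represent [B] for all vectors [x] at once. These sets form a Dynkin system,
    and the half-open intervals it contains are stable under intersection and generate the Borel
    sets. *)
Let G : set (set R) := [set B | measurable B /\
 exists P, proj P /\ forall x, mu x B = (ip (P x) x)%:E].

(** Additivity of the measures gives [P + S <= 1], and projections with this property are
    orthogonal. *)
Let orth B C P S : measurable B -> measurable C -> B `&` C = set0 -> proj P -> proj S ->
 (forall x, mu x B = (ip (P x) x)%:E) -> (forall x, mu x C = (ip (S x) x)%:E) -> P * S = 0.
Proof.
move=> mB mC BC hP hS eP eS; apply: proj_orth=> //; apply: loP.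
- by apply: saD; [case: hP|case: hS].
- exact: sa1.
move=> x; rewrite -lee_fin op1 -mu_T opE ipDl EFinD -eP -eS.
rewrite -measureU //; apply: le_measure=> //; rewrite inE //; exact: measurableU.
Qed.

Let dynkinG : dynkin G.
Proof.
split.
- by split=> //; exists 1; split; [exact: proj1|move=> x; rewrite mu_T].
- move=> B [mB [P [hP eP]]]; split; first exact: measurableC.
 exists (1 - P); split; first exact: projC.
 move=> x; rewrite -setTD measureD //; last by have := mu_T x=> /= ->; rewrite ltry.
 by rewrite setTI opB op1 ipBl EFinB; congr (_ - _)%E; [exact: mu_T|exact: eP].
- move=> F tF hF; have mF n : measurable (F n) by case: (hF n).
 split; first exact: bigcup_measurable.
 have hex n : {P | proj P /\ forall x, mu x (F n) = (ip (P x) x)%:E} by apply/cid; case: (hF n).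
 pose P n := sval (hex n).
 have pP n : proj (P n) by rewrite /P; case: (hex n) => ? [].
 have eP n x : mu x (F n) = (ip (P n x) x)%:E by rewrite /P; case: (hex n) => ? [a b] /=; exact: b.
 have oP i j : i != j -> P i * P j = 0.
  move=> ij; apply: (@orth (F i) (F j)) => //.
  by move/trivIsetP: tF=> /(_ i j I I ij).
 pose S n := \sum_(k < n) P k.
 have SP n k : (n <= k)%N -> S n * P k = 0.
  move=> nk; rewrite /S mulr_suml big1 // => i _; apply: oP.
  by rewrite neq_ltn (leq_trans (ltn_ord i) nk).
 have PS n k : (n <= k)%N -> P k * S n = 0.
  move=> nk; rewrite /S mulr_sumr big1 // => i _; apply: oP.
  by rewrite neq_ltn (leq_trans (ltn_ord i) nk) orbT.
 have pS n : proj (S n).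
  elim: n=> [|n IH]; first by rewrite /S big_ord0; exact: proj0.
  have -> : S n.+1 = S n + P n by rewrite /S big_ord_recr.
  split; first by apply: saD; [case: IH|case: (pP n)].
  by rewrite mulrDl !mulrDr SP // PS // addr0 add0r IH.2 (pP n).2.
 have [||| Q [sQ cQ _ _]] := @vigier _ _ S 1.
 - by move=> n; case: (pS n).
 - move=> n; rewrite /lo /S big_ord_recr /= addrAC subrr add0r; exact: proj_pos.
 - by move=> n; rewrite rso1; exact: proj_lo1.
 exists Q; split; first split=> //.
  apply: (@scv_uniq _ _ (fun n => S n * S n)).
   by apply: (scvM (m := 1)) => // n; exact: proj_opn.
  by under eq_fun do rewrite (pS _).2.
 move=> x; rewrite measure_semi_bigcup //; last exact: bigcup_measurable.
 apply/cvg_lim=> //.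
 have -> : (fun n => \sum_(0 <= i < n) mu x (F i))%E = (fun n => (ip (S n x) x)%:E).
  apply/funext=> n; rewrite big_mkord /S; elim: n=> [|n IH].
   by rewrite !big_ord0 op0 ip0l.
  by rewrite !big_ord_recr IH opD ipDl EFinD; congr (_ + _)%E; exact: eP.
 apply/cvg_EFin; first by near=> n.
 by apply: cv_ip=> //; exact: cv_const.
Unshelve. all: by end_near. Qed.

Lemma specfam_pvm : exists (P : set R -> bop K) (m : K -> {measure set R -> \bar R}), pvm P m /\ forall a b, a <= b -> P `]a, b]%classic = E b - E a.
Proof.
have hG B : measurable B -> G B.
 move=> mB; have hB : <<s @ocitv R >> B := mB.
 rewrite -setI_closed_g_dynkin_g_sigma_algebra in hB; last exact: ocitvI.
 have := hB G; apply; split; first exact: dynkinG.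
 move=> _ [[a b] _ <-] /=; split; first exact: measurable_itv.
 have [ab|ba] := leP a b.
  exists (E b - E a); split; last by move=> x; rewrite mu_ocitv // opE ipBl.
  split; first by apply: saB; apply: (sf_proj hE _).1.
  have h := sf_mono hE ab; have h' : E a * E b = E a.
   by have := congr1 (@adj _ _) h; rewrite adjM !(sf_proj hE _).1.
  by rewrite mulrBl !mulrBr h h' !(sf_proj hE _).2 subrr subr0.
 exists 0; split; first exact: proj0.
 by move=> x; rewrite set_itv_ge ?measure0 ?op0 ?ip0l // bnd_simp -leNgt ltW.
have hex B : {P | measurable B -> proj P /\ forall x, mu x B = (ip (P x) x)%:E}.
 apply/cid; have [mB|nB] := pselect (measurable B); last by exists 0.
 by have [_ [P hP]] := hG _ mB; exists P.
pose P B := sval (hex B).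
have hP B : measurable B -> proj (P B) /\ forall x, mu x B = (ip (P B x) x)%:E by rewrite /P; case: (hex B).
have uniq B T : measurable B -> sa T -> (forall x, mu x B = (ip (T x) x)%:E) -> P B = T.
 move=> mB sT h; have [[s _] h'] := hP _ mB; apply: sa_ext=> // x.
 by have := h x; rewrite h'=> -[].
have disj B C : measurable B -> measurable C -> B `&` C = set0 -> P B * P C = 0.
 move=> mB mC BC; have [p1 e1] := hP _ mB; have [p2 e2] := hP _ mC.
 exact: (orth mB mC BC p1 p2 e1 e2).
have add B C : measurable B -> measurable C -> B `&` C = set0 -> P (B `|` C) = P B + P C.
 move=> mB mC BC; have [p1 e1] := hP _ mB; have [p2 e2] := hP _ mC.
 apply: uniq; [exact: measurableU | by apply: saD; [case: p1|case: p2] | move=> x].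
 by rewrite measureU // opE ipDl EFinD; congr (_ + _)%E; [exact: e1|exact: e2].
exists P, mu; split; first split.
- by move=> B /hP[].
- by apply: uniq=> //; exact: sa1.
- move=> B C mB mC; have mI : measurable (B `&` C) by exact: measurableI.
 have mBC : measurable (B `\` C) by exact: measurableD.
 have mCB : measurable (C `\` B) by exact: measurableD.
 (* Multiplicativity follows from additivity: after splitting [B] and [C] along their intersection,
    every cross term involves disjoint sets and vanishes. *)
 have eB : P B = P (B `&` C) + P (B `\` C).
  rewrite -add //; last by apply/seteqP; split=> z /=; tauto.
  by congr P; apply/seteqP; split=> z /=; case: (pselect (C z)); tauto.
 have eC : P C = P (B `&` C) + P (C `\` B).
  rewrite -add //; last by apply/seteqP; split=> z /=; tauto.
  by congr P; apply/seteqP; split=> z /=; case: (pselect (B z)); tauto.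
 rewrite {1}eB {1}eC mulrDl !mulrDr (hP _ mI).1.2.
 by rewrite !disj ?addr0 //; apply/seteqP; split=> z /=; tauto.
- by move=> x B /hP[].
- move=> a b ab; apply: uniq; first exact: measurable_itv.
  by apply: saB; apply: (sf_proj hE _).1.
 by move=> x; rewrite mu_ocitv // opE ipBl.
Qed.
End SpectralFamily.

(** * Unbounded self-adjoint operators and their resolvents *)

Section SelfAdjoint.
Variables (R : realType) (K : hilb R).
Implicit Types (x y z : K) (c : R) (S T U P : bop K) (D : operator K).

Definition dsa D := self_adjoint (hdot K) D.

Section Facts.
Variable D : operator K.
Hypothesis hD : dsa D.
Let dom := op_dom D.

Lemma domP (k : R[i]) x y : dom x -> dom y -> dom (k *: x + y).
Proof. by case: hD=> h _ _; exact: h. Qed.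
Lemma dom_dense x : exists u : nat -> K, (forall n, dom (u n)) /\ cv u x.
Proof.
have : closure (op_dom D) x by case: hD=> _ -> _.
move=> hx; have h n : {y | dom y /\ nm (y - x) < n.+1%:R^-1}.
 apply/cid; have [|y [dy]] := hx (ball x (n.+1%:R^-1)%:C).
  by apply: nbhsx_ballx; rewrite ltcR.
 by rewrite -ball_normE /ball_ /= normE ltcR nmBC=> hy; exists y.
exists (fun n => sval (h n)); split=> [n|]; first by case: (h n) => ? [].
apply: (@cv_le _ _ _ _ (fun n => n.+1%:R^-1)); last exact: cvg_harmonic.
by move=> n; case: (h n) => ? [? h'] /=; exact: ltW.
Qed.
Lemma dom0 : dom 0.
Proof.
have [u [hu _]] := dom_dense 0.
by have := domP (-1) (hu 0%N) (hu 0%N); rewrite scaleN1r addNr.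
Qed.
Lemma domZ (k : R[i]) x : dom x -> dom (k *: x).
Proof. by move=> hx; have := domP k hx dom0; rewrite addr0. Qed.
Lemma domD x y : dom x -> dom y -> dom (x + y).
Proof. by move=> hx hy; have := domP 1 hx hy; rewrite scale1r. Qed.
Lemma domN x : dom x -> dom (- x).
Proof. by move=> hx; rewrite -scaleN1r; exact: domZ. Qed.
Lemma domB x y : dom x -> dom y -> dom (x - y).
Proof. by move=> hx hy; apply: domD=> //; exact: domN. Qed.
Lemma dsym_dot x y : dom x -> dom y -> hdot K (D x) y = hdot K x (D y).
Proof. by case: hD=> _ _ h dx dy; have [_ /(_ (conj dy erefl))] := h y (D y); apply. Qed.
Lemma dsym x y : dom x -> dom y -> ip (D x) y = ip x (D y).
Proof. by move=> dx dy; rewrite /ip dsym_dot. Qed.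
Lemma dmax_dot y z : (forall x, dom x -> hdot K (D x) y = hdot K x z) -> dom y /\ D y = z.
Proof. by case: hD=> _ _ h hy; apply/(h y z).1. Qed.
Lemma dopP k x y : dom x -> dom y -> D (k *: x + y) = k *: D x + D y.
Proof.
move=> dx dy; apply: (proj2 (dmax_dot _)) => z dz.
by rewrite !linearDr !linearZr_LR /= !dsym_dot.
Qed.
Lemma dop0 : D 0 = 0.
Proof. by have := dopP (-1) dom0 dom0; rewrite !scaleN1r !addNr. Qed.
Lemma dopZ k x : dom x -> D (k *: x) = k *: D x.
Proof. by move=> dx; have := dopP k dx dom0; rewrite !addr0 dop0 addr0. Qed.
Lemma dopD x y : dom x -> dom y -> D (x + y) = D x + D y.
Proof. by move=> dx dy; have := dopP 1 dx dy; rewrite !scale1r. Qed.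
Lemma dopN x : dom x -> D (- x) = - D x.
Proof. by move=> dx; rewrite -scaleN1r dopZ // scaleN1r. Qed.
Lemma dopB x y : dom x -> dom y -> D (x - y) = D x - D y.
Proof. by move=> dx dy; rewrite dopD ?dopN //; exact: domN. Qed.
(** A self-adjoint operator has no proper symmetric extension. Testing with the real form suffices,
    since the domain is stable under multiplication by ['i]. *)
Lemma dmax y z : (forall x, dom x -> ip (D x) y = ip x z) -> dom y /\ D y = z.
Proof.
move=> h; apply: dmax_dot=> x dx; rewrite !dotE h //; congr (_ +i* _).
have := h ('i *: x) (domZ _ dx); rewrite dopZ // !ip_i; lra.
Qed.
Lemma dclosed (u : nat -> K) x y : (forall n, dom (u n)) -> cv u x -> cv (fun n => D (u n)) y ->
 dom x /\ D x = y.
Proof.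
move=> hu ux uy; apply: dmax=> z dz.
have h1 : ip (D z) (u n) @[n --> \oo] --> ip (D z) x by apply: cv_ip=> //; exact: cv_const.
have h2 : ip z (D (u n)) @[n --> \oo] --> ip z y by apply: cv_ip=> //; exact: cv_const.
apply: (cvg_unique _ h1) => //=; under eq_fun do rewrite (dsym dz (hu _)).
exact: h2.
Qed.
Lemma dip_i x : dom x -> ip (D x) ('i *: x) = 0.
Proof.
move=> dx; have := dsym dx (domZ 'i dx); rewrite dopZ // (ipC x) ip_i=> h; lra.
Qed.

(** The cross term drops out because [<D x, i x>] has vanishing real part for symmetric [D]. *)
Lemma shift_nm (s : R) x : s ^+ 2 = 1 -> dom x ->
 ip (D x + rs s ('i *: x)) (D x + rs s ('i *: x)) = ip (D x) (D x) + ip x x.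
Proof.
move=> s1 dx; rewrite !ipE ip_ii (ipC ('i *: x)) dip_i // mulrA -expr2 s1; lra.
Qed.

(** By [shift_nm] the shift [D + s i] is bounded below, so its range is closed. A vector orthogonal
    to the range lies in the domain with [D v = s i v], and [dip_i] forces it to vanish. *)
Lemma shift_surj (s : R) y : s ^+ 2 = 1 -> exists2 x, dom x & D x + rs s ('i *: x) = y.
Proof.
move=> s1; pose V := [set y | exists2 x, dom x & D x + rs s ('i *: x) = y].
have sV : subspace V.
 split; first by exists 0; [exact: dom0|rewrite dop0 scaler0 /rs scaler0 addr0].
  move=> _ _ [x dx <-] [z dz <-]; exists (x + z); first exact: domD.
  by rewrite dopD // scalerDr rsD addrACA.
 move=> c _ [x dx <-]; exists (rs c x); first exact: domZ.
 by rewrite dopZ // rsD !rs_rs; congr (_ + _); rewrite /rs !scalerA; congr (_ *: _);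
  rewrite rmorphM; ring.
have diff u v : dom u -> dom v -> (D u + rs s ('i *: u)) - (D v + rs s ('i *: v)) =
 D (u - v) + rs s ('i *: (u - v)) by move=> du dv; rewrite dopB // scalerBr /rs scalerBr opprD addrACA.
have cV : seq_closed V.
 move=> w v hw wv; have hx n : {x | dom x /\ D x + rs s ('i *: x) = w n}.
  by apply/cid; have [x] := hw n; exists x.
 pose u n := sval (hx n).
 have du n : dom (u n) by rewrite /u; case: (hx n) => ? [].
 have eu n : D (u n) + rs s ('i *: u n) = w n by rewrite /u; case: (hx n) => ? [? /=].
 have bd n m : nm (u n - u m) <= nm (w n - w m).
  apply: nm_le; first exact: nm_ge0.
  rewrite nmsq -!eu diff // shift_nm //; last exact: domB.
  by rewrite lerDr ip_ge0.
 have [|x ux] := @cv_complete _ _ u.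
  move=> e e0; have e2 : 0 < e / 2 by lra.
  have [n0 hn] := (cvP _ _).1 wv _ e2; exists n0=> n m hn1 hm1.
  apply: le_lt_trans (bd n m) _; have := nmD (w n - v) (v - w m).
  rewrite addrA subrK (nmBC v) => h; have := hn _ hn1; have := hn _ hm1; lra.
 have cD : cv (fun n => D (u n)) (v - rs s ('i *: x)).
  have -> : (fun n => D (u n)) = fun n => w n - rs s ('i *: u n) by apply/funext=> n; rewrite -eu addrK.
  by apply: cvB=> //; apply: cvZ; apply: cvZ.
 by have [dx ex] := dclosed du ux cD; exists x=> //; rewrite ex subrK.
have [p [x dx ex] hp] := projection_thm y sV cV.
exists x=> //; rewrite ex; apply/esym/subr0_eq; set v := y - p in hp *.
have hv z : dom z -> ip (D z) v = ip z (rs s ('i *: v)).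
 move=> dz; have /hp : V (D z + rs s ('i *: z)) by exists z.
 by rewrite ipDr ipZr !(ipC v) ip_i ipZr; lra.
have [dv ev] := dmax hv.
have := dip_i dv; rewrite ev ipZl ip_ii=> h; apply: ipxx_eq0.
by move: (congr1 (fun t => s * t) h); rewrite mulr0 mulrA -expr2 s1 mul1r.
Qed.

(* [resC] is (1 + D^2)^-1 and [resB] is D (1 + D^2)^-1 *)
Lemma res_ex y : exists u, [/\ dom u, dom (D u) & u + D (D u) = y].
Proof.
have [v dv ev] := @shift_surj 1 y (expr1n _ _).
have [|w dw ew] := @shift_surj (-1) y; first by rewrite sqrrN expr1n.
rewrite rs1 in ev; rewrite /rs rmorphN scaleN1r in ew.
have Dv : D v = y - 'i *: v by rewrite -ev addrK.
have Dw : D w = y + 'i *: w by rewrite -ew subrK.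
have i2 (z : K) : 'i *: ('i *: z) = - z by rewrite scalerA -expr2 sqr_i scaleN1r.
(* Partial fractions: [(1 + D^2)^-1] is [i/2] times the difference of the inverses of [D + i] and
   [D - i]. *)
pose u : K := rs 2^-1 ('i *: (v - w)).
have du : dom u by apply: domZ; apply: domZ; apply: domB.
have Du : D u = rs 2^-1 (v + w).
 rewrite dopZ; last by apply: domZ; apply: domB.
 rewrite dopZ; last exact: domB.
 by rewrite dopB // Dv Dw opprD addrACA subrr add0r -opprD -scalerDr scalerN i2 opprK.
have dDu : dom (D u) by rewrite Du; apply: domZ; exact: domD.
exists u; split=> //; rewrite Du dopZ; last exact: domD.
rewrite dopD // Dv Dw /u scalerBr -/(rs _ _); apply: ip_ext=> z; rewrite !ipE; lra.
Qed.

Lemma res_graph u : dom u -> dom (D u) -> ip (u + D (D u)) u = ip u u + ip (D u) (D u).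
Proof. by move=> du dDu; rewrite ipDl (dsym dDu du). Qed.
Lemma res_uniq u v : dom u -> dom (D u) -> dom v -> dom (D v) ->
 u + D (D u) = v + D (D v) -> u = v.
Proof.
move=> du dDu dv dDv h; apply/subr0_eq/ipxx_eq0.
have dw := domB du dv; have dDw : dom (D (u - v)) by rewrite dopB //; exact: domB.
have := res_graph dw dDw.
rewrite dopB // dopB // addrACA -opprD h subrr ip0l.
have := ip_ge0 (u - v); have := ip_ge0 (D u - D v); lra.
Qed.
Definition rC y := sval (cid (res_ex y)).
Lemma rCP y : [/\ dom (rC y), dom (D (rC y)) & rC y + D (D (rC y)) = y].
Proof. by rewrite /rC; case: cid. Qed.
Lemma rC_uniq y u : dom u -> dom (D u) -> u + D (D u) = y -> rC y = u.
Proof. by move=> a b c; have [d e f] := rCP y; apply: res_uniq=> //; rewrite f c. Qed.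
Lemma rC_bd y : ip (rC y) (rC y) + ip (D (rC y)) (D (rC y)) = ip y (rC y).
Proof. by have [a b c] := rCP y; rewrite -(res_graph a b) c. Qed.
Lemma rC_nm y : nm (rC y) <= nm y.
Proof.
have := rC_bd y; have := ip_le y (rC y); have := ip_ge0 (D (rC y)); rewrite -[ip (rC y) _]nmsq.
have := nm_ge0 (rC y); rewrite le_eqVlt=> /orP[/eqP <- _ _ _|p h1 h2 h3]; first exact: nm_ge0.
by rewrite -(ler_pM2r p) -expr2; lra.
Qed.
Lemma rB_nm y : nm (D (rC y)) <= nm y.
Proof.
apply: nm_le; first exact: nm_ge0.
have := rC_bd y; have := ip_le y (rC y); have := ip_ge0 (rC y).
have : nm y * nm (rC y) <= nm y ^+ 2 by rewrite expr2 ler_wpM2l ?nm_ge0 // rC_nm.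
by lra.
Qed.
Lemma rC_lin : linear rC.
Proof.
move=> k x y; have [a b c] := rCP x; have [d e f] := rCP y; apply: rC_uniq.
- exact: domP.
- by rewrite dopP //; exact: domP.
- by rewrite dopP // dopP // addrACA -scalerDr c f.
Qed.
Lemma rB_lin : linear (fun y => D (rC y)).
Proof. by move=> k x y; rewrite rC_lin dopP //; have [] := rCP x; have [] := rCP y. Qed.
Definition resC : bop K := mkbop (@bounded_lin _ _ rC 1 rC_lin (fun y => eq_rect_r (fun t => nm (rC y) <= t) (rC_nm y) (mul1r _))).
Definition resB : bop K := mkbop (@bounded_lin _ _ _ 1 rB_lin (fun y => eq_rect_r (fun t => nm (D (rC y)) <= t) (rB_nm y) (mul1r _))).
Lemma resC_dom y : dom (resC y). Proof. by case: (rCP y). Qed.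
Lemma resC_dom2 y : dom (resB y). Proof. by case: (rCP y). Qed.
Lemma resBE y : D (resC y) = resB y. Proof. by []. Qed.
Lemma resE y : resC y + D (resB y) = y. Proof. by case: (rCP y). Qed.
Lemma resC_inj y : resC y = 0 -> y = 0.
Proof. by move=> h; rewrite -(resE y) -resBE h !dop0 addr0. Qed.
Lemma resC_sa : sa resC.
Proof.
apply: saP=> y z; rewrite -[z in LHS]resE -[y in RHS]resE ipDr ipDl; congr (_ + _).
by rewrite -(dsym (resC_dom y) (resC_dom2 z)) (dsym (resC_dom2 y) (resC_dom z)).
Qed.
Lemma resC_ip y : ip (resC y) y = ip (resC y) (resC y) + ip (resB y) (resB y).
Proof. by rewrite ipC -rC_bd. Qed.
Lemma resC_pos : pos resC.
Proof. by split; [exact: resC_sa|move=> y; rewrite resC_ip addr_ge0 ?ip_ge0]. Qed.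
Lemma resC_comm_dom x : dom x -> resC (D x) = resB x.
Proof.
move=> dx; apply: rC_uniq; first exact: resC_dom2.
 have -> : D (resB x) = x - resC x by rewrite -{2}(resE x) addrAC subrr add0r.
 by apply: domB=> //; exact: resC_dom.
have -> : D (resB x) = x - resC x by rewrite -{2}(resE x) addrAC subrr add0r.
by rewrite dopB //; [rewrite resBE addrC subrK|exact: resC_dom].
Qed.
Lemma resB_sa : sa resB.
Proof.
apply: saP=> y z; rewrite -{1}(resE z) ipDr -(dsym (resC_dom2 _) (resC_dom2 _)).
rewrite -[resB y in LHS]resBE (dsym (resC_dom _) (resC_dom _)) resBE.
rewrite -ipDl.
by rewrite resE.
Qed.
Lemma resBC : resB * resC = resC * resB.
Proof. by apply: bop_ext=> y; rewrite !opM -[resB y]resBE resC_comm_dom //; exact: resC_dom. Qed.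
Lemma res_dom x : dom x -> x = resC x + resB (D x).
Proof. by move=> dx; rewrite -[resB (D x)]resBE resC_comm_dom // resE. Qed.

(** A vector of the domain is [resC x + resB (D x)], and both ranges lie in the domain; an operator
    commuting with [resC] and [resB] therefore maps the domain into itself. *)
Lemma comm_dom U : U * resC = resC * U -> U * resB = resB * U -> forall x, dom x ->
 dom (U x) /\ D (U x) = U (D x).
Proof.
move=> hC hB x dx.
have e : U x = resC (U x) + resB (U (D x)) by rewrite {1}(res_dom dx) op_add -!opM hC hB.
have d : dom (U x) by rewrite e; apply: domD; [exact: resC_dom|exact: resC_dom2].
split=> //; rewrite e dopD; [|exact: resC_dom|exact: resC_dom2].
rewrite resBE -[in resB _]opM -hB opM -resC_comm_dom // -(opM U) hC opM.
by rewrite resE.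
Qed.
End Facts.
End SelfAdjoint.

(** * The spectral theorem *)

Section SpectralTheorem.
Variables (R : realType) (K : hilb R) (D : operator K).
Hypothesis hD : dsa D.
Implicit Types (x y z : K) (c : R) (S T U P : bop K).
Let C := resC hD.
Let B := resB hD.
(** This is [(D - a) (1 + D^2)^-1], a bounded operator with the sign of [D - a]; its nonpositive
    projection is the spectral projection for []-oo, a]]. *)
Let G a := B - rso a C.
Let sG a : sa (G a).
Proof. by apply: saB; [exact: resB_sa|apply: saR; exact: resC_sa]. Qed.
Let E a := sval (cid (neg_proj (sG a))).
Let EP a : [/\ proj (E a), forall U, U * G a = G a * U -> U * E a = E a * U,
 forall x, E a x = x -> ip (G a x) x <= 0 &
 forall x, E a x = 0 -> 0 <= ip (G a x) x /\ (ip (G a x) x = 0 -> x = 0)].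
Proof. by rewrite /E; case: cid. Qed.
Let pE a : proj (E a). Proof. by case: (EP a). Qed.
Let Gip a x : ip (G a x) x = ip (B x) x - a * ip (C x) x.
Proof. by rewrite /G opB ipBl opR ipZl. Qed.
Let commG U a : U * C = C * U -> U * B = B * U -> U * G a = G a * U.
Proof. by move=> h1 h2; rewrite /G mulrBr mulrBl rsoMr rsoMl h1 h2. Qed.
Let EC a : E a * C = C * E a.
Proof. by case: (EP a) => _ h _ _; apply/esym/h/commG=> //; rewrite /C /B resBC. Qed.
Let EB a : E a * B = B * E a.
Proof. by case: (EP a) => _ h _ _; apply/esym/h/commG=> //; rewrite /C /B resBC. Qed.
Let EE a b : E a * E b = E b * E a.
Proof. by case: (EP b) => _ h _ _; apply/h/commG; [exact: EC|exact: EB]. Qed.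
Let Cpos x : 0 <= ip (C x) x. Proof. exact: (resC_pos hD).2. Qed.
Let C0 x : ip (C x) x = 0 -> x = 0.
Proof. by move/(pos_ker (resC_pos hD))/(resC_inj). Qed.

Lemma spec_family : exists F, specfam F /\
 (forall a, F a * C = C * F a /\ F a * B = B * F a) /\
 forall a b x, F b x = x -> F a x = 0 -> a * ip (C x) x <= ip (B x) x <= b * ip (C x) x.
Proof.
have leE a x : E a x = x -> ip (B x) x <= a * ip (C x) x by case: (EP a) => _ _ h _ /h; rewrite Gip subr_le0.
have geE a x : E a x = 0 -> a * ip (C x) x <= ip (B x) x by case: (EP a) => _ _ _ h /h[]; rewrite Gip subr_ge0.
have mono a b : a <= b -> E b * E a = E a.
 rewrite le_eqVlt=> /orP[/eqP ->|ab]; first exact: (pE b).2.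
 (* The vector [y] lies both below [a] and above [b], so [(b - a) <C y, y>] is at most 0; since [C]
    is injective and positive, [y = 0]. *)
 apply: bop_ext=> x; set y := (1 - E b) (E a x).
 have y1 : E a y = y.
  have EEx : E a (E b (E a x)) = E b (E a (E a x)) by rewrite -!opM EE.
  by rewrite /y opB op1 op_sub EEx !proj_idem.
 have y2 : E b y = 0 by rewrite /y opB op1 op_sub !proj_idem // subrr.
 have h1 := leE _ _ y1; have h2 := geE _ _ y2.
 have y0 : y = 0.
  apply: C0; apply/eqP; rewrite eq_le Cpos andbT -(ler_pM2l (_ : 0 < b - a)) ?subr_gt0 //.
  by rewrite mulr0; lra.
 by rewrite opM; apply/esym/subr0_eq; move: y0; rewrite /y opB op1.
have lo_mono a b : a <= b -> lo (E a) (E b) by move=> ab; apply/(proj_lo (pE a) (pE b))/mono.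
(* Limits of [E] along decreasing sequences, obtained from the increasing complements. Used for
   right continuity and for the limit at minus infinity. *)
have declim (s : nat -> R) : (forall n, s n.+1 <= s n) -> exists Q, [/\ proj Q, scv (fun n => E (s n)) Q,
  forall n, E (s n) * Q = Q & forall a, (forall n, a <= s n) -> Q * E a = E a].
 move=> ds; have [||| T [sT cT _ uT]] := @vigier _ _ (fun n => 1 - E (s n)) 1.
 - by move=> n; apply: saB; [exact: sa1|case: (pE (s n))].
 - move=> n; have := lo_mono _ _ (ds n); rewrite /lo; congr pos.
  by rewrite opprB [RHS]addrC addrA subrK.
 - by move=> n; rewrite rso1; apply/proj_lo1/projC.
 have cQ : scv (fun n => E (s n)) (1 - T).
  move=> x; have -> : (fun n => E (s n) x) = fun n => x - (1 - E (s n)) x.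
   by apply/funext=> n; rewrite opB op1 opprB addrC subrK.
  by rewrite opB op1; apply: cvB; [exact: cv_const|exact: cT].
 have smono n k : (n <= k)%N -> s k <= s n by move=> /subnK <-; elim: (k - n)%N=> [|j IH] //; rewrite addSn (le_trans (ds _)).
 have pQ : proj (1 - T).
  split; first by apply: saB; [exact: sa1|exact: sT].
  apply: (@scv_uniq _ _ (fun n => E (s n) * E (s n))).
   by apply: (scvM (m := 1)) => // n; exact: proj_opn.
  by under eq_fun do rewrite (pE _).2.
 exists (1 - T); split=> // [n|a ha].
  apply: (@scv_uniq _ _ (fun k => E (s n) * E (s k))).
   by apply: (scvM (m := opn (E (s n)))) => //; exact: scv_cst.
  move=> x; apply/cvP=> e e0; have [n0 h] := (cvP _ _).1 (cQ x) e e0.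
  exists (maxn n n0) => k; rewrite geq_max=> /andP[nk n0k].
  by rewrite mono ?h // smono.
 apply: (@scv_uniq _ _ (fun k => E (s k) * E a)).
  by apply: (scvM (m := 1)) => //; [move=> n; exact: proj_opn|exact: scv_cst].
 by under eq_fun do rewrite mono //; exact: scv_cst.
exists E; split; [split|split]=> //.
- move=> a; have [|Q [pQ cQ EQ QE]] := declim (fun n => a + n.+1%:R^-1).
  by move=> n; rewrite lerD2l lef_pV2 ?posrE // ler_nat.
 suff -> : E a = Q by [].
 have hQE : Q * E a = E a by apply: QE=> n; rewrite lerDl.
 have EQc : E a * Q = E a by have := congr1 (@adj _ _) hQE; rewrite adjM (pE a).1 pQ.1.
 apply: bop_ext=> x; set y := Q x - E a x.
 have yE n : E (a + n.+1%:R^-1) y = y by rewrite /y op_sub -!opM EQ mono // lerDl.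
 have y2 : E a y = 0 by rewrite /y op_sub -!opM EQc (pE a).2 subrr.
 have hle : ip (G a y) y <= 0.
  rewrite Gip; have hn n : ip (B y) y - (a + n.+1%:R^-1) * ip (C y) y <= 0.
   by rewrite subr_le0; exact: leE.
  have h1 : ip (B y) y - (a + n.+1%:R^-1) * ip (C y) y @[n --> \oo] --> ip (B y) y - (a + 0) * ip (C y) y.
   apply: cvgB; first exact: cvg_cst.
   by apply: cvgMl; apply: cvgD; [exact: cvg_cst|exact: cvg_harmonic].
  rewrite addr0 in h1; apply: (ler_cvg_to h1 (cvg_cst 0)); near=> n; exact: hn.
 have [_ _ _ /(_ _ y2) [hge hz]] := EP a.
 have y0 : y = 0 by apply: hz; apply/eqP; rewrite eq_le hle hge.
 by have /subr0_eq -> := y0.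
- have [|Q [pQ cQ EQ QE]] := declim (fun n => - n%:R).
  by move=> n; rewrite lerN2 ler_nat.
 suff <- : Q = 0 by [].
 apply: bop_ext=> x; set y := Q x.
 have yE n : E (- n%:R) y = y by rewrite /y -opM EQ.
 apply: C0; apply/eqP; rewrite eq_le Cpos andbT leNgt; apply/negP=> cp.
 have [n] := nat_gt (- ip (B y) y / ip (C y) y).
 rewrite ltr_pdivrMr //; have := leE _ _ (yE n); lra.
- have [|Q [pQ cQ EQ QE]] := declim (fun n => - n%:R).
  by move=> n; rewrite lerN2 ler_nat.
 have [||| T [sT cT lT _]] := @vigier _ _ (fun n => E n%:R) 1.
 + by move=> n; case: (pE n%:R).
 + by move=> n; apply: lo_mono; rewrite ler_nat.
 + by move=> n; rewrite rso1; exact: proj_lo1.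
 suff <- : T = 1 by [].
 apply: bop_ext=> x; set y := x - T x.
 have TE n : E n%:R * T = E n%:R.
  apply: (@scv_uniq _ _ (fun k => E n%:R * E k%:R)).
   by apply: (scvM (m := opn (E n%:R))) => //; exact: scv_cst.
  move=> z; apply/cvP=> e e0; exists n=> k nk; rewrite EE mono ?ler_nat //.
  by rewrite subrr nm0.
 have yE n : E n%:R y = 0 by rewrite /y op_sub -opM TE subrr.
 suff y0 : y = 0 by have := y0; rewrite /y=> /subr0_eq <-.
 apply: C0; apply/eqP; rewrite eq_le Cpos andbT leNgt; apply/negP=> cp.
 have [n] := nat_gt (ip (B y) y / ip (C y) y).
 rewrite ltr_pdivrMr //; have := geE _ _ (yE n); lra.
- by move=> a b x h1 h2; rewrite geE //= leE.
Unshelve. all: by end_near. Qed.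

(** Formally [1 + D^2] is [(D - i)(D + i)], so with [w = (D + i) x] the resolvents cancel. This
    carries the comparison of the forms of [B] and [C] over to the form of [D] itself. *)
Lemma dform x : op_dom D x -> let w := D x + 'i *: x in
 ip (C w) w = ip x x /\ ip (B w) w = ip (D x) x.
Proof.
move=> dx w; have e1 : C (D x) = B x by exact: resC_comm_dom.
have e2 : B (D x) = x - C x by rewrite {2}(res_dom hD dx) addrAC subrr add0r.
have e3 : D (B x) = x - C x by rewrite -{2}(resE hD x) addrAC subrr add0r.
have di : op_dom D ('i *: x) by exact: domZ.
have dC : op_dom D (C x) by exact: resC_dom.
have dB : op_dom D (B x) by exact: resC_dom2.
have eC : D (C x) = B x by [].
have h1 : ip ('i *: C x) (D x) = - ip (B x) ('i *: x) by rewrite ip_i -(dopZ hD) // -(dsym hD dC di) eC.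
have h2 : ip ('i *: B x) (D x) = - ip (x - C x) ('i *: x) by rewrite ip_i -(dopZ hD) // -(dsym hD dB di) e3.
have h3 : ip (B x) (D x) = ip (x - C x) x by rewrite -(dsym hD dB dx) e3.
have h4 : ip (C x) (D x) = ip (B x) x by rewrite -(dsym hD dC dx) eC.
rewrite /w !opX e1 e2; split; rewrite !ipDl !ipDr ip_ii.
 by rewrite h1 h3 ipBl; lra.
by rewrite h2 !ipDl !ipNl h4 (ipC x (D x)); lra.
Qed.

Lemma spectral_theorem : exists (P : set R -> bop K) (mu : K -> {measure set R -> \bar R}),
 [/\ pvm P mu, op_dom D = [set x | (\int[mu x]_l (l ^+ 2)%:E < +oo)%E] &
 forall x, op_dom D x -> ip (D x) x = \int[mu x]_l l].
Proof.
have [F [sF [cF fF]]] := spec_family; have [P [mu [hP eP]]] := specfam_pvm sF.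
have mI (a b : R) : measurable `]a, b]%classic by exact: measurable_itv.
have pP a b := pvm_proj hP (mI a b).
have comm a b : a <= b -> forall x, op_dom D x -> op_dom D (P `]a, b]%classic x) /\
  D (P `]a, b]%classic x) = P `]a, b]%classic (D x).
 move=> ab; apply: comm_dom; rewrite eP // mulrBl mulrBr.
  by rewrite (cF a).1 (cF b).1.
 by rewrite (cF a).2 (cF b).2.
have ranF a b x : a <= b -> P `]a, b]%classic x = x -> F b x = x /\ F a x = 0.
 move=> ab hx; have h : F a * F b = F a.
  by have := congr1 (@adj _ _) (sf_mono sF ab); rewrite adjM !(sf_proj sF _).1.
 have Fa : F a x = 0.
  rewrite -hx eP // opB op_sub -!opM h (sf_proj sF a).2 subrr //.
 by split=> //; move: hx; rewrite eP // opB Fa subr0.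
have form a b x : a <= b -> op_dom D x -> P `]a, b]%classic x = x ->
  a * ip x x <= ip (D x) x <= b * ip x x.
 move=> ab dx hx; have [e1 e2] := dform dx; set w := D x + _ in e1 e2.
 have hw : P `]a, b]%classic w = w by rewrite /w op_add op_cz -(comm _ _ ab _ dx).2 hx.
 have [h1 h2] := ranF _ _ _ ab hw; rewrite -e1 -e2; exact: fF.
(* On the range of the projection of []a, b]] the form of [D - a] lies between 0 and [b - a];
   polarization converts the form bound into a norm bound without using boundedness of [D] there. *)
have nmb a b x : a < b -> op_dom D x -> P `]a, b]%classic x = x ->
  nm (D x - rs a x) <= (b - a) * nm x.
 move=> ab dx hx; set M := b - a; have M0 : 0 < M by rewrite subr_gt0.
 set z := D x - rs a x; set Q := P `]a, b]%classic.
 have hz : Q z = z by rewrite /z op_sub op_rs -(comm _ _ (ltW ab) _ dx).2 hx.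
 have q v : op_dom D v -> Q v = v -> 0 <= ip (D v - rs a v) v <= M * ip v v.
  move=> dv hv; have := form _ _ _ (ltW ab) dv hv; rewrite ipBl ipZl /M mulrBl; lra.
 have key v : op_dom D v -> Q v = v -> 4 * ip z v <= M * (2 * ip x x + 2 * ip v v).
  move=> dv hv.
  have /andP[_ a1] := q (x + v) (domD hD dx dv) ltac:(by rewrite op_add hx hv).
  have /andP[a2 _] := q (x - v) (domB hD dx dv) ltac:(by rewrite op_sub hx hv).
  have s : ip (D v) x = ip (D x) v by rewrite (dsym hD dv dx) ipC.
  move: a1 a2; rewrite (dopD hD) // (dopB hD) // /z !ipE s (ipC v x).
  have := ip_ge0 (x - v); rewrite !ipE (ipC v x) => g.
  by have := mulr_ge0 (ltW M0) g; lra.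
 have [u [du uz]] := dom_dense hD z.
 (* The best test vector in [key] is [z / M]. It is not known to lie in the domain, hence the
    approximating sequence [u]. *)
 have key2 : 4 * (M^-1 * ip z z) <= M * (2 * ip x x + 2 * ip (rs M^-1 z) (rs M^-1 z)).
  have cz : cv (fun n => Q (rs M^-1 (u n))) (rs M^-1 z) by rewrite -hz -op_rs; apply: cv_bop; exact: cvZ.
  have h1 : 4 * ip z (Q (rs M^-1 (u n))) @[n --> \oo] --> 4 * ip z (rs M^-1 z) by apply: cvgMr; apply: cv_ip=> //; exact: cv_const.
  have h2 : M * (2 * ip x x + 2 * ip (Q (rs M^-1 (u n))) (Q (rs M^-1 (u n)))) @[n --> \oo] -->
    M * (2 * ip x x + 2 * ip (rs M^-1 z) (rs M^-1 z)) by apply: cvgMr; apply: cvgD; [exact: cvg_cst|apply: cvgMr; exact: cv_ip].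
  rewrite ipZr in h1; apply: (ler_cvg_to h1 h2); near=> n; apply: key.
   by apply: (comm _ _ (ltW ab) _ _).1; exact: domZ.
  exact/proj_idem/pP.
 apply: nm_le; first by rewrite mulr_ge0 ?nm_ge0 // ltW.
 move: key2; rewrite !ipZl !ipZr exprMn nmsq; set t := ip z z.
 have -> : M * (2 * ip x x + 2 * (M^-1 * (M^-1 * t))) = 2 * M * ip x x + 2 * (M^-1 * t) by field; rewrite gt_eqF.
 move=> h; have {h} : M^-1 * t <= M * ip x x by lra.
 by rewrite mulrC ler_pdivrMr // expr2; lra.
(* [D] is bounded on the projections of a dense set of domain vectors, and it is closed; so the
   whole range lies in the domain. *)
have rdom a b x : a < b -> op_dom D (P `]a, b]%classic x).
 move=> ab; set Q := P `]a, b]%classic; have [u [du ux]] := dom_dense hD x.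
 have dQ n : op_dom D (Q (u n)) by apply: (comm _ _ (ltW ab) _ _).1.
 have bd n m : nm (D (Q (u n)) - D (Q (u m))) <= (b - a + `|a|) * nm (u n - u m).
  rewrite -(dopB hD) // -op_sub; set v := Q (u n - u m).
  have dv : op_dom D v by rewrite /v op_sub; exact: domB.
  have hv : nm v <= nm (u n - u m) by apply: proj_nm; exact: pP.
  have h1 := nmb _ _ _ ab dv (proj_idem _ (pP a b)).
  have h2 : nm (D v) <= nm (D v - rs a v) + `|a| * nm v by rewrite -nmZ; apply: le_trans (nmD _ _); rewrite subrK.
  have h3 : (b - a + `|a|) * nm v <= (b - a + `|a|) * nm (u n - u m) by rewrite ler_wpM2l // addr_ge0 // subr_ge0 ltW.
  by move: h3; rewrite mulrDl; lra.
 have [|y hy] := @cv_complete _ _ (fun n => D (Q (u n))).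
  move=> e e0; have c0 : 0 < b - a + `|a| by rewrite ltr_pwDl // subr_gt0.
  have e2 : 0 < e / (2 * (b - a + `|a|)) by rewrite divr_gt0 // mulr_gt0.
  have [n0 hn] := (cvP _ _).1 ux _ e2; exists n0=> n m hn1 hm1.
  apply: le_lt_trans (bd n m) _; have := nmD (u n - x) (x - u m).
  rewrite addrA subrK (nmBC x) => h; have {}h : nm (u n - u m) < e / (b - a + `|a|).
   have -> : e / (b - a + `|a|) = e / (2 * (b - a + `|a|)) + e / (2 * (b - a + `|a|)) by field; rewrite gt_eqF.
   by have := hn _ hn1; have := hn _ hm1; lra.
  by rewrite mulrC -ltr_pdivlMr.
 by have [] := dclosed hD dQ (cv_bop Q ux) hy.
pose t (a b l : R) : R := l * \1_(`]a, b]%classic) l.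
have bt := @bm_itv R.
have bt0 a b : bm (t a b) by exact: bm_itv0.
have DT a b x : a < b -> D (P `]a, b]%classic x) = fc mu (t a b) x.
 move=> ab; set Q := P `]a, b]%classic; set T := fc mu (t a b).
 have TQ J : measurable J -> J `<=` `]a, b]%classic -> T * P J = fc mu (fun l => l * \1_J l).
  move=> mJ sJ; rewrite fc_mul_ind //; congr fc; apply/funext=> l.
  rewrite /t -mulrA indM; congr (l * \1__ l); apply/seteqP; split=> z /=; first by case.
  by move=> hz; split=> //; exact: sJ.
 set z := D (Q x) - T x; apply/subr0_eq/nm_eq0; rewrite -/z.
 have QT : Q * T = T.
  have -> : Q * T = T * Q by apply: (fc_comm hP (bt0 a b)) => S mS; rewrite /Q (pvm_comm hP).
  by rewrite TQ.
 have Qz : Q z = z.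
  rewrite /z op_sub -(comm _ _ (ltW ab) _ (rdom _ _ x ab)).2 proj_idem; last exact: pP.
  by rewrite -opM QT.
 (* On each of [N] subintervals of length [d], both [D] and the integral [T] are within [d] of the
    left end point. The pieces are orthogonal, so the squared error is at most [(2 d)^2 <x, x>],
    which tends to 0 as [N] grows. *)
 have bd N : (0 < N)%N -> ip z z <= 4 * ((b - a) / N%:R) ^+ 2 * ip x x.
  move=> N0; set d := (b - a) / N%:R.
  have NR : 0 < N%:R :> R by rewrite ltr0n.
  have d0 : 0 < d by rewrite divr_gt0 // subr_gt0.
  pose c k := a + d * k%:R; pose J k := `]c k, c k.+1]%classic.
  have cc k : c k < c k.+1 by rewrite ltrD2l ltr_pM2l // ltr_nat.
  have cdE k : c k.+1 - c k = d by rewrite /c -natr1; ring.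
  have sJ k : (k < N)%N -> J k `<=` `]a, b]%classic.
   move=> kN; apply: subset_itv; rewrite leBSide /=.
    by rewrite lerDl mulr_ge0 // ltW.
   have -> : b = a + d * N%:R by rewrite /d divfK ?gt_eqF // addrC subrK.
   by rewrite lerD2l ler_pM2l // ler_nat.
  have PJQ k : (k < N)%N -> P (J k) * Q = P (J k) by move=> kN; rewrite -(pvmI hP); [|exact: mI|exact: mI]; congr P; apply/seteqP; split=> y; [by case|by move=> h; split=> //; exact: (sJ k)].
  have sumJ : \sum_(k < N) P (J k) = Q.
   transitivity (\sum_(0 <= k < N) (F (c k.+1) - F (c k))).
    by rewrite big_mkord; apply: eq_bigr=> k _; rewrite /J eP // ltW.
   rewrite telescope_sumr // /Q eP ?ltW //; congr (F _ - F _); rewrite /c ?mulr0 ?addr0 //.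
   by rewrite /d divfK ?gt_eqF // addrC subrK.
  have pJ k := pP (c k) (c k.+1).
  have mJ k : measurable (J k) by exact: mI.
  have each k : (k < N)%N -> nm (P (J k) z) <= 2 * d * nm (P (J k) x).
   move=> kN; set v := P (J k) x.
   have dv : op_dom D v by exact: rdom.
   have hv : P (J k) v = v by apply: proj_idem; exact: pJ.
   have -> : P (J k) z = D v - T v.
    rewrite /z op_sub -(comm _ _ (ltW (cc k)) _ (rdom _ _ x ab)).2 -/(J k) -(opM (P (J k)) Q) PJQ //.
    congr (_ - _); rewrite -(opM (P (J k)) T) /v -(opM T); congr (bfun _ x).
    by apply: (fc_comm hP (bt0 a b)) => C' mC'; rewrite (pvm_comm hP).
   have h1 := nmb _ _ _ (cc k) dv hv; rewrite cdE in h1.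
   have h2 : nm (T v - rs (c k) v) <= d * nm v.
    have -> : T v - rs (c k) v = fc mu (fun l => (l - c k) * \1_(J k) l) v.
     rewrite -{1}hv -(opM T) TQ //; last exact: sJ.
     rewrite -{2}hv -opR -opB; congr (bfun _ v).
     have b0 := bm_ind (R := R) (mJ k).
     have b1 : bm (fun l : R => l * \1_(J k) l) by exact: bt0.
     rewrite -(fc_ind hP (mJ k)) -(fcZ hP _ b0) -(fcB hP b1 (bmZ _ b0)).
     by congr fc; apply/funext=> l; ring.
    apply: le_trans (opnP _ _) _; apply: ler_wpM2r; first exact: nm_ge0.
    apply: (fc_opn hP (ltW d0) (bt (c k) (c k.+1) (c k))) => l. rewrite normrM ind_oc.
    case: ifPn=> [/andP[al lb]|_]; last by rewrite normr0 mulr0 ltW.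
    rewrite normr1 mulr1 ger0_norm ?subr_ge0; last exact: ltW.
    by have := cdE k; lra.
   have := nmB (D v - rs (c k) v) (T v - rs (c k) v).
   rewrite opprB addrA subrK; lra.
  have -> : ip z z = \sum_(k < N) nm (P (J k) z) ^+ 2.
   rewrite -{1}Qz -sumJ op_sum; elim/big_rec2: _=> [|k r y _ <-]; first by rewrite ip0l.
   by rewrite ipDl proj_ip //; exact: pJ.
  have e2 : \sum_(k < N) nm (P (J k) x) ^+ 2 = ip (Q x) x.
   rewrite -sumJ op_sum; elim/big_rec2: _=> [|k r y _ ->]; first by rewrite ip0l.
   by rewrite ipDl proj_ip //; exact: pJ.
  apply: le_trans (_ : \sum_(k < N) 4 * d ^+ 2 * nm (P (J k) x) ^+ 2 <= _).
   apply: ler_sum=> k _; have -> : 4 * d ^+ 2 * nm (P (J k) x) ^+ 2 = (2 * d * nm (P (J k) x)) ^+ 2 by ring.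
   have h0 : 0 <= 2 * d * nm (P (J k) x) by rewrite mulr_ge0 ?nm_ge0 // mulr_ge0 // ltW.
   by rewrite ler_pXn2r ?nnegrE ?nm_ge0 //; exact: each.
  rewrite -mulr_sumr e2 ler_wpM2l //; first by rewrite mulr_ge0 ?sqr_ge0.
  by have := loE x (proj_lo1 (pP a b)).
 have h1 : 4 * ((b - a) / n.+1%:R) ^+ 2 * ip x x @[n --> \oo] --> 4 * ((b - a) * 0) ^+ 2 * ip x x.
  apply: cvgMl; apply: cvgMr; rewrite expr2; apply: cvgM; apply: cvgMr; exact: cvg_harmonic.
 rewrite mulr0 expr0n /= mulr0 mul0r in h1.
 have h2 : ip z z <= 0 by apply: (ler_cvg_to (cvg_cst (ip z z)) h1); near=> n; exact: bd.
 by rewrite (ipxx_eq0 (x := z)) ?nm0 //; apply/eqP; rewrite eq_le h2 ip_ge0.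
pose Pn n := P `](- n.+1%:R), n.+1%:R]%classic.
have lt_n := @ltNn R.
have cvP' x : cv (fun n => Pn n x) x.
 rewrite -{2}[x](subr0 x) -(op0 x) -{1}(op1 x).
 have -> : (fun n => Pn n x) = fun n => F n.+1%:R x - F (- n.+1%:R) x by apply/funext=> n; rewrite /Pn eP // ltW.
 apply: cvB.
  apply/cvP=> e e0; have [n0 h] := (cvP _ _).1 (sf_y sF x) e e0.
  by exists n0=> n hn; apply: h; exact: leqW.
 apply/cvP=> e e0; have [n0 h] := (cvP _ _).1 (sf_ny sF x) e e0.
 by exists n0=> n hn; apply: h; exact: leqW.
have eT n x : D (Pn n x) = fc mu (@tn R n) x by rewrite /Pn DT.
have bdd x : op_dom D x -> forall n, nm (fc mu (@tn R n) x) <= nm (D x).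
 move=> dx n; rewrite -eT (comm _ _ (ltW (lt_n n)) _ dx).2; apply: proj_nm; exact: pP.
exists P, mu; split=> //.
- apply/seteqP; split=> x /=; first by move=> dx; apply/(moment_bd hP); exists (nm (D x)); exact: bdd.
 move=> /(moment_bd hP)[c hc]; have [y hy] := moment_cv hP hc.
 have dPn n : op_dom D (Pn n x) by exact: rdom.
 have hy' : cv (fun n => D (Pn n x)) y by under eq_fun do rewrite eT.
 by have [] := dclosed hD dPn (cvP' x) hy'.
- move=> x dx.
 have h1 : ip (D (Pn n x)) x @[n --> \oo] --> ip (D x) x.
  apply: cv_ip; last exact: cv_const.
  have -> : (fun n => D (Pn n x)) = fun n => Pn n (D x) by apply/funext=> n; rewrite (comm _ _ (ltW (lt_n n)) _ dx).2.
  exact: cvP'.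
 have h2 : (\int[mu x]_l (l ^+ 2)%:E < +oo)%E by apply/(moment_bd hP); exists (nm (D x)); exact: bdd.
 apply: (cvg_unique _ h1) => //=; under eq_fun do rewrite eT.
 exact: (moment1 hP h2).
Unshelve. all: by end_near. Qed.
End SpectralTheorem.

Lemma mf_inv (R : realType) d (T : measurableType d) (f : T -> R) (c : R) : 0 < c ->
 (forall x, c <= f x) -> measurable_fun setT f -> measurable_fun setT (fun x => (f x)^-1).
Proof.
move=> c0 hc mf; have -> : (fun x => (f x)^-1) = (fun y => (Num.max y c)^-1) \o f.
 by apply/funext=> x /=; rewrite max_l.
apply: measurableT_comp=> //; apply: continuous_measurable_fun=> x.
apply: cvgV; first by rewrite gt_eqF // lt_max c0 orbT.
by apply: (@continuous_max _ _ id (cst c)); [exact: cvg_id|exact: cvg_cst].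
Qed.

Lemma cmf (R : realType) (f : R -> R) : continuous f -> measurable_fun setT f.
Proof. exact: continuous_measurable_fun. Qed.

Lemma bmX (R : realType) (f : R -> R) n : bm f -> bm (fun l => f l ^+ n).
Proof.
move=> bf; elim: n=> [|n IH]; first exact: (bm_cst 1).
by rewrite (_ : (fun l => f l ^+ n.+1) = fun l => f l * f l ^+ n); [exact: bmM|apply/funext=> l; rewrite exprS].
Qed.

Section Rational.
Variable R : realType.
Implicit Types l : R.
(** [bf l + i cf l] is [1 / (l - i)]: the two functions are the real and imaginary parts of a
    resolvent, which keeps the whole functional calculus real. *)
Definition cf l : R := (1 + l ^+ 2)^-1.
Definition bf l : R := l * cf l.
Lemma cf_gt0 l : 0 < cf l. Proof. by rewrite invr_gt0 ltr_pwDl // sqr_ge0. Qed.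
Lemma cf_ge0 l : 0 <= cf l. Proof. exact: ltW (cf_gt0 l). Qed.
Lemma cf_le1 l : cf l <= 1. Proof. by rewrite invf_le1 ?lerDl ?sqr_ge0 // ltr_pwDl // sqr_ge0. Qed.
Lemma mf_sq1 : measurable_fun setT (fun l : R => 1 + l ^+ 2).
Proof. by apply: measurable_funD; [exact: measurable_cst|apply: measurable_funX; exact: measurable_id]. Qed.
Lemma bm_cf : bm cf.
Proof.
split; last by exists 1=> l; rewrite ger0_norm ?cf_ge0 ?cf_le1.
by apply: (mf_inv (c := 1)) => // [l|]; [rewrite lerDl sqr_ge0|exact: mf_sq1].
Qed.
Lemma bf_le1 l : `|bf l| <= 1.
Proof.
rewrite /bf normrM (ger0_norm (cf_ge0 _)) ler_pdivrMr ?ltr_pwDl ?sqr_ge0 // mul1r.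
by rewrite ler_norml; have := sqr_ge0 (l - 1); have := sqr_ge0 (l + 1); have := sqr_ge0 l; rewrite !expr2; lra.
Qed.
Lemma bm_bf : bm bf.
Proof.
split; last by exists 1; exact: bf_le1.
by apply: measurable_funM; [exact: measurable_id|case: bm_cf].
Qed.
Lemma lbfE l : l * bf l = 1 - cf l.
Proof.
have l0 : 1 + l ^+ 2 != 0 by rewrite gt_eqF // ltr_pwDl // sqr_ge0.
by rewrite /bf /cf; field.
Qed.
Lemma bm_lbf : bm (fun l : R => l * bf l).
Proof. by under eq_fun do rewrite lbfE; apply: bmB; [exact: bm_cst|exact: bm_cf]. Qed.
End Rational.

Lemma tn_mulle (R : realType) n (l a : R) : `|tn n l * a| <= `|l * a|.
Proof. by rewrite [X in _ <= X]normrM (normrM (tn n l)); exact: ler_wpM2r (normr_ge0 a) _ _ (tn_le n l). Qed.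

(** * Uniqueness of the spectral resolution *)

Section Resolution.
Variables (R : realType) (K : hilb R).
Implicit Types (x y z : K) (c : R) (S T U X : bop K) (D : operator K) (P : set R -> bop K)
 (mu : K -> {measure set R -> \bar R}) (f g : R -> R).

Definition sres D P mu := [/\ pvm P mu,
 op_dom D = [set x | (\int[mu x]_l (l ^+ 2)%:E < +oo)%E] &
 forall x, op_dom D x -> ip (D x) x = \int[mu x]_l l].

Section Local.
Variables (D : operator K) (P : set R -> bop K) (mu : K -> {measure set R -> \bar R}).
Hypotheses (hD : dsa D) (hS : sres D P mu).
Let hP : pvm P mu. Proof. by case: hS. Qed.

Lemma sdom x : op_dom D x <-> exists c, forall n, nm (fc mu (@tn R n) x) <= c.
Proof. by case: hS=> _ -> _; exact: (moment_bd hP). Qed.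

(** The limit [L] of the truncations is symmetric on the domain and has the quadratic form of [D]
    there. Polarization and density of the domain give [L = D]. *)
Lemma slim x : op_dom D x -> cv (fun n => fc mu (@tn R n) x) (D x).
Proof.
have hex y : {z | op_dom D y -> cv (fun n => fc mu (@tn R n) y) z}.
 apply/cid; have [dy|nd] := pselect (op_dom D y); last by exists 0.
 by have [c hc] := (sdom y).1 dy; have [z hz] := moment_cv hP hc; exists z.
pose L y := sval (hex y).
have cL y : op_dom D y -> cv (fun n => fc mu (@tn R n) y) (L y) by rewrite /L; case: (hex y).
have Ls y z : op_dom D y -> op_dom D z -> ip (L y) z = ip (L z) y.
 move=> dy dz; have h1 := cv_ip (cL y dy) (cv_const z).
 apply: (cvg_unique _ h1) => //=; have h2 := cv_ip (cL z dz) (cv_const y).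
 rewrite (_ : (fun n => ip (fc mu (@tn R n) y) z) = fun n => ip (fc mu (@tn R n) z) y) //.
 by apply/funext=> n; rewrite (saE _ _ (fc_sa hP (bm_tn R n))) ipC.
have Lq y : op_dom D y -> ip (L y) y = ip (D y) y.
 move=> dy; have h1 := cv_ip (cL y dy) (cv_const y).
 apply: (cvg_unique _ h1) => //=; case: hS=> _ eD q; rewrite q //.
 by apply: (moment1 hP); rewrite eD in dy.
have LD y z : op_dom D y -> op_dom D z -> L (y + z) = L y + L z.
 move=> dy dz; apply: (cv_uniq (cL _ (domD hD dy dz))).
 by under eq_fun do rewrite op_add; apply: cvD; exact: cL.
have Lp y z : op_dom D y -> op_dom D z -> ip (L y) z = ip (D y) z.
 move=> dy dz; have := Lq _ (domD hD dy dz); rewrite LD // (dopD hD) // !ipDl !ipDr !Lq //.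
 by rewrite (Ls z y) // (dsym hD dz dy) (ipC z); lra.
move=> dx; suff -> : D x = L x by exact: cL.
apply/esym/ip_ext=> z; have [u [du cu]] := dom_dense hD z.
have h1 := cv_ip (cv_const (L x)) cu; apply: (cvg_unique _ h1) => //=.
under eq_fun do rewrite Lp //.
exact: cv_ip (cv_const _) cu.
Qed.

Lemma sdom_fc f x : bm f -> op_dom D x -> op_dom D (fc mu f x) /\ D (fc mu f x) = fc mu f (D x).
Proof.
move=> bf dx; have e n : fc mu (@tn R n) (fc mu f x) = fc mu f (fc mu (@tn R n) x).
 by rewrite -!opM (fc_commute hP (bm_tn R n) bf).
have dd : op_dom D (fc mu f x).
 have [c hc] := (sdom x).1 dx; apply/sdom; exists (opn (fc mu f) * c) => n.
 by rewrite e (le_trans (opnP _ _)) // ler_wpM2l ?opn_ge0.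
split=> //; apply: (cv_uniq (slim dd)); under eq_fun do rewrite e.
by apply: cv_bop; exact: slim.
Qed.

Lemma sdom_lf f x : bm f -> bm (fun l : R => l * f l) ->
 op_dom D (fc mu f x) /\ D (fc mu f x) = fc mu (fun l => l * f l) x.
Proof.
move=> bf blf; have btf n : bm (fun l : R => tn n l * f l) := bmM (bm_tn R n) bf.
have e n : fc mu (@tn R n) (fc mu f x) = fc mu (fun l => tn n l * f l) x by rewrite -opM (fcM hP (bm_tn R n) bf).
have [mlf [c hc]] := blf.
have c0 : 0 <= c by apply: le_trans (hc 0).
have le n l : `|tn n l * f l| <= c by apply: le_trans (hc l); exact: tn_mulle.
have dd : op_dom D (fc mu f x).
 apply/sdom; exists (c * nm x) => n; rewrite e; apply: le_trans (opnP _ _) _.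
 by rewrite ler_wpM2r ?nm_ge0 // (fc_opn hP).
split=> //; apply: (cv_uniq (slim dd)); under eq_fun do rewrite e.
apply: (fc_scv hP (c := c)) => //; first by move=> n; case: (btf n).
move=> l; apply: cvgM; [exact: tn_cv|exact: cvg_cst].
Qed.
End Local.

Lemma fc_intertwine P1 mu1 P2 mu2 X f : pvm P1 mu1 -> pvm P2 mu2 -> bm f ->
 (forall B, measurable B -> X * P1 B = P2 B * X) -> X * fc mu1 f = fc mu2 f * X.
Proof.
move=> h1 h2 bf hX; have [g [c [c0 mg g01 ->]]] := bm_affine bf.
have bg : bm g by split=> //; exists 1=> l; have /andP[a b] := g01 l; rewrite ger0_norm.
move: (2 * c) => e; have be := bmZ e bg; have bc := bm_cst (R := R) (T := R) (- c).
rewrite (fcD h1 bc be) (fcD h2 bc be) (fc_cst h1) (fc_cst h2) (fcZ h1 _ bg) (fcZ h2 _ bg).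
rewrite mulrDl mulrDr !rsoMl !rsoMr mul1r mulr1; congr (_ + rso _ _).
have [T1 [e1 c1]] := fc01 h1 mg g01; have [T2 [e2 c2]] := fc01 h2 mg g01.
rewrite (fc_uniq e1) (fc_uniq e2).
apply: (@scv_uniq _ _ (fun n => X * dop P1 g n)); first by apply: (@scvM _ _ _ _ _ _ (opn X)) => //; exact: scv_cst.
have -> : (fun n => X * dop P1 g n) = fun n => dop P2 g n * X.
 apply/funext=> n; rewrite /dop mulr_sumr mulr_suml; apply: eq_bigr=> k _.
 by rewrite rsoMl rsoMr hX //; exact: (mdg mg k).2.
by move=> x; have h := c2 (X x); rewrite /cv opM; under eq_fun do rewrite opM.
Qed.

Lemma fc_res D P mu x : dsa D -> sres D P mu ->
 [/\ op_dom D (fc mu (@cf R) x), D (fc mu (@cf R) x) = fc mu (@bf R) x, op_dom D (fc mu (@bf R) x) &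
   fc mu (@cf R) x + D (fc mu (@bf R) x) = x].
Proof.
move=> hD hS; have [hP _ _] := hS.
have [d1 e1] := sdom_lf hD hS x (bm_cf R) (bm_bf R).
have [d2 e2] := sdom_lf hD hS x (bm_bf R) (bm_lbf R).
split=> //; rewrite e2 (_ : (fun l : R => l * bf l) = fun l => 1 - cf l); last by apply/funext=> l; rewrite lbfE.
by rewrite (fcB hP (bm_cst 1) (bm_cf R)) (fc_cst hP) rso1 opB op1 addrC subrK.
Qed.

Definition smooth (y : R) : R := y ^+ 2 * (3 - 2 * y).

(** Below 1/2 each application contracts by at least the factor [d (3 - 2 d)], which is less than 1
    because [1 - 3 d + 2 d^2 = (1 - d)(1 - 2 d)]. The symmetry under [y -> 1 - y] takes care of the
    other half. *)
Lemma smooth_lim (d : R) : 0 <= d < 2^-1 -> iter n smooth d @[n --> \oo] --> (0 : R).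
Proof.
move=> /andP[d0 d2]; set r := d * (3 - 2 * d).
have [r0 r1] : 0 <= r /\ r < 1 by rewrite /r; split; nra.
apply: (@squeeze0 _ _ (fun n => r ^+ n)); last by apply: cvg_expr; rewrite ger0_norm.
move=> n; suff /andP[-> h] : 0 <= iter n smooth d <= d * r ^+ n.
 by apply: le_trans h _; rewrite ler_piMl ?exprn_ge0 //; lra.
elim: n=> [|n /andP[y0 yn]]; first by rewrite expr0 mulr1 lexx d0.
have yd : iter n smooth d <= d by apply: le_trans yn _; rewrite ler_piMr // exprn_ile1 // ltW.
rewrite iterS exprSr mulrA; move: (iter n smooth d) y0 yn yd=> y y0 yn yd.
rewrite /smooth expr2 -mulrA; apply/andP; split; first by rewrite !mulr_ge0 //; lra.
by apply: ler_pM=> //; rewrite ?mulr_ge0 /r //; nra.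
Qed.

(* Functions f with X f(D1) = f(D2) X form an algebra closed under bounded
 pointwise limits. It contains (l - a) / (1 + l^2), whose sign is that of
 l - a; iterating the polynomial [smooth] produces the indicator of l > a. *)
Lemma intertwine D1 D2 P1 P2 mu1 mu2 X : dsa D1 -> sres D1 P1 mu1 -> dsa D2 -> sres D2 P2 mu2 ->
 (forall x, op_dom D1 x -> op_dom D2 (X x) /\ D2 (X x) = X (D1 x)) ->
 forall B, measurable B -> X * P1 B = P2 B * X.
Proof.
move=> hD1 hS1 hD2 hS2 hX; have [h1 _ _] := hS1; have [h2 _ _] := hS2.
pose ok f := bm f /\ X * fc mu1 f = fc mu2 f * X.
have okC c : ok (fun=> c) by split; [exact: bm_cst|rewrite (fc_cst h1) (fc_cst h2) rsoMr rsoMl mul1r mulr1].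
have okD f g : ok f -> ok g -> ok (fun l => f l + g l) by move=> [bf e] [bg e']; split; [exact: bmD|rewrite (fcD h1) // (fcD h2) // mulrDr mulrDl e e'].
have okM f g : ok f -> ok g -> ok (fun l => f l * g l) by move=> [bf e] [bg e']; split; [exact: bmM|rewrite -(fcM h1) // -(fcM h2) // mulrA e -mulrA e' mulrA].
have okL f (f_ : nat -> R -> R) c : bm f -> (forall n, ok (f_ n)) ->
  (forall l, f_ n l @[n --> \oo] --> f l) -> (forall n l, `|f_ n l| <= c) -> ok f.
 move=> bf hf lim hc; split=> //.
 have mf n : measurable_fun setT (f_ n) by case: (hf n) => -[].
 have [m _] := bf; have s1 := fc_scv h1 mf m lim hc; have s2 := fc_scv h2 mf m lim hc.
 apply: (@scv_uniq _ _ (fun n => X * fc mu1 (f_ n))).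
  by apply: (@scvM _ _ _ _ _ _ (opn X)) => //; exact: scv_cst.
 rewrite (_ : (fun n => X * fc mu1 (f_ n)) = fun n => fc mu2 (f_ n) * X) => [x|].
  by have := s2 (X x); rewrite /cv opM; under [in X in _ -> X]eq_fun do rewrite opM.
 by apply/funext=> n; case: (hf n).
have res x : X (fc mu1 (@cf R) x) = fc mu2 (@cf R) (X x) /\ X (fc mu1 (@bf R) x) = fc mu2 (@bf R) (X x).
 have [d1 e1 d2 e2] := fc_res x hD1 hS1; have [k1 f1 k2 f2] := fc_res (X x) hD2 hS2.
 have [x1 y1] := hX _ d1; have [x2 y2] := hX _ d2.
 have e : X (fc mu1 (@cf R) x) = fc mu2 (@cf R) (X x) by apply: (res_uniq hD2) => //; rewrite ?y1 ?e1 ?f1 // f2 y2 -op_add e2.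
 by split=> //; rewrite -f1 -e y1 e1.
have okc : ok (@cf R) by split; [exact: bm_cf|apply: bop_ext=> x; exact: (res x).1].
have okb : ok (@bf R) by split; [exact: bm_bf|apply: bop_ext=> x; exact: (res x).2].
have okr a : ok \1_(`]a, +oo[%classic).
 (* [1 + |a|] bounds [|l - a| / (1 + l^2)], so [g] takes values in [[0, 1]] and compares with 1/2
    exactly as [l] compares with [a]. *)
 pose r := 1 + `|a|; have r0 : 0 < r by rewrite ltr_pwDl.
 pose g (l : R) : R := 2^-1 + (2 * r)^-1 * (bf l + - a * cf l).
 have gE l : g l = 2^-1 + (l - a) * cf l / (2 * r) by rewrite /g /bf; ring.
 have g01 l : 0 <= g l <= 1.
  have : `|(l - a) * cf l| <= r.
   rewrite normrM (ger0_norm (cf_ge0 l)) ler_pdivrMr ?ltr_pwDl ?sqr_ge0 //.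
   apply: le_trans (ler_normB _ _) _; rewrite /r -[l ^+ 2]real_normK ?num_real //.
   by have := normr_ge0 a; have := sqr_ge0 (`|l| - 1); rewrite !expr2; have := normr_ge0 l; nra.
  rewrite gE ler_norml=> /andP[b1 b2]; have i0 : 0 < 2 * r by lra.
  have : - 2^-1 <= (l - a) * cf l / (2 * r) <= 2^-1 by rewrite ler_pdivlMr // ler_pdivrMr //; apply/andP; split; lra.
  by lra.
 have okg n : ok (fun l => iter n smooth (g l)).
  elim: n=> [|n IH] /=; first by apply: (okD) => //; apply: (okM) => //; apply: (okD) => //; exact: okM.
  rewrite /smooth; under eq_fun do rewrite expr2 -mulNr.
  by apply: (okM); [exact: okM|apply: (okD) => //; exact: okM].
 pose s (l : R) : R := 2^-1 * (\1_(`[a, +oo[%classic) l + \1_(`]a, +oo[%classic) l).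
 have bs : bm s by apply: bmZ; apply: bmD; apply: bm_ind; exact: measurable_itv.
 have sym n (y : R) : iter n smooth (1 - y) = 1 - iter n smooth y by elim: n=> [|n IH] //; rewrite !iterS IH /smooth; ring.
 have lim l : iter n smooth (g l) @[n --> \oo] --> s l.
  rewrite /s !indicE !mem_setE !in_itv /= !andbT.
  have c0 := cf_gt0 l; have r2 : 0 < (2 * r)^-1 by rewrite invr_gt0; lra.
  have /andP[g0 g1] := g01 l; have [la|al|la] := ltgtP l a.
  - rewrite addr0 mulr0; apply: smooth_lim; rewrite g0 gE gtrDl pmulr_llt0 // pmulr_llt0 //; lra.
  - rewrite (_ : 2^-1 * _ = 1 - 0); last by rewrite /=; lra.
   rewrite -[g l](subKr 1); under eq_fun do rewrite sym.
   apply: cvgB; first exact: cvg_cst.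
   apply: smooth_lim; rewrite subr_ge0 g1 /= gE.
   have : 0 < (l - a) * cf l / (2 * r) by rewrite mulr_gt0 // mulr_gt0 // subr_gt0.
   set z := _ / _; lra.
  - rewrite addr0 mulr1 gE la subrr !mul0r addr0; apply: cvg_near_cst; exists 0%N=> // n _.
   by elim: n=> //= n ->; rewrite /smooth expr2; lra.
 have oks : ok s.
  apply: (okL _ _ 1 bs okg lim) => n l; suff /andP[y0 y1] : 0 <= iter n smooth (g l) <= 1 by rewrite ger0_norm.
  elim: n=> //= n; rewrite /smooth expr2; move: (iter n smooth _) => y /andP[y0 y1].
  have h : 0 <= (1 - y) ^+ 2 * (1 + 2 * y) by rewrite mulr_ge0 ?sqr_ge0 //; lra.
  by apply/andP; split; [rewrite !mulr_ge0 //; lra|rewrite expr2 in h; lra].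
 (* The limit [s] takes the values 0, 1/2 and 1; the polynomial [2 s^2 - s] sends the middle value
    to 0 and fixes the other two. *)
 rewrite (_ : \1_ _ = fun l => 2 * (s l * s l) + -1 * s l); last first.
  apply/funext=> l; rewrite /s !indicE !mem_setE !in_itv /= !andbT.
  by have [] := ltgtP a l=> /=; lra.
 by apply: (okD); apply: (okM) => //; exact: okM.
pose G : set (set R) := [set B | measurable B /\ ok \1_B].
have GC B : G B -> G (~` B).
 move=> [mB kB]; split; first exact: measurableC.
 rewrite (_ : \1_(~` B) = fun l => 1 + -1 * \1_B l); first by apply: (okD) => //; exact: okM.
 by apply/funext=> l; rewrite !indicE in_setC; case: (_ \in _) => /=; lra.
have GI B C : G B -> G C -> G (B `&` C).
 move=> [mB kB] [mC kC]; split; first exact: measurableI.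
 by rewrite (_ : \1_(B `&` C) = fun l => \1_B l * \1_C l); [exact: okM|apply/funext=> l; rewrite indM].
move=> B mB; suff [_ [_]] : G B by rewrite (fc_ind h1) // (fc_ind h2).
have hB : (@ocitv R).-sigma.-measurable B := mB; rewrite RGenOInfty.measurableE in hB.
apply: (hB G); split=> [|_ [a ->]]; last by split; [exact: measurable_itv|exact: okr].
have G0 : G set0 by split=> //; rewrite indic0; exact: (okC 0).
split=> [//|C GB|F GF]; first by rewrite setTD; exact: GC.
have GU n : G (\big[setU/set0]_(k < n) F k).
 elim: n=> [|n IH]; first by rewrite big_ord0.
 by rewrite big_ord_recr /= -[_ `|` _]setCK setCU; apply: (GC); apply: GI; exact: GC.
have mU : measurable (\bigcup_k F k) by apply: bigcup_measurable=> k _; case: (GF k).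
split=> //; apply: (okL _ (fun n => \1_(\big[setU/set0]_(k < n) F k)) 1).
- exact: bm_ind.
- by move=> n; case: (GU n).
- move=> l; have [[k _ hk]|h] := pselect ((\bigcup_n F n) l).
  apply: cvg_near_cst; exists k.+1=> // n /= kn; rewrite !indicE !mem_set //; first by exists k.
  by rewrite -bigcup_mkord; exists k.
 apply: cvg_near_cst; exists 0%N=> // n _; rewrite !indicE !memNset //.
 by rewrite -bigcup_mkord=> -[k _ hk]; apply: h; exists k.
- by move=> n l; rewrite indicE; case: (_ \in _); rewrite ?normr1 ?normr0.
Qed.
End Resolution.

Definition pfm (R : realType) (m : {measure set R -> \bar R}) (f : R -> R) (mf : measurable_fun setT f) :
 {measure set R -> \bar R} := measure_function_pushforward__canonical__measure_function_Measure m mf.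

Section SquareIntegrable.
Variables (R : realType) (m : {measure set R -> \bar R}).
Hypothesis mT : (m setT < +oo)%E.
Implicit Types f g : R -> R.

Lemma l2_int f : measurable_fun setT f -> (\int[m]_l (f l ^+ 2)%:E < +oo)%E -> m.-integrable setT (EFin \o f).
Proof.
move=> mf h; have hi : m.-integrable setT (fun l => (1%:E + (f l ^+ 2)%:E)%E).
 apply: integrableD=> //; first exact: (bm_int mT (bm_cst 1)).
 apply/integrableP; split; first by apply/measurable_EFinP; exact: measurable_funX.
 by under eq_integral do rewrite gee0_abs ?lee_fin ?sqr_ge0 //.
apply: le_integrable hi=> //; first exact/measurable_EFinP.
move=> l _; rewrite -EFinD /= lee_fin [leRHS]ger0_norm ?addr_ge0 ?sqr_ge0 // ler_norml.
have := sqr_ge0 (f l - 1); have := sqr_ge0 (f l + 1); have := sqr_ge0 (f l); rewrite !expr2.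
move: (f l) => a; lra.
Qed.

Lemma l2_shift f g : measurable_fun setT f -> bm g -> (\int[m]_l (f l ^+ 2)%:E < +oo)%E ->
 (\int[m]_l ((f l + g l) ^+ 2)%:E < +oo)%E.
Proof.
move=> mf bg h; have mf2 : measurable_fun setT (fun l => (f l ^+ 2)%:E).
 by apply/measurable_EFinP; exact: measurable_funX.
have mg2 : measurable_fun setT (fun l => (g l ^+ 2)%:E) by apply/measurable_EFinP; apply: measurable_funX; case: bg.
apply: (@le_lt_trans _ _ (\int[m]_l (2%:E * (f l ^+ 2)%:E + 2%:E * (g l ^+ 2)%:E))%E).
 apply: ge0_le_integral=> //.
 - by move=> l _; rewrite lee_fin sqr_ge0.
 - by apply/measurable_EFinP; apply: measurable_funX; apply: measurable_funD=> //; case: bg.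
 - by apply: emeasurable_funD; apply: measurable_funeM.
 - move=> l _; rewrite -!EFinM -EFinD lee_fin; have := sqr_ge0 (f l - g l); rewrite !expr2.
  move: (f l) (g l) => a b; lra.
rewrite ge0_integralD //; try by move=> l _; rewrite -EFinM lee_fin mulr_ge0 ?sqr_ge0.
- rewrite !ge0_integralZl_EFin //; try by move=> l _; rewrite lee_fin sqr_ge0.
 apply: lte_add_pinfty; apply: lte_mul_pinfty=> //.
 by have /integrable_lty := bm_int mT (bmM bg bg); apply.
- exact: measurable_funeM.
- exact: measurable_funeM.
Qed.
End SquareIntegrable.

(** * The functional calculus of a self-adjoint operator *)

Section Calculus.
Variables (R : realType) (K : hilb R).
Implicit Types (x y z : K) (c : R) (S T U X A : bop K) (D : operator K) (P : set R -> bop K)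
 (mu : K -> {measure set R -> \bar R}) (f g : R -> R).

Lemma sa_dot T x : sa T -> ip (T x) ('i *: x) = 0.
Proof.
by move=> sT; have := ip_i (T x) x; rewrite ipC (saE _ _ sT) op_cz=> h; have := ip_i x (T x); rewrite ipC; lra.
Qed.

Lemma anti0 S : (forall x, ip (S x) ('i *: x) = 0) -> (forall x y, ip (S x) y = - ip x (S y)) -> S = 0.
Proof.
move=> h1 Sa; apply: bop_ext=> x; rewrite op0; apply: ip_ext=> z; rewrite ip0l.
have e2 y : ip (S x) ('i *: y) = 0.
 have := h1 (x + y); rewrite op_add scalerDr !ipDl !ipDr !h1.
 rewrite [ip (S y) _]Sa op_cz; have := ip_i y (S x); rewrite (ipC ('i *: y)); lra.
have := e2 (- ('i *: z)); rewrite scalerN scalerA -expr2 sqr_i scaleN1r opprK; exact.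
Qed.

(** On a complex Hilbert space a real quadratic form forces self-adjointness: the skew part has a
    vanishing form, hence vanishes by polarization with [x] and ['i *: x]. *)
Lemma dot_sa T : (forall x, ip (T x) ('i *: x) = 0) -> sa T.
Proof.
move=> h; pose S := T - adj T.
have h1 x : ip (S x) ('i *: x) = 0.
 rewrite opB ipBl h adjEl op_cz; have := ip_i x (T x).
 by have := h x; rewrite ipC=> ->; lra.
have Sa x y : ip (S x) y = - ip x (S y) by rewrite !opB !ipE adjEl adjE; lra.
by apply/eqP; rewrite eq_sym -subr_eq0; apply/eqP; exact: anti0 h1 Sa.
Qed.

Lemma pvm_uniq D P mu P' mu' B : dsa D -> sres D P mu -> sres D P' mu' -> measurable B -> P B = P' B.
Proof.
move=> hD h h' mB; have := @intertwine _ _ D D P P' mu mu' 1 hD h hD h' _ B mB.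
by rewrite mul1r mulr1; apply=> x dx; rewrite !op1.
Qed.

Lemma fc_eq P mu P' mu' f : pvm P mu -> pvm P' mu' -> (forall B, measurable B -> P B = P' B) ->
 bm f -> fc mu f = fc mu' f.
Proof.
move=> h h' e bf; have := @fc_intertwine _ _ P mu P' mu' 1 f h h' bf.
by rewrite mul1r mulr1; apply=> B mB; rewrite e // mul1r mulr1.
Qed.

(** The choice ranges over all resolutions of [D]; [pvm_uniq] makes the result independent of it, so
    [fn] can be computed in any resolution ([fnE]). *)
Definition fn D f : bop K := xget 0 [set T | exists P mu, sres D P mu /\ is_fc mu f T].

Lemma fnE D P mu f : dsa D -> sres D P mu -> bm f -> fn D f = fc mu f.
Proof.
move=> hD hS bf; have [hP _ _] := hS.
have : [set T | exists P mu, sres D P mu /\ is_fc mu f T] (fn D f) by apply: xgetPex; exists (fc mu f), P, mu; split=> //; exact: (fcP hP).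
move=> [P' [mu' [hS' h]]]; have [hP' _ _] := hS'; rewrite -(fc_uniq h).
by apply: (fc_eq hP' hP) => // B mB; exact: (pvm_uniq hD hS' hS).
Qed.

Section OneOperator.
Variable D : operator K.
Hypothesis hD : dsa D.

Lemma fnP : exists P mu, [/\ sres D P mu, pvm P mu & forall f, bm f -> fn D f = fc mu f].
Proof.
have [P [mu [h1 h2 h3]]] := spectral_theorem hD; have hS : sres D P mu by split.
by exists P, mu; split=> // f bf; exact: (fnE hD hS).
Qed.

Lemma fn_sa f : bm f -> sa (fn D f).
Proof. by have [P [mu [_ hP e]]] := fnP=> bf; rewrite e //; exact: (fc_sa hP). Qed.
Lemma fnD f g : bm f -> bm g -> fn D (fun l => f l + g l) = fn D f + fn D g.
Proof.
by have [P [mu [_ hP e]]] := fnP=> bf bg; rewrite !e //; [exact: (fcD hP)|exact: bmD].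
Qed.
Lemma fnB f g : bm f -> bm g -> fn D (fun l => f l - g l) = fn D f - fn D g.
Proof.
by have [P [mu [_ hP e]]] := fnP=> bf bg; rewrite !e //; [exact: (fcB hP)|exact: bmB].
Qed.
Lemma fnM f g : bm f -> bm g -> fn D f * fn D g = fn D (fun l => f l * g l).
Proof.
by have [P [mu [_ hP e]]] := fnP=> bf bg; rewrite !e //; [exact: (fcM hP)|exact: bmM].
Qed.
Lemma fnZ c f : bm f -> fn D (fun l => c * f l) = rso c (fn D f).
Proof.
by have [P [mu [_ hP e]]] := fnP=> bf; rewrite !e //; [exact: (fcZ hP)|exact: bmZ].
Qed.
Lemma fnN f : bm f -> fn D (fun l => - f l) = - fn D f.
Proof.
by have [P [mu [_ hP e]]] := fnP=> bf; rewrite !e //; [exact: (fcN hP)|exact: bmN].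
Qed.
Lemma fn_cst c : fn D (fun=> c) = rso c 1.
Proof. by have [P [mu [_ hP e]]] := fnP; rewrite e; [exact: (fc_cst hP)|exact: bm_cst]. Qed.
Lemma fn1 : fn D (fun=> 1) = 1. Proof. by rewrite fn_cst rso1. Qed.
Lemma fn0 : fn D (fun=> 0) = 0. Proof. by rewrite fn_cst rso0. Qed.
Lemma fn_lo f g : bm f -> bm g -> (forall l, f l <= g l) -> lo (fn D f) (fn D g).
Proof. by have [P [mu [_ hP e]]] := fnP=> bf bg h; rewrite !e //; exact: (fc_lo hP). Qed.
Lemma fn_pos f : bm f -> (forall l, 0 <= f l) -> pos (fn D f).
Proof. by have [P [mu [_ hP e]]] := fnP=> bf h; rewrite !e //; exact: (fc_pos hP). Qed.
Lemma fn_opn f c : 0 <= c -> bm f -> (forall l, `|f l| <= c) -> opn (fn D f) <= c.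
Proof. by have [P [mu [_ hP e]]] := fnP=> c0 bf h; rewrite !e //; exact: (fc_opn hP). Qed.
Lemma fn_commute f g : bm f -> bm g -> fn D f * fn D g = fn D g * fn D f.
Proof. by have [P [mu [_ hP e]]] := fnP=> bf bg; rewrite !e //; exact: (fc_commute hP). Qed.
Lemma fn_scv f (f_ : nat -> R -> R) c : (forall n, measurable_fun setT (f_ n)) ->
 measurable_fun setT f -> (forall l, f_ n l @[n --> \oo] --> f l) -> (forall n l, `|f_ n l| <= c) ->
 scv (fun n => fn D (f_ n)) (fn D f).
Proof.
have [P [mu [_ hP e]]] := fnP=> mf_ mf cf hc.
rewrite e; last first.
 split=> //; exists c=> l; apply: (ler_cvg_to (cvg_norm (cf l)) (cvg_cst c)).
 by near=> n.
have -> : (fun n => fn D (f_ n)) = fun n => fc mu (f_ n) by apply/funext=> n; rewrite e //; split=> //; exists c.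
exact: (fc_scv hP (c := c)).
Unshelve. all: by end_near. Qed.
Lemma fn_proj (B : set R) : measurable B -> proj (fn D \1_B).
Proof.
move=> mB; have b := bm_ind (R := R) mB; split; first exact: fn_sa.
by rewrite fnM //; congr fn; apply/funext=> l; rewrite indM setIid.
Qed.
Lemma fn_fc_dom f x : bm f -> op_dom D x -> op_dom D (fn D f x) /\ D (fn D f x) = fn D f (D x).
Proof. by have [P [mu [hS hP e]]] := fnP=> bf dx; rewrite e //; exact: (sdom_fc hD hS). Qed.
Lemma fn_dom f x : bm f -> bm (fun l : R => l * f l) ->
 op_dom D (fn D f x) /\ D (fn D f x) = fn D (fun l => l * f l) x.
Proof. by have [P [mu [hS hP e]]] := fnP=> bf blf; rewrite !e //; exact: (sdom_lf hD hS). Qed.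

(** If [D x = 0] then [x] is fixed by [(1 + D^2)^-1], hence by its powers, which converge strongly
    to the projection of [{0}]. *)
Lemma ker_fn x : (op_dom D x /\ D x = 0) <-> fn D \1_[set 0] x = x.
Proof.
have m0 : measurable [set (0 : R)] by exact: measurable_set1.
have b0 := bm_ind (R := R) m0.
split; last first.
 move=> e; have e0 : (fun l : R => l * \1_[set 0] l) = fun=> 0.
  apply/funext=> l; rewrite indicE; case: (boolP (l \in _)); last by rewrite mulr0.
  by rewrite inE=> ->; rewrite mul0r.
 have [|d1 d2] := fn_dom x b0; first by rewrite e0; exact: bm_cst.
 by rewrite -e; split=> //; rewrite d2 e0 fn0 op0.
move=> [dx Dx].
have h1 : fn D (@cf R) x = x.
 have [_ d2] := fn_dom x (bm_bf R) (bm_lbf R); rewrite (fn_fc_dom (bm_bf R) dx).2 Dx op_zero in d2.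
 have : fn D (fun l => 1 - cf l) x = 0 by rewrite [RHS]d2; congr (bfun (fn D _) x); apply/funext => l; rewrite lbfE.
 by rewrite fnB ?fn1 ?opB ?op1; [move/eqP; rewrite subr_eq0 eq_sym=> /eqP|exact: bm_cst|exact: (bm_cf R)].
have bX n : bm (fun l : R => cf l ^+ n) := bmX n (bm_cf R).
have hX n : fn D (fun l => cf l ^+ n) x = x.
 elim: n=> [|n IH]; first by under eq_fun do rewrite expr0; rewrite fn1 op1.
 by under eq_fun do rewrite exprS; rewrite -fnM ?opM ?IH //; exact: (bm_cf R).
apply/esym/(cv_uniq (cv_const x)).
have -> : (fun=> x) = (fun n => fn D (fun l => cf l ^+ n) x) by apply/funext=> n; rewrite hX.
apply: (fn_scv (c := 1)); [by move=> n; case: (bX n) | exact: measurable_indic | |].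
- move=> l; rewrite indicE; have [->|l0] := eqVneq l 0.
  rewrite mem_set //=; under eq_fun do rewrite /cf expr0n addr0 invr1 expr1n; exact: cvg_cst.
 rewrite memNset; last by apply/eqP.
 apply: cvg_expr; rewrite ger0_norm ?cf_ge0 // /cf invf_lt1.
  by rewrite ltrDl exprn_even_gt0.
 by rewrite ltr_pwDl // sqr_ge0.
- by move=> n l; rewrite ger0_norm ?exprn_ge0 ?cf_ge0 // exprn_ile1 ?cf_ge0 ?cf_le1.
Qed.
End OneOperator.

Lemma fn_inter D1 D2 X f : dsa D1 -> dsa D2 ->
 (forall x, op_dom D1 x -> op_dom D2 (X x) /\ D2 (X x) = X (D1 x)) -> bm f ->
 X * fn D1 f = fn D2 f * X.
Proof.
move=> h1 h2 hX bf; have [P1 [mu1 [S1 hP1 e1]]] := fnP h1; have [P2 [mu2 [S2 hP2 e2]]] := fnP h2.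
by rewrite e1 // e2 //; apply: (fc_intertwine hP1 hP2 bf); exact: (intertwine h1 S1 h2 S2 hX).
Qed.

(** The resolution of [D'] is the image under [psi] of that of [D]; uniqueness then identifies the
    two calculi. Instances are bounded functions [psi(D)] and perturbations [D + phi(D)]. *)
Lemma fn_push D D' (psi f : R -> R) : dsa D -> dsa D' -> measurable_fun setT psi ->
 (forall P mu, sres D P mu -> op_dom D' = [set x | (\int[mu x]_l (psi l ^+ 2)%:E < +oo)%E]) ->
 (forall P mu x, sres D P mu -> op_dom D' x -> ip (D' x) x = \int[mu x]_l psi l /\
  (mu x : {measure set R -> \bar R}).-integrable setT (EFin \o psi)) ->
 bm f -> fn D' f = fn D (f \o psi).
Proof.
move=> hD hD' mpsi hdom hip bf; have [P [mu [hS hP e]]] := fnP hD.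
have mpre B : measurable B -> measurable (psi @^-1` B) by move=> mB; rewrite -[X in measurable X]setTI; exact: mpsi.
pose P' B := P (psi @^-1` B); pose mu' x := pfm (mu x) mpsi.
have hP' : pvm P' mu'.
 split.
 - by move=> B mB; apply: (pvm_proj hP); exact: mpre.
 - by rewrite /P' preimage_setT (pvmT hP).
 - by move=> B C mB mC; rewrite /P' preimage_setI (pvmI hP) //; exact: mpre.
 - by move=> x B mB; rewrite /mu' /= /pushforward (pvm_mu hP) //; exact: mpre.
have I2 x : (\int[mu' x]_l (l ^+ 2)%:E = \int[mu x]_l (psi l ^+ 2)%:E)%E.
 apply: (@ge0_integral_pushforward _ _ _ _ R psi mpsi (mu x) setT (fun l : R => (l ^+ 2)%:E)) => //.
 by apply/measurable_EFinP; apply: measurable_funX; exact: measurable_id.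
 by move=> l _; rewrite lee_fin sqr_ge0.
have hS' : sres D' P' mu'.
 split=> //.
 - rewrite (hdom _ _ hS); apply/seteqP; split=> x /=; have <- // := I2 x.
 - move=> x dx; have [-> hi] := hip _ _ _ hS dx; rewrite /Rintegral; congr fine.
  apply/esym; apply: (@integral_pushforward _ _ _ _ R psi mpsi (mu x) setT (fun l : R => l%:E)) => //.
  by apply/measurable_EFinP; exact: measurable_id.
have bfp : bm (f \o psi).
 case: bf=> mf [c hc]; split; last by exists c=> l; exact: hc.
 exact: measurableT_comp.
rewrite (fnE hD' hS' bf) (e _ bfp); apply: fc_uniq; split; first exact: (fc_sa hP).
move=> x; rewrite (fcq hP _ bfp) /Rintegral; congr fine.
apply/esym; apply: (@integral_pushforward _ _ _ _ R psi mpsi (mu x) setT (fun l : R => (f l)%:E)) => //.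
 by apply/measurable_EFinP; case: bf.
exact: (bm_int (mu_fin hP x) bfp).
Qed.

Lemma dsa_every T : sa T -> dsa (everywhere (T : K -> K)).
Proof.
move=> sT; split=> //=.
- by rewrite closureT.
- move=> y z; split=> [h|[_ <-] x _]; last by rewrite !dotE !(saE _ _ sT) -op_cz.
 split=> //; apply/ip_ext=> x; rewrite (saE _ _ sT) ipC [RHS]ipC.
 by have := h x I; rewrite !dotE=> -[-> _]; rewrite ipC.
Qed.

Lemma fn_every D psi f : dsa D -> bm psi -> bm f ->
 fn (everywhere (fn D psi : K -> K)) f = fn D (f \o psi).
Proof.
move=> hD bp bf; apply: fn_push=> //; first by apply: dsa_every; exact: fn_sa.
- by case: bp.
- move=> P mu [hP _ _]; apply/seteqP; split=> // x _ /=.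
 by have /integrable_lty := bm_int (mu_fin hP x) (bmM bp bp); apply.
- move=> P mu x hS _ /=; have [hP _ _] := hS; split; last exact: (bm_int (mu_fin hP x) bp).
 by rewrite (fnE hD hS bp) (fcq hP _ bp).
Qed.

Lemma dsa_perturb D A : dsa D -> sa A -> dsa (perturb D A).
Proof.
move=> hD sA; split=> /=.
- by move=> k x y dx dy; apply: (domP hD).
- by case: hD.
- move=> y z; have sAd x w : hdot K (A x) w = hdot K x (A w) by rewrite !dotE !(saE _ _ sA) -op_cz.
 split=> [h|[dy <-] x dx].
  have [|dy e] := dmax_dot hD (y := y) (z := z - A y).
   move=> x dx; rewrite linearB /= -h // -sAd -linearBl; congr (hdot K _ _); by rewrite /= addrK.
  by split=> //; rewrite /= -[RHS](subrK (A y)) -e.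
 by rewrite linearDl linearD /= sAd (dsym_dot hD).
Qed.

Lemma fn_perturb D phi f : dsa D -> bm phi -> bm f ->
 fn (perturb D (fn D phi : K -> K)) f = fn D (fun l => f (l + phi l)).
Proof.
move=> hD bp bf; apply: (fn_push (psi := fun l => l + phi l)) => //.
- by apply: dsa_perturb=> //; exact: fn_sa.
- by apply: measurable_funD; [exact: measurable_id|case: bp].
- move=> P mu [hP eD _] /=; rewrite eD; apply/seteqP; split=> x /= h.
 + by apply: (l2_shift (mu_fin hP x)) h=> //; exact: measurable_id.
 + have mp : measurable_fun setT (fun l : R => l + phi l) by apply: measurable_funD; [exact: measurable_id|case: bp].
  have := l2_shift (mu_fin hP x) mp (bmN bp) h.
  by under eq_integral do rewrite addrK.
- move=> P mu x hS /= dx; have [hP eD q] := hS.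
 have l2 : (\int[mu x]_l (l ^+ 2)%:E < +oo)%E by rewrite eD in dx.
 have i1 := l2_int (mu_fin hP x) (@measurable_id _ _ setT) l2.
 have i2 := bm_int (mu_fin hP x) bp.
 rewrite ipDl q // (fnE hD hS bp) (fcq hP _ bp) -RintegralD //; split=> //.
 by apply: (integrableD measurableT i1 i2).
Qed.

Lemma pvm_of E mu : is_pvm (hdot K) E mu -> exists2 P, pvm P mu & forall B, measurable B -> E B = P B.
Proof.
move=> [h1 h2 h3 h4].
pose P B : bop K := if pselect (measurable B) is left mB then mkbop (let: And3 b _ _ := h1 B mB in b) else 0.
have e B : measurable B -> E B = P B by rewrite /P=> mB; case: pselect.
exists P=> //; split.
- move=> B mB; have [_ pp a] := h1 B mB; split.
  by apply/(is_adjointE (P B) (P B)); rewrite -e.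
 by apply: bop_ext=> x; rewrite opM -!e //; have /(congr1 (@^~ x)) := pp.
- by apply: bop_ext=> x; rewrite -e // h2 op1.
- by move=> B C mB mC; apply: bop_ext=> x; rewrite opM -!e ?h3 //; exact: measurableI.
- by move=> x B mB; rewrite h4 // e.
Qed.

(** The witness chosen by [funcalc] is not assumed self-adjoint, but its form is real, so [dot_sa]
    applies and the uniqueness of the bundled calculus identifies it. *)
Lemma funcalcE D f : dsa D -> bm f -> funcalc (hdot K) D f = fn D f.
Proof.
move=> hD bf; have [P [mu [hS hP e]]] := fnP hD.
have h : [set T : K -> K | bounded_op T /\ exists E mu, spectral_resolution (hdot K) D E mu /\
   forall x, hdot K (T x) x = (\int[mu x]_l f l)%:C] (funcalc (hdot K) D f).
 apply: xgetPex; exists (bfun (fn D f)); split; first exact: bopP.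
 have [_ eD q] := hS; exists (fun B => P B : K -> K), mu; split; last first.
  move=> x; rewrite dotE -(fcq hP _ bf) e //; congr (_ +i* _).
  by rewrite sa_dot //; exact: (fc_sa hP).
 split=> //.
 - split.
  + move=> B mB; have [sB BB] := pvm_proj hP mB; split; first exact: bopP.
    by apply/funext=> x; rewrite /= -opM BB.
   by apply/is_adjointE.
  + by apply/funext=> x; rewrite (pvmT hP) op1.
  + by move=> B C mB mC; apply/funext=> x; rewrite (pvmI hP).
  + by move=> x B mB; rewrite (pvm_mu hP).
 - by move=> x dx; rewrite dotE q // (dip_i hD).
move: h=> [bT [E [mu' [[hE eD q] h]]]]; have [P' hP' eP'] := pvm_of hE.
have hS' : sres D P' mu' by split=> // x dx; have := q x dx; rewrite dotE=> -[].
rewrite (fnE hD hS' bf) -[LHS]/(mkbop bT : K -> K); congr bfun.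
apply/esym/fc_uniq; split; last by move=> x; have := h x; rewrite dotE=> -[].
apply: dot_sa=> x; have := h x; rewrite dotE=> -[_]; exact.
Qed.
End Calculus.

Lemma half_bop (R : realType) (K : hilb R) (V : bop K) : (2^-1)%:C *: (V + V) = V.
Proof.
rewrite -/(rso 2^-1 (V + V)) rsoD -rsoDl (_ : 2^-1 + 2^-1 = 1) ?rso1 //.
by lra.
Qed.

Lemma posE (R : realType) (K : hilb R) (T : bop K) : op_le (hdot K) 0 T <-> pos T.
Proof.
split=> [h|[sT hT] x].
 have h' x : 0 <= ip (T x) x /\ ip (T x) ('i *: x) = 0.
  have := h x; rewrite /= linear0l dotE lecE /= => /andP[/eqP -> ]; by split.
 by split=> [|x]; [apply: dot_sa=> x; case: (h' x)|case: (h' x)].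
by rewrite /= linear0l dotE lecE /= (sa_dot _ sT) eqxx hT.
Qed.

Lemma op_leE (R : realType) (K : hilb R) (S T : bop K) : op_le (hdot K) S T <-> lo S T.
Proof.
by rewrite /lo -posE; split=> h x; have := h x; rewrite /= linear0l linearBl subr_ge0.
Qed.

Ltac bop_lra := apply: bop_ext=> ?; apply: ip_ext=> ?; rewrite !(opE, opR, ipE); lra.
Set Default Proof Using "All".

(** * Von Neumann algebras and affiliated operators *)

Section Semifinite.
Variables (R : realType) (K : hilb R) (N : set (K -> K)) (tau : (K -> K) -> \bar R).
Hypothesis HN : von_neumann_algebra (hdot K) N.
Hypothesis Htau : fns_trace (hdot K) N tau.
Local Notation aff := (affiliated (hdot K) N).
Local Notation evr T := (everywhere (T : K -> K)).
Implicit Types (x y z : K) (c : R) (S T U X : bop K) (D : operator K) (f g : R -> R).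

Definition inN (T : bop K) := N T.
Definition inC (U : bop K) := forall T, inN T -> U * T = T * U.

Lemma inC_commutant U : commutant N U <-> inC U.
Proof.
have [hb _ _] := HN; split=> [[_ h] T hT|h].
 by apply: bop_ext=> x; have /(congr1 (@^~ x)) := h _ hT; rewrite !opM.
split=> [|S hS]; first exact: bopP.
by apply/funext=> x /=; have := h (mkbop (hb S hS)) hS=> /(congr1 (fun V : bop K => V x)); rewrite !opM.
Qed.

(** The bicommutant condition. It makes membership in [N] an equation with each [U] of the
    commutant, stable under sums, products and strong limits. *)
Lemma inNP T : inN T <-> forall U, inC U -> T * U = U * T.
Proof.
have [_ _ e] := HN; split=> [hT U hU|h]; first by rewrite hU.
rewrite /inN -e; split=> [|S hS]; first exact: bopP.
have [bS _] := hS; have hS' : inC (mkbop bS) by apply/inC_commutant.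
by apply/funext=> x; have /(congr1 (fun V : bop K => V x)) := h _ hS'; rewrite !opM.
Qed.

Lemma inN1 : inN 1. Proof. by apply/inNP=> U _; rewrite mul1r mulr1. Qed.
Lemma inN0 : inN 0. Proof. by apply/inNP=> U _; rewrite mul0r mulr0. Qed.
Lemma inND S T : inN S -> inN T -> inN (S + T).
Proof. by move=> /inNP a /inNP b; apply/inNP=> U hU; rewrite mulrDl mulrDr a ?b. Qed.
Lemma inNM S T : inN S -> inN T -> inN (S * T).
Proof. by move=> /inNP a /inNP b; apply/inNP=> U hU; rewrite -mulrA b // mulrA a // mulrA. Qed.
Lemma inNZ k T : inN T -> inN (k *: T).
Proof. by move=> /inNP a; apply/inNP=> U hU; rewrite -bZAl -bZAr a. Qed.
Lemma inNR c T : inN T -> inN (rso c T). Proof. exact: inNZ. Qed.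
Lemma inNN T : inN T -> inN (- T). Proof. by move=> h; rewrite -scaleN1r; exact: inNZ. Qed.
Lemma inNB S T : inN S -> inN T -> inN (S - T).
Proof. by move=> a b; apply: inND=> //; exact: inNN. Qed.
Lemma inN_adj T : inN T -> inN (adj T).
Proof.
have [hb ha _] := HN=> /ha[S hS aS].
rewrite /inN (_ : adj T = mkbop (hb S hS)) //.
by apply/is_adjointE.
Qed.
Lemma inN_scv (F : nat -> bop K) T : (forall n, inN (F n)) -> scv F T -> inN T.
Proof.
move=> h c; apply/inNP=> U hU; apply/esym; apply: (scv_comm _ c) => n.
by apply: hU.
Qed.
Lemma inC_adj U : inC U -> inC (adj U).
Proof.
move=> h T hT; have := h _ (inN_adj hT) => /(congr1 (@adj _ _)).
by rewrite !adjM adjK.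
Qed.

Definition commD D U := forall x, op_dom D x -> op_dom D (U x) /\ D (U x) = U (D x).

Lemma commDD D U V : dsa D -> commD D U -> commD D V -> commD D (U + V).
Proof.
move=> hD a b x dx; have [d1 e1] := a x dx; have [d2 e2] := b x dx; rewrite !opD.
by split; [exact: domD|rewrite (dopD hD) // e1 e2].
Qed.
Lemma commDZ D U k : dsa D -> commD D U -> commD D (k *: U).
Proof.
move=> hD a x dx; have [d1 e1] := a x dx; rewrite !opZ.
by split; [exact: domZ|rewrite (dopZ hD) // e1].
Qed.

Lemma unitary_bop U : adj U * U = 1 -> U * adj U = 1 -> unitary (hdot K) U.
Proof.
move=> h1 h2; split; first exact: bopP.
exists (adj U); split; [exact: bopP | by apply/is_adjointE | |].
 by apply/funext=> x; rewrite /= -opM h2 op1.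
by apply/funext=> x; rewrite /= -opM h1 op1.
Qed.

(** Affiliation speaks of unitaries only. A self-adjoint contraction [V] of the commutant is the
    mean of the unitaries [V + iS] and [V - iS] with [S] the square root of [1 - V^2]; scaling and
    splitting into self-adjoint parts reach every [U]. *)
Lemma affil_comm D U : dsa D -> aff D -> inC U -> commD D U.
Proof.
move=> hD aff.
have h1 V : inC V -> unitary (hdot K) V -> commD D V by move=> hV uV x dx; apply: aff=> //; apply/inC_commutant.
have h2 V : inC V -> sa V -> opn V <= 1 -> commD D V.
 move=> hV sV V1.
 have p : pos (1 - V * V).
  apply: loP; [exact: saM|exact: sa1|move=> x].
  rewrite op1 opM (saE _ _ sV) -!nmsq ler_pXn2r ?nnegrE ?nm_ge0 //.
  by apply: le_trans (opnP _ _) _; rewrite ler_piMl ?nm_ge0.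
 have [S [pS SS cS]] := sqrt_ex p.
 have SV : S * V = V * S by apply/esym/cS; rewrite mulrBl mulrBr mul1r mulr1 mulrA.
 have hS : inC S.
  move=> T hT; apply/esym/cS; rewrite mulrBl mulrBr mul1r mulr1; congr (_ - _).
  by rewrite mulrA -(hV _ hT) -!mulrA (hV _ hT).
 have hU (s : R[i]) : inC (V + s *: S) by move=> T hT; rewrite mulrDl mulrDr -bZAl -bZAr (hV _ hT) (hS _ hT).
 have uni (s : R[i]) : s * s = -1 -> (V + s *: S) * (V - s *: S) = 1.
  move=> s2; rewrite mulrBr !mulrDl -!bZAl -!bZAr SV SS scalerA s2 scaleN1r opprD opprK.
  by rewrite addrA addrK addrC subrK.
 have ai : adj (V + 'i *: S) = V - 'i *: S by rewrite adjD adji sV pS.1.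
 have ai' : adj (V + (- 'i) *: S) = V + 'i *: S by rewrite scaleNr adjB adji sV pS.1 opprK.
 have i2 : 'i * 'i = -1 :> R[i] by rewrite -expr2 sqr_i.
 have u1 := uni 'i i2; have u2 : (V - 'i *: S) * (V + 'i *: S) = 1.
  by have := uni (- 'i); rewrite mulrNN=> /(_ i2); rewrite scaleNr opprK.
 have c1 : commD D (V + 'i *: S) by apply: h1=> //; apply: unitary_bop; rewrite ai.
 have c2 : commD D (V + (- 'i) *: S) by apply: h1=> //; apply: unitary_bop; rewrite ai' scaleNr.
 have := commDZ (2^-1)%:C hD (commDD hD c1 c2).
 by rewrite scaleNr addrACA subrr addr0 half_bop.
have h3 V : inC V -> sa V -> commD D V.
 move=> hV sV; have n0 := opn_ge0 V; pose c := opn V + 1; have c0 : 0 < c by rewrite /c; lra.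
 have -> : V = c%:C *: rso c^-1 V by rewrite -/(rso c _) rsoA divff ?gt_eqF // rso1.
 apply: commDZ=> //; apply: h2.
 - by move=> T hT; rewrite rsoMl rsoMr (hV _ hT).
 - exact: saR.
 - apply: le_trans (opnR _ _) _; have -> : `|c^-1| = c^-1 by rewrite ger0_norm // invr_ge0 ltW.
  by rewrite mulrC ler_pdivrMr // mul1r /c lerDl.
move=> hU; have hA := inC_adj hU.
have -> : U = (2^-1)%:C *: (U + adj U) + (- ('i * (2^-1)%:C)) *: ('i *: (U - adj U)).
 rewrite scalerA mulNr mulrAC -expr2 sqr_i mulN1r opprK -scalerDr addrACA subrr addr0.
 by rewrite half_bop.
apply: commDD=> //; apply: commDZ=> //; apply: h3.
- by move=> T hT; rewrite mulrDl mulrDr (hU _ hT) (hA _ hT).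
- by rewrite /sa adjD adjK addrC.
- by move=> T hT; rewrite -bZAl -bZAr mulrBl mulrBr (hU _ hT) (hA _ hT).
- by rewrite /sa adji adjB adjK -scalerN opprB.
Qed.

Lemma inN_fn D f : dsa D -> aff D -> bm f -> inN (fn D f).
Proof.
move=> hD aff bf; apply/inNP=> U hU; apply/esym; apply: (fn_inter hD hD) => //.
exact: affil_comm.
Qed.

Lemma affil_perturb D A : aff D -> inN A -> aff (perturb D A).
Proof.
move=> aff hA u cu uu x /= dx; have [d e] := aff u cu uu x dx; split=> //.
have [_ hu] := cu; have /(congr1 (@^~ x)) /= eA := hu _ hA.
rewrite /= -[(op_fun D + A) (u x)]/(D (u x) + A (u x)) e -eA.
have [lu _] := uu.1.
by have := lu 1 (D x) (A x); rewrite !scale1r=> ->.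
Qed.

Lemma affil_every T : inN T -> aff (evr T).
Proof.
move=> hT u [_ hu] _ x _; split=> //=.
by have /(congr1 (@^~ x)) /= := hu _ hT=> <-.
Qed.

Lemma inN_sqrt T : pos T -> inN T -> exists S, [/\ pos S, inN S & S * S = T].
Proof.
move=> pT hT; have [S [pS SS cS]] := sqrt_ex pT; exists S; split=> //.
by apply/inNP=> U hU; apply/esym/cS; apply: hU.
Qed.

(** * The trace: positive elements, square integrable elements, linear extension *)

Definition pN T := pos T /\ inN T.
Lemma pNE T : positive_part (hdot K) N T <-> pN T.
Proof. by split=> [[a /posE b]|[/posE a b]]. Qed.
Lemma pND S T : pN S -> pN T -> pN (S + T).
Proof. by move=> [a b] [c d]; split; [exact: posD|exact: (inND)]. Qed.
Lemma pNR c T : 0 <= c -> pN T -> pN (rso c T).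
Proof. by move=> c0 [a b]; split; [exact: posR|exact: (inNR)]. Qed.
Lemma pN_sq S : inN S -> pN (adj S * S).
Proof. by move=> h; split; [exact: pos_sq|apply: (inNM) => //; exact: (inN_adj)]. Qed.

Definition tp (T : bop K) : \bar R := tau T.
Lemma tp_ge0 T : pN T -> (0 <= tp T)%E.
Proof. by move=> /pNE; exact: (trace_ge0 Htau). Qed.
Lemma tpD S T : pN S -> pN T -> tp (S + T) = (tp S + tp T)%E.
Proof. by move=> /pNE a /pNE b; rewrite /tp -(trace_add Htau). Qed.
Lemma tpR c T : 0 <= c -> pN T -> tp (rso c T) = (c%:E * tp T)%E.
Proof. by move=> c0 /pNE a; rewrite /tp -(trace_scale Htau). Qed.
Lemma tp_le S T : pN S -> pN T -> lo S T -> (tp S <= tp T)%E.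
Proof.
move=> hS hT h; have hB : pN (T - S) by split=> //; apply: (inNB); [case: hT|case: hS].
by have -> : T = S + (T - S); [rewrite addrC subrK|rewrite tpD // leeDl // tp_ge0].
Qed.
Lemma tp_comm S : inN S -> tp (adj S * S) = tp (S * adj S).
Proof.
move=> h; rewrite /tp -[LHS]/(tau (adj S \o S)) -[RHS]/(tau (S \o adj S)).
by apply: (trace_comm Htau) => //; [exact: (inN_adj)|apply/is_adjointE].
Qed.
(** Normality is stated for directed sets and least upper bounds within [N]; an increasing strongly
    convergent sequence is such a set and its limit is such a bound. *)
Lemma tp_normal (F : nat -> bop K) T : (forall n, pN (F n)) -> (forall n, lo (F n) (F n.+1)) ->
 pN T -> scv F T -> tp T = ereal_sup (range (fun n => tp (F n))).
Proof.
move=> hF mF hT cF; have mono n k : (n <= k)%N -> lo (F n) (F k) by exact: mono_le.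
have E : tau T = ereal_sup (tau @` [set (F n : K -> K) | n in [set: nat]]).
 apply: (trace_normal Htau).
 - by move=> _ [n _ <-]; apply/pNE.
 - split; first by exists (F 0%N : K -> K), 0%N.
  move=> _ _ [n _ <-] [k _ <-]; exists (F (maxn n k) : K -> K); split; first by exists (maxn n k).
   by apply/op_leE; apply: mono; exact: leq_maxl.
  by apply/op_leE; apply: mono; exact: leq_maxr.
 - split; first exact/pNE.
   move=> _ [n _ <-]; apply/op_leE; apply: loP; [by case: (hF n) => -[]|by case: hT=> -[]|move=> x].
   have h := cv_ip (cF x) (cv_const x); apply: (ler_cvg_to (cvg_cst _) h); near=> k.
   by apply: loE; apply: mono; near: k; exact: nbhs_infty_ge.
  move=> U hU h; have [bU pU] : bounded_op U /\ op_le (hdot K) 0 U.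
   by case: hU=> /(let: And3 hb _ _ := HN in hb U) a b.
  have e : U = mkbop bU :> (K -> K) by [].
  rewrite e; apply/op_leE; apply: loP; [by case: hT=> -[]| |move=> x].
   by have /posE[] : op_le (hdot K) 0 (mkbop bU) by [].
  apply: (scv_lo_le cF) => n; apply: loE; apply/op_leE; apply: h; by exists n.
rewrite /tp E; congr ereal_sup; apply/seteqP; split.
 by move=> _ [_ [n _ <-] <-]; exists n.
by move=> _ [n _ <-]; exists (F n : K -> K) => //; exists n.
Unshelve. all: by end_near. Qed.

(** The elements with [tau(|S|^2)] finite play the part of Hilbert-Schmidt operators: products of
    two of them are trace class, and cyclicity is proved for such products first. *)
Definition n2 S := inN S /\ (tp (adj S * S)%R < +oo)%E.
Definition q2 S : R := fine (tp (adj S * S)).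
Definition fp T := pN T /\ (tp T < +oo)%E.
Definition ft T : R := fine (tp T).

Lemma fp_fin T : fp T -> tp T = (ft T)%:E.
Proof. by move=> [a b]; rewrite /ft fineK // ge0_fin_numE // tp_ge0. Qed.
Lemma fpP T r : pN T -> tp T = r%:E -> fp T /\ ft T = r.
Proof. by move=> a e; split; [split; rewrite ?e ?ltry|rewrite /ft e]. Qed.
Lemma ft_ge0 T : fp T -> 0 <= ft T.
Proof. by move=> h; rewrite -lee_fin -fp_fin // tp_ge0 //; case: h. Qed.
Lemma fpD S T : fp S -> fp T -> fp (S + T) /\ ft (S + T) = ft S + ft T.
Proof.
move=> a b; apply: fpP; first by apply: pND; [case: a|case: b].
by rewrite tpD ?fp_fin //; [case: a|case: b].
Qed.
Lemma fpR c T : 0 <= c -> fp T -> fp (rso c T) /\ ft (rso c T) = c * ft T.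
Proof.
move=> c0 a; apply: fpP; first by apply: pNR=> //; case: a.
by rewrite tpR ?fp_fin //; case: a.
Qed.
Lemma fp_le S T : pN S -> lo S T -> fp T -> fp S /\ ft S <= ft T.
Proof.
move=> hS h hT; have [pT iT] := hT; have le := tp_le hS pT h.
have fS : fp S by split=> //; exact: le_lt_trans iT.
by split=> //; rewrite -lee_fin -!fp_fin.
Qed.
Lemma fp0 : fp 0 /\ ft 0 = 0.
Proof.
apply: fpP; first by split; [exact: pos0|exact: (inN0)].
have p0 : pN 0 by split; [exact: pos0|exact: (inN0)].
by have := tpR (lexx 0) p0; rewrite rso0 mul0e.
Qed.

Lemma n2fp S : n2 S <-> inN S /\ fp (adj S * S).
Proof. by split=> [[a b]|[a [b c]]]; split=> //; split=> //; exact: pN_sq. Qed.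
Lemma n2_adj S : n2 S -> n2 (adj S) /\ q2 (adj S) = q2 S.
Proof.
move=> [a b]; rewrite /q2 adjK -tp_comm //; split=> //; split; first exact: (inN_adj).
by rewrite adjK -tp_comm.
Qed.
Lemma n2R c S : n2 S -> n2 (rso c S).
Proof.
move=> /n2fp[a b]; apply/n2fp; split; first exact: (inNR).
by rewrite adjR rsoMl rsoMr rsoA; exact: (fpR (sqr_ge0 c) b).1.
Qed.
Lemma adjiM S T : adj ('i *: S) * ('i *: T) = adj S * T.
Proof. by rewrite adji mulNr -bZAl -bZAr scalerA -expr2 sqr_i scaleN1r opprK. Qed.
Lemma n2i S : n2 S -> n2 ('i *: S).
Proof. by move=> [a b]; split; [exact: (inNZ)|rewrite adjiM]. Qed.
Lemma n2D S T : n2 S -> n2 T -> n2 (S + T).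
Proof.
move=> /n2fp[a b] /n2fp[c d]; apply/n2fp; split; first exact: (inND).
have h := (fpR (c := 2) (ler0n _ _) (fpD b d).1).1; apply: (fp_le _ _ h).1.
 by apply: pN_sq; exact: (inND).
apply: loP; [by case: (pos_sq (S + T)) | by case: h=> -[[]] | move=> x].
(* Parallelogram law: [|S + T|^2] is at most [2 |S|^2 + 2 |T|^2] because the missing term is
   [|S - T|^2]. *)
have := ip_ge0 ((S - T) x); rewrite opR opB opM !opD !opM ipZl !ipDl !adjEl !opD !ipE.
rewrite (ipC (T x) (S x)); lra.
Qed.
Lemma n2B S T : n2 S -> n2 T -> n2 (S - T).
Proof. by move=> a b; rewrite -[- T]rso1 rsoN -rsoNl; apply: n2D=> //; exact: n2R. Qed.
Lemma n2M X S : inN X -> n2 S -> n2 (X * S).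
Proof.
move=> hX /n2fp[a b]; apply/n2fp; split; first exact: (inNM).
have h := (fpR (sqr_ge0 (opn X)) b).1; apply: (fp_le _ _ h).1.
 by apply: pN_sq; exact: (inNM).
apply: loP; [by case: (pos_sq (X * S)) | by case: h=> -[[]] | move=> x].
rewrite opR !opM ipZl !adjEl opM -!nmsq -exprMn ler_pXn2r ?nnegrE ?nm_ge0 ?mulr_ge0 ?nm_ge0 ?opn_ge0 //.
exact: opnP.
Qed.
Lemma n2Mr X S : inN X -> n2 S -> n2 (S * X).
Proof.
move=> hX hS; rewrite -[S * X]adjK adjM; apply: (n2_adj _).1; apply: n2M; first exact: (inN_adj).
exact: (n2_adj hS).1.
Qed.
Lemma fp_sqrt G : fp G -> exists h, [/\ pos h, n2 h & h * h = G].
Proof.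
move=> [[pG hG] iG]; have [h [ph Nh hh]] := inN_sqrt pG hG; exists h; split=> //.
by split=> //; rewrite ph.1 hh.
Qed.

Definition tc T := trace_class (hdot K) N tau T.
Definition ctr (T : bop K) : R[i] := op_trace (hdot K) N tau T.
Definition tr T : R := complex.Re (ctr T).
Definition ist T (r s : R) := exists T1 T2 T3 T4, [/\ [/\ fp T1, fp T2, fp T3 & fp T4],
 T = T1 - T2 + 'i *: (T3 - T4), r = ft T1 - ft T2 & s = ft T3 - ft T4].

Lemma fpE T : finite_positive (hdot K) N tau T <-> fp T.
Proof. by split=> [[/pNE a b]|[/pNE a b]]. Qed.
Lemma istE T (w : R[i]) : is_trace (hdot K) N tau T w <-> ist T (complex.Re w) (complex.Im w).
Proof.
have [hb _ _] := HN; split.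
 move=> [T1 [T2 [T3 [T4 [[f1 f2 f3 f4] [e ->]]]]]].
 have b1 := hb _ f1.1.1; have b2 := hb _ f2.1.1; have b3 := hb _ f3.1.1; have b4 := hb _ f4.1.1.
 exists (mkbop b1), (mkbop b2), (mkbop b3), (mkbop b4); split=> //.
  by split; apply/fpE.
 by apply: bop_ext=> x; rewrite e.
move=> [T1 [T2 [T3 [T4 [[f1 f2 f3 f4] e er es]]]]]; exists T1, T2, T3, T4; split.
 by split; apply/fpE.
by split; [rewrite e|case: w er es=> a b /= -> ->].
Qed.
(** Adding an equation to its adjoint removes the imaginary parts and leaves [T1 + S2 = S1 + T2]
    between positive elements, where the trace is additive. The imaginary parts follow on
    multiplying by ['i]. *)
Lemma ist_re T r s r' s' : ist T r s -> ist T r' s' -> r = r'.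
Proof.
move=> [T1 [T2 [T3 [T4 [[f1 f2 f3 f4] -> -> _]]]]] [S1 [S2 [S3 [S4 [[g1 g2 g3 g4] e -> _]]]]].
have sa' V : fp V -> adj V = V by case=> -[[]].
have e' := congr1 (@adj _ _) e; rewrite !(adjD _ ('i *: _)) !adji !adjB !sa' // in e'.
have E : T1 + S2 = S1 + T2.
 apply: bop_ext=> x; apply: ip_ext=> z.
 have := congr1 (fun V : bop K => ip (V x) z) e; have := congr1 (fun V : bop K => ip (V x) z) e'.
 by rewrite !opE !ipE; move: (ip ('i *: _) z) (ip ('i *: _) z) => u v; lra.
by have := congr1 ft E; rewrite (fpD f1 g2).2 (fpD g1 f2).2; lra.
Qed.
Lemma ist_i T r s : ist T r s -> ist ('i *: T) (- s) r.
Proof.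
move=> [T1 [T2 [T3 [T4 [[f1 f2 f3 f4] -> -> ->]]]]]; exists T4, T3, T1, T2; split=> //; last by rewrite opprB.
by rewrite scalerDr scalerA -expr2 sqr_i scaleN1r opprB addrC.
Qed.
Lemma ist_uniq T r s r' s' : ist T r s -> ist T r' s' -> r = r' /\ s = s'.
Proof.
move=> a b; split; first exact: ist_re a b.
by have := ist_re (ist_i a) (ist_i b); move=> /eqP; rewrite eqr_opp=> /eqP.
Qed.
Lemma tcE T : tc T <-> exists r s, ist T r s.
Proof.
split=> [[w /istE h]|[r [s h]]]; first by do 2!eexists; exact: h.
by exists (r +i* s); apply/istE.
Qed.
Lemma ctrE T r s : ist T r s -> ctr T = r +i* s.
Proof.
move=> h; have : is_trace (hdot K) N tau T (ctr T).
 by apply: xgetPex; exists (r +i* s); apply/istE.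
by move=> /istE h'; have [-> ->] := ist_uniq h h'; case: (ctr T).
Qed.
Lemma trE T r s : ist T r s -> tr T = r. Proof. by rewrite /tr=> /ctrE ->. Qed.
Lemma istD S T r s r' s' : ist S r s -> ist T r' s' -> ist (S + T) (r + r') (s + s').
Proof.
move=> [T1 [T2 [T3 [T4 [[f1 f2 f3 f4] -> -> ->]]]]] [S1 [S2 [S3 [S4 [[g1 g2 g3 g4] -> -> ->]]]]].
have [a1 b1] := fpD f1 g1; have [a2 b2] := fpD f2 g2; have [a3 b3] := fpD f3 g3; have [a4 b4] := fpD f4 g4.
exists (T1 + S1), (T2 + S2), (T3 + S3), (T4 + S4); split=> //; try (rewrite ?b1 ?b2 ?b3 ?b4; ring).
rewrite addrACA -scalerDr; congr (_ + _ *: _); by rewrite opprD addrACA.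
Qed.
Lemma istN T r s : ist T r s -> ist (- T) (- r) (- s).
Proof. by move=> /ist_i/ist_i; rewrite scalerA -expr2 sqr_i scaleN1r. Qed.
Lemma istR c T r s : ist T r s -> ist (rso c T) (c * r) (c * s).
Proof.
wlog c0 : c T r s / 0 <= c.
 move=> W h; have [c0|c0] := leP 0 c; first exact: W.
 have c0' : 0 <= - c by rewrite oppr_ge0 ltW.
 by have := W _ _ _ _ c0' (istN h); rewrite rsoNl rsoN opprK !mulrNN.
move=> [T1 [T2 [T3 [T4 [[f1 f2 f3 f4] -> -> ->]]]]].
have [a1 b1] := fpR c0 f1; have [a2 b2] := fpR c0 f2; have [a3 b3] := fpR c0 f3; have [a4 b4] := fpR c0 f4.
exists (rso c T1), (rso c T2), (rso c T3), (rso c T4); split=> //; rewrite ?b1 ?b2 ?b3 ?b4 ?mulrBr //.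
have -> : rso c T3 - rso c T4 = rso c (T3 - T4) by rewrite rsoD rsoN.
by rewrite rsoD rsoD rsoN; congr (_ + _); rewrite /rso !scalerA mulrC.
Qed.
Lemma ist_fp G : fp G -> ist G (ft G) 0.
Proof.
have [f0 e0] := fp0; move=> h; exists G, 0, 0, 0; split=> //; rewrite ?e0 ?subr0 //.
by rewrite scaler0 addr0.
Qed.

Lemma tcD S T : tc S -> tc T -> tc (S + T).
Proof. by move=> /tcE[r [s h]] /tcE[r' [s' h']]; apply/tcE; do 2!eexists; exact: istD h h'. Qed.
Lemma tcR c T : tc T -> tc (rso c T).
Proof. by move=> /tcE[r [s h]]; apply/tcE; do 2!eexists; exact: istR h. Qed.
Lemma tci T : tc T -> tc ('i *: T).
Proof. by move=> /tcE[r [s h]]; apply/tcE; do 2!eexists; exact: ist_i h. Qed.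
Lemma tcN T : tc T -> tc (- T).
Proof. by move=> /tcE[r [s h]]; apply/tcE; do 2!eexists; exact: istN h. Qed.
Lemma tcB S T : tc S -> tc T -> tc (S - T).
Proof. by move=> a b; apply: tcD=> //; exact: tcN. Qed.
Lemma tc0 : tc 0.
Proof. by apply/tcE; do 2!eexists; apply: ist_fp; case: fp0. Qed.
Lemma tc_inN T : tc T -> inN T.
Proof.
move=> /tcE[r [s [T1 [T2 [T3 [T4 [[f1 f2 f3 f4] -> _ _]]]]]]].
have i V : fp V -> inN V by case=> -[].
by apply: (inND); [|apply: (inNZ)]; apply: (inNB); exact: i.
Qed.
Lemma trD S T : tc S -> tc T -> tr (S + T) = tr S + tr T.
Proof. by move=> /tcE[r [s h]] /tcE[r' [s' h']]; rewrite (trE h) (trE h') (trE (istD h h')). Qed.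
Lemma trN T : tc T -> tr (- T) = - tr T.
Proof. by move=> /tcE[r [s h]]; rewrite (trE h) (trE (istN h)). Qed.
Lemma trB S T : tc S -> tc T -> tr (S - T) = tr S - tr T.
Proof. by move=> a b; rewrite trD ?trN //; exact: tcN. Qed.
Lemma trR c T : tc T -> tr (rso c T) = c * tr T.
Proof. by move=> /tcE[r [s h]]; rewrite (trE h) (trE (istR c h)). Qed.
Lemma tr0 : tr 0 = 0. Proof. by have [a b] := fp0; rewrite (trE (ist_fp a)) b. Qed.
Lemma fp_tc G : fp G -> tc G /\ tr G = ft G.
Proof. by move=> h; split; [apply/tcE; do 2!eexists; exact: ist_fp h|rewrite (trE (ist_fp h))]. Qed.
Lemma ctr_i T : tc T -> complex.Im (ctr T) = - tr ('i *: T).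
Proof. by move=> /tcE[r [s h]]; rewrite (ctrE h) (trE (ist_i h)) opprK. Qed.

Lemma sa_dec T : sa T -> tc T -> exists T1 T2, [/\ fp T1, fp T2, T = T1 - T2, tr T = ft T1 - ft T2 & complex.Im (ctr T) = 0].
Proof.
move=> sT /tcE[r [s h]]; have [T1 [T2 [T3 [T4 [[f1 f2 f3 f4] e er es]]]]] := h.
have sa' V : fp V -> adj V = V by case=> -[[]].
have e' := congr1 (@adj _ _) e; rewrite sT !(adjD _ ('i *: _)) !adji !adjB !sa' // in e'.
have eT : T = T1 - T2.
 apply: bop_ext=> x; apply: ip_ext=> z.
 have := congr1 (fun V : bop K => ip (V x) z) e; have := congr1 (fun V : bop K => ip (V x) z) e'.
 by rewrite !opE !ipE; move: (ip ('i *: _) z) => u; lra.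
have [f0 e0] := fp0; exists T1, T2; split=> //; first by rewrite (trE h).
have h2 : ist T r 0 by exists T1, T2, 0, 0; split=> //; rewrite ?e0 ?subrr // scaler0 addr0.
by rewrite (ctrE h2).
Qed.
Lemma ctr_sa T : sa T -> tc T -> ctr T = (tr T)%:C.
Proof. by move=> a b; have [T1 [T2 [_ _ _ _]]] := sa_dec a b; rewrite /tr; case: (ctr T) => u v /= ->. Qed.
Lemma tc_pos T : pos T -> tc T -> fp T.
Proof.
move=> pT cT; have [T1 [T2 [f1 f2 e _ _]]] := sa_dec pT.1 cT.
apply: (fp_le _ _ f1).1; first by split=> //; exact: tc_inN.
by rewrite /lo e opprB addrC subrK; case: f2=> -[].
Qed.
Lemma tr_ge0 T : pos T -> tc T -> 0 <= tr T.
Proof. by move=> a b; have f := tc_pos a b; rewrite (fp_tc f).2 ft_ge0. Qed.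
Lemma tr_le S T : tc S -> tc T -> lo S T -> tr S <= tr T.
Proof. by move=> a b h; rewrite -subr_ge0 -trB // tr_ge0 //; exact: tcB. Qed.

(** Polarization writes [adj A * T] as a combination of four positive elements of finite trace; the
    first two determine the real part. *)
Lemma ist_n2 A T : n2 A -> n2 T -> exists s, ist (adj A * T) (4^-1 * (q2 (A + T) - q2 (A - T))) s.
Proof.
move=> hA hT; have q0 : 0 <= 4^-1 :> R by rewrite invr_ge0.
have f V : n2 V -> fp (rso 4^-1 (adj V * V)) /\ ft (rso 4^-1 (adj V * V)) = 4^-1 * q2 V by move=> /n2fp[_ h]; exact: fpR q0 h.
have hiT := n2i hT.
have [a1 b1] := f _ (n2D hA hT); have [a2 b2] := f _ (n2B hA hT).
have [a3 b3] := f _ (n2B hA hiT); have [a4 b4] := f _ (n2D hA hiT).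
set P1 := rso _ _ in a1 b1; set P2 := rso _ _ in a2 b2; set P3 := rso _ _ in a3 b3; set P4 := rso _ _ in a4 b4.
exists (ft P3 - ft P4), P1, P2, P3, P4; split=> //; last by rewrite b1 b2 mulrBr.
have E (V W : bop K) : adj (V + W) * (V + W) = adj V * V + adj V * W + (adj W * V + adj W * W) by rewrite adjD !mulrDl !mulrDr.
have E' (V W : bop K) : adj (V - W) * (V - W) = adj V * V - adj V * W - (adj W * V - adj W * W) by rewrite adjB !mulrBl !mulrBr.
have e3 : P3 - P4 = 'i *: rso 2^-1 (adj T * A - adj A * T).
 rewrite /P3 /P4 (E' A) (E A) adjiM adji !mulNr -!bZAl -!bZAr.
 move: (adj A * A) (adj T * T) (adj A * T) (adj T * A) => AA TT AT TA.
 apply: bop_ext=> x; apply: ip_ext=> z; rewrite !(opE, opR, ipE).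
 have -> : 'i *: rs 2^-1 (TA x - AT x) = rs 2^-1 ('i *: TA x - 'i *: AT x) by rewrite -scalerBr /rs !scalerA mulrC.
 rewrite !ipE; lra.
rewrite e3 scalerA -expr2 sqr_i scaleN1r /P1 /P2 (E' A) (E A).
move: (adj A * A) (adj T * T) (adj A * T) (adj T * A) => AA TT AT TA.
bop_lra.
Qed.
Lemma tc_n2 S T : n2 S -> n2 T -> tc (S * T).
Proof.
by move=> hS hT; have [s h] := ist_n2 (n2_adj hS).1 hT; rewrite adjK in h; apply/tcE; do 2!eexists; exact: h.
Qed.
(** After polarization only the quantities [q2] occur, and these are invariant under the adjoint by
    the tracial property. *)
Lemma tr_n2 S T : n2 S -> n2 T -> tr (S * T) = tr (T * S).
Proof.
move=> hS hT; have [s h] := ist_n2 (n2_adj hS).1 hT; rewrite adjK in h.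
have [s' h'] := ist_n2 (n2_adj hT).1 hS; rewrite adjK in h'.
rewrite (trE h) (trE h'); congr (_ * (_ - _)).
 have [_ <-] := n2_adj (n2D (n2_adj hT).1 hS); by rewrite adjD adjK addrC.
have [_ <-] := n2_adj (n2B (n2_adj hT).1 hS); rewrite adjB adjK.
by rewrite /q2 -opprB adjN mulrNN.
Qed.
Lemma ctr_n2 S T : n2 S -> n2 T -> ctr (S * T) = ctr (T * S).
Proof.
move=> hS hT; have e := tr_n2 hS hT; have e' := tr_n2 (n2i hS) hT.
rewrite -bZAl -bZAr in e'; have i1 := ctr_i (tc_n2 hS hT); have i2 := ctr_i (tc_n2 hT hS).
by apply/eqP; rewrite eq_complex i1 i2 e' -!/(tr _) e !eqxx.
Qed.
Lemma tcM X T : inN X -> tc T -> tc (X * T).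
Proof.
move=> hX /tcE[r [s [T1 [T2 [T3 [T4 [[f1 f2 f3 f4] -> _ _]]]]]]].
have k V : fp V -> tc (X * V) by move=> /fp_sqrt[h [_ nh <-]]; rewrite mulrA; apply: tc_n2=> //; exact: n2M.
rewrite mulrDr -bZAr !mulrBr; apply: tcD; first by apply: tcB; exact: k.
by apply: tci; apply: tcB; exact: k.
Qed.
Lemma tcMr X T : inN X -> tc T -> tc (T * X).
Proof.
move=> hX /tcE[r [s [T1 [T2 [T3 [T4 [[f1 f2 f3 f4] -> _ _]]]]]]].
have k V : fp V -> tc (V * X) by move=> /fp_sqrt[h [_ nh <-]]; rewrite -mulrA; apply: tc_n2=> //; exact: n2Mr.
rewrite mulrDl -bZAl !mulrBl; apply: tcD; first by apply: tcB; exact: k.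
by apply: tci; apply: tcB; exact: k.
Qed.
Lemma tr_comm_fp X G : inN X -> fp G -> tr (X * G) = tr (G * X).
Proof.
move=> hX /fp_sqrt[h [_ nh <-]]; rewrite mulrA (tr_n2 (n2M hX nh) nh) mulrA (tr_n2 _ _) // ?mulrA //.
 exact: n2Mr.
Qed.
Lemma tr_comm X T : inN X -> tc T -> tr (X * T) = tr (T * X).
Proof.
move=> hX /tcE[r [s [T1 [T2 [T3 [T4 [[f1 f2 f3 f4] -> _ _]]]]]]].
have t V : fp V -> tc V by move=> h; case: (fp_tc h).
have m V : fp V -> tc (X * V) by move=> h; apply: tcM=> //; exact: t.
have mr V : fp V -> tc (V * X) by move=> h; apply: tcMr=> //; exact: t.
have hiX : inN ('i *: X) := inNZ _ hX.
have mi V : fp V -> tc (('i *: X) * V) by move=> h; apply: tcM=> //; exact: t.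
have mir V : fp V -> tc (V * ('i *: X)) by move=> h; apply: tcMr=> //; exact: t.
have k V : fp V -> tr (X * V) = tr (V * X) by exact: tr_comm_fp.
have k' V : fp V -> tr (('i *: X) * V) = tr (V * ('i *: X)) by exact: tr_comm_fp.
have -> : X * (T1 - T2 + 'i *: (T3 - T4)) = X * T1 - X * T2 + (('i *: X) * T3 - ('i *: X) * T4) by rewrite mulrDr -bZAr !mulrBr scalerBr -!bZAl.
have -> : (T1 - T2 + 'i *: (T3 - T4)) * X = T1 * X - T2 * X + (T3 * ('i *: X) - T4 * ('i *: X)) by rewrite mulrDl -bZAl !mulrBl scalerBr -!bZAr.
have [m1 m2] := (m _ f1, m _ f2); have [n1 n2'] := (mr _ f1, mr _ f2).
have [m3 m4] := (mi _ f3, mi _ f4); have [n3 n4] := (mir _ f3, mir _ f4).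
rewrite (trD (tcB m1 m2) (tcB m3 m4)) (trD (tcB n1 n2') (tcB n3 n4)) !trB //.
by rewrite !k ?k'.
Qed.
(** With [G = h^2] cyclicity turns [X G] into [h X h], and only its self-adjoint part [Y]
    contributes to the real trace. The form of [Y] is bounded by [opn X] times that of [G], so
    positivity of the trace applies. *)
Lemma tr_bd X G : inN X -> fp G -> `|tr (X * G)| <= opn X * ft G.
Proof.
move=> hX hG; have [h [ph nh hh]] := fp_sqrt hG.
have sh : adj h = h by case: ph.
have e : tr (X * G) = tr (h * (X * h)) by rewrite -hh mulrA (tr_n2 (n2M hX nh) nh).
have tY : tc (h * (X * h)) by apply: tc_n2=> //; exact: n2M.
pose Y := rso 2^-1 (h * (X * h) + adj (h * (X * h))).
have [hXa nha] : inN (adj X) /\ n2 (adj X * h) by split; [exact: (inN_adj)|apply: n2M=> //; exact: (inN_adj)].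
have tYa : tc (adj (h * (X * h))) by rewrite !adjM sh -mulrA; exact: tc_n2.
have eY : tr Y = tr (h * (X * h)).
 rewrite /Y trR ?trD //; last exact: tcD.
 have -> : tr (adj (h * (X * h))) = tr (h * (X * h)).
  move/tcE: tY=> [r [s H]]; rewrite (trE H).
  move: H=> [T1 [T2 [T3 [T4 [[f1 f2 f3 f4] -> -> _]]]]].
  have sa' V : fp V -> adj V = V by case=> -[[]].
  apply: (@trE _ _ (- (ft T3 - ft T4))); exists T1, T2, T4, T3; split=> //; last by rewrite opprB.
  by rewrite (adjD _ ('i *: _)) adji !adjB !sa' // -scalerN opprB.
 lra.
rewrite e -eY; have tYY : tc Y by apply: tcR; exact: tcD.
have sY : sa Y by rewrite /Y; apply: saR; rewrite /sa adjD adjK addrC.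
have [tG eG] := fp_tc hG; have n0 := opn_ge0 X.
have sG : sa G by case: hG=> -[[]].
have bd x : `|ip (Y x) x| <= opn X * ip (G x) x.
 have -> : ip (Y x) x = ip (X (h x)) (h x).
  rewrite /Y opR ipZl opD ipDl adjEl (ipC x) !opM (saE _ _ ph.1); lra.
 by rewrite -hh opM (saE _ _ ph.1); exact: sa_abs_le.
have hs c : c * ft G = tr (rso c G) by rewrite trR // eG.
rewrite ler_norml -mulNr !hs; apply/andP; split.
 apply: tr_le=> //; first exact: tcR.
 apply: loP=> //; first exact: saR.
 by move=> x; rewrite opR ipZl mulNr; have := bd x; rewrite ler_norml=> /andP[].
apply: tr_le=> //; first exact: tcR.
apply: loP=> //; first exact: saR.
by move=> x; rewrite opR ipZl; have := bd x; rewrite ler_norml=> /andP[].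
Qed.
(** [X * G] is not self-adjoint, but it has the complex trace of the self-adjoint [h X h]. Hence the
    one-form takes real values. *)
Lemma ctr_sandwich X G : sa X -> inN X -> fp G -> ctr (X * G) = (tr (X * G))%:C.
Proof.
move=> sX hX hG; have [h [ph nh <-]] := fp_sqrt hG; rewrite mulrA.
have hXh := n2M hX nh; rewrite /tr (ctr_n2 hXh nh).
have t : tc (h * (X * h)) by exact: tc_n2.
by rewrite ctr_sa // /sa !adjM ph.1 sX mulrA.
Qed.

(** * The spectral measure of the trace *)

Section TraceMeasure.
Variable D : operator K.
Hypotheses (hD : dsa D) (aD : aff D).

Lemma pN_fn f : bm f -> (forall l, 0 <= f l) -> pN (fn D f).
Proof. by move=> bf f0; split; [exact: fn_pos|exact: inN_fn]. Qed.

Lemma fp_fn_le f g : bm f -> bm g -> (forall l, 0 <= f l <= g l) -> fp (fn D g) ->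
 fp (fn D f) /\ ft (fn D f) <= ft (fn D g).
Proof.
move=> bf bg h; apply: fp_le; first by apply: pN_fn=> // l; case/andP: (h l).
by apply: fn_lo=> // l; case/andP: (h l).
Qed.

Lemma tc_fn f g : bm f -> bm g -> (forall l, `|f l| <= g l) -> fp (fn D g) -> tc (fn D f).
Proof.
move=> bf bg h hg; have b2 := bmZ 2 bg; have bfg := bmD bf bg.
have e : fn D f = fn D (fun l => f l + g l) - fn D g by rewrite fnD // addrK.
rewrite e; apply: tcB; last by case: (fp_tc hg).
have h0 l : 0 <= f l + g l <= 2 * g l by have := h l; rewrite ler_norml=> /andP[]; move: (f l) (g l) => p q; lra.
have f2 : fp (fn D (fun l => 2 * g l)) by rewrite fnZ //; case: (fpR (ler0n _ 2) hg).
have [h2 _] := fp_fn_le bfg b2 h0 f2.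
by case: (fp_tc h2).
Qed.

Lemma tr_fn_bd f g : bm f -> bm g -> (forall l, `|f l| <= g l) -> fp (fn D g) ->
 `|tr (fn D f)| <= ft (fn D g).
Proof.
move=> bf bg h hg; have t := tc_fn bf bg h hg; have [tg eg] := fp_tc hg.
rewrite ler_norml -eg -trN //; apply/andP; split; apply: tr_le=> //; first exact: tcN.
 rewrite -fnN //; apply: fn_lo=> //; first exact: bmN.
 by move=> l; have := h l; rewrite ler_norml=> /andP[].
by apply: fn_lo=> // l; have := h l; rewrite ler_norml=> /andP[].
Qed.

Variable g : R -> R.
Hypotheses (bg : bm g) (g0 : forall l, 0 <= g l) (fg : fp (fn D g)).
Let bgi (B : set R) : measurable B -> bm (fun l : R => g l * \1_B l).
Proof. by move=> mB; apply: bmM=> //; exact: bm_ind. Qed.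
Let i01 (B : set R) l : 0 <= (\1_B l : R) <= 1.
Proof. by rewrite indicE; case: (_ \in _); rewrite lexx ler01. Qed.
Let gi (B : set R) l : 0 <= g l * \1_B l <= g l.
Proof. by have /andP[a b] := i01 B l; rewrite mulr_ge0 // ler_piMr. Qed.
Let fgi (B : set R) : measurable B -> fp (fn D (fun l : R => g l * \1_B l)).
Proof. by move=> mB; case: (fp_fn_le (bgi mB) bg (gi B) fg). Qed.

(** The weight [g] makes the measure finite although the trace of [D]'s spectral projections may be
    infinite. Sets that are not measurable get the value 0 because the function has to be total. *)
Definition tm (B : set R) : \bar R :=
 if pselect (measurable B) then tp (fn D (fun l : R => g l * \1_B l)) else 0%E.
Let tmE B : measurable B -> tm B = tp (fn D (fun l : R => g l * \1_B l)).
Proof. by rewrite /tm; case: pselect. Qed.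
Let tm0 : tm set0 = 0%E.
Proof.
rewrite tmE //; have -> : fn D (fun l => g l * \1_set0 l) = 0.
 by rewrite -(fn0 hD); congr fn; apply/funext=> l; rewrite indic0 mulr0.
by have [a b] := fp0; rewrite fp_fin // b.
Qed.
Let tm_ge0 B : (0 <= tm B)%E.
Proof.
rewrite /tm; case: pselect=> // mB; apply: tp_ge0; apply: pN_fn; first exact: bgi.
by move=> l; case/andP: (gi B l).
Qed.
Let tm_sigma : semi_sigma_additive tm.
Proof.
move=> F mF tF mU; pose U n : set R := \big[setU/set0]_(k < n) F k.
have mUn n : measurable (U n) by exact: bigsetU_measurable.
have hU n l : \1_(U n) l = \sum_(k < n) \1_(F k) l :> R.
 elim: n=> [|n IH]; first by rewrite /U !big_ord0 indic0.
 rewrite /U !big_ord_recr /= -IH !indicE in_setU.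
 have [h|h] := boolP (l \in F n); rewrite ?addr0 ?orbF // orbT.
 rewrite memNset ?add0r // => hl; move: hl; rewrite /U -bigcup_mkord=> -[k /= kn hk].
 move: h; rewrite inE=> h; move/trivIsetP: tF=> /(_ k n I I).
 by rewrite (ltn_eqF kn) => /(_ isT) /seteqP[/(_ l) /(_ (conj hk h))].
have e n : (\sum_(0 <= i < n) tm (F i) = tp (fn D (fun l => (g l * \1_(U n) l)%R)))%E.
 elim: n=> [|n IH].
  rewrite big_nil -tmE; last exact: mUn.
  by rewrite /U big_ord0 tm0.
 rewrite big_nat_recr //= IH tmE // -tpD.
 - congr tp; rewrite -fnD //; [|exact: bgi|exact: bgi]; congr fn; apply/funext=> l.
  by rewrite !hU big_ord_recr /= mulrDr.
 - by case: (fgi (mUn n)).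
 - by case: (fgi (mF n)).
have -> : (fun n => \sum_(0 <= i < n) tm (F i))%E = (fun n => tp (fn D (fun l => g l * \1_(U n) l))).
 exact/funext.
have mon n : U n `<=` U n.+1 by rewrite /U big_ord_recr /=; exact: subsetUl.
have lom n : lo (fn D (fun l => g l * \1_(U n) l)) (fn D (fun l => g l * \1_(U n.+1) l)).
 apply: (fn_lo hD); [exact: bgi|exact: bgi|move=> l; apply: ler_wpM2l=> //].
 by rewrite !hU big_ord_recr /= lerDl; case/andP: (i01 (F n) l).
rewrite tmE // (@tp_normal (fun n => fn D (fun l => g l * \1_(U n) l))) //.
- apply: ereal_nondecreasing_cvgn; apply/nondecreasing_seqP=> n; apply: tp_le=> //.
  by case: (fgi (mUn n)).
 by case: (fgi (mUn n.+1)).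
- by move=> n; case: (fgi (mUn n)).
- by case: (fgi mU).
have [mg [c hc]] := bg.
apply: (fn_scv hD (c := c)); first by move=> n; case: (bgi (mUn n)).
- by case: (bgi mU).
- move=> l; apply: cvgMr.
 have [[k _ hk]|h] := pselect ((\bigcup_n F n) l).
  apply: cvg_near_cst; exists k.+1=> // n /= kn; rewrite !indicE !mem_set //; first by exists k.
  by rewrite /U -bigcup_mkord; exists k.
 apply: cvg_near_cst; exists 0%N=> // n _; rewrite !indicE !memNset //.
 by rewrite /U -bigcup_mkord=> -[k _ hk]; apply: h; exists k.
- move=> n l; rewrite normrM; apply: le_trans (hc l); rewrite ler_piMr //.
 by have /andP[a b] := i01 (U n) l; rewrite ger0_norm.
Qed.
HB.instance Definition _ := isMeasure.Build _ _ _ tm tm0 tm_ge0 tm_sigma.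

Lemma trace_measure : exists m : {measure set R -> \bar R}, [/\ (m setT < +oo)%E,
 fine (m setT) = ft (fn D g) &
 forall f, bm f -> tc (fn D (fun l => g l * f l)) /\ tr (fn D (fun l => g l * f l)) = \int[m]_l f l].
Proof.
pose m : {measure set R -> \bar R} := tm.
have eT : fn D (fun l => g l * \1_setT l) = fn D g by congr fn; apply/funext=> l; rewrite indicT mulr1.
have mT : m setT = (ft (fn D g))%:E by rewrite /m /= tmE // eT fp_fin.
have fT : (m setT < +oo)%E by rewrite mT ltry.
have tcf f : bm f -> tc (fn D (fun l => g l * f l)).
 move=> bf; have [_ [c hc]] := bf; have c0 : 0 <= c by apply: le_trans (hc 0).
 apply: (@tc_fn _ (fun l => c * g l)); [exact: bmM|exact: bmZ| |].
  by move=> l; rewrite normrM ger0_norm // mulrC ler_wpM2r.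
 by rewrite fnZ //; case: (fpR c0 fg).
exists m; split=> // [|f bf]; first by rewrite mT.
split; first exact: tcf.
(* The defect [L] is linear, vanishes on indicators and is bounded by the sup norm, so it vanishes
   on uniform limits of dyadic sums. *)
pose L f := tr (fn D (fun l => g l * f l)) - \int[m]_l f l.
have LD p q : bm p -> bm q -> L (fun l => p l + q l) = L p + L q.
 move=> bp bq; rewrite /L bint_D // (_ : (fun l => g l * _) = fun l => g l * p l + g l * q l).
  by rewrite fnD ?trD //; [lra|exact: tcf|exact: tcf|exact: bmM|exact: bmM].
 by apply/funext=> l; rewrite mulrDr.
have LZ k p : bm p -> L (fun l => k * p l) = k * L p.
 move=> bp; rewrite /L bint_Z // (_ : (fun l => g l * _) = fun l => k * (g l * p l)).
  by rewrite fnZ ?trR ?mulrBr //; [exact: tcf|exact: bmM].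
 by apply/funext=> l; rewrite mulrCA.
have LI B : measurable B -> L \1_B = 0.
 move=> mB; rewrite /L bint_ind // /m /= tmE //.
 by have fB := fgi mB; rewrite (fp_tc fB).2 fp_fin //= subrr.
have Lbd p e : bm p -> (forall l, `|p l| <= e) -> `|L p| <= 2 * e * ft (fn D g).
 move=> bp he; have e0 : 0 <= e by apply: le_trans (he 0).
 have bge := bmZ e bg.
 have h1 : `|tr (fn D (fun l => g l * p l))| <= e * ft (fn D g).
  have [a <-] := fpR e0 fg; rewrite -fnZ // in a *; apply: tr_fn_bd=> //; first exact: bmM.
  by move=> l; rewrite normrM ger0_norm // mulrC ler_wpM2r.
 have h2 : `|\int[m]_l p l| <= e * ft (fn D g).
  have ec : e * ft (fn D g) = \int[m]_l e by rewrite bint_cst // mT.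
  rewrite ec ler_norml; apply/andP; split; last first.
   apply: bint_le=> //; first exact: bm_cst.
   by move=> l; have := he l; rewrite ler_norml=> /andP[].
  rewrite -ec -mulNr; have -> : - e * ft (fn D g) = \int[m]_l (- e) by rewrite bint_cst // mT.
  apply: bint_le=> //; first exact: bm_cst.
  by move=> l; have := he l; rewrite ler_norml=> /andP[].
 by apply: le_trans (ler_normB _ _) _; rewrite -mulrA [2 * _]mulrDl mul1r lerD.
have L1 : L (fun=> 1) = 0 by have := LI setT measurableT; congr (L _ = 0); apply/funext=> l; rewrite indicT.
have L01 (p : R -> R) : measurable_fun setT p -> (forall l, 0 <= p l <= 1) -> L p = 0.
 move=> mp p01; have bp : bm p by split=> //; exists 1=> l; have /andP[a b] := p01 l; rewrite ger0_norm.
 have bd n := bm_dsum mp n.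
 have Ld n : L (dsum p n) = 0.
  elim: n=> [|n IH].
   have -> : dsum p 0 = fun l => 0 * 1 by apply/funext=> l; rewrite /dsum big_ord0 mul0r.
   by rewrite LZ ?mul0r //; exact: bm_cst.
  have md := (mdg mp n).2; have bi := bm_ind (R := R) md.
  have -> : dsum p n.+1 = fun l => dsum p n l + 2^-1 ^+ n.+1 * \1_(dset p n) l by apply/funext=> l; rewrite /dsum big_ord_recr.
  by rewrite LD ?IH ?LZ ?LI ?mulr0 ?addr0 //; exact: bmZ.
 have h n : `|L p| <= 2 * 2^-1 ^+ n * ft (fn D g).
  have -> : L p = L (fun l => p l - dsum p n l).
   have := LD _ _ (bmB bp (bd n)) (bd n); rewrite Ld addr0=> <-.
   by congr L; apply/funext=> l; rewrite subrK.
  apply: Lbd; first exact: bmB.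
  by move=> l; have /andP[a b] := dsum_bd p01 n l; rewrite ger0_norm.
 have hl : 2 * 2^-1 ^+ n * ft (fn D g) @[n --> \oo] --> 2 * 0 * ft (fn D g) by apply: cvgMl; apply: cvgMr; exact: half_cvg.
 apply/eqP; rewrite -normr_le0; rewrite mulr0 mul0r in hl.
 by apply: (ler_cvg_to (cvg_cst _) hl); exact: nearW.
have [p [c [c0 mp p01 ->]]] := bm_affine bf.
have bp : bm p by split=> //; exists 1=> l; have /andP[a b] := p01 l; rewrite ger0_norm.
have bc := bm_cst (R := R) (T := R) (- c).
apply/eqP; rewrite -subr_eq0; apply/eqP; rewrite -/(L _).
have -> : L (fun l => - c + 2 * c * p l) = L (fun=> - c) + (2 * c) * L p by rewrite -(LZ _ _ bp) -(LD _ _ bc) //; exact: bmZ.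
rewrite (L01 _ mp p01) mulr0 addr0.
have -> : L (fun=> - c) = L (fun l => - c * 1) by congr L; apply/funext=> l; rewrite mulr1.
by rewrite LZ ?L1 ?mulr0 //; exact: bm_cst.
Qed.
End TraceMeasure.

(** The hypothesis says [k E <= E G E]. With [s^2 = G] the tracial property gives [E G E] and
    [s E s] the same trace, and the latter is at most [G]. *)
Lemma weak_kaplansky E G k : 0 < k -> proj E -> inN E -> fp G ->
 (forall x, E x = x -> k * ip x x <= ip (G x) x) -> fp E /\ k * ft E <= ft G.
Proof.
move=> k0 pE hE fG h; have [s [ps [hs _] ss]] := fp_sqrt fG.
have pNE' : pN E by split=> //; exact: proj_pos.
have hsE : inN (s * E) by exact: inNM.
have e1 : adj (s * E) * (s * E) = E * G * E by rewrite adjM pE.1 ps.1 -ss !mulrA.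
have e2 : (s * E) * adj (s * E) = s * E * s by rewrite adjM pE.1 ps.1 mulrA -(mulrA s) pE.2.
have pGEG : pN (s * E * s) by rewrite -e2 -{1}[s * E]adjK; apply: pN_sq; exact: inN_adj.
have [f2 l2] : fp (s * E * s) /\ ft (s * E * s) <= ft G.
 apply: fp_le=> //; apply: loP; [by case: pGEG=> -[] | by case: fG=> -[[]] | move=> x].
 rewrite -ss !opM (saE _ _ ps.1) (saE (s x) x ps.1).
 exact: loE (proj_lo1 pE).
have t1 : tp (E * G * E) = tp (s * E * s) by rewrite -e1 tp_comm // e2.
have pEGE : pN (E * G * E) by rewrite -e1; exact: pN_sq.
have f1 : fp (E * G * E) by split=> //; rewrite t1; case: f2.
have e3 : ft (E * G * E) = ft (s * E * s) by rewrite /ft t1.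
have [f3 l3] : fp (rso k E) /\ ft (rso k E) <= ft (E * G * E).
 apply: fp_le=> //; first by apply: pNR=> //; exact: ltW.
 apply: loP; [by apply: saR; case: pE | by case: pEGE=> -[] | move=> x].
 rewrite opR ipZl !opM (saE (G (E x)) _ pE.1) (proj_ip2 _ pE); apply: h.
 by rewrite -opM pE.2.
have fE : fp E.
 have := (fpR (c := k^-1) _ f3).1; rewrite rsoA mulVf ?gt_eqF // rso1; apply.
 by rewrite invr_ge0 ltW.
split=> //; rewrite -(fpR (ltW k0) fE).2; apply: le_trans l3 _.
by rewrite e3.
Qed.

(** * Theta-summability under bounded perturbations *)

Definition chi (r : R) : R -> R := \1_(`[- r, r]%classic).
Definition gs (t : R) : R -> R := fun l => expR (- t * l ^+ 2).
Lemma chiE r l : chi r l = if `|l| <= r then 1 else 0.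
Proof. by rewrite /chi indicE mem_setE in_itv /= -ler_norml; case: ifP. Qed.
Lemma bm_chi r : bm (chi r). Proof. by apply: bm_ind; exact: measurable_itv. Qed.
Lemma chi01 r l : 0 <= chi r l <= 1. Proof. by rewrite chiE; case: ifP; rewrite lexx ler01. Qed.
Lemma gs_gt0 t l : 0 < gs t l. Proof. exact: expR_gt0. Qed.
Lemma gs_le1 t l : 0 <= t -> gs t l <= 1.
Proof. by move=> t0; rewrite /gs -expR0 ler_expR mulNr oppr_le0 mulr_ge0 ?sqr_ge0. Qed.
Lemma bm_gs t : 0 <= t -> bm (gs t).
Proof.
move=> t0; split; last by exists 1=> l; rewrite ger0_norm ?gs_le1 // ltW ?gs_gt0.
apply: measurableT_comp=> //; apply: measurable_funM; first exact: measurable_cst.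
by apply: measurable_funX; exact: measurable_id.
Qed.

Lemma sqn (l : R) : `|l| ^+ 2 = l ^+ 2.
Proof. by rewrite real_normK ?num_real. Qed.
Lemma lgs_bd (t l : R) : 0 < t -> `|l * gs t l| <= 1 + t^-1.
Proof.
move=> t0; rewrite normrM (ger0_norm (ltW (gs_gt0 _ _))) /gs mulNr expRN.
have p1 := expR_gt0 (t * l ^+ 2); rewrite ler_pdivrMr //.
have p2 := expR_ge1Dx (t * l ^+ 2).
have c0 : 0 <= 1 + t^-1 by rewrite addr_ge0 // invr_ge0 ltW.
apply: le_trans (ler_wpM2l c0 p2); rewrite -(sqn l); set z := `|l|; have z0 : 0 <= z := normr_ge0 l.
have -> : (1 + t^-1) * (1 + t * z ^+ 2) = 1 + z ^+ 2 + (t^-1 + t * z ^+ 2) by field; rewrite gt_eqF.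
have : 0 <= t^-1 + t * z ^+ 2 by rewrite addr_ge0 ?mulr_ge0 ?sqr_ge0 ?invr_ge0 // ltW.
by have := sqr_ge0 (z - 2^-1); rewrite !expr2; lra.
Qed.

Lemma bm_lgs t : 0 < t -> bm (fun l : R => l * gs t l).
Proof.
move=> t0; split; last by exists (1 + t^-1) => l; exact: lgs_bd.
by apply: measurable_funM; [exact: measurable_id|case: (bm_gs (ltW t0))].
Qed.

(** [Q] is the function [1/l] off [[-r, r]] and 0 on it. Dividing by [max(l^2, r^2)] keeps the
    denominator away from 0, which gives measurability. *)
Lemma chi_quot D r : dsa D -> 0 < r -> exists2 Q, opn Q <= r^-1 &
 forall x, op_dom D x -> (1 - fn D (chi r)) x = Q (D x).
Proof.
move=> hD r0; pose q (l : R) := l * (1 - chi r l) * (Num.max (l ^+ 2) (r ^+ 2))^-1.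
have b1 := bmB (bm_cst 1) (bm_chi r).
have qe l : l * q l = 1 - chi r l.
 rewrite /q chiE; case: ifPn=> h; first by rewrite subrr mulr0 mul0r mulr0.
 rewrite -ltNge in h; have h2 : r ^+ 2 <= l ^+ 2.
  by rewrite -[l ^+ 2]real_normK ?num_real // ler_pXn2r ?nnegrE ?normr_ge0 ?(ltW r0) //; exact: ltW.
 have l0 : l != 0 by rewrite -normr_gt0 (lt_trans r0).
 by rewrite max_l // subr0 mulr1 mulrA -expr2 divff // sqrf_eq0.
have qb l : `|q l| <= r^-1.
 rewrite /q chiE; case: ifPn=> h; first by rewrite subrr mulr0 mul0r normr0 invr_ge0 ltW.
 rewrite -ltNge in h; have h2 : r ^+ 2 <= l ^+ 2.
  by rewrite -[l ^+ 2]real_normK ?num_real // ler_pXn2r ?nnegrE ?normr_ge0 ?(ltW r0) //; exact: ltW.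
 have l0 : l != 0 by rewrite -normr_gt0 (lt_trans r0).
 rewrite max_l // subr0 mulr1 expr2 invfM mulrA divff // mul1r normfV.
 by rewrite lef_pV2 ?posrE ?(lt_trans r0 h) //; exact: ltW.
have bq : bm q.
 split; last by exists r^-1.
 apply: measurable_funM; first by apply: measurable_funM; [exact: measurable_id|case: b1].
 apply: (mf_inv (c := r ^+ 2)); first by rewrite exprn_gt0.
  by move=> l; rewrite le_max lexx orbT.
 by apply: measurable_maxr; [apply: measurable_funX; exact: measurable_id|exact: measurable_cst].
have blq : bm (fun l : R => l * q l) by rewrite (_ : (fun l : R => l * q l) = fun l => 1 - chi r l) //; exact/funext.
exists (fn D q) => [|x dx]; first by apply: fn_opn=> //; rewrite invr_ge0 ltW.
have -> : 1 - fn D (chi r) = fn D (fun l => l * q l).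
 rewrite -(fn1 hD) -fnB //; [|exact: bm_cst|exact: bm_chi].
 by congr fn; apply/funext=> l; rewrite qe.
by have [_ <-] := fn_dom hD x bq blq; rewrite (fn_fc_dom hD bq dx).2.
Qed.

Section Counting.
Variables (D : operator K) (A : bop K).
Hypotheses (hD : dsa D) (aD : aff D) (sA : sa A) (hA : inN A).
Let D' := perturb D A.
Let hD' : dsa D'. Proof. exact: dsa_perturb. Qed.
Let aD' : aff D'. Proof. exact: affil_perturb. Qed.

(** For [x] in the spectral subspace of [[-r, r]] for [D + A] the norm of [D x] is at most
    [(r + a) |x|]. So the part of [x] where [|D| > 2 (r + a)] has norm at most [|x| / 2], and at
    least 3/4 of the squared norm lies inside; [weak_kaplansky] compares the traces. *)
Lemma counting r a : 0 < r -> opn A <= a -> fp (fn D (chi (2 * (r + a)))) ->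
 fp (fn D' (chi r)) /\ ft (fn D' (chi r)) <= 4 / 3 * ft (fn D (chi (2 * (r + a)))).
Proof.
move=> r0 Aa fG; have a0 : 0 <= a := le_trans (opn_ge0 A) Aa.
set rho := r + a; have rho0 : 0 < rho by rewrite /rho; lra.
have pG : proj (fn D (chi (2 * rho))) by apply: fn_proj=> //; exact: measurable_itv.
have pE : proj (fn D' (chi r)) by apply: fn_proj=> //; exact: measurable_itv.
have hE : inN (fn D' (chi r)) by apply: inN_fn=> //; exact: bm_chi.
have k0 : (0 : R) < 3 / 4 by lra.
have [|fE le] := weak_kaplansky k0 pE hE fG; last first.
 split=> //; move: (ft _) (ft _) le=> p q; lra.
move=> x Ex.
have blr : bm (fun l : R => l * chi r l).
 have := bm_chi r=> -[m _]; split; first by apply: measurable_funM=> //; exact: measurable_id.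
 exists r=> l; rewrite normrM chiE; case: ifP=> h; rewrite ?normr1 ?mulr1 //.
 by rewrite normr0 mulr0 ltW.
have [dx ex] := fn_dom hD' x (bm_chi r) blr; rewrite Ex in dx ex.
have n1 : nm (D' x) <= r * nm x.
 rewrite ex; apply: le_trans (opnP _ _) _; rewrite ler_wpM2r ?nm_ge0 // fn_opn // ?ltW // => l.
 rewrite normrM chiE; case: ifP=> h; rewrite ?normr1 ?mulr1 //.
 by rewrite normr0 mulr0 ltW.
have n2' : nm (D x) <= rho * nm x.
 have -> : D x = D' x - A x by rewrite /D' /= addrK.
 apply: le_trans (nmB _ _) _; rewrite /rho mulrDl lerD // (le_trans (opnP _ _)) //.
 by rewrite ler_wpM2r ?nm_ge0.
have n3 : nm ((1 - fn D (chi (2 * rho))) x) <= 2^-1 * nm x.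
 have [||Q Q1 ->] // := @chi_quot D (2 * rho); first by lra.
 apply: le_trans (opnP _ _) _; apply: (@le_trans _ _ ((2 * rho)^-1 * (rho * nm x))).
  by apply: ler_pM; rewrite ?opn_ge0 ?nm_ge0.
 by rewrite le_eqVlt; apply/orP; left; apply/eqP; move: (nm x) => u; field; exact: lt0r_neq0.
have := proj_pyth x pG; rewrite -nmsq (proj_ip _ pG) => ->.
have : nm ((1 - fn D (chi (2 * rho))) x) ^+ 2 <= (2^-1 * nm x) ^+ 2 by rewrite ler_pXn2r ?nnegrE ?mulr_ge0 ?nm_ge0 ?invr_ge0.
rewrite exprMn (proj_pyth x pG).
move: (nm _ ^+ 2) (nm _ ^+ 2) => u v; rewrite !expr2; lra.
Qed.
End Counting.

(** Uses [(y + 1 + a)^2 <= 2 y^2 + 2 (1 + a)^2] and then [y <= y^2], valid for natural numbers; the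
    resulting linear exponent gives a geometric series. *)
Lemma theta_arith (t a y z : R) : 0 < t -> y <= y ^+ 2 -> z = y + 1 ->
 - t * y ^+ 2 + t / 16 * (2 * (z + a)) ^+ 2 <= t * (1 + a) ^+ 2 / 2 + y * - (t / 2).
Proof.
move=> t0 hy ->; have h : 0 <= t * ((y ^+ 2 - y) / 2 + (y - (1 + a)) ^+ 2 / 4).
 apply: mulr_ge0; first exact: ltW.
 by apply: addr_ge0; apply: divr_ge0=> //; rewrite ?subr_ge0 ?sqr_ge0.
rewrite -subr_ge0; suff -> : t * (1 + a) ^+ 2 / 2 + y * - (t / 2) - (- t * y ^+ 2 + t / 16 * (2 * (y + 1 + a)) ^+ 2)
 = t * ((y ^+ 2 - y) / 2 + (y - (1 + a)) ^+ 2 / 4) by [].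
by field.
Qed.

(** The Gaussian is dominated on the shells [n <= |l| < n + 1] by multiples of indicators whose
    traces [counting] controls through [D] alone. The contributions form a geometric series with a
    sum depending on [A] only through [a], and normality passes to the limit. *)
Lemma theta_stable D t a : 0 < t -> dsa D -> aff D -> 0 <= a ->
 (forall s, 0 < s -> fp (fn D (gs s))) ->
 exists M, forall A, sa A -> inN A -> opn A <= a ->
  fp (fn (perturb D A) (gs t)) /\ ft (fn (perturb D A) (gs t)) <= M.
Proof.
(* Counting for radius [n + 1] looks at [D] up to [2 (n + 1 + a)], at a cost of
   [exp(4 s (n + 1 + a)^2)]; with [s = t/16] this is beaten by [exp(-t n^2)]. *)
move=> t0 hD aD a0 th; pose s := t / 16; have s0 : 0 < s by rewrite /s divr_gt0.
pose F := ft (fn D (gs s)).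
have F0 : 0 <= F by apply: ft_ge0; exact: th.
have fchi r : fp (fn D (chi r)) /\ ft (fn D (chi r)) <= expR (s * r ^+ 2) * F.
 have b : bm (fun l => expR (s * r ^+ 2) * gs s l) by apply: bmZ; apply: bm_gs; exact: ltW.
 have [fg eg] := fpR (ltW (expR_gt0 (s * r ^+ 2))) (th s s0).
 rewrite -/F -(fnZ hD) in fg eg; last by apply: bm_gs; exact: ltW.
 rewrite -eg.
 apply: fp_fn_le=> //; first exact: bm_chi.
 move=> l; rewrite chiE; case: ifP=> h; last by rewrite lexx mulr_ge0 ?ltW ?expR_gt0.
 apply/andP; split=> //; rewrite /gs -expRD -[X in X <= _]expR0 ler_expR mulNr -mulrBr mulr_ge0 ?(ltW s0) // subr_ge0.
 by rewrite -[l ^+ 2]real_normK ?num_real // ler_pXn2r ?nnegrE // (le_trans _ h).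
pose C := 4 / 3 * (expR (t * (1 + a) ^+ 2 / 2) * F); have C0 : 0 <= C.
 by rewrite /C !mulr_ge0 // ltW ?expR_gt0.
pose q := expR (- (t / 2)); have q1 : q < 1 by rewrite /q -expR0 ltr_expR oppr_lt0 divr_gt0.
have q0 : 0 < q by exact: expR_gt0.
exists (C / (1 - q)) => A sA hA Aa.
have hD' : dsa (perturb D A) by exact: dsa_perturb.
have aD' : aff (perturb D A) by exact: affil_perturb.
pose I n : set R := `]- n%:R, n%:R[%classic.
pose f n (l : R) := gs t l * \1_(I n) l.
have mI n : measurable (I n) by exact: measurable_itv.
have IE n l : \1_(I n) l = if `|l| < n%:R then 1 else 0 :> R by rewrite indicE mem_setE in_itv /= -ltr_norml; case: ifP.
have bgt := bm_gs (ltW t0).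
have bf n : bm (f n) by apply: bmM=> //; exact: bm_ind.
have f01 n l : 0 <= f n l <= gs t l by rewrite /f IE; case: ifP; rewrite ?mulr1 ?mulr0 ?lexx ltW ?gs_gt0.
have fmon n l : f n l <= f n.+1 l.
 apply: ler_wpM2l; first exact: ltW (gs_gt0 _ _).
 rewrite !IE; case: ifPn=> h1; last by case: ifP.
 by rewrite (lt_le_trans h1) // ler_nat.
have rec n : fp (fn (perturb D A) (f n)) /\ ft (fn (perturb D A) (f n)) <= C * ((1 - q ^+ n) / (1 - q)).
 elim: n=> [|n [IH1 IH2]].
  have -> : fn (perturb D A) (f 0%N) = 0.
   rewrite -(fn0 hD'); congr fn; apply/funext=> l; rewrite /f IE ltNge normr_ge0 /= mulr0 //.
  by have [x ->] := fp0; rewrite expr0 subrr mul0r mulr0.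
 have r0 : (0 : R) < n.+1%:R by [].
 have [g1 g2] := fchi (2 * (n.+1%:R + a)).
 have [h1 h2] := counting hD aD sA hA r0 Aa g1.
 have e0 := ltW (expR_gt0 (- t * n%:R ^+ 2)).
 have [k1 k2] := fpR e0 h1; rewrite -(fnZ hD') in k1 k2; last exact: bm_chi.
 have [m1 m2] := fpD IH1 k1; rewrite -(fnD hD') in m1 m2; [|exact: bf|by apply: bmZ; exact: bm_chi].
 have [||p1 p2] := fp_fn_le hD' aD' (bf n.+1) _ _ m1.
 - by apply: bmD=> //; apply: bmZ; exact: bm_chi.
 - move=> l; have /andP[-> _] /= := f01 n.+1 l.
  rewrite /f !IE chiE; case: (ltP `|l| n%:R) => l1.
   have l2 : `|l| < n.+1%:R by rewrite (lt_le_trans l1) // ler_nat.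
   by rewrite l2 (ltW l2) !mulr1 lerDl.
  case: ltP=> l2; rewrite ?mulr0 ?mulr1 ?add0r; last by case: ifP; rewrite ?mulr1 ?mulr0.
  rewrite (ltW l2) mulr1 /gs ler_expR !mulNr lerN2; apply: ler_wpM2l; first exact: ltW.
  by rewrite -[leRHS]real_normK ?num_real // ler_pXn2r ?nnegrE.
 split=> //; apply: le_trans p2 _; rewrite m2 k2.
 have hC : expR (- t * n%:R ^+ 2) * ft (fn (perturb D A) (chi n.+1%:R)) <= C * q ^+ n.
  apply: (@le_trans _ _ (expR (- t * n%:R ^+ 2) * (4 / 3 * (expR (s * (2 * (n.+1%:R + a)) ^+ 2) * F)))).
   by apply: ler_wpM2l=> //; apply: le_trans h2 _; apply: ler_wpM2l.
  have -> : expR (- t * n%:R ^+ 2) * (4 / 3 * (expR (s * (2 * (n.+1%:R + a)) ^+ 2) * F)) =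
    (4 / 3 * F) * (expR (- t * n%:R ^+ 2) * expR (s * (2 * (n.+1%:R + a)) ^+ 2)) by ring.
  have -> : C * q ^+ n = (4 / 3 * F) * (expR (t * (1 + a) ^+ 2 / 2) * q ^+ n) by rewrite /C; ring.
  apply: ler_wpM2l; first by rewrite mulr_ge0.
  rewrite /q -expRM_natl -!expRD ler_expR /s.
  have n1 : (n%:R : R) <= n%:R ^+ 2 by rewrite expr2 -natrM ler_nat; case: (n) => // k; rewrite leq_pmulr.
  by apply: theta_arith=> //; rewrite natr1.
 have q1' : 1 - q != 0 by rewrite subr_eq0 eq_sym lt_eqF.
 have -> : C * ((1 - q ^+ n.+1) / (1 - q)) = C * ((1 - q ^+ n) / (1 - q)) + C * q ^+ n by rewrite exprS; field.
 exact: lerD.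
have bd n : ft (fn (perturb D A) (f n)) <= C / (1 - q).
 have [_ h] := rec n; apply: le_trans h _; apply: ler_wpM2l=> //.
 by rewrite ler_piMl ?invr_ge0 ?subr_ge0 ?(ltW q1) // gerBl exprn_ge0 // ltW.
have pf n : pN (fn (perturb D A) (f n)) by case: (rec n) => -[].
have pg : pN (fn (perturb D A) (gs t)) by apply: pN_fn=> // l; exact: ltW (gs_gt0 _ _).
have E := @tp_normal (fun n => fn (perturb D A) (f n)) (fn (perturb D A) (gs t)) pf _ pg _.
have tb : (tp (fn (perturb D A) (gs t)) <= (C / (1 - q))%:E)%E.
 rewrite E; first last.
 - apply: (fn_scv hD' (c := 1)); [by move=> n; case: (bf n)|by case: bgt| |].
   move=> l; apply: cvg_near_cst; have [n0 hn] := nat_gt `|l|; exists n0=> // n /= n0n.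
   by rewrite /f IE (lt_le_trans hn) ?ler_nat // mulr1.
  move=> n l; have /andP[u v] := f01 n l; rewrite ger0_norm //; apply: le_trans v _.
  by apply: gs_le1; exact: ltW.
 - by move=> n; apply: fn_lo.
 by apply: ge_ereal_sup=> _ [n _ <-]; rewrite fp_fin ?lee_fin //; case: (rec n).
have fg : fp (fn (perturb D A) (gs t)) by split=> //; apply: le_lt_trans tb _; exact: ltry.
by split=> //; rewrite -lee_fin -fp_fin.
Qed.

(** * Norm resolvent continuity of Gaussians *)

Section GaussianApproximation.

Lemma bernoulli (a : R) n : 0 <= a -> 1 + n%:R * a <= (1 + a) ^+ n.
Proof.
move=> a0; elim: n=> [|n IH]; first by rewrite mul0r addr0.
rewrite exprS -natr1; apply: (@le_trans _ _ ((1 + a) * (1 + n%:R * a))); last first.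
 by apply: ler_wpM2l=> //; rewrite addr_ge0.
have : 0 <= n%:R * a * a by rewrite !mulr_ge0.
move: (n%:R : R) => k; lra.
Qed.

Lemma expX_diff (p q : R) n : 0 <= q <= p -> p ^+ n.+1 - q ^+ n.+1 <= n.+1%:R * (p - q) * p ^+ n.
Proof.
move=> /andP[q0 qp]; have p0 := le_trans q0 qp; elim: n=> [|n IH]; first by rewrite !expr1 expr0 mul1r mulr1.
have -> : p ^+ n.+2 - q ^+ n.+2 = p * (p ^+ n.+1 - q ^+ n.+1) + (p - q) * q ^+ n.+1 by rewrite [in LHS]exprS [q ^+ n.+2]exprS; ring.
have -> : n.+2%:R * (p - q) * p ^+ n.+1 = p * (n.+1%:R * (p - q) * p ^+ n) + (p - q) * p ^+ n.+1 by rewrite -[n.+2%:R]natr1 [p ^+ n.+1]exprS; ring.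
apply: lerD; first exact: ler_wpM2l.
by apply: ler_wpM2l; rewrite ?subr_ge0 // lerXn2r ?nnegrE.
Qed.

(** The error must decay in [y], since it will be multiplied by [1 + |l|]. Taking [m] divisible by 3
    gives [(1 + y/m)^m >= (1 + y/3)^3 >= 1 + y^3/27] by Bernoulli, which is where 27 comes from;
    [expX_diff] supplies the factor [y^2/m]. *)
Lemma exp_approx (y : R) M m : 0 <= y -> m = (3 * M.+1)%N ->
 0 <= (1 + y / m%:R)^-1 ^+ m - expR (- y) <= 27 * (y ^+ 2 / (27 + y ^+ 3)) / m%:R.
Proof.
move=> y0 mE; have N0 : 0 < m%:R :> R by rewrite ltr0n mE muln_gt0.
set a := y / m%:R; have a0 : 0 <= a by rewrite divr_ge0 // ltW.
have a1 : 0 < 1 + a by rewrite ltr_pwDl.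
set p := (1 + a)^-1; set q := expR (- a).
have q0 : 0 <= q by rewrite ltW // expR_gt0.
have qp : q <= p by rewrite /q expRN lef_pV2 ?posrE ?expR_gt0 //; exact: expR_ge1Dx.
have qN : expR (- y) = q ^+ m by rewrite /q -expRM_natl mulrN /a mulrCA divff ?mulr1 // gt_eqF.
have p0 : 0 < p by rewrite invr_gt0.
have pq : p - q <= a ^+ 2 * p.
 have h := expR_ge1Dx (- a); have e : p - (1 - a) = a ^+ 2 * p by rewrite /p; field; exact: lt0r_neq0.
 by rewrite -e lerB.
rewrite qN subr_ge0 lerXn2r ?nnegrE ?(ltW p0) //=.
have h1 := @expX_diff p q m.-1; rewrite prednK // in h1; last by rewrite mE muln_gt0.
apply: le_trans (h1 _) _; first by rewrite q0.
have h2 : p ^+ m <= 27 / (27 + y ^+ 3).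
 have y3 : 0 < 27 + y ^+ 3 by rewrite ltr_pwDl // exprn_ge0.
 rewrite /p exprVn -[leRHS]invrK lef_pV2 ?posrE ?invr_gt0 ?divr_gt0 ?exprn_gt0 //.
 rewrite invf_div mE mulnC exprM.
 apply: (@le_trans _ _ ((1 + y / 3) ^+ 3)).
  have -> : (27 + y ^+ 3) / 27 = 1 + (y / 3) ^+ 3 by field.
  have : 0 <= y / 3 by rewrite divr_ge0.
  move: (y / 3) => z z0; rewrite !exprS !expr0; have : 0 <= z * z by rewrite mulr_ge0.
  nra.
 rewrite lerXn2r ?nnegrE ?addr_ge0 ?exprn_ge0 ?divr_ge0 ?(ltW a1) //.
 apply: le_trans (bernoulli M.+1 a0); rewrite lerD2l /a mE natrM.
 have M0 : (M.+1%:R : R) != 0 by rewrite pnatr_eq0.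
 by rewrite le_eqVlt; apply/orP; left; apply/eqP; move: (M.+1%:R : R) M0=> u u0; field.
have -> : 27 * (y ^+ 2 / (27 + y ^+ 3)) / m%:R = m%:R * a ^+ 2 * (27 / (27 + y ^+ 3)).
 have y3 : 0 < 27 + y ^+ 3 by rewrite ltr_pwDl // exprn_ge0.
 rewrite /a; move: (m%:R : R) N0=> u u0; move: (27 + y ^+ 3) y3=> v v0; field; rewrite !lt0r_neq0 //.
apply: (@le_trans _ _ (m%:R * a ^+ 2 * p ^+ m)); last first.
 by apply: ler_wpM2l=> //; rewrite mulr_ge0 ?sqr_ge0 // ltW.
have -> : m%:R * a ^+ 2 * p ^+ m = m%:R * (a ^+ 2 * p) * p ^+ m.-1.
 have -> : p ^+ m = p * p ^+ m.-1 by rewrite -exprS prednK // mE muln_gt0.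
 by rewrite !mulrA.
apply: ler_wpM2r; first by rewrite exprn_ge0 // ltW.
by apply: ler_wpM2l=> //; exact: ltW.
Qed.
(** With [y = t l^2] the error of [exp_approx] decays like [1/y], fast enough to absorb the factor
    [1 + |l|] uniformly in [l]. *)
Lemma poly_arith (t l : R) : 0 < t ->
 (1 + `|l|) * (t * l ^+ 2) ^+ 2 <= (1 + t^-1) * (27 + (t * l ^+ 2) ^+ 3).
Proof.
move=> t0; have y0 : 0 <= t * l ^+ 2 by rewrite mulr_ge0 ?sqr_ge0 // ltW.
have -> : (1 + t^-1) * (27 + (t * l ^+ 2) ^+ 3) = 27 + (t * l ^+ 2) ^+ 3 + (27 / t + l ^+ 2 * (t * l ^+ 2) ^+ 2) by field; exact: lt0r_neq0.
have l1 : `|l| <= 1 + l ^+ 2 by rewrite -[l ^+ 2]real_normK ?num_real //; have := sqr_ge0 (`|l| - 1); rewrite !expr2; have := normr_ge0 l; nra.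
have t1 : 0 <= 27 / t by rewrite divr_ge0 // ltW.
move: (t * l ^+ 2) y0=> y y0.
have h : (1 + `|l|) * y ^+ 2 <= (2 + l ^+ 2) * y ^+ 2 by apply: ler_wpM2r; [exact: sqr_ge0|move: l1; lra].
have y2 : 2 * y ^+ 2 <= 27 + y ^+ 3.
 have [y3|y3] := leP y 2; rewrite !exprS expr0.
  have : 0 <= y * (y * y) by rewrite !mulr_ge0.
  have : y * y <= 4 by nra.
  lra.
 have : 0 <= (y - 2) * (y * y) by rewrite mulr_ge0 // ?mulr_ge0 // subr_ge0 ltW.
 lra.
move: h; have -> : (2 + l ^+ 2) * y ^+ 2 = 2 * y ^+ 2 + l ^+ 2 * y ^+ 2 by ring.
move: y2 t1; move: (27 / t) (y ^+ 3) ((1 + `|l|) * y ^+ 2) (l ^+ 2 * y ^+ 2) (2 * y ^+ 2) => a b c d v; lra.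
Qed.
End GaussianApproximation.

Lemma cf_D D x : dsa D -> op_dom D x ->
 fn D (@cf R) (D x) = fn D (@bf R) x /\ fn D (@bf R) (D x) = x - fn D (@cf R) x.
Proof.
move=> hD dx; have [_ e1] := fn_fc_dom hD (bm_cf R) dx; have [_ e2] := fn_dom hD x (bm_cf R) (bm_bf R).
have [_ e3] := fn_fc_dom hD (bm_bf R) dx; have [_ e4] := fn_dom hD x (bm_bf R) (bm_lbf R).
split; first by rewrite -e1 e2.
rewrite -e3 e4 (_ : (fun l : R => l * bf l) = fun l => 1 - cf l); last by apply/funext=> l; rewrite lbfE.
by rewrite (fnB hD (bm_cst 1) (bm_cf R)) fn1 // opB op1.
Qed.

(** The imaginary and real parts of the second resolvent identity at [i]. *)
Lemma res_id D A : dsa D -> sa A -> let D' := perturb D A in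
 fn D' (@cf R) - fn D (@cf R) = - (fn D' (@bf R) * A * fn D (@cf R) + fn D' (@cf R) * A * fn D (@bf R)) /\
 fn D' (@bf R) - fn D (@bf R) = fn D' (@cf R) * A * fn D (@cf R) - fn D' (@bf R) * A * fn D (@bf R).
Proof.
move=> hD sA D'; have hD' : dsa D' by exact: dsa_perturb.
have key x : let y := fn D (@cf R) x in let z := fn D (@bf R) x in
  fn D' (@cf R) x = y - fn D' (@bf R) (A y) - fn D' (@cf R) (A z) /\
  fn D' (@bf R) x = z + fn D' (@cf R) (A y) - fn D' (@bf R) (A z).
 move=> y z; have [dy ey] := fn_dom hD x (bm_cf R) (bm_bf R).
 have [dz ez] := fn_dom hD x (bm_bf R) (bm_lbf R).
 have {}ez : D z = x - y.
  rewrite /z ez (_ : (fun l : R => l * bf l) = fun l => 1 - cf l); last by apply/funext=> l; rewrite lbfE.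
  by rewrite (fnB hD (bm_cst 1) (bm_cf R)) fn1 // opB op1.
 have [a1 a2] := cf_D hD' (dy : op_dom D' y); have [b1 b2] := cf_D hD' (dz : op_dom D' z).
 rewrite -[D' y]/(D y + A y) -[D y]/(D (fn D (@cf R) x)) ey -[fn D _ x]/z !op_add in a1 a2.
 rewrite -[D' z]/(D z + A z) ez !opX in b1 b2.
 have g (X Y W Z : K) : X - Y + W = Z -> X = Z + Y - W by move=> <-; rewrite addrAC addrK subrK.
 have h (X Y Z : K) : X + Y = Z -> X = Z - Y by move=> <-; rewrite addrK.
 rewrite (g _ _ _ _ b1) (h _ _ _ a2) (g _ _ _ _ b2) -a1; split; last by rewrite addrA subrK.
 by rewrite [_ - _ - _]addrAC subrK.
by split; apply: bop_ext=> x; have [k1 k2] := key x; rewrite !opE ?k1 ?k2; apply: ip_ext=> w; rewrite !ipE; lra.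
Qed.

Lemma cf_opn D : dsa D -> opn (fn D (@cf R)) <= 1 /\ opn (fn D (@bf R)) <= 1.
Proof.
move=> hD; split; apply: fn_opn=> //; [exact: bm_cf|move=> l|exact: bm_bf|exact: bf_le1].
by rewrite ger0_norm ?cf_ge0 ?cf_le1.
Qed.

Definition res_near (d : R) D1 D2 :=
 opn (fn D2 (@cf R) - fn D1 (@cf R)) <= d /\ opn (fn D2 (@bf R) - fn D1 (@bf R)) <= d.

Lemma res_near_le (d d' : R) D1 D2 : d <= d' -> res_near d D1 D2 -> res_near d' D1 D2.
Proof. by move=> le [h1 h2]; split; [exact: le_trans h1 le|exact: le_trans h2 le]. Qed.

Lemma res_lip D A : dsa D -> sa A -> res_near (2 * opn A) D (perturb D A).
Proof.
move=> hD sA; have [e1 e2] := res_id hD sA.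
have [c1 b1] := cf_opn hD; have [c2 b2] := cf_opn (dsa_perturb hD sA).
have s (X Y : bop K) : opn X <= 1 -> opn Y <= 1 -> opn (X * A * Y) <= opn A.
 move=> x y; apply: opnM_le; rewrite -[leRHS]mulr1; apply: ler_pM; rewrite ?opn_ge0 //.
 by apply: opnM_le; rewrite ler_piMl ?opn_ge0.
have -> : 2 * opn A = opn A + opn A by rewrite mulr_natl.
by split; rewrite ?e1 ?e2 ?opnN; [apply: le_trans (opnD _ _) _|apply: le_trans (opnB _ _) _];
 apply: lerD; exact: s.
Qed.

Lemma fn_opn_diff D f g c : dsa D -> bm f -> bm g -> 0 <= c -> (forall l, `|f l - g l| <= c) ->
 opn (fn D f - fn D g) <= c.
Proof. by move=> hD bf bg c0 h; rewrite -fnB // fn_opn //; exact: bmB. Qed.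

Lemma fnX D f n : dsa D -> bm f -> fn D (fun l => f l ^+ n) = fn D f ^+ n.
Proof.
move=> hD bf; elim: n=> [|n IH]; first by rewrite expr0 -(fn1 hD); congr fn; apply/funext=> l; rewrite expr0.
rewrite exprS -IH fnM //; last exact: bmX.
by congr fn; apply/funext=> l; rewrite exprS.
Qed.

(* Functions continuous for the norm resolvent topology; they form an algebra
 closed under uniform limits and bounded inverses. *)
Definition rcont f := bm f /\ forall e, 0 < e -> exists2 d, 0 < d &
 forall D1 D2, dsa D1 -> dsa D2 -> res_near d D1 D2 -> opn (fn D2 f - fn D1 f) <= e.

Lemma bm_opn f : bm f -> exists2 c, 0 < c & forall D, dsa D -> opn (fn D f) <= c.
Proof.
move=> bf; have [_ [c hc]] := bf; have c0 := le_trans (normr_ge0 _) (hc 0).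
exists (c + 1) => [|D hD]; first by rewrite ltr_wpDl.
by apply: fn_opn=> // [|l]; [rewrite addr_ge0|apply: le_trans (hc l) _; rewrite lerDl].
Qed.

Lemma rcont_cst c : rcont (fun=> c).
Proof.
split; [exact: bm_cst|move=> e e0; exists 1=> // D1 D2 h1 h2 _].
by rewrite !fn_cst // subrr opn0 ltW.
Qed.

Lemma rcont_res : rcont (@cf R) /\ rcont (@bf R).
Proof. by split; (split; [exact: bm_cf || exact: bm_bf | move=> e e0; exists e=> // D1 D2 _ _ []]). Qed.

Lemma rcontD f g : rcont f -> rcont g -> rcont (fun l => f l + g l).
Proof.
move=> [bf hf] [bg hg]; split; [exact: bmD|move=> e e0; have e2 : 0 < e / 2 by rewrite divr_gt0].
have [d1 p1 k1] := hf _ e2; have [d2 p2 k2] := hg _ e2; exists (Num.min d1 d2); first by rewrite lt_min p1.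
move=> D1 D2 h1 h2 n; rewrite !fnD // opprD addrACA [e]splitr; apply: le_trans (opnD _ _) _.
by apply: lerD; [apply: k1|apply: k2]=> //; apply: res_near_le n; rewrite ge_min lexx ?orbT.
Qed.

Lemma rcontM f g : rcont f -> rcont g -> rcont (fun l => f l * g l).
Proof.
move=> [bf hf] [bg hg]; split; [exact: bmM|move=> e e0].
have [a a0 ha] := bm_opn bf; have [b b0 hb] := bm_opn bg.
have [d1 p1 k1] := hf (e / 2 / b) (divr_gt0 (divr_gt0 e0 (ltr0n _ 2)) b0).
have [d2 p2 k2] := hg (e / 2 / a) (divr_gt0 (divr_gt0 e0 (ltr0n _ 2)) a0).
exists (Num.min d1 d2) => [|D1 D2 h1 h2 n]; first by rewrite lt_min p1.
have n1 : opn (fn D2 f - fn D1 f) <= e / 2 / b by apply: k1=> //; apply: res_near_le n; rewrite ge_min lexx.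
have n2 : opn (fn D2 g - fn D1 g) <= e / 2 / a by apply: k2=> //; apply: res_near_le n; rewrite ge_min lexx orbT.
rewrite -!fnM //; have -> (X2 X1 Y2 Y1 : bop K) : X2 * Y2 - X1 * Y1 = (X2 - X1) * Y2 + X1 * (Y2 - Y1).
 by rewrite mulrBl mulrBr addrA subrK.
have -> : e = e / 2 / b * b + a * (e / 2 / a) by field; rewrite !lt0r_neq0.
apply: le_trans (opnD _ _) _; apply: lerD; apply: opnM_le.
 by apply: ler_pM n1 (hb _ h2); exact: opn_ge0.
by apply: ler_pM (ha _ h1) n2; exact: opn_ge0.
Qed.

Lemma rcontV f c : 0 < c -> (forall l, c <= f l) -> rcont f -> rcont (fun l => (f l)^-1).
Proof.
move=> c0 fc [bf hf]; have f0 l : 0 < f l by exact: lt_le_trans (fc l).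
have bi : bm (fun l => (f l)^-1).
 split; first by apply: mf_inv fc _=> //; case: bf.
 by exists c^-1=> l; rewrite ger0_norm ?invr_ge0 ?(ltW (f0 l)) // lef_pV2 ?posrE.
split; [exact: bi|move=> e e0]; have [b b0 hb] := bm_opn bi; have b2 : 0 < b * b by rewrite mulr_gt0.
have [d d0 k] := hf (e / (b * b)) (divr_gt0 e0 b2); exists d=> // D1 D2 h1 h2 n.
have i D : dsa D -> fn D f * fn D (fun l => (f l)^-1) = 1 /\ fn D (fun l => (f l)^-1) * fn D f = 1 by move=> h; rewrite !fnM // -(fn1 h); split; congr fn; apply/funext=> l; rewrite ?mulfV ?mulVf // lt0r_neq0.
have -> : fn D2 (fun l => (f l)^-1) - fn D1 (fun l => (f l)^-1) =
  fn D2 (fun l => (f l)^-1) * (fn D1 f - fn D2 f) * fn D1 (fun l => (f l)^-1) by rewrite mulrBr (i _ h2).2 mulrBl mul1r -mulrA (i _ h1).1 mulr1.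
apply: opnM_le; have -> : e = b * (e / (b * b)) * b by field; exact: lt0r_neq0.
apply: ler_pM; rewrite ?opn_ge0 ?hb //; apply: opnM_le.
by apply: ler_pM; rewrite ?opn_ge0 ?hb // opn_bc; exact: k.
Qed.

Lemma rcontL f : bm f -> (forall e, 0 < e -> exists2 g, rcont g & forall l, `|f l - g l| <= e) -> rcont f.
Proof.
move=> bf h; split; [exact: bf|move=> e e0]; have e3 : 0 < e / 3 by rewrite divr_gt0.
have [g [bg hg] fg] := h _ e3; have [d d0 k] := hg _ e3; exists d=> // D1 D2 h1 h2 n.
have a D : dsa D -> opn (fn D f - fn D g) <= e / 3 by move=> hD; apply: fn_opn_diff=> //; exact: ltW.
have -> : fn D2 f - fn D1 f = (fn D2 f - fn D2 g) + (fn D2 g - fn D1 g) - (fn D1 f - fn D1 g) by rewrite addrA subrK opprB addrA subrK.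
have -> : e = e / 3 + e / 3 + e / 3 by field.
apply: le_trans (opnB _ _) _; apply: lerD (a _ h1); apply: le_trans (opnD _ _) _.
exact: lerD (a _ h2) (k _ _ h1 h2 n).
Qed.

(* The Heron iterates s -> (s + f^2 / s) / 2 decrease to |f|, halving the error. *)
Lemma rcont_abs f : rcont f -> (forall l, `|f l| <= 1) -> rcont (fun l => `|f l|).
Proof.
move=> rf f1; have [[mf [c fc]] _] := rf.
have key n : exists2 s : R -> R, rcont s & exists2 d, 0 < d & forall l, d <= s l /\ 0 <= s l - `|f l| <= 2^-1 ^+ n.
 elim: n=> [|n [s rs [d d0 hs]]].
  by exists (fun=> 1); [exact: rcont_cst|exists 1=> // l; split; rewrite ?expr0 ?subr_ge0 ?f1 ?gerBl /=].
 exists (fun l => 2^-1 * (s l + f l * f l * (s l)^-1)).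
  have rv := rcontV d0 (fun l => (hs l).1) rs.
  exact: rcontM (rcont_cst _) (rcontD rs (rcontM (rcontM rf rf) rv)).
 exists (2^-1 * d) => [|l]; first by rewrite mulr_gt0.
 have [ds /andP[h1 h2]] := hs l; have s0 := lt_le_trans d0 ds.
 have -> : f l * f l = `|f l| * `|f l| by rewrite -!expr2 sqn.
 move: (normr_ge0 (f l)) h1 h2; move: `|f l| => a a0 h1 h2; split.
  by apply: ler_wpM2l=> //; apply: le_trans ds _; rewrite lerDl mulr_ge0 ?invr_ge0 ?mulr_ge0 // ltW.
 have -> : 2^-1 * (s l + a * a * (s l)^-1) - a = 2^-1 * ((s l - a) * ((s l - a) / s l)) by field; exact: lt0r_neq0.
 have q0 : 0 <= (s l - a) / s l by rewrite divr_ge0 // ltW.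
 have q1 : (s l - a) / s l <= 1 by rewrite ler_pdivrMr // mul1r gerBl.
 have h0 : 0 <= 2^-1 :> R by rewrite invr_ge0.
 rewrite exprS; apply/andP; split; first exact: mulr_ge0 h0 (mulr_ge0 h1 q0).
 apply: (ler_wpM2l h0); apply: le_trans h2; exact: ler_piMr h1 q1.
apply: rcontL=> [|e e0]; first by split; [exact: measurableT_comp|exists c=> l; rewrite normr_id].
have [n hn] := nat_gt e^-1; have [s rs [d _ hs]] := key n; exists s=> // l.
have [_ /andP[h1 h2]] := hs l; rewrite distrC ger0_norm //; apply: le_trans h2 _.
rewrite exprVn -[leRHS]invrK lef_pV2 ?posrE ?exprn_gt0 ?invr_gt0 //; apply: le_trans (ltW hn) _.
have h : (n <= 2 ^ n)%N := ltnW (ltn_expl n (ltnSn 1)).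
by rewrite -natrX ler_nat.
Qed.

(** Both functions are uniform limits of rational functions of the resolvent: [(1 + t l^2/m)^-m]
    approximates the Gaussian with an error that stays small after multiplication by [l]. *)
Lemma rcont_heat (t : R) : 0 < t -> rcont (gs t) /\ rcont (fun l => l * gs t l).
Proof.
move=> t0; have [rc rb] := rcont_res.
have key e : 0 < e -> exists p : R -> R, [/\ rcont p, rcont (fun l => l * p l) & forall l, (1 + `|l|) * `|gs t l - p l| <= e].
 move=> e0; have [M hM] := nat_gt (27 * (1 + t^-1) / e).
 pose m := (3 * M.+1)%N; have m0 : 0 < m%:R :> R by rewrite ltr0n /m muln_gt0.
 have m1 : m = m.-1.+1 by rewrite prednK // /m muln_gt0.
 pose u := t / m%:R; have u0 : 0 < u by rewrite divr_gt0.
 (* [(1 + u l^2)^-1] is [cf / (u + (1 - u) cf)], and this denominator is at least [min(u, 1)], so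
    [rcontV] applies. *)
 pose f0 (l : R) : R := u + (1 - u) * cf l; pose c l := cf l * (f0 l)^-1.
 have f0E l : f0 l = (1 + u * l ^+ 2) * cf l by rewrite /f0 /cf; field; rewrite gt_eqF // ltr_pwDl ?sqr_ge0.
 have cE l : c l = (1 + t * l ^+ 2 / m%:R)^-1.
  rewrite /c f0E invfM mulrCA mulfV ?mulr1 ?gt_eqF ?cf_gt0 //.
  by rewrite /u [t * _ / _]mulrAC.
 have rf : rcont (fun l => (f0 l)^-1).
  apply: (@rcontV _ (Num.min u 1)) => [|l|]; first by rewrite lt_min u0 ltr01.
   have := cf_ge0 l; have := cf_le1 l; rewrite /f0; have [h|h] := leP u 1; nra.
  exact: rcontD (rcont_cst _) (rcontM (rcont_cst _) rc).
 have rX n : rcont (fun l => c l ^+ n).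
  elim: n=> [|n IH]; first exact: (rcont_cst 1).
  by under eq_fun do rewrite exprS; exact: (rcontM (rcontM rc rf) IH).
 exists (fun l => c l ^+ m); split=> [||l]; first exact: rX.
  have -> : (fun l => l * c l ^+ m) = fun l => bf l * (f0 l)^-1 * c l ^+ m.-1 by apply/funext=> l; rewrite {1}m1 exprS /c /bf; ring.
  exact: rcontM (rcontM rb rf) (rX _).
 have y0 : 0 <= t * l ^+ 2 by rewrite mulr_ge0 ?sqr_ge0 // ltW.
 have := exp_approx y0 (erefl m); rewrite -cE -mulNr=> /andP[h1 h2]; rewrite distrC [`|_ - _|]ger0_norm //.
 apply: le_trans (_ : (1 + `|l|) * (27 * ((t * l ^+ 2) ^+ 2 / (27 + (t * l ^+ 2) ^+ 3)) / m%:R) <= _).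
  by apply: ler_wpM2l=> //; rewrite addr_ge0.
 apply: (@le_trans _ _ (27 * (1 + t^-1) / m%:R)).
  rewrite (mulrA (1 + `|l|)); apply: ler_wpM2r; first by rewrite invr_ge0 ltW.
  have -> (a Y Z : R) : a * (27 * (Y / Z)) = 27 * (a * Y / Z) by ring.
  apply: ler_wpM2l=> //; rewrite ler_pdivrMr; last by rewrite ltr_pwDl // exprn_ge0.
  exact: poly_arith.
 rewrite ler_pdivrMr // [leRHS]mulrC -ler_pdivrMr //; apply: le_trans (ltW hM) _.
 by rewrite ler_nat /m; lia.
split; (apply: rcontL=> [|e e0]; [exact: bm_gs (ltW t0) || exact: bm_lgs|]); have [p [r1 r2 hp]] := key e e0.
 by exists p=> // l; apply: le_trans (hp l); rewrite ler_peMl // lerDl.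
by exists (fun l => l * p l) => // l; apply: le_trans (hp l); rewrite -mulrBr normrM ler_wpM2r // lerDr.
Qed.

(** [a^2 - b^2 = (a - b) a + b (a - b)]; cyclicity puts the difference next to the bounded factor
    and leaves [a] or [b] to supply the trace. This is why heat operators are written as squares:
    norm continuity of the root yields continuity of the trace. *)
Lemma tr_sq_diff X (a b : bop K) : inN X -> fp a -> fp b -> opn a <= 1 -> opn b <= 1 ->
 `|tr (X * (a * a)) - tr (X * (b * b))| <= opn X * (opn (a - b) * (ft a + ft b)).
Proof.
move=> hX fa fb a1 b1.
have ha : inN a by case: fa=> -[]. have hb : inN b by case: fb=> -[].
have hab : inN (a - b) by exact: inNB.
have [ta ea] := fp_tc fa; have [tb eb] := fp_tc fb.
have hX1 : inN (X * (a - b)) by exact: inNM.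
have hX2 : inN ((a - b) * X) by exact: inNM.
have -> : tr (X * (a * a)) - tr (X * (b * b)) = tr ((X * (a - b)) * a) + tr ((X * b) * (a - b)).
 have [t1 t2] : tc (X * (a - b) * a) /\ tc (X * b * (a - b)) by split; [exact: tcM|apply: tcMr=> //; exact: tcM].
 have [t3 t4] : tc (X * (a * a)) /\ tc (X * (b * b)) by split; apply: tcM=> //; exact: tcM.
 rewrite -trB // -trD //.
 congr tr; rewrite -!mulrA -mulrBr -mulrDr; congr (_ * _).
 by rewrite mulrBl mulrBr addrA subrK.
have -> : tr ((X * b) * (a - b)) = tr (((a - b) * X) * b).
 have tXb : tc (X * b) by exact: tcM.
 by rewrite -(tr_comm hab tXb) mulrA.
apply: le_trans (ler_normD _ _) _; rewrite (mulrA (opn X)) (mulrDr (opn X * opn (a - b))); apply: lerD.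
 apply: le_trans (tr_bd hX1 fa) _; apply: ler_wpM2r; [exact: ft_ge0|exact: opnM].
apply: le_trans (tr_bd hX2 fb) _; apply: ler_wpM2r; [exact: ft_ge0 |].
by rewrite mulrC; exact: opnM.
Qed.

(** Write [2 n Z] as [H1 Z + Z H2] plus [(n e1 - H1) Z] plus [Z (n e2 - H2)]: for positive [H1],
    [H2] bounded below by [c1], [c2] the remainders are small enough that [n] cancels. *)
Lemma corner_bound (e1 e2 H1 H2 Z : bop K) n c1 c2 : 0 <= c1 <= n -> 0 <= c2 <= n ->
 e1 * Z = Z -> Z * e2 = Z -> opn (rso n e1 - H1) <= n - c1 -> opn (rso n e2 - H2) <= n - c2 ->
 opn Z * (c1 + c2) <= opn (H1 * Z + Z * H2).
Proof.
move=> /andP[c10 c1n] /andP[c20 c2n] h1 h2 b1 b2; set Y := H1 * Z + Z * H2.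
have e : rso (2 * n) Z = Y + (rso n e1 - H1) * Z + Z * (rso n e2 - H2).
 rewrite /Y mulrBl mulrBr rsoMl rsoMr h1 h2; have -> : 2 * n = n + n by ring.
 by rewrite rsoDl; bop_lra.
have n0 : 0 <= n := le_trans c10 c1n.
have z0 := opn_ge0 Z.
have l : 2 * n * opn Z <= opn Y + (n - c1) * opn Z + opn Z * (n - c2).
 have -> : 2 * n * opn Z = opn (rso (2 * n) Z).
  apply/eqP; rewrite eq_le; apply/andP; split.
   have [->|n1] := eqVneq n 0; first by rewrite mulr0 mul0r opn_ge0.
   have n2 : 2 * n != 0 by rewrite mulf_neq0.
   have := opnR (2 * n)^-1 (rso (2 * n) Z); rewrite rsoA mulVf // rso1 normfV ger0_norm ?mulr_ge0 //.
   by rewrite mulrC ler_pdivlMr ?[opn Z * _]mulrC // lt_neqAle eq_sym n2 mulr_ge0.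
  by apply: le_trans (opnR _ _) _; rewrite ger0_norm ?mulr_ge0.
 rewrite e; apply: le_trans (opnD _ _) _; apply: lerD.
  apply: le_trans (opnD _ _) _; rewrite lerD2l; apply: opnM_le.
  exact: ler_wpM2r.
 apply: opnM_le; exact: ler_wpM2l.
move: l; move: (opn Z) (opn Y) => p q; lra.
Qed.

(** * A Sylvester equation for the phases of self-adjoint operators *)

Section Sylvester.
Variables (u w h : R -> R) (m : R).
Hypotheses (bu : bm u) (bw : bm w) (mh : measurable_fun setT h) (h0 : forall l, 0 <= h l).
Hypotheses (uh : forall l, u l * h l = l) (wh : forall l, w l * h l = m).
Hypotheses (uw : forall l, u l ^+ 2 + w l ^+ 2 = 1) (hm : forall l, h l <= `|l| + `|m|).

(** The unitary phase of [D + i m], whose modulus is [h(D)]: the hypotheses on [u], [w], [h] say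
    that [(u + i w) h = l + i m] and that [u + i w] has modulus 1. *)
Definition VV D : bop K := locked (fn D u + 'i *: fn D w).
Let VVE D : VV D = fn D u + 'i *: fn D w. Proof. by rewrite /VV -lock. Qed.

Lemma VV_adj D : dsa D -> adj (VV D) = fn D u - 'i *: fn D w.
Proof. by move=> hD; rewrite VVE adjD adji !fn_sa. Qed.
Lemma VV_unit D : dsa D -> adj (VV D) * VV D = 1 /\ VV D * adj (VV D) = 1.
Proof.
move=> hD; rewrite VV_adj // VVE.
have e : fn D u * fn D u + fn D w * fn D w = 1.
 rewrite !fnM // -fnD //; [|exact: bmM|exact: bmM].
 by rewrite -(fn1 hD); congr fn; apply/funext=> l; rewrite -(uw l) !expr2.
have ii : 'i * 'i = -1 :> R[i] by rewrite -expr2 sqr_i.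
have c := fn_commute hD bu bw; move: (fn D u) (fn D w) e c=> a b e c.
split; [rewrite mulrBl !mulrDr|rewrite mulrDl !mulrBr];
 rewrite -!bZAl -!bZAr scalerA ii scaleN1r c -e;
 by bop_lra.
Qed.
Lemma VV_opn D : dsa D -> opn (VV D) <= 1 /\ opn (adj (VV D)) <= 1.
Proof.
move=> hD; rewrite opn_adj; suff H : opn (VV D) <= 1 by [].
apply: opn_le=> // x; rewrite mul1r; apply: nm_le; first exact: nm_ge0.
by rewrite -(adjEl (VV D)) -opM (VV_unit hD).1 op1 nmsq.
Qed.

Section Bounded.
Variables (D : operator K) (B : set R) (n : R).
Hypotheses (hD : dsa D) (mB : measurable B) (Bn : forall l, B l -> `|l| <= n).
Let e := fn D \1_B.
Let H := fn D (fun l => h l * \1_B l).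
Let L := fn D (fun l => l * \1_B l).
Let n0 : 0 <= n \/ B = set0.
Proof.
have [[l Bl]|h'] := pselect (B !=set0); first by left; apply: le_trans (Bn Bl).
by right; apply/eqP/negPn/negP=> /set0P.
Qed.
Let bI : bm (\1_B : R -> R). Proof. exact: bm_ind. Qed.
Lemma bm_hB : bm (fun l => h l * \1_B l).
Proof.
case: n0=> [n0'|->]; last first.
 by under eq_fun do rewrite indic0 mulr0; exact: bm_cst.
split; first by apply: measurable_funM=> //; exact: measurable_indic.
exists (n + `|m|) => l; rewrite indicE; case: (boolP (l \in B)) => Bl; rewrite ?mulr1 ?mulr0 ?normr0 ?addr_ge0 //.
by rewrite ger0_norm //; apply: le_trans (hm l) _; rewrite lerD2r Bn // -in_setE.
Qed.
Lemma bm_lB : bm (fun l : R => l * \1_B l).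
Proof.
case: n0=> [n0'|->]; last first.
 by under eq_fun do rewrite indic0 mulr0; exact: bm_cst.
split; first by apply: measurable_funM; [exact: measurable_id|exact: measurable_indic].
exists n=> l; rewrite indicE; case: (boolP (l \in B)) => Bl; rewrite ?mulr1 ?mulr0 ?normr0 //.
by rewrite Bn // -in_setE.
Qed.
Let I2 l : (\1_B l : R) * \1_B l = \1_B l. Proof. by rewrite indM setIid. Qed.
Lemma eH : e * H = H /\ H * e = H.
Proof.
have b1 := bm_hB; rewrite /e /H (fnM hD bI b1) (fnM hD b1 bI).
split; congr fn; apply/funext=> l; first by rewrite mulrCA I2.
by rewrite -mulrA I2.
Qed.
Lemma VL : VV D * H = L + 'i *: rso m e /\ H * adj (VV D) = L - 'i *: rso m e.
Proof.
rewrite VV_adj // VVE mulrDl mulrBr -bZAl -bZAr /H /L /e.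
have b1 := bm_hB; have b2 : bm (fun l => m * \1_B l) by exact: bmZ.
rewrite -(fnZ hD m bI) !fnM //.
split; congr (fn _ _ + _ *: fn _ _) || congr (fn _ _ - _ *: fn _ _); apply/funext=> l.
- by rewrite mulrA uh.
- by rewrite mulrA wh.
- by rewrite mulrAC [h l * _]mulrC uh.
- by rewrite mulrAC [h l * _]mulrC wh.
Qed.
Lemma VVe : VV D * e = e * VV D /\ adj (VV D) * e = e * adj (VV D).
Proof.
by rewrite VV_adj // VVE !mulrDl !mulrDr mulNr mulrN -!bZAl -!bZAr !(fn_commute hD bI).
Qed.
Lemma VVH : VV D * H = H * VV D /\ adj (VV D) * H = H * adj (VV D).
Proof.
have b1 := bm_hB.
by rewrite VV_adj // VVE !mulrDl !mulrDr mulNr mulrN -!bZAl -!bZAr !(fn_commute hD b1).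
Qed.
Lemma H_opn k c : (forall l, B l -> c <= h l) -> c <= k -> n + `|m| <= k -> opn (rso k e - H) <= k - c.
Proof.
move=> hc ck nk; have b1 := bm_hB.
rewrite /e /H -(fnZ hD k bI) -(fnB hD (bmZ k bI) b1); apply: fn_opn=> //.
- by rewrite subr_ge0.
- by apply: bmB=> //; exact: bmZ.
move=> l; rewrite indicE; case: (boolP (l \in B)) => Bl; rewrite ?mulr1 ?mulr0 ?subrr ?normr0 ?subr_ge0 //.
have Bl' : B l by rewrite -in_setE.
rewrite ger0_norm ?subr_ge0 ?lerB ?hc //.
by apply: le_trans nk; apply: le_trans (hm l) _; rewrite lerD2r Bn.
Qed.
Lemma D_e x : op_dom D (e x) /\ D (e x) = L x.
Proof. exact: (fn_dom hD x bI bm_lB). Qed.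
Lemma e_D x : op_dom D x -> e (D x) = L x.
Proof. by move=> dx; rewrite -(fn_fc_dom hD bI dx).2; case: (D_e x). Qed.
End Bounded.

Variables (D : operator K) (A : bop K).
Hypotheses (hD : dsa D) (sA : sa A).
Let D' := perturb D A.
Let hD' : dsa D'. Proof. exact: dsa_perturb. Qed.
Let X := adj (VV D) * VV D' - 1.

(** With [V h = D + i m] and its primed version, the shift [i m] cancels in [D' - D = A].
    Multiplying by the adjoint of [V] on the left, or by [V'] on the right, and subtracting gives
    [h X + X h'] equal to [adj V A - A V']; the two terms explain the factor 2, and [corner_bound]
    inverts the left side. *)
Lemma sylvester_bd (B1 B2 : set R) n c1 c2 : 0 <= c1 -> 0 <= c2 -> measurable B1 -> measurable B2 ->
 (forall l, B1 l -> `|l| <= n) -> (forall l, B2 l -> `|l| <= n) ->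
 (forall l, B1 l -> c1 <= h l) -> (forall l, B2 l -> c2 <= h l) ->
 opn (fn D \1_B1 * X * fn D' \1_B2) * (c1 + c2) <= 2 * opn (fn D \1_B1 * A * fn D' \1_B2).
Proof.
move=> c10 c20 m1 m2 n1 n2 h1 h2.
set e1 := fn D \1_B1; set e2 := fn D' \1_B2.
pose H1 := fn D (fun l => h l * \1_B1 l); pose H2 := fn D' (fun l => h l * \1_B2 l).
pose L1 := fn D (fun l => l * \1_B1 l); pose L2 := fn D' (fun l => l * \1_B2 l).
have [eH1 He1] := eH hD m1 n1; have [eH2 He2] := eH hD' m2 n2.
have [VL1 HV1] := VL hD m1 n1; have [VL2 HV2] := VL hD' m2 n2.
have [Ve1 Vae1] := VVe hD m1 n1; have [Ve2 Vae2] := VVe hD' m2 n2.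
have [VH1 VaH1] := VVH hD m1 n1; have [VH2 VaH2] := VVH hD' m2 n2.
have [U1 U1'] := VV_unit hD; have [U2 U2'] := VV_unit hD'.
rewrite -/e1 -/H1 -/L1 in eH1 He1 VL1 HV1 Ve1 Vae1 VH1 VaH1.
rewrite -/e2 -/H2 -/L2 in eH2 He2 VL2 HV2 Ve2 Vae2 VH2 VaH2.
have p1 : proj e1 by exact: fn_proj. have p2 : proj e2 by exact: fn_proj.
set Z := e1 * A * e2.
have ZL : Z = e1 * L2 - L1 * e2.
 apply: bop_ext=> x; rewrite /Z !(opM, opB).
 have [d2 ed2] := D_e hD' m2 n2 x; rewrite -/e2 -/L2 in d2 ed2.
 rewrite -(e_D hD m1 n1 (d2 : op_dom D (e2 x))) -ed2 -op_sub; congr (bfun e1 _).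
 by rewrite -[D' (e2 x)]/(D (e2 x) + A (e2 x)) addrC addKr.
have Z1 : adj (VV D) * Z = e1 * (adj (VV D) * VV D') * H2 - H1 * e2.
 have -> : Z = e1 * (VV D' * H2) - VV D * H1 * e2.
  rewrite ZL VL1 VL2 mulrDr mulrDl -bZAl -bZAr rsoMl rsoMr opprD addrACA.
  by rewrite subrr addr0.
 by rewrite mulrBr !mulrA Vae1 U1 mul1r.
have Z2 : Z * VV D' = e1 * H2 - H1 * (adj (VV D) * VV D') * e2.
 have -> : Z = e1 * (H2 * adj (VV D')) - H1 * adj (VV D) * e2.
  rewrite ZL HV1 HV2 mulrBr mulrBl -bZAl -bZAr rsoMl rsoMr opprB addrA.
  by rewrite subrK.
 by rewrite mulrBl -!mulrA U2 mulr1 -Ve2.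
have key : H1 * (e1 * X * e2) + (e1 * X * e2) * H2 = adj (VV D) * Z - Z * VV D'.
 rewrite Z1 Z2 /X; move: (adj (VV D) * VV D') => V.
 have -> : H1 * (e1 * (V - 1) * e2) = H1 * (V - 1) * e2 by rewrite !mulrA He1.
 have -> : e1 * (V - 1) * e2 * H2 = e1 * (V - 1) * H2 by rewrite -!mulrA eH2.
 rewrite !mulrBr !mulrBl !mulr1; apply: bop_ext=> x; apply: ip_ext=> z.
 by rewrite !(opE, ipE); lra.
have n0' : 0 <= `|n| + `|m| + c1 + c2 by rewrite !addr_ge0.
set k := `|n| + `|m| + c1 + c2.
have kk : n + `|m| <= k by have := ler_norm n; rewrite /k; lra.
have nn := normr_ge0 n; have nm' := normr_ge0 m.
have k1 : 0 <= c1 <= k by rewrite c10 /k; lra.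
have k2 : 0 <= c2 <= k by rewrite c20 /k; lra.
have i1 : e1 * (e1 * X * e2) = e1 * X * e2 by rewrite !mulrA p1.2.
have i2 : e1 * X * e2 * e2 = e1 * X * e2 by rewrite -!mulrA p2.2.
have o1 : opn (rso k e1 - H1) <= k - c1 by apply: (H_opn hD m1 n1) => //; case/andP: k1.
have o2 : opn (rso k e2 - H2) <= k - c2 by apply: (H_opn hD' m2 n2) => //; case/andP: k2.
apply: le_trans (corner_bound k1 k2 i1 i2 o1 o2) _; rewrite key.
have [v1 _] := VV_opn hD'; have [_ v2] := VV_opn hD.
have -> : 2 * opn Z = opn Z + opn Z by ring.
apply: le_trans (opnB _ _) _; apply: lerD; apply: opnM_le.
 by rewrite ler_piMl ?opn_ge0.
by rewrite ler_piMr ?opn_ge0.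
Qed.

(** The bound does not depend on the cut-off [n], so the bounded sets can be exhausted by a strong
    limit on both sides. *)
Lemma sylvester (B1 B2 : set R) c1 c2 : 0 <= c1 -> 0 <= c2 -> measurable B1 -> measurable B2 ->
 (forall l, B1 l -> c1 <= h l) -> (forall l, B2 l -> c2 <= h l) ->
 opn (fn D \1_B1 * X * fn D' \1_B2) * (c1 + c2) <= 2 * opn (fn D \1_B1 * A * fn D' \1_B2).
Proof.
move=> c10 c20 m1 m2 h1 h2.
pose I n : set R := `[- n%:R, n%:R]%classic.
have mI n : measurable (I n) by exact: measurable_itv.
have In n l : I n l -> `|l| <= n%:R by rewrite /I /= in_itv /= ler_norml.
have m1n n : measurable (B1 `&` I n) by exact: measurableI.
have m2n n : measurable (B2 `&` I n) by exact: measurableI.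
set e1 := fn D \1_B1; set e2 := fn D' \1_B2.
have E (T : operator K) (hT : dsa T) B n : measurable B -> fn T \1_(B `&` I n) = fn T \1_B * fn T \1_(I n).
 move=> mB; rewrite (fnM hT (bm_ind mB) (bm_ind (mI n))); congr fn; apply/funext=> l.
 by rewrite indM.
have cvI (T : operator K) : dsa T -> scv (fun n => fn T \1_(I n)) 1.
 move=> hT; rewrite -(fn1 hT); apply: (fn_scv hT (c := 1)).
 - by move=> n; exact: measurable_indic (mI n).
 - exact: measurable_cst.
 - move=> l; apply: cvg_near_cst; have [n0 hn] := nat_gt `|l|; exists n0=> // n /= n0n.
  rewrite indicE mem_set // /I /= in_itv /= -ler_norml ltW // (lt_le_trans hn) // ler_nat //.
 - by move=> n l; rewrite indicE; case: (_ \in _); rewrite ?normr1 ?normr0.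
have bI n (T : operator K) : dsa T -> opn (fn T \1_(I n)) <= 1 by move=> hT; apply: proj_opn; exact: fn_proj.
have cs : 0 <= c1 + c2 by exact: addr_ge0.
have bd n : opn (fn D \1_(I n) * (e1 * X * e2) * fn D' \1_(I n)) * (c1 + c2) <= 2 * opn (e1 * A * e2).
 have -> : fn D \1_(I n) * (e1 * X * e2) * fn D' \1_(I n) =
   fn D \1_(B1 `&` I n) * X * fn D' \1_(B2 `&` I n) by rewrite !E // (fn_commute hD (bm_ind m1) (bm_ind (mI n))) !mulrA.
 apply: le_trans (@sylvester_bd _ _ n%:R c1 c2 c10 c20 (m1n n) (m2n n) _ _ _ _) _.
 - by move=> l [_ /In].
 - by move=> l [_ /In].
 - by move=> l [/h1].
 - by move=> l [/h2].
 have -> : fn D \1_(B1 `&` I n) * A * fn D' \1_(B2 `&` I n) =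
   fn D \1_(I n) * (e1 * A * e2) * fn D' \1_(I n) by rewrite !E // (fn_commute hD (bm_ind m1) (bm_ind (mI n))) !mulrA.
 apply: ler_wpM2l=> //; apply: opnM_le; apply: le_trans (ler_piMr _ (bI _ _ hD')) _.
  exact: opn_ge0.
 by apply: opnM_le; rewrite ler_piMl ?opn_ge0 ?bI.
have [c0|c0] := eqVneq (c1 + c2) 0; first by rewrite c0 mulr0 mulr_ge0 ?opn_ge0.
have cp : 0 < c1 + c2 by rewrite lt_neqAle eq_sym c0.
rewrite -ler_pdivlMr //; apply: opn_le; first by rewrite divr_ge0 ?mulr_ge0 ?opn_ge0.
move=> x; have hc : nm ((fn D \1_(I n) * (e1 * X * e2) * fn D' \1_(I n)) x) @[n --> \oo] --> nm ((e1 * X * e2) x).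
 apply: cv_nm; rewrite -[e1 * X * e2]mul1r -[1 * _]mulr1.
 have s1 : scv (fun n => fn D \1_(I n) * (e1 * X * e2)) (1 * (e1 * X * e2)) by apply: (@scvM _ _ _ _ _ _ 1); [move=> n; exact: bI|exact: cvI|exact: scv_cst].
 apply: (@scvM _ _ _ _ _ _ (opn (e1 * X * e2))); [|exact: s1|exact: cvI].
 by move=> n; apply: opnM_le; rewrite ler_piMl ?opn_ge0 ?bI.
apply: (ler_cvg_to hc (cvg_cst _)); apply: nearW=> n.
apply: le_trans (opnP _ _) _; apply: ler_wpM2r; first exact: nm_ge0.
by rewrite ler_pdivlMr.
Qed.
End Sylvester.

(** [FT + i GT] is the phase of [l + i] and [HT] its modulus: the case [m = 1] of the previous
    section. *)
Definition FT (l : R) := l / Num.sqrt (1 + l ^+ 2).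
Definition GT (l : R) := (Num.sqrt (1 + l ^+ 2))^-1.
Definition HT (l : R) := Num.sqrt (1 + l ^+ 2).
Lemma HT_ge1 l : 1 <= HT l.
Proof. by rewrite /HT -[leLHS]sqrtr1 ler_wsqrtr // lerDl sqr_ge0. Qed.
Lemma HT_gt0 l : 0 < HT l. Proof. exact: lt_le_trans (HT_ge1 l). Qed.
Lemma HT_sq l : HT l ^+ 2 = 1 + l ^+ 2.
Proof. by rewrite sqr_sqrtr // addr_ge0 ?sqr_ge0. Qed.
Lemma mf_HT : measurable_fun setT HT.
Proof.
apply: measurableT_comp; first by apply: cmf; exact: sqrt_continuous.
exact: mf_sq1.
Qed.
Lemma FT_bd l : `|FT l| <= 1.
Proof.
rewrite /FT -/(HT l) normrM normfV [`|HT l|]ger0_norm ?(ltW (HT_gt0 l)) //.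
rewrite ler_pdivrMr ?HT_gt0 // mul1r -(@ler_pXn2r _ 2) ?nnegrE ?(ltW (HT_gt0 l)) //.
by rewrite HT_sq real_normK ?num_real // lerDr.
Qed.
Lemma bm_GT : bm GT.
Proof.
split; last by exists 1=> l; rewrite /GT -/(HT l) normfV ger0_norm ?(ltW (HT_gt0 l)) // invf_le1 ?HT_gt0 ?HT_ge1.
by apply: (mf_inv (c := 1)) => //; [exact: HT_ge1|exact: mf_HT].
Qed.
Lemma bm_FT : bm FT.
Proof.
split; last by exists 1; exact: FT_bd.
by apply: measurable_funM; [exact: measurable_id|case: bm_GT].
Qed.

(** Since [HT >= 1], [sylvester] with both constants 1 bounds the difference of the phases by
    [opn A]; the bounded transform is the real part of the phase. *)
Lemma bounded_transform_lip D A : dsa D -> sa A -> opn (fn (perturb D A) FT - fn D FT) <= opn A.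
Proof.
move=> hD sA; have hD' := dsa_perturb hD sA.
have h0 l : 0 <= HT l := ltW (HT_gt0 l).
have uh l : FT l * HT l = l by rewrite /FT -/(HT l) divfK // lt0r_neq0 ?HT_gt0.
have wh l : GT l * HT l = 1 by rewrite /GT -/(HT l) mulVf // lt0r_neq0 ?HT_gt0.
have uw l : FT l ^+ 2 + GT l ^+ 2 = 1.
 have H0 := lt0r_neq0 (HT_gt0 l); rewrite /FT /GT -/(HT l).
 have -> : (l / HT l) ^+ 2 + (HT l)^-1 ^+ 2 = (1 + l ^+ 2) / HT l ^+ 2 by field.
 by rewrite -HT_sq divff // expf_neq0.
have hm l : HT l <= `|l| + `|1 : R|.
 rewrite normr1 -(@ler_pXn2r _ 2) ?nnegrE ?h0 ?addr_ge0 // HT_sq.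
 rewrite -[X in 1 + X]real_normK ?num_real //; have := normr_ge0 l; move: `|l| => a; nra.
have mT := mf_HT; have bF := bm_FT; have bG := bm_GT.
have one : (0 : R) <= 1 by [].
have h := @sylvester FT GT HT 1 bF bG mT h0 uh wh uw hm D A hD sA setT setT 1 1 one one measurableT measurableT
 (fun l _ => HT_ge1 l) (fun l _ => HT_ge1 l).
have i1 (T : operator K) : dsa T -> fn T \1_setT = 1 by move=> hT; rewrite -(fn1 hT); congr fn; apply/funext=> l; rewrite indicT.
rewrite !i1 // !mul1r !mulr1 in h.
set V := VV FT GT D in h; set V' := VV FT GT (perturb D A) in h.
have [U1 U2] := VV_unit bF bG mT h0 uh wh uw hm hD.
have e : V' - V = V * (adj V * V' - 1) by rewrite mulrBr mulrA U2 mul1r mulr1.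
have nV : opn (V' - V) <= opn A.
 rewrite e; apply: opnM_le; have [v1 _] := VV_opn bF bG mT h0 uh wh uw hm hD.
 apply: le_trans (ler_piMl (opn_ge0 _) v1) _; move: h; move: (opn _) (opn A) => a b; lra.
have eF : fn (perturb D A) FT - fn D FT = (2^-1)%:C *: (V' - V + adj (V' - V)).
 rewrite adjB !(VV_adj bF bG mT h0 uh wh uw hm) // /V' /V /VV -!lock.
 rewrite -[LHS]half_bop; congr (_ *: _).
 by bop_lra.
rewrite eF; apply: le_trans (opnR _ _) _; rewrite ger0_norm ?invr_ge0 //.
have := opnD (V' - V) (adj (V' - V)); rewrite opn_adj; move: nV; move: (opn _) (opn _) (opn A) => a b c; lra.
Qed.

(** * Spectral projections modulo the compact ideal *)

Definition pos01 (l : R) : R := if 0 <= l then 1 else 0.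
Definition sg (l : R) : R := 2 * pos01 l - 1.
Definition PP D : bop K := fn D pos01.
Lemma pos01E : pos01 = \1_(`[0, +oo[%classic).
Proof. by apply/funext=> l; rewrite /pos01 indicE mem_setE in_itv /= andbT; case: ifP. Qed.
Lemma bm_pos01 : bm pos01. Proof. by rewrite pos01E; apply: bm_ind; exact: measurable_itv. Qed.
Lemma bm_sg : bm sg. Proof. by apply: bmB; [apply: bmZ; exact: bm_pos01|exact: bm_cst]. Qed.
Lemma sgE l : sg l = if 0 <= l then 1 else -1.
Proof. by rewrite /sg /pos01; case: ifP=> _; lra. Qed.
Lemma PP_proj D : dsa D -> proj (PP D).
Proof. by move=> hD; rewrite /PP pos01E; apply: fn_proj=> //; exact: measurable_itv. Qed.
Lemma fn_sg D : dsa D -> fn D sg = rso 2 (PP D) - 1.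
Proof.
move=> hD; have b := bm_pos01; rewrite /sg (fnB hD (bmZ 2 b) (bm_cst 1)) fn1 // fnZ //.
Qed.
Lemma sg_sq D : dsa D -> fn D sg * fn D sg = 1.
Proof.
move=> hD; have b := bm_sg; rewrite fnM // -(fn1 hD); congr fn; apply/funext=> l.
by rewrite sgE; case: ifP=> _; rewrite ?mulr1 // mulrN1 opprK.
Qed.
Lemma sg_opn D : dsa D -> opn (fn D sg) <= 1.
Proof. by move=> hD; apply: fn_opn=> //; [exact: bm_sg|move=> l; rewrite sgE; case: ifP; rewrite ?normrN normr1]. Qed.

(** The case [m = 0]: the phase is [sg(D)], with value 1 at 0 so that it is unitary, and the modulus
    is [|D|]. *)
Lemma sg_sylvester D A (B1 B2 : set R) c1 c2 : dsa D -> sa A -> 0 <= c1 -> 0 <= c2 -> measurable B1 -> measurable B2 ->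
 (forall l, B1 l -> c1 <= `|l|) -> (forall l, B2 l -> c2 <= `|l|) ->
 opn (fn D \1_B1 * (fn D sg * fn (perturb D A) sg - 1) * fn (perturb D A) \1_B2) * (c1 + c2) <=
 2 * opn (fn D \1_B1 * A * fn (perturb D A) \1_B2).
Proof.
move=> hD sA c10 c20 m1 m2 h1 h2; have hD' := dsa_perturb hD sA.
have mh : measurable_fun setT (fun l : R => `|l|) by apply: cmf; exact: norm_continuous.
have uh l : sg l * `|l| = l by rewrite sgE; case: ifPn=> h; [rewrite mul1r ger0_norm|rewrite -ltNge in h; rewrite mulN1r ltr0_norm // opprK].
have wh (l : R) : (0 : R) * `|l| = 0 by rewrite mul0r.
have uw l : sg l ^+ 2 + 0 ^+ 2 = 1 by rewrite expr0n addr0 sgE; case: ifP=> _; rewrite ?sqrrN expr1n.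
have hm (l : R) : `|l| <= `|l| + `|0 : R| by rewrite normr0 addr0.
have b0 : bm (fun _ : R => 0 : R) := bm_cst 0.
have := @sylvester sg (fun=> 0) (fun l => `|l|) 0 bm_sg b0 mh (fun l => normr_ge0 l) uh wh uw hm D A hD sA B1 B2 c1 c2 c10 c20 m1 m2 h1 h2.
have V (T : operator K) : dsa T -> VV sg (fun=> 0) T = fn T sg by move=> hT; rewrite /VV -lock fn0 // scaler0 addr0.
by rewrite !V // (fn_sa hD bm_sg).
Qed.

(** Norm limits of trace class elements. A closed ideal containing the trace class contains them, so
    they lie in [compact_ideal]. *)
Definition cmp T := inN T /\ forall e, 0 < e -> exists2 S, tc S & opn (T - S) <= e.
Lemma cmp_ideal T : cmp T -> compact_ideal (hdot K) N tau T.
Proof.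
move=> [hT h] J [_ _ _ _ hJ] tJ; apply: hJ=> // e e0; have [S tS le] := h e e0.
exists (S : K -> K); first exact: tJ.
by apply/(opn_leE (T - S)); split=> //; exact: ltW.
Qed.

Lemma fp_chi D r : dsa D -> aff D -> (forall s, 0 < s -> fp (fn D (gs s))) -> fp (fn D (chi r)).
Proof.
move=> hD aD th; have b1 := bm_gs (ltW ltr01).
have [fg _] := fpR (ltW (expR_gt0 (r ^+ 2))) (th 1 ltr01); rewrite -(fnZ hD _ b1) in fg.
have [|//] := fp_fn_le hD aD (bm_chi r) (bmZ _ b1) _ fg.
move=> l; rewrite chiE; case: ifP=> h; last by rewrite lexx mulr_ge0 ?ltW ?expR_gt0.
apply/andP; split=> //; rewrite /gs -expRD -[X in X <= _]expR0 ler_expR mulN1r subr_ge0.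
by rewrite -[l ^+ 2]real_normK ?num_real // ler_pXn2r ?nnegrE // (le_trans _ h).
Qed.

Lemma chiC D r : dsa D -> 1 - fn D (chi r) = fn D \1_(~` `[- r, r]%classic).
Proof.
move=> hD; rewrite -(fn1 hD) -fnB //; [|exact: bm_cst|exact: bm_chi]; congr fn; apply/funext=> l.
by rewrite /chi !indicE in_setC; case: (_ \in _); rewrite /= ?subrr ?subr0.
Qed.

(** The difference is [S (S S' - 1) / 2] for the sign operators. [sg_sylvester] makes the part of
    [S S' - 1] beyond [|D| = n] of norm [O(1/n)], while the part inside contains a spectral
    projection of finite trace. *)
Lemma cmp_P D A : dsa D -> aff D -> (forall s, 0 < s -> fp (fn D (gs s))) ->
 sa A -> inN A -> cmp (PP (perturb D A) - PP D).
Proof.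
move=> hD aD th sA hA; have hD' := dsa_perturb hD sA; have aD' := affil_perturb aD hA.
have b := bm_pos01; have bs := bm_sg.
split; first by apply: inNB; exact: inN_fn.
move=> e e0; have [n hn] := nat_gt (opn A / e).
set S := fn D sg; set S' := fn (perturb D A) sg.
have eP : PP (perturb D A) - PP D = rso 2^-1 (S * (S * S' - 1)).
 rewrite mulrBr mulrA sg_sq // mul1r mulr1 /S' /S !fn_sg // /rso.
 rewrite -[LHS]half_bop; congr (_ *: _); apply: bop_ext=> x; apply: ip_ext=> z.
 by rewrite !(opE, opR, ipE); lra.
exists (rso 2^-1 (S * (fn D (chi n%:R) * (S * S' - 1)))).
 apply: tcR; apply: tcM; first exact: inN_fn.
 apply: tcMr; last by case: (fp_tc (fp_chi n%:R hD aD th)).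
 by apply: inNB; [apply: inNM; exact: inN_fn|exact: inN1].
have -> : PP (perturb D A) - PP D - rso 2^-1 (S * (fn D (chi n%:R) * (S * S' - 1))) =
  rso 2^-1 (S * ((1 - fn D (chi n%:R)) * (S * S' - 1))) by rewrite eP -rsoN -rsoD -mulrN -mulrDr mulrBl mul1r.
have nn : 0 < n%:R :> R by apply: le_lt_trans hn; rewrite divr_ge0 ?opn_ge0 // ltW.
have := @sg_sylvester D A (~` `[- n%:R, n%:R]%classic) setT n%:R 0 hD sA (ltW nn) (lexx 0)
 (measurableC (measurable_itv _)) measurableT.
have -> : fn (perturb D A) \1_setT = 1 by rewrite -(fn1 hD'); congr fn; apply/funext=> l; rewrite indicT.
rewrite !mulr1 -chiC // addr0 -/S -/S'=> /(_ _ _)h.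
have {h} : opn ((1 - fn D (chi n%:R)) * (S * S' - 1)) * n%:R <= 2 * opn A.
 apply: le_trans (h _ _) _=> //.
  by move=> l /=; rewrite in_itv /= -ler_norml=> /negP; rewrite -ltNge=> /ltW.
 apply: ler_wpM2l=> //; apply: opnM_le; rewrite ler_piMl ?opn_ge0 //.
 by apply: proj_opn; apply: projC; apply: fn_proj=> //; exact: measurable_itv.
rewrite -ler_pdivlMr // => h; apply: le_trans (opnR _ _) _; rewrite ger0_norm ?invr_ge0 //.
have h2 : opn (S * ((1 - fn D (chi n%:R)) * (S * S' - 1))) <= 2 * opn A / n%:R.
 apply: opnM_le; apply: le_trans h; rewrite ler_piMl ?opn_ge0 //; exact: sg_opn.
apply: (@le_trans _ _ (opn A / n%:R)).
 rewrite mulrC ler_pdivrMr //; apply: le_trans h2 _.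
 by rewrite le_eqVlt; apply/orP; left; apply/eqP; ring.
by rewrite ler_pdivrMr // mulrC -ler_pdivrMr // ltW.
Qed.

(** [1 - F^2] is [(1 + D^2)^-1], a norm limit of its finite-trace cut-offs; so [F] serves as its own
    parametrix. *)
Lemma cmp_cf D : dsa D -> aff D -> (forall s, 0 < s -> fp (fn D (gs s))) ->
 cmp (1 - fn D FT * fn D FT).
Proof.
move=> hD aD th; have bF := bm_FT; have b := bm_cf R.
have -> : 1 - fn D FT * fn D FT = fn D (@cf R).
 rewrite -(fn1 hD) fnM // -fnB //; [|exact: bm_cst|exact: bmM]; congr fn; apply/funext=> l.
 rewrite /FT -/(HT l) mulrACA -invfM -!expr2 HT_sq /cf; field.
 by rewrite lt0r_neq0 // ltr_pwDl // sqr_ge0.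
split; first exact: inN_fn.
move=> e e0; have [n hn] := nat_gt e^-1; have bc := bm_chi n%:R.
have nn : 0 < n%:R :> R by apply: lt_trans hn; rewrite invr_gt0.
exists (fn D (@cf R) * fn D (chi n%:R)).
 by apply: tcM; [exact: inN_fn|case: (fp_tc (fp_chi n%:R hD aD th))].
rewrite fnM //; apply: fn_opn_diff=> //; [exact: bmM|exact: ltW|].
move=> l; rewrite chiE; case: ifPn=> h; first by rewrite mulr1 subrr normr0 ltW.
rewrite -ltNge in h; rewrite mulr0 subr0 ger0_norm ?cf_ge0 // /cf.
apply: (@le_trans _ _ n%:R^-1); last by rewrite -[leRHS]invrK lef_pV2 ?posrE ?invr_gt0 // ltW.
rewrite lef_pV2 ?posrE // ?ltr_pwDl ?sqr_ge0 //.
rewrite -[l ^+ 2]real_normK ?num_real //; have := sqr_ge0 (`|l| - 1); rewrite !expr2; have := normr_ge0 l; nra.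
Qed.
Lemma indE (B : set R) l : \1_B l = if l \in B then 1 else 0 :> R.
Proof. by rewrite indicE; case: (l \in B). Qed.

Lemma proj_on_eq (V : set K) (E : bop K) : proj E -> (forall x, V x <-> E x = x) ->
 proj_on (hdot K) V = (E : K -> K).
Proof.
move=> [sE EE] hV; apply: xget_unique.
 split.
  split; [exact: bopP|by apply/funext=> x /=; rewrite -opM EE|exact/is_adjointE].
 apply/seteqP; split=> [_ [x _ <-]|x /hV h]; last by exists x.
 by apply/hV; rewrite -opM EE.
move=> F [[bF FF aF] rF]; pose F' := mkbop bF.
have pF : proj F' by split; [exact/(is_adjointE F' F')|apply: bop_ext=> x; rewrite opM; exact: (congr1 (fun h => h x) FF)].
suff -> : E = F' by [].
apply: proj_ext=> // x; rewrite -hV -rF; split=> [[y _ <-]|h].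
 exact: (congr1 (fun h => h y) FF).
by exists x.
Qed.

(** For [r > m], [1 - e = Q T] with [opn Q <= 1/r], and [1 - e] is idempotent, so its norm is at
    most [m/r] times itself and vanishes. The closed interval allows [r] to decrease to [m]. *)
Lemma every_clip T (m : R) : sa T -> opn T <= m -> fn (evr T) (chi m) = 1.
Proof.
move=> sT Tm; have hD := dsa_every sT; set D := everywhere _ in hD *.
have m0 : 0 <= m := le_trans (opn_ge0 T) Tm.
have main r : m < r -> fn D (chi r) = 1.
 move=> mr; have r0 := le_lt_trans m0 mr; have [Q Q1 hQ] := chi_quot hD r0.
 have [_ pP] := projC (fn_proj hD (measurable_itv `[- r, r]) : proj (fn D (chi r))).
 have e : 1 - fn D (chi r) = Q * T by apply: bop_ext=> x; rewrite hQ.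
 apply/eqP; rewrite eq_sym -subr_eq0; apply/eqP/opn_eq0/eqP; rewrite eq_le opn_ge0 andbT leNgt; apply/negP=> q0.
 have h : opn (1 - fn D (chi r)) <= r^-1 * m * opn (1 - fn D (chi r)).
  rewrite -{1}pP {1}e; apply: opnM_le; apply: ler_wpM2r; first exact: opn_ge0.
  by apply: opnM_le; apply: ler_pM; rewrite ?opn_ge0.
 by move: h; rewrite ler_pMl // mulrC ler_pdivlMr // mul1r leNgt mr.
have h : scv (fun k => fn D (chi (m + k.+1%:R^-1))) 1.
 rewrite (_ : (fun k => _) = fun=> 1); first exact: scv_cst.
 by apply/funext=> k; apply: main; rewrite ltrDl.
apply: scv_uniq h; apply: (@fn_scv _ _ _ hD _ _ 1).
- by move=> k; case: (bm_chi (m + k.+1%:R^-1)).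
- by case: (bm_chi m).
- move=> l; apply: cvg_near_cst; have [h|h] := leP `|l| m.
  by near=> k; rewrite !chiE h (le_trans h) // lerDl.
 have hp : 0 < `|l| - m by rewrite subr_gt0.
 near=> k; rewrite !chiE [`|l| <= m]leNgt h /=; have : k.+1%:R^-1 < `|l| - m.
  by near: k; exact: (near_infty_natSinv_lt (PosNum hp)).
 by rewrite ltrBrDl ltNge=> /negbTE ->.
- by move=> k l; have /andP[h1 h2] := chi01 (m + k.+1%:R^-1) l; rewrite ger0_norm.
Unshelve. all: by end_near.
Qed.

Lemma bm_clip (m : R) : bm (fun l : R => l * chi m l).
Proof.
have b := bm_chi m; split; first by apply: measurable_funM; [exact: measurable_id|case: b].
exists `|m| => l; rewrite chiE; case: ifP=> h; rewrite ?mulr1 ?mulr0 ?normr0 //.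
by apply: le_trans h _; exact: ler_norm.
Qed.

Lemma every_fn T (m : R) : sa T -> opn T <= m ->
 fn (evr T) (fun l : R => l * chi m l) = T.
Proof.
move=> sT Tm; apply: bop_ext=> x.
have [_] := fn_dom (dsa_every sT) x (bm_chi m) (bm_clip m).
by rewrite (every_clip sT Tm) op1=> <-.
Qed.

(** * The index of a pair of projections *)

Section Index.
Variables (P Q : bop K).
Hypotheses (pP : proj P) (pQ : proj Q) (hP : inN P) (hQ : inN Q).
Let T := Q - P.
Let S := 1 - P - Q.
Let D := evr T.
Let cl (l : R) : R := l * chi 1 l.

Lemma dproj_sa : sa T. Proof. by apply: saB; [case: pQ|case: pP]. Qed.
Lemma dproj_opn : opn T <= 1.
Proof.
apply: sa_opn=> //; first exact: dproj_sa.
move=> x; rewrite mul1r /T opB ipBl ler_norml.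
have [a1 a2] := (loE x (proj_lo1 pP), loE x (proj_lo1 pQ)).
have [b1 b2] := ((proj_pos pP).2 x, (proj_pos pQ).2 x).
by rewrite !op1 in a1 a2; apply/andP; split; lra.
Qed.
Let hD : dsa D. Proof. by apply: dsa_every; exact: dproj_sa. Qed.
Let aD : aff D. Proof. by apply: affil_every; exact: inNB. Qed.
Let TE : fn D cl = T. Proof. exact: every_fn dproj_sa dproj_opn. Qed.
Let bcl : bm cl. Proof. exact: bm_clip. Qed.

(** [S] reverses the sign of [T] and [S^2 = 1 - T^2]: it matches the spectrum of [Q - P] in [(0, 1)]
    with that in [(-1, 0)], leaving only the eigenvalues 1 and -1 unpaired. *)
Lemma dproj_anti : S * T = - (T * S).
Proof.
have [[_ PP] [_ QQ]] := (pP, pQ).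
rewrite /S /T !(mulrBl, mulrBr) !mul1r !mulr1 PP QQ.
by bop_lra.
Qed.

Lemma dproj_sq : S * S = 1 - T * T.
Proof.
have [[_ PP] [_ QQ]] := (pP, pQ).
rewrite /S /T !(mulrBl, mulrBr) !mul1r !mulr1 PP QQ.
by bop_lra.
Qed.

Lemma dproj_odd f : bm f -> (forall l, f (- l) = - f l) -> (forall l, 1 < `|l| -> f l = 0) ->
 S * fn D f = - (fn D f * S).
Proof.
move=> bf fo fv.
have bcN : bm (fun l => - cl l) by exact: bmN.
have eN : fn D (fun l => - cl l) = - T by rewrite fnN // TE.
have hN : dsa (evr (fn D (fun l => - cl l))) by apply: dsa_every; exact: fn_sa.
rewrite (fn_inter hD hN _ bf); last first.
 move=> x _; split=> //; change ((fn D (fun l => - cl l)) (S x) = S (T x)).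
 by rewrite eN opN -!opM dproj_anti opN.
rewrite fn_every // -mulNr -fnN //; congr (fn D _ * S); apply/funext=> l /=.
rewrite /cl chiE; case: ifP=> h; first by rewrite mulr1 fo.
have f0 : f 0 = 0 by have := fo 0; rewrite oppr0; lra.
by rewrite mulr0 oppr0 f0 fv ?oppr0 // ltNge h.
Qed.

(** The two subspaces in the index are the eigenspaces of [Q - P] for 1 and -1, as the forms of [P]
    and [Q] take values between 0 and [|x|^2]. *)
Lemma codim_indexE : codim_index (hdot K) tau P Q = ft (fn D \1_[set 1]) - ft (fn D \1_[set -1]).
Proof.
have eig (s : R) (V : set K) : `|s| = 1 -> (forall x, V x <-> T x = rs s x) ->
  proj_on (hdot K) V = (fn D \1_[set s] : K -> K).
 move=> s1 hV; apply: proj_on_eq; first by apply: fn_proj=> //; exact: measurable_set1.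
 pose psi (l : R) : R := cl l - s.
 have bpsi : bm psi by apply: bmB=> //; exact: bm_cst.
 have ePsi : fn D psi = T - rso s 1 by rewrite /psi fnB ?fn_cst ?TE //; exact: bm_cst.
 have hE : dsa (evr (fn D psi)) by apply: dsa_every; exact: fn_sa.
 move=> x; rewrite hV.
 have -> : fn D \1_[set s] = fn (evr (fn D psi)) \1_[set 0].
  rewrite fn_every //; last by apply: bm_ind; exact: measurable_set1.
  congr fn; apply/funext=> l /=; rewrite !indicE; congr (_%:R); congr (nat_of_bool _).
  apply/idP/idP; rewrite !inE /psi /cl chiE /=.
   by move=> ->; rewrite s1 lexx mulr1 subrr.
  case: ifP=> h; rewrite ?mulr1 ?mulr0; first by move/eqP; rewrite subr_eq0=> /eqP.
  by rewrite sub0r=> /eqP; rewrite oppr_eq0=> /eqP h0; move: s1; rewrite h0 normr0; lra.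
 rewrite -(ker_fn hE) /= ePsi !(opE, opR); split=> [->|[_ /eqP]]; first by rewrite subrr.
 by rewrite subr_eq0=> /eqP.
have fixP (E : bop K) x : proj E -> (range E x <-> E x = x) by move=> [_ EE]; split=> [[y _ <-]|h]; [rewrite -opM EE|exists x].
have fixn (E : bop K) x : proj E -> ip (E x) x = ip x x -> E x = x.
 move=> pE; rewrite (proj_ip2 _ pE) => h.
 apply/eqP; rewrite eq_sym -subr_eq0 -[x in x - _]op1 -opB; apply/eqP; apply: ipxx_eq0.
 by rewrite -(proj_ip2 _ (projC pE)) opB op1 ipBl (proj_ip2 _ pE) h subrr.
have zero (E : bop K) x : proj E -> ip (E x) x = 0 -> E x = 0 by move=> pE; rewrite (proj_ip2 _ pE) => /ipxx_eq0.
rewrite /codim_index /ft /tp; congr (fine (tau _) - fine (tau _)); apply: eig; rewrite ?normrN ?normr1 // => x.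
 split=> [[/(fixP _ _ pQ) q p]|h].
  by rewrite /T opB q [P x]p subr0 rs1.
 have := congr1 (fun y => ip y x) h; rewrite rs1 /T opB ipBl.
 have [a1 a2] := (loE x (proj_lo1 pQ), (proj_pos pP).2 x); rewrite op1 in a1=> e.
 split; first by apply/fixP=> //; apply: fixn=> //; lra.
 by apply: zero=> //; lra.
split=> [[q /(fixP _ _ pP) p]|h].
 by rewrite /T opB p [Q x]q sub0r -[x in - x]rs1 /rs -scaleNr -rmorphN.
have := congr1 (fun y => ip y x) h; rewrite /T opB ipBl ipZl.
have [a1 a2] := (loE x (proj_lo1 pP), (proj_pos pQ).2 x); rewrite op1 in a1=> e.
split; last by apply/fixP=> //; apply: fixn=> //; lra.
by apply: zero=> //; lra.
Qed.

(** An odd function of [Q - P] has its traces cancelled by the symmetry [S] except at 1 and -1. The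
    even factor [g] supplies trace class, and [g 1 * u 1 = 1] normalizes the two surviving terms. *)
Lemma index_fn g (u : R -> R) : bm g -> (forall l, 0 <= g l) -> (forall l, g (- l) = g l) ->
 (forall l, 1 < `|l| -> g l = 0) -> bm u -> (forall l, u (- l) = - u l) -> g 1 * u 1 = 1 ->
 fp (fn D g) -> tr (fn D (fun l => g l * u l)) = codim_index (hdot K) tau P Q.
Proof.
move=> bg g0 ge gv bu uo gu1 fg; rewrite codim_indexE.
have g1 : 0 < g 1.
 rewrite lt_def g0 andbT; apply/eqP=> h; move: gu1; rewrite h mul0r; lra.
(* Replace [1 - T^2] by [S S]: moving one [S] around the trace and then across the odd function
   changes the sign, so the trace is zero. *)
have odd0 (w : R -> R) : bm w -> (forall l, w (- l) = - w l) ->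
  tr (fn D (fun l => g l * (w l * (1 - cl l ^+ 2)))) = 0.
 move=> bw wo; pose v l := g l * w l.
 have bv : bm v by exact: bmM.
 have [c hc] : exists c, forall l, `|w l| <= c by case: bw.
 have tv : tc (fn D v).
  apply: (tc_fn hD aD bv (bmZ c bg)).
   by move=> l; rewrite normrM (ger0_norm (g0 l)) mulrC; apply: ler_wpM2r.
  rewrite fnZ //; apply: (fpR _ fg).1.
  by apply: le_trans (hc 0).
 have bq : bm (fun l => 1 - cl l ^+ 2) by apply: bmB; [exact: bm_cst|exact: bmX].
 have hS : inN S by apply: inNB=> //; apply: inNB=> //; exact: inN1.
 have vo : S * fn D v = - (fn D v * S).
  apply: dproj_odd=> // [l|l /gv h]; first by rewrite /v ge wo mulrN.
  by rewrite /v h mul0r.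
 have -> : (fun l => g l * (w l * (1 - cl l ^+ 2))) = (fun l => v l * (1 - cl l ^+ 2)) by apply/funext=> l; rewrite mulrA.
 rewrite -fnM // fnB ?fn1 ?fnX ?TE //; [|exact: bm_cst|exact: bmX].
 rewrite expr2 -dproj_sq mulrA.
 have tvS : tc (fn D v * S) by exact: tcMr.
 have := tr_comm hS tvS; rewrite mulrA vo mulNr trN; last exact: tcMr.
 by lra.
have [m [mT _ hm]] := trace_measure hD aD bg g0 fg.
have b1 (s : R) : bm (\1_[set s] : R -> R) by apply: bm_ind; exact: measurable_set1.
have f1 (s : R) : g s = g 1 -> fp (fn D \1_[set s]).
 move=> gs; apply: (fp_fn_le hD aD (b1 s) (bmZ (g 1)^-1 bg) _ _).1.
  move=> l; rewrite indE; case: ifP=> h /=; first by move/set_mem: h=> ->; rewrite gs mulVf ?gt_eqF // ler01 lexx.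
  by rewrite lexx mulr_ge0 // invr_ge0 ltW.
 by rewrite fnZ //; apply: (fpR _ fg).1; rewrite invr_ge0 ltW.
have [t1 e1] := fp_tc (f1 1 erefl).
have [t2 e2] := fp_tc (f1 (-1) (ge 1)).
pose u0 l := u l - u l * \1_[set 1] l - u l * \1_[set -1] l.
have bu0 : bm u0 by apply: bmB; [apply: bmB=> // |]; exact: bmM.
have z0 : tr (fn D (fun l => g l * u0 l)) = 0.
 rewrite (hm _ bu0).2.
 pose s l : R := cl l ^+ 2.
 have bs : bm s by exact: bmX.
 have s01 l : 0 <= s l <= 1.
  rewrite /s sqr_ge0 /= -sqn expr_le1 // /cl chiE; case: ifP=> //; rewrite ?mulr1 ?mulr0 ?normr0 //.
 (* [1 - s^n] is [1 - s] times a geometric sum, so [odd0] applies to each [uu n]; as [n] grows these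
    tend to [u] with its values at 1 and -1 removed. *)
 pose uu (n : nat) l := u l * (1 - s l ^+ n).
 have buu n : bm (uu n) by apply: bmM=> //; apply: bmB; [exact: bm_cst|exact: bmX].
 have zn n : \int[m]_l uu n l = 0.
  rewrite -(hm _ (buu n)).2.
  pose w l := u l * \sum_(i <- index_iota 0 n) s l ^+ i.
  have sN l : s (- l) = s l by rewrite /s /cl !chiE normrN mulNr sqrrN.
  rewrite -(odd0 w) //.
  - congr (tr (fn D _)); apply/funext=> l; congr (_ * _); rewrite /w /uu -mulrA; congr (_ * _).
   by rewrite -[LHS]opprB subrX1 big_mkord -mulNr opprB mulrC.
  - by apply: bmM=> //; apply: bm_sum=> i; exact: bmX.
  - by move=> l; rewrite /w uo sN mulNr.
 have [c hc] : exists c, forall l, `|u l| <= c by case: bu.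
 suff : \int[m]_l uu n l @[n --> \oo] --> \int[m]_l u0 l.
  have -> : (fun n => \int[m]_l uu n l) = (fun=> 0) by apply/funext=> n; exact: zn.
  by move=> h; apply/esym; apply: (cvg_unique _ _ h) => //; exact: cvg_cst.
 apply: (@bint_dct _ _ _ _ mT uu u0 c).
 - by move=> n; case: (buu n).
 - by case: bu0.
 - move=> l; rewrite /uu /u0.
  have [e|ne] := eqVneq (s l) 1.
   have [->|->] : l = 1 \/ l = -1.
    move: e; rewrite /s /cl chiE; case: ifP=> _; rewrite ?mulr1 ?mulr0 ?expr0n /=; last by lra.
    by move/eqP; rewrite sqrf_eq1=> /orP[]/eqP ->; [left|right].
   + have -> : (fun n => u 1 * (1 - s 1 ^+ n)) = fun=> 0 by apply/funext=> n; rewrite /s /cl chiE normr1 lexx !mulr1 expr1n expr1n subrr mulr0.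
    rewrite !indicE mem_set // memNset /=; last by move=> h; lra.
    rewrite mulr1 mulr0 subr0 subrr; exact: cvg_cst.
   + have -> : (fun n => u (-1) * (1 - s (-1) ^+ n)) = fun=> 0 by apply/funext=> n; rewrite /s /cl chiE normrN normr1 lexx !mulr1 sqrrN expr1n expr1n subrr mulr0.
    rewrite !indicE memNset /=; last by move=> h; lra.
    rewrite mem_set // mulr1 mulr0 subr0 subrr; exact: cvg_cst.
  have h (r : R) : `|r| = 1 -> \1_[set r] l = 0 :> R.
   move=> r1; rewrite indicE memNset //= => h; move/eqP: ne; apply.
   by rewrite h /s /cl chiE r1 lexx mulr1 -sqn r1 expr1n.
  rewrite !h ?normrN ?normr1 // !mulr0 !subr0 -[X in _ --> X]mulr1; apply: cvgM; first exact: cvg_cst.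
  rewrite -[X in _ --> X]subr0; apply: cvgB; first exact: cvg_cst.
  apply: cvg_expr; rewrite ger0_norm; last by case/andP: (s01 l).
  by rewrite lt_def eq_sym ne; case/andP: (s01 l).
 - move=> n l; rewrite /uu normrM -[leRHS]mulr1; apply: ler_pM=> //.
  have /andP[a b] := s01 l.
  have c1 := exprn_ge0 n a; have c2 := exprn_ile1 n a b.
  by rewrite ger0_norm; lra.
have tg : tc (fn D (fun l => g l * u0 l)) by case: (hm _ bu0).
have -> : (fun l => g l * u l) = (fun l => \1_[set 1] l - \1_[set -1] l + g l * u0 l).
 apply/funext=> l; rewrite /u0.
 have [->|n1] := eqVneq l 1.
  rewrite !indicE mem_set // memNset /=; last by move=> h; lra.
  by rewrite !mulr1 !mulr0 !subr0 subrr mulr0 addr0.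
 have [->|n2] := eqVneq l (-1).
  rewrite !indicE memNset /=; last by move=> h; lra.
  by rewrite mem_set // !mulr1 !mulr0 !subr0 subrr mulr0 addr0 ge uo mulrN gu1 sub0r.
 rewrite !indicE !memNset /=; [by rewrite !mulr0 !subr0 add0r|exact/eqP|exact/eqP].
rewrite fnD ?fnB //; [|exact: bmB|exact: bmM].
by rewrite trD // ?trB // ?z0 ?addr0 ?e1 ?e2 //; exact: tcB.
Qed.

(** Write [l] as [|l|] times the sign of [l]; the weight [|T|] is trace class as the product of [T]
    with a bounded function of [T]. *)
Lemma index_tc : tc T -> tr T = codim_index (hdot K) tau P Q.
Proof.
move=> tT.
pose u (l : R) : R := \1_`]0, +oo[%classic l - \1_`]-oo, 0[%classic l.
have uE l : u l = Num.sg l.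
 rewrite /u !indicE !mem_setE !in_itv /= andbT; case: (ltgtP l 0) => h.
 - by rewrite sub0r ltr0_sg.
 - by rewrite subr0 gtr0_sg.
 - by rewrite h subrr sgr0.
have bu : bm u by apply: bmB; apply: bm_ind; exact: measurable_itv.
pose g l := u l * cl l.
have bg : bm g by exact: bmM.
have gE l : g l = `|cl l|.
 rewrite /g uE /cl normrM (ger0_norm (andP (chi01 1 l)).1) mulrA; congr (_ * _).
 by rewrite normrEsg.
have -> : tr T = tr (fn D (fun l => g l * u l)).
 rewrite -[in LHS]TE; congr (tr (fn D _)); apply/funext=> l.
 rewrite /g uE mulrAC -expr2 sqr_sg; case: eqP=> [->|_]; rewrite ?mul1r //.
 by rewrite /cl mul0r mulr0.
apply: index_fn=> //.
- by move=> l; rewrite gE.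
- by move=> l; rewrite !gE /cl chiE normrN -chiE mulNr normrN.
- by move=> l h; rewrite gE /cl chiE leNgt h mulr0 normr0.
- by move=> l; rewrite !uE sgrN.
- by rewrite gE uE /cl chiE normr1 lexx mulr1 normr1 sgr1 mulr1.
apply: tc_pos; first by apply: fn_pos=> // l; rewrite gE.
by rewrite /g -fnM // TE; apply: tcM=> //; exact: inN_fn.
Qed.

End Index.

(** The positive part of [4/5 - cf], scaled. Since [cf(1/2) = 4/5] and [cf(1) = 1/2], it vanishes
    for [|l| <= 1/2] and equals 1 at 1 and -1; as a continuous function of the resolvent it depends
    norm continuously on the operator. *)
Definition bump0 (l : R) : R := 5 / 3 * (4 / 5 - cf l + `|4 / 5 - cf l|).
Definition bump l := bump0 l * chi 1 l.

Lemma rcont_bump0 : rcont bump0.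
Proof.
have ry : rcont (fun l => 4 / 5 - cf l).
 under eq_fun do rewrite -[- _]mulN1r.
 exact: rcontD (rcont_cst _) (rcontM (rcont_cst _) rcont_res.1).
apply: rcontM (rcont_cst _) (rcontD ry (rcont_abs ry _)) => l.
by have := cf_ge0 l; have := cf_le1 l; rewrite ler_norml=> h1 h2; apply/andP; split; lra.
Qed.

Lemma bump_out l : 1 < `|l| -> bump l = 0.
Proof. by move=> h; rewrite /bump chiE leNgt h mulr0. Qed.

Lemma bump01 l : 0 <= bump l <= 1.
Proof.
have [|h] := ltP 1 `|l|; first by move=> /bump_out ->; rewrite lexx ler01.
have h2 : l ^+ 2 <= 1 by rewrite -sqn expr_le1.
have : 2^-1 <= cf l by rewrite lef_pV2 ?posrE ?ltr_pwDl ?sqr_ge0 //; lra.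
rewrite /bump chiE h mulr1 /bump0; have := cf_le1 l=> c2 c1.
by case: (leP 0 (4 / 5 - cf l)) => h1; [rewrite ger0_norm //|rewrite ltr0_norm //]; apply/andP; split; lra.
Qed.

Lemma bm_bump : bm bump. Proof. exact: bmM rcont_bump0.1 (bm_chi 1). Qed.

Lemma bump_small l : `|l| < 2^-1 -> bump l = 0.
Proof.
move=> h; rewrite /bump /bump0 ler0_norm ?subrr ?mulr0 ?mul0r // subr_le0 (_ : 4 / 5 = (5 / 4)^-1); last by field.
rewrite lef_pV2 ?posrE ?ltr_pwDl ?sqr_ge0 //; have : l ^+ 2 <= 2^-1 ^+ 2.
 by rewrite -sqn ler_pXn2r ?nnegrE ?invr_ge0 // ltW.
rewrite [2^-1 ^+ 2]expr2; lra.
Qed.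

Lemma bump_mod e : 0 < e -> exists2 d, 0 < d & forall S T, sa S -> sa T -> opn S <= 1 -> opn T <= 1 ->
 opn (S - T) <= d ->
 opn (fn (evr S) bump - fn (evr T) bump) <= e.
Proof.
move=> e0; have [b0 /(_ e e0)[d d0 h]] := rcont_bump0; exists (d / 2); first by rewrite divr_gt0.
move=> S T sS sT S1 T1 ST.
have E (X : bop K) : sa X -> opn X <= 1 -> fn (evr X) bump = fn (evr X) bump0 by move=> sX X1; rewrite -[RHS]mulr1 -(every_clip sX X1) fnM //; [exact: dsa_every|exact: bm_chi].
rewrite !E //; apply: h; [exact: dsa_every ..|].
have -> : evr S = perturb (evr T) (S - T) by rewrite /perturb; congr Operator; apply/funext=> x; rewrite -[RHS]/(T x + (S - T) x) opB addrC subrK.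
apply: res_near_le (res_lip (dsa_every sT) (saB sS sT)); lra.
Qed.

(** Where [|T| >= 1/2], the trace class approximant still satisfies [|S x| >= |x| / 4], and
    [weak_kaplansky] for [adj S * S] gives the constant [16 = 4^2]. The bound depends on [S] only,
    hence is common to all nearby [T]. *)
Lemma window_bd T S : sa T -> inN T -> opn T <= 1 -> tc S -> opn (T - S) <= 4^-1 ->
 fp (fn (evr T) bump) /\
 ft (fn (evr T) bump) <= 16 * ft (adj S * S).
Proof.
move=> sT hT T1 tS TS; have hD := dsa_every sT; have aD := affil_every hT.
pose B : set R := `[-1, 1]%classic `\` `](- 2^-1), 2^-1[%classic.
have mB : measurable B by apply: measurableD; exact: measurable_itv.
have BE l : B l <-> 2^-1 <= `|l| <= 1.
 rewrite /B /= !in_itv /= -ler_norml -ltr_norml; split.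
  by move=> [-> /negP]; rewrite -leNgt=> ->.
 by move=> /andP[h ->]; split=> //; apply/negP; rewrite -leNgt.
have bB : bm (\1_B : R -> R) := bm_ind mB; have bc := bm_clip 1; have bb := bm_bump.
have hS : inN S := tc_inN tS.
have fSS : fp (adj S * S) by apply: tc_pos; [exact: pos_sq|apply: tcM=> //; exact: inN_adj].
have [fE lE] : fp (fn (evr T) \1_B) /\
  16^-1 * ft (fn (evr T) \1_B) <= ft (adj S * S).
 apply: weak_kaplansky=> //; [exact: fn_proj|exact: inN_fn|move=> x hx].
 rewrite opM -[adj S]/(adj S) adjEl -!nmsq.
 have h1 : 2^-1 * nm x <= nm (T x).
  rewrite -(@ler_pXn2r _ 2) ?nnegrE ?mulr_ge0 ?nm_ge0 ?invr_ge0 //.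
  rewrite exprMn !nmsq -(every_fn sT T1) (saE _ _ (fn_sa hD bc)) -opM fnM // (ipC x).
  rewrite -{1}hx -ipZl -opR -fnZ //; apply: loE; apply: fn_lo=> //; [exact: bmZ|exact: bmM|move=> l].
  rewrite indE; case: ifP=> h; last by rewrite mulr0 -expr2 sqr_ge0.
  have /andP[l1 l2] := (BE l).1 (set_mem h).
  rewrite mulr1 chiE l2 mulr1 -expr2 -(sqn l) ler_pXn2r ?nnegrE ?invr_ge0 //.
 have h2 : 4^-1 * nm x <= nm (S x).
  have -> : S x = T x - (T - S) x by rewrite opB opprB addrC subrK.
  have := nmD (T x - (T - S) x) ((T - S) x); rewrite subrK.
  have := opnP (T - S) x; have := ler_wpM2r (nm_ge0 x) TS; lra.
 have -> : 16^-1 = 4^-1 ^+ 2 :> R by rewrite exprVn -natrX.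
 by rewrite -exprMn ler_pXn2r ?nnegrE ?mulr_ge0 ?nm_ge0 ?invr_ge0.
have [|f1 l1] := fp_fn_le hD aD bb bB _ fE.
 move=> l; have /andP[-> b1] := bump01 l; rewrite indE; case: ifPn=> // /negP h.
 have [h1|h1] := ltP `|l| 2^-1; first by rewrite bump_small ?lexx.
 have [h2|h2] := ltP 1 `|l|; first by rewrite bump_out ?lexx.
 by exfalso; apply: h; rewrite inE; apply/BE; rewrite h1 h2.
by split=> //; lra.
Qed.

(** Both indices are traces of [X bump(X)^2] with [X = F n - P] or [Q - P]. The windows have
    uniformly bounded traces and converge in norm, so the traces converge; for [F n] the index is
    also the plain trace. *)
Lemma index_lim P Q (F : nat -> bop K) : proj P -> proj Q -> (forall n, proj (F n)) ->
 inN P -> inN Q -> (forall n, inN (F n)) -> (forall n, tc (F n - P)) -> cmp (Q - P) ->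
 opn (F n - Q) @[n --> \oo] --> (0 : R) ->
 tr (F n - P) @[n --> \oo] --> codim_index (hdot K) tau P Q.
Proof.
move=> pP pQ pF hP hQ hF tF [_ cQ] FQ.
pose E (X : bop K) : bop K := fn (evr X) bump.
have idx (X : bop K) : proj X -> inN X -> fp (E (X - P)) ->
  tr ((X - P) * (E (X - P) * E (X - P))) = codim_index (hdot K) tau P X.
 move=> pX hX fE; have sX := dproj_sa pP pX hP hX; have hD := dsa_every sX.
 have aD : aff (evr (X - P)) by apply: affil_every; exact: inNB.
 have bb := bm_bump; have bc := bm_clip 1.
 rewrite -(index_fn pP pX hP hX (g := fun l => bump l * bump l) (u := fun l => l * chi 1 l)).
 - congr tr; rewrite -{1}(every_fn sX (dproj_opn pP pX hP hX)) /E fnM // fnM //; last exact: bmM.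
  by congr fn; apply/funext=> l; rewrite mulrC.
 - exact: bmM.
 - by move=> l; rewrite -expr2 sqr_ge0.
 - by move=> l; rewrite /bump /bump0 /cf !chiE normrN sqrrN.
 - by move=> l /bump_out ->; rewrite mulr0.
 - by [].
 - by move=> l; rewrite !chiE normrN mulNr.
 - rewrite /bump /bump0 /cf chiE normr1 lexx !mulr1 expr1n -[1 + 1]/(2 : R) ger0_norm; lra.
 apply: (fp_fn_le hD aD (bmM bb bb) bb _ fE).1=> l.
 by have /andP[a b] := bump01 l; rewrite mulr_ge0 // ler_piMl.
have sT (X : bop K) : proj X -> inN X -> sa (X - P) /\ opn (X - P) <= 1 by move=> pX hX; split; [exact: (dproj_sa pP pX hP hX)|exact: (dproj_opn pP pX hP hX)].
(* The approximant within 1/8 of [Q - P] is within 1/4 of every [X - P] with [X] within 1/8 of [Q],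
   as [window_bd] demands. *)
have [S tS QS] := cQ 8^-1 (ltac:(by rewrite invr_gt0)).
have hS := tc_inN tS; set C := 16 * ft (adj S * S).
have fSS : fp (adj S * S) by apply: tc_pos; [exact: pos_sq|apply: tcM=> //; exact: inN_adj].
have C0 : 0 <= C by rewrite mulr_ge0 ?ft_ge0.
have win (X : bop K) : proj X -> inN X -> opn (X - Q) <= 8^-1 -> fp (E (X - P)) /\ ft (E (X - P)) <= C.
 move=> pX hX d; have [s1 s2] := sT X pX hX; apply: window_bd=> //; first exact: inNB.
 have -> : X - P - S = (X - Q) + (Q - P - S) by rewrite -!addrA addKr.
 by have := opnD (X - Q) (Q - P - S); lra.
have [fQ lQ] := win Q pQ hQ (ltac:(by rewrite subrr opn0 invr_ge0)).
have [sQ nQ] := sT Q pQ hQ.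
have E1 (X : bop K) : sa X -> opn (E X) <= 1.
 move=> sX; apply: fn_opn=> //; [exact: dsa_every|exact: bm_bump|move=> l].
 by have /andP[a b] := bump01 l; rewrite ger0_norm.
apply/cvgrPdist_le=> e e0.
(* [2 C e1] comes from the change of the windows and [C e1] from that of the outer factor; the 1
   only keeps the denominator positive. *)
pose e1 := e / (3 * C + 1).
have e10 : 0 < e1 by rewrite divr_gt0 //; lra.
have [d d0 hd] := bump_mod e10.
have h0 : 0 < Order.min 8^-1 (Order.min e1 d) by rewrite !lt_min e10 d0 invr_gt0 /= ltr0n.
have /cvgrPdist_le /(_ _ h0) FQ' := FQ.
near=> n.
have dn : opn (F n - Q) <= Order.min 8^-1 (Order.min e1 d).
 have : `|0 - opn (F n - Q)| <= Order.min 8^-1 (Order.min e1 d) by near: n; exact: FQ'.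
 by rewrite sub0r normrN ger0_norm ?opn_ge0.
move: dn; rewrite !le_min=> /and3P[dn1 dn2 dn3].
have [fF lF] := win (F n) (pF n) (hF n) dn1.
have [sF nF] := sT (F n) (pF n) (hF n).
rewrite (index_tc pP (pF n) hP (hF n) (tF n)) -!idx //.
set a := E (Q - P) in fQ lQ *; set b := E (F n - P) in fF lF *.
have ab : opn (a - b) <= e1.
 apply: hd=> //; have -> : Q - P - (F n - P) = - (F n - Q).
  by rewrite opprB addrA subrK opprB.
 by rewrite opnN.
have hQP : inN (Q - P) by exact: inNB.
have hFQ : inN (F n - Q) by exact: inNB.
have [ta _] := fp_tc fQ; have [tb eb] := fp_tc fF.
have taa : tc (a * a) by apply: tcM=> //; exact: tc_inN.
have tbb : tc (b * b) by apply: tcM=> //; exact: tc_inN.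
have -> : (F n - P) * (b * b) = (Q - P) * (b * b) + (F n - Q) * (b * b) by rewrite -mulrDl; congr (_ * _); rewrite [RHS]addrC addrA subrK.
rewrite trD; [|exact: tcM|exact: tcM].
have h1 := tr_sq_diff hQP fQ fF (E1 _ sQ) (E1 _ sF).
have h2 : `|tr ((F n - Q) * (b * b))| <= e1 * C.
 rewrite mulrA; apply: le_trans (tr_bd _ fF) _; first by apply: inNM=> //; exact: tc_inN.
 apply: ler_pM=> //; rewrite ?opn_ge0 ?ft_ge0 //.
 by apply: opnM_le; rewrite -[e1]mulr1; apply: ler_pM; rewrite ?opn_ge0 ?E1.
have h3 : opn (Q - P) * (opn (a - b) * (ft a + ft b)) <= 1 * (e1 * (C + C)).
 apply: ler_pM; rewrite ?mulr_ge0 ?addr_ge0 ?opn_ge0 ?ft_ge0 //.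
 by apply: ler_pM; rewrite ?addr_ge0 ?opn_ge0 ?ft_ge0 // lerD.
rewrite opprD addrA; apply: le_trans (ler_normB _ _) _.
have : e1 * (3 * C + 1) = e by rewrite /e1 divfK // gt_eqF //; lra.
by lra.
Unshelve. all: by end_near.
Qed.
Lemma sub4 (S T U X : bop K) : S - T - (U - X) = S - U - (T - X).
Proof. by rewrite !opprB addrACA [RHS]addrACA (addrC (- T)). Qed.

Lemma tr_bd_l X G : inN X -> fp G -> `|tr (G * X)| <= opn X * ft G.
Proof. by move=> hX fG; rewrite -(tr_comm_fp hX fG); exact: tr_bd. Qed.

Lemma fn_sum D n (c : nat -> R) (f : nat -> R -> R) : dsa D -> (forall i, bm (f i)) ->
 fn D (fun l => \sum_(i < n) c i * f i l) = \sum_(i < n) rso (c i) (fn D (f i)).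
Proof.
move=> hD hf; elim: n=> [|n IH].
 by rewrite big_ord0; under eq_fun do rewrite big_ord0; rewrite fn0.
under eq_fun do rewrite big_ord_recr /=.
rewrite fnD //; last exact: bmZ.
 by rewrite IH fnZ // big_ord_recr.
by apply: bm_sum=> i; exact: bmZ.
Qed.

(** * Klein's inequality by spectral discretization *)

Section Steps.
Variables (L d : R).
Hypothesis d0 : 0 < d.
Definition spt (i : nat) : R := - L + d * i%:R.
Definition sset (i : nat) : set R := `[spt i, spt i.+1[%classic.

Lemma spt_le i j : (i <= j)%N -> spt i <= spt j.
Proof. by move=> ij; rewrite lerD2l ler_pM2l // ler_nat. Qed.

Lemma ssetE i l : \1_(sset i) l = if spt i <= l < spt i.+1 then 1 else 0 :> R.
Proof. by rewrite indE mem_setE in_itv /=. Qed.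

Lemma step_sum n l : - L <= l -> l < spt n -> exists2 i, (i < n)%N & [/\ `|l - spt i| <= d, - L <= spt i <= l &
 forall c : nat -> R, \sum_(j < n) c j * \1_(sset j) l = c i].
Proof.
move=> lL; elim: n=> [|n IH] ln.
 by move: ln; rewrite /spt mulr0 addr0 ltNge lL.
have [l1|l1] := ltP l (spt n).
 have [i i1 [i2 i4 i3]] := IH l1; exists i; first exact: leqW.
 split=> // c; rewrite big_ord_recr /= i3 ssetE leNgt l1 /= mulr0 addr0 //.
exists n=> //; split.
 have e : spt n.+1 = spt n + d by rewrite /spt -natr1 mulrDr mulr1 addrA.
 by rewrite ger0_norm ?subr_ge0 //; move: ln; rewrite e; lra.
- by rewrite l1 andbT lerDl mulr_ge0 ?ler0n // ltW.
move=> c; rewrite big_ord_recr /= big1 ?add0r ?ssetE ?l1 ?ln ?mulr1 // => j _.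
rewrite ssetE; case: ifP=> [/andP[_ h]|_]; last by rewrite mulr0.
by move: (lt_le_trans h (spt_le (ltn_ord j))); rewrite ltNge l1.
Qed.
End Steps.

Lemma bm_sset L d i : bm (\1_(sset L d i) : R -> R).
Proof. by apply: bm_ind; exact: measurable_itv. Qed.

Section Klein.
Variables (h g : R -> R) (C : R).
Hypotheses (bh : bm h) (bg : bm g) (C0 : 0 <= C).
Hypotheses (h1 : forall l m, `|h l - h m| <= C * `|l - m|) (g1 : forall l m, `|g l - g m| <= C * `|l - m|).
Hypotheses (gC : forall l, `|g l| <= C) (hg : forall l m, `|h m - h l - g l * (m - l)| <= C * (m - l) ^+ 2).

Section OneStep.
Variables (M : bop K) (L d : R) (n : nat).
Hypotheses (sM : sa M) (ML : opn M <= L) (d0 : 0 < d) (nL : L < spt L d n).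
Let o := evr M.
Let ho : dsa o. Proof. exact: dsa_every. Qed.
Definition sproj (i : nat) : bop K := fn o \1_(sset L d i).
(** A step-function version of [F(M)]: on a grid starting at [-L] each cell carries the value of [F]
    at its left end. Different functions share the same projections, so [sop] is multiplicative in
    [F]. *)
Definition sop (F : R -> R) : bop K := \sum_(i < n) rso (F (spt L d i)) (sproj i).

Lemma sop_fn F : sop F = fn o (fun l => \sum_(i < n) F (spt L d i) * \1_(sset L d i) l).
Proof. by rewrite (fn_sum n (fun i => F (spt L d i)) ho (bm_sset L d)). Qed.

Lemma sop_approx (F : R -> R) (B : R) : bm F -> 0 <= B ->
 (forall l m, `|l| <= L -> `|m| <= L -> `|F l - F m| <= B * `|l - m|) ->
 opn (fn o F - sop F) <= B * d.
Proof.
move=> bF B0 hF; rewrite sop_fn.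
have bS : bm (fun l => \sum_(i < n) F (spt L d i) * \1_(sset L d i) l) by apply: bm_sum=> i; apply: bmZ; exact: bm_sset.
have bc := bm_chi L; have E := every_clip sM ML.
rewrite -[fn o F]mulr1 -[X in _ - X]mulr1 -E !fnM //.
apply: fn_opn_diff=> //; [exact: bmM|exact: bmM|by rewrite mulr_ge0 // ltW|move=> l].
rewrite chiE; case: ifP=> hl; last by rewrite !mulr0 subrr normr0 mulr_ge0 // ltW.
move: (hl); rewrite ler_norml=> /andP[l1 l2].
have [i _ [i1 /andP[i3 i4] i2]] := step_sum d0 l1 (le_lt_trans l2 nL).
rewrite (i2 (fun i => F (spt L d i))) !mulr1; apply: le_trans (hF _ _ hl _) _.
 by rewrite ler_norml i3 (le_trans i4).
exact: ler_wpM2l.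
Qed.

Lemma sop1 : sop (fun=> 1) = 1.
Proof.
have := @sop_approx (fun=> 1) 0 (bm_cst 1) (lexx 0).
rewrite mul0r=> /(_ _)H; have /opn_eq0 : opn (fn o (fun=> 1) - sop (fun=> 1)) = 0.
 by apply/eqP; rewrite eq_le opn_ge0 andbT H // => l m _ _; rewrite subrr normr0 mul0r.
by rewrite fn1 // => /eqP; rewrite subr_eq0=> /eqP.
Qed.

Lemma sopM F G : sop F * sop G = sop (fun l => F l * G l).
Proof.
have bS (H : R -> R) : bm (fun l => \sum_(i < n) H (spt L d i) * \1_(sset L d i) l) by apply: bm_sum=> i; apply: bmZ; exact: bm_sset.
have bc := bm_chi L; have E := every_clip sM ML.
rewrite !sop_fn fnM // -[LHS]mulr1 -[RHS]mulr1 -E !fnM //;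
 try solve [exact: bmM | exact: (bS (fun l => F l * G l))].
congr fn; apply/funext=> l; rewrite chiE; case: ifP=> hl; last by rewrite !mulr0.
move: hl; rewrite ler_norml=> /andP[l1 l2].
have [i _ [_ _ i1]] := step_sum d0 l1 (le_lt_trans l2 nL).
rewrite (i1 (fun i => F (spt L d i))) (i1 (fun i => G (spt L d i))).
by rewrite (i1 (fun i => F (spt L d i) * G (spt L d i))).
Qed.

Lemma inN_sproj i : inN M -> inN (sproj i).
Proof. by move=> hM; apply: inN_fn=> //; [exact: affil_every|exact: bm_sset]. Qed.

Lemma inN_sop F : inN M -> inN (sop F).
Proof. by move=> hM; apply: (big_ind inN) => [|S T|i _]; [exact: inN0|exact: inND|apply: inNR; exact: inN_sproj]. Qed.

Lemma sop_opn F (B : R) : 0 <= B -> (forall l, `|F l| <= B) -> opn (sop F) <= B.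
Proof.
move=> B0 FB.
have bS : bm (fun l => \sum_(i < n) F (spt L d i) * \1_(sset L d i) l) by apply: bm_sum=> i; apply: bmZ; exact: bm_sset.
have bc := bm_chi L; have E := every_clip sM ML.
rewrite sop_fn -[X in opn X]mulr1 -E fnM //; apply: fn_opn=> //; first exact: bmM.
move=> l; rewrite chiE; case: ifP=> hl; last by rewrite mulr0 normr0.
move: hl; rewrite ler_norml=> /andP[l1 l2].
have [i _ [_ _ i1]] := step_sum d0 l1 (le_lt_trans l2 nL).
by rewrite (i1 (fun i => F (spt L d i))) mulr1.
Qed.
End OneStep.

Section TwoSteps.
Variables (e M M' : bop K).
Hypotheses (sM : sa M) (sM' : sa M') (hM : inN M) (hM' : inN M') (pe : proj e) (fe : fp e).
Hypotheses (eM : e * M = M * e) (eM' : e * M' = M' * e).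

Lemma comm_every X f : sa X -> e * X = X * e -> bm f ->
 e * fn (evr X) f = fn (evr X) f * e.
Proof.
move=> sX eX bf; have hX := dsa_every sX.
by apply: fn_inter=> // x _; split=> //; rewrite /= -!opM eX.
Qed.

(** Inserting both resolutions of the identity turns either trace into a double sum with the same
    weights [t i j = tr(e P_i P'_j)]. The weights are nonnegative, so the scalar Taylor estimate
    [hg] holds term by term. *)
Lemma klein_step L d n : opn M <= L -> opn M' <= L -> 0 < d -> L < spt L d n ->
 `|tr (e * (sop M' L d n h - sop M L d n h - sop M L d n g * (sop M' L d n id - sop M L d n id)))| <=
 C * tr (e * ((sop M' L d n id - sop M L d n id) * (sop M' L d n id - sop M L d n id))).
Proof.
move=> ML M'L d0 nL; set H := sop M L d n; set H' := sop M' L d n.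
have he : inN e by case: fe=> -[].
have [te _] := fp_tc fe.
have aM := affil_every hM; have aM' := affil_every hM'.
have hS F : inN (H F) by exact: inN_sop.
have hS' F : inN (H' F) by exact: inN_sop.
pose a i : R := spt L d i.
pose t (i j : nat) := tr (e * (sproj M L d i * sproj M' L d j)).
have tc1 X : inN X -> tc (e * X) by move=> hX; exact: tcMr.
have hs i : inN (sproj M L d i) by exact: (inN_sproj sM ML d0 nL).
have hs' i : inN (sproj M' L d i) by exact: (inN_sproj sM' M'L d0 nL).
have t0 i j : 0 <= t i j.
 have p1 : proj (sproj M L d i) by apply: fn_proj; [exact: dsa_every|exact: measurable_itv].
 have p2 : proj (sproj M' L d j) by apply: fn_proj; [exact: dsa_every|exact: measurable_itv].
 (* This is where [e] must commute with [M]: [e P_i] is then a projection, and [t i j] is the trace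
    of the positive [P'_j (e P_i) P'_j]. *)
 have p3 : proj (e * sproj M L d i) by apply: projM=> //; apply: (comm_every sM eM); exact: bm_sset.
 have -> : t i j = tr (adj (sproj M' L d j) * (e * sproj M L d i) * sproj M' L d j).
  rewrite p2.1 -[in RHS]mulrA (tr_comm (hs' j)); last by rewrite -mulrA; apply: tc1; exact: inNM.
  by rewrite /t -!mulrA p2.2.
 apply: tr_ge0; first by apply: pos_conj; exact: proj_pos.
 rewrite -mulrA; apply: tcM; first exact: inN_adj.
 by rewrite -mulrA; apply: tc1; exact: inNM.
have tsum I (r : seq I) (F : I -> bop K) : (forall i, inN (F i)) -> tr (e * (\sum_(i <- r) F i)) = \sum_(i <- r) tr (e * F i).
 move=> hF; elim: r=> [|i r IH]; first by rewrite !big_nil mulr0 tr0.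
 rewrite !big_cons mulrDr trD ?IH //; [exact: tc1|apply: tc1].
 by apply: (big_ind inN) => //; [exact: inN0|exact: inND].
have dbl F G : tr (e * (H F * H' G)) = \sum_(i < n) \sum_(j < n) F (a i) * G (a j) * t i j.
 rewrite /H /sop mulr_suml tsum=> [|i]; last by apply: inNM; [exact: inNR|exact: hS'].
 apply: eq_bigr=> i _; rewrite /H' /sop mulr_sumr tsum=> [|j]; last by apply: inNM; exact: inNR.
 apply: eq_bigr=> j _; rewrite rsoMl (rsoMr (G _) (sproj M L d i)) rsoA rsoMr trR //.
 by apply: tc1; exact: inNM.
have one : H (fun=> 1) = 1 by exact: sop1.
have one' : H' (fun=> 1) = 1 by exact: sop1.
have lin F G P Q : tc F -> tc G -> tc P -> tc Q -> tr (F - G - (P - Q)) = tr F - tr G - tr P + tr Q by move=> *; rewrite !trB //; [lra|exact: tcB|exact: tcB].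
have -> : tr (e * (H' h - H h - H g * (H' id - H id))) =
  \sum_(i < n) \sum_(j < n) (h (a j) - h (a i) - g (a i) * (a j - a i)) * t i j.
 have -> : e * (H' h - H h - H g * (H' id - H id)) = e * (H (fun=> 1) * H' h) - e * (H h * H' (fun=> 1)) -
   (e * (H g * H' id) - e * (H (fun l => g l * l) * H' (fun=> 1))).
  rewrite one one' mul1r !mulr1 -[H (fun l => g l * l)](sopM sM ML d0 nL g id).
  by rewrite !mulrBr.
 rewrite lin; [|by apply: tc1; apply: inNM ..].
 rewrite !dbl -!sumrB -big_split /=; apply: eq_bigr=> i _.
 rewrite -!sumrB -big_split /=; apply: eq_bigr=> j _; lra.
have -> : tr (e * ((H' id - H id) * (H' id - H id))) = \sum_(i < n) \sum_(j < n) (a j - a i) ^+ 2 * t i j.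
 have c1 : H id * e = e * H id.
  rewrite /H (sop_fn sM ML d0 nL) (comm_every sM eM) //.
  by apply: bm_sum=> i; apply: bmZ; exact: bm_sset.
 have sw : tr (e * (H' id * H id)) = tr (e * (H id * H' id)).
  rewrite mulrA -(tr_comm (hS id)); last exact: tc1.
  by rewrite mulrA c1 -mulrA.
 have -> : e * ((H' id - H id) * (H' id - H id)) = e * (H (fun=> 1) * H' (fun l => l * l)) - e * (H id * H' id) -
   (e * (H' id * H id) - e * (H (fun l => l * l) * H' (fun=> 1))).
  rewrite one one' mul1r !mulr1 -[H' (fun l => l * l)](sopM sM' M'L d0 nL id id).
  rewrite -[H (fun l => l * l)](sopM sM ML d0 nL id id) -!mulrBr; congr (_ * _).
  by rewrite mulrBl !mulrBr sub4.
 rewrite lin; [|by apply: tc1; apply: inNM ..].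
 rewrite sw !dbl -!sumrB -big_split /=; apply: eq_bigr=> i _.
 rewrite -!sumrB -big_split /=; apply: eq_bigr=> j _; rewrite expr2; lra.
rewrite mulr_sumr; apply: le_trans (ler_norm_sum _ _ _) _; apply: ler_sum=> i _.
rewrite mulr_sumr; apply: le_trans (ler_norm_sum _ _ _) _; apply: ler_sum=> j _.
by rewrite normrM (ger0_norm (t0 i j)) mulrA; apply: ler_wpM2r.
Qed.

(** Replacing the operators by their discretizations of mesh [d] changes every term by a multiple of
    [d ft e]; letting [d] tend to 0 leaves the bound of [klein_step]. *)
Lemma klein :
 `|tr (e * (fn (evr M') h - fn (evr M) h -
      fn (evr M) g * (M' - M)))| <= C * opn (M' - M) ^+ 2 * ft e.
Proof.
set F := fn (evr M); set F' := fn (evr M'); have f0 := ft_ge0 fe; set q := ft e in f0 *; set D := opn (M' - M).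
have D0 : 0 <= D := opn_ge0 _.
pose L := Order.max (opn M) (opn M').
have ML : opn M <= L by rewrite le_max lexx.
have M'L : opn M' <= L by rewrite le_max lexx orbT.
have hF f : bm f -> inN (F f) by move=> bf; apply: inN_fn=> //; [exact: dsa_every|exact: affil_every].
have hF' f : bm f -> inN (F' f) by move=> bf; apply: inN_fn=> //; [exact: dsa_every|exact: affil_every].
have main d : 0 < d -> d <= 1 ->
  `|tr (e * (F' h - F h - F g * (M' - M)))| <= C * D ^+ 2 * q + d * (q * (C * (4 * D + 4) + (2 * C + (C * D + C * 2)))).
 move=> d0 d1.
 have [n hn] := nat_gt (2 * L / d).
 have nL : L < spt L d n by move: hn; rewrite ltr_pdivrMr // /spt mulrC; lra.
 have he : inN e by case: fe=> -[].
 have := klein_step ML M'L d0 nL; set H := sop M L d n; set H' := sop M' L d n.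
 have hS f : inN (H f) by exact: inN_sop.
 have hS' f : inN (H' f) by exact: inN_sop.
 have idc X (sX : sa X) (XL : opn X <= L) : opn (X - sop X L d n id) <= d.
  pose L' := Order.max L (spt L d n).
  have LL' : L <= L' by rewrite le_max lexx.
  have := sop_approx sX XL d0 nL (bm_clip L') ler01; rewrite mul1r every_fn ?(le_trans XL) //.
  have -> : sop X L d n (fun l => l * chi L' l) = sop X L d n id.
   apply: eq_bigr=> i _; rewrite chiE ler_norml; case: ifPn; rewrite ?mulr1 // => /negP[].
   apply/andP; split.
    apply: (@le_trans _ _ (- L)); first by rewrite lerN2.
    by rewrite lerDl mulr_ge0 ?ler0n // ltW.
   by rewrite le_max (spt_le L d0 (ltnW (ltn_ord i))) orbT.
  apply=> l m l1 l2; rewrite !chiE (le_trans l1 LL') (le_trans l2 LL') !mulr1 mul1r //.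
 have i1 : opn (M - H id) <= d by exact: idc.
 have i2 : opn (M' - H' id) <= d by exact: idc.
 have a1 : opn (F h - H h) <= C * d by exact: sop_approx.
 have a2 : opn (F' h - H' h) <= C * d by exact: sop_approx.
 have a3 : opn (F g - H g) <= C * d by exact: sop_approx.
 have a4 : opn (H g) <= C by exact: sop_opn.
 set Y := H' h - H h - H g * (H' id - H id) => k1.
 have dd : opn (M' - M - (H' id - H id)) <= 2 * d.
  have -> : M' - M - (H' id - H id) = (M' - H' id) - (M - H id).
   exact: sub4.
  by have := opnB (M' - H' id) (M - H id); lra.
 have hd : opn (H' id - H id) <= D + 2 * d.
  have -> : H' id - H id = M' - M - (M' - M - (H' id - H id)) by rewrite [RHS]subKr.
  by have := opnB (M' - M) (M' - M - (H' id - H id)); rewrite -/D; lra.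
 have hS1 : inN (H' id - H id) by exact: inNB.
 have k2 : tr (e * ((H' id - H id) * (H' id - H id))) <= (D + 2 * d) ^+ 2 * q.
  apply: le_trans (ler_norm _) _; apply: le_trans (tr_bd_l _ fe) _; first exact: inNM.
  apply: ler_wpM2r=> //; apply: opnM_le.
  by rewrite expr2; apply: ler_pM; rewrite ?opn_ge0.
 set Z := F' h - F h - F g * (M' - M).
 have hZ : inN Z by apply: inNB; [apply: inNB; [exact: hF'|exact: hF] | apply: inNM; [exact: hF|exact: inNB]].
 have hY : inN Y by apply: inNB; [exact: inNB|exact: inNM].
 have ZY : opn (Z - Y) <= 2 * C * d + (C * d * D + C * (2 * d)).
  have -> : Z - Y = (F' h - H' h) - (F h - H h) - ((F g - H g) * (M' - M) + H g * (M' - M - (H' id - H id))).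
   rewrite mulrBl (mulrBr (H g) (M' - M)) addrA subrK /Z /Y.
   apply: bop_ext=> x; apply: ip_ext=> z; rewrite !(opB, opM, ipBl); lra.
  apply: le_trans (opnB _ _) _.
  have b1 := opnB (F' h - H' h) (F h - H h).
  have b2 := opnD ((F g - H g) * (M' - M)) (H g * (M' - M - (H' id - H id))).
  have b3 : opn ((F g - H g) * (M' - M)) <= C * d * D by apply: opnM_le; apply: ler_wpM2r.
  have b4 : opn (H g * (M' - M - (H' id - H id))) <= C * (2 * d) by apply: opnM_le; apply: ler_pM; rewrite ?opn_ge0.
  lra.
 have tZY : `|tr (e * (Z - Y))| <= (2 * C * d + (C * d * D + C * (2 * d))) * q.
  apply: le_trans (tr_bd_l _ fe) _; first exact: inNB.
  exact: ler_wpM2r.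
 have [te _] := fp_tc fe.
 have -> : e * Z = e * Y + e * (Z - Y) by rewrite -mulrDr addrC subrK.
 rewrite trD; [|exact: tcMr|by apply: tcMr=> //; exact: inNB].
 apply: le_trans (ler_normD _ _) _.
 have k3 := le_trans k1 (ler_wpM2l C0 k2).
 have k4 : C * ((D + 2 * d) ^+ 2 * q) <= C * D ^+ 2 * q + d * (q * (C * (4 * D + 4))).
  have -> : C * D ^+ 2 * q + d * (q * (C * (4 * D + 4))) = C * ((D ^+ 2 + d * (4 * D + 4)) * q) by lra.
  apply: ler_wpM2l=> //; apply: ler_wpM2r=> //.
  have : d * d <= d * 1 by rewrite ler_pM2l.
  by rewrite !expr2; lra.
 lra.
set c := q * _ in main; apply/ler_addgt0Pr=> r r0.
have c0 : 0 <= c.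
 apply: mulr_ge0=> //; rewrite !addr_ge0 ?mulr_ge0 ?addr_ge0 ?mulr_ge0 //.
pose d := Order.min 1 (r / (c + 1)).
have d0 : 0 < d by rewrite lt_min ltr01 divr_gt0 //; lra.
have d1 : d <= 1 by rewrite ge_min lexx.
have d2 : d * (c + 1) <= r by rewrite -ler_pdivlMr ?ge_min ?lexx ?orbT //; lra.
by apply: le_trans (main d d0 d1) _; rewrite lerD2l; lra.
Qed.
End TwoSteps.
End Klein.

(** * One-variable calculus on closed intervals *)

Section Within.
Local Notation mu := (@lebesgue_measure R).
Implicit Types (F : R -> R) (p q : R).

Lemma within_ed f p q : (forall t, p <= t <= q -> forall e, 0 < e -> exists2 d, 0 < d &
  forall s, p <= s <= q -> `|s - t| <= d -> `|f s - f t| <= e) ->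
 {within `[p, q]%classic, continuous f}.
Proof.
move=> h; apply/subspace_continuousP=> t /=; rewrite in_itv /= => ht.
apply/cvgrPdist_le=> e e0; have [d d0 hd] := h t ht e e0.
rewrite near_withinE; near=> s=> /=; rewrite in_itv /= => hs.
rewrite distrC; apply: hd=> //; rewrite distrC; near: s; exact: (iffLR cvgrPdist_le (@cvg_id _ (nbhs t)) d d0).
Unshelve. all: by end_near. Qed.

(** Differentiability is expressed by first-order remainders relative to the interval, which
    includes one-sided derivatives at the end points and matches the derivatives of paths. *)
Lemma ftc_within F f p q : p < q -> {within `[p, q]%classic, continuous f} ->
 (forall t, p <= t <= q -> forall e, 0 < e -> exists2 d, 0 < d &
  forall s, p <= s <= q -> `|s - t| <= d -> `|F s - F t - (s - t) * f t| <= e * `|s - t|) ->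
 \int[mu]_(x in `[p, q]) f x = F q - F p.
Proof.
move=> pq cf h.
have cF : {within `[p, q]%classic, continuous F}.
 apply: within_ed=> t ht e e0; have [d d0 hd] := h t ht 1 ltr01.
 have c0 : 0 < 1 + `|f t| by rewrite ltr_pwDl.
 exists (Order.min d (e / (1 + `|f t|))); first by rewrite lt_min d0 divr_gt0.
 move=> s hs; rewrite le_min=> /andP[sd se].
 have := hd s hs sd; rewrite mul1r=> hF.
 have -> : F s - F t = (F s - F t - (s - t) * f t) + (s - t) * f t by rewrite subrK.
 apply: le_trans (ler_normD _ _) _; rewrite normrM.
 by move: se; rewrite ler_pdivlMr //; lra.
have dF t : t \in `]p, q[ -> is_derive t 1 F (f t).
 rewrite in_itv /= => /andP[pt tq].
 have lim : (h0^-1 *: (F (h0 *: 1 + t) - F t)) @[h0 --> 0^'] --> f t.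
  apply/cvgrPdist_le=> e e0.
  have [|d d0 hd] := h t _ e e0; first by rewrite !ltW.
  have m0 : 0 < Order.min d (Order.min (t - p) (q - t)) by rewrite !lt_min d0 !subr_gt0 pt.
  near=> y.
  have y0 : y != 0 by near: y; exact: nbhs_dnbhs_neq.
  have ym : `|y| <= Order.min d (Order.min (t - p) (q - t)).
   near: y; apply: dnbhs0_le; exact: m0.
  move: ym; rewrite !le_min=> /and3P[y1 y2 y3].
  have := hd (y *: 1 + t).
  have -> : y *: (1 : R) = y by rewrite scaler1.
  rewrite addrK=> /(_ _ y1)h1.
  rewrite distrC; have -> : y^-1 *: (F (y + t) - F t) - f t = y^-1 * (F (y + t) - F t - y * f t).
   by rewrite mulrBr mulrA mulVf // mul1r.
  rewrite normrM normfV -(@ler_pM2l _ `|y|) ?normr_gt0 // mulrA mulfV ?normr_eq0 // mul1r [leRHS]mulrC.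
  apply: h1; move: y2 y3; rewrite !ler_norml=> /andP[a1 a2] /andP[a3 a4]; apply/andP; split; lra.
 by apply: DeriveDef; [apply/cvg_ex; exists (f t)|exact: cvg_lim].
have [cp cq] : F @ p^'+ --> F p /\ F @ q^'- --> F q by move/continuous_within_itvP: cF=> /(_ pq)[_ ].
rewrite /Rintegral (@continuous_FTC2 _ f F p q) //.
- by split=> // t /dF ?; exact: ex_derive.
- by move=> t /dF ?; rewrite derive1E derive_val.
Unshelve. all: by end_near. Qed.

Lemma within_int f p q : {within `[p, q]%classic, continuous f} ->
 mu.-integrable `[p, q] (EFin \o f).
Proof. by move=> cf; apply: continuous_compact_integrable=> //; exact: segment_compact. Qed.

Lemma within_bd f p q : p <= q -> {within `[p, q]%classic, continuous f} ->
 exists2 c, 0 <= c & forall t, p <= t <= q -> f t <= c.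
Proof.
move=> pq cf; have [c _ hc] := EVT_max pq cf.
exists `|f c| => // t ht; apply: le_trans (ler_norm _).
by apply: hc; rewrite in_itv.
Qed.

Lemma int_diff_bd f g p q (e : R) : p < q -> {within `[p, q]%classic, continuous f} ->
 {within `[p, q]%classic, continuous g} -> (forall t, p <= t <= q -> `|f t - g t| <= e) ->
 `|\int[mu]_(x in `[p, q]) f x - \int[mu]_(x in `[p, q]) g x| <= e * (q - p).
Proof.
move=> pq cf cg h; have fi := within_int cf; have gi := within_int cg.
have mI : measurable (`[p, q]%classic : set R) by exact: measurable_itv.
have di : mu.-integrable `[p, q] (EFin \o (fun t => f t - g t)).
 rewrite (_ : _ \o _ = (EFin \o f) \- (EFin \o g))%E; first exact: integrableB.
 by apply/funext=> t; rewrite /= EFinB.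
rewrite -RintegralB //.
apply: (@le_trans _ _ (\int[mu]_(x in `[p, q]) `|f x - g x|)); first exact: le_normr_Rintegral.
have -> : e * (q - p) = \int[mu]_(t in `[p, q]) e by rewrite Rintegral_cst //= lebesgue_measure_itv /= lte_fin pq -EFinB.
apply: le_Rintegral=> //; first exact: (integrable_norm di).
 apply: within_int; apply: within_ed=> t _ r r0; exists 1=> // s _ _.
 by rewrite subrr normr0 ltW.
Qed.
End Within.

Lemma perturb_perturb D S T : perturb (perturb D S) T = perturb D (S + T).
Proof. by rewrite /perturb /=; congr Operator; apply/funext=> x; rewrite /= -addrA. Qed.

Lemma perturb0 D : perturb D (0 : bop K) = D.
Proof. by case: D=> d f; rewrite /perturb /=; congr Operator; apply/funext=> x; exact: addr0. Qed.

Lemma heat_lip t e : 0 < t -> 0 < e -> exists2 d, 0 < d & forall D S T, dsa D -> sa S -> sa T ->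
 opn (S - T) <= d ->
 opn (fn (perturb D S) (gs t) - fn (perturb D T) (gs t)) <= e.
Proof.
move=> t0 e0; have [[_ h] _] := rcont_heat t0; have [d d0 k] := h _ e0.
exists (d / 2) => [|D S T hD sS sT ST]; first by rewrite divr_gt0.
apply: k; [exact: dsa_perturb|exact: dsa_perturb |].
have := res_lip (dsa_perturb hD sT) (saB sS sT); rewrite perturb_perturb [T + _]addrC subrK.
by apply: res_near_le; lra.
Qed.

Lemma gs_half (t l : R) : gs t l = gs (t / 2) l * gs (t / 2) l.
Proof. by rewrite /gs -expRD; congr expR; lra. Qed.

(** * Compressions to spectral projections of finite trace *)

Section Corner.
Variable D : operator K.
Hypotheses (hD : dsa D) (aD : aff D).
Hypothesis th : forall s, 0 < s -> fp (fn D (gs s)).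

Definition ec (n : nat) : bop K := fn D (chi n%:R).
Definition cut n T : bop K := ec n * T * ec n.

Lemma ec_proj n : proj (ec n). Proof. by apply: fn_proj=> //; exact: measurable_itv. Qed.
Lemma ec_fp n : fp (ec n). Proof. exact: fp_chi. Qed.
Lemma inN_ec n : inN (ec n). Proof. by apply: inN_fn=> //; exact: bm_chi. Qed.
Lemma ec_opn n : opn (ec n) <= 1. Proof. exact: proj_opn (ec_proj n). Qed.
Lemma cutB n S T : cut n (S - T) = cut n S - cut n T.
Proof. by rewrite /cut mulrBr mulrBl. Qed.
Lemma cutR n c T : cut n (rso c T) = rso c (cut n T).
Proof. by rewrite /cut rsoMr rsoMl. Qed.
Lemma sa_cut n T : sa T -> sa (cut n T).
Proof. by move=> sT; have := sa_conj (ec n) sT; rewrite (ec_proj n).1. Qed.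
Lemma inN_cut n T : inN T -> inN (cut n T).
Proof. by move=> hT; apply: inNM; [apply: inNM=> // |]; exact: inN_ec. Qed.
Lemma cut_opn n T : opn (cut n T) <= opn T.
Proof.
apply: opnM_le; rewrite -[leRHS]mulr1; apply: ler_pM; rewrite ?opn_ge0 ?ec_opn //.
by apply: opnM_le; rewrite -[leRHS]mul1r; apply: ler_pM; rewrite ?opn_ge0 ?ec_opn.
Qed.
Lemma cut_e n T : ec n * cut n T = cut n T /\ cut n T * ec n = cut n T.
Proof. by have [_ E] := ec_proj n; rewrite /cut; split; [rewrite !mulrA E|rewrite -mulrA E]. Qed.

Lemma ec_comm n T f : sa T -> bm f ->
 ec n * fn (perturb D (cut n T)) f = fn (perturb D (cut n T)) f * ec n.
Proof.
move=> sT bf; have hT := dsa_perturb hD (sa_cut n sT).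
apply: fn_inter=> // x hx; have [h1 h2] := fn_fc_dom hD (bm_chi n%:R) hx; split=> //.
have [e1 e2] := cut_e n T.
change (D (ec n x) + cut n T (ec n x) = ec n (D x + cut n T x)).
by rewrite op_add -!opM e1 e2 h2.
Qed.

(** Off [[-n, n]] the projection is [w(D) D] with [opn (w(D)) <= 1/n], and [D f(D + T)] equals
    [(l f)(D + T) - T f(D + T)], which is bounded. *)
Lemma op_cut T f c d n : sa T -> (0 < n)%N -> bm f -> bm (fun l : R => l * f l) -> 0 <= c -> 0 <= d ->
 (forall l, `|l * f l| <= c) -> (forall l, `|f l| <= d) ->
 opn ((1 - ec n) * fn (perturb D T) f) <= (c + opn T * d) / n%:R.
Proof.
move=> sT n0 bf blf c0 d0 hc hd; have hT := dsa_perturb hD sT.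
have nn : 0 < n%:R :> R by rewrite ltr0n.
have bc := bm_chi n%:R.
(* [w] is [1/l] off [[-n, n]] and 0 on it; dividing by [q], which is at least [n^2], shows that it
   is measurable. *)
pose q (l : R) := l ^+ 2 * (1 - chi n%:R l) + n%:R ^+ 2 * chi n%:R l.
pose w (l : R) := l * (1 - chi n%:R l) * (q l)^-1.
have qE l : q l = if `|l| <= n%:R then n%:R ^+ 2 else l ^+ 2 by rewrite /q chiE; case: ifP=> _; rewrite ?subrr ?subr0 ?mulr0 ?mulr1 ?addr0 ?add0r.
have lw l : l * w l = 1 - chi n%:R l.
 rewrite /w qE chiE; case: ifP=> h; first by rewrite subrr mulr0 mul0r mulr0.
 rewrite subr0 mulr1 mulrA -expr2 divff // sqrf_eq0; apply/eqP=> l0.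
 by move: h; rewrite l0 normr0 ler0n.
have bw : bm w.
 have mid : measurable_fun setT (@id R) by exact: measurable_id.
 split.
  apply: measurable_funM.
   by apply: measurable_funM=> //; case: (bmB (bm_cst 1) bc).
  apply: (@mf_inv _ _ _ q (n%:R ^+ 2)); first by rewrite exprn_gt0.
   move=> l; rewrite qE; case: ifPn=> //; rewrite -ltNge=> h.
   by rewrite -(sqn l) ler_pXn2r ?nnegrE // ltW.
  apply: measurable_funD; last by apply: measurable_funM; [exact: measurable_cst|case: bc].
  by apply: measurable_funM; [exact: measurable_funX|case: (bmB (bm_cst 1) bc)].
 exists n%:R^-1=> l; have [l0|l0] := eqVneq l 0; first by rewrite /w l0 !mul0r normr0.
 rewrite -(@ler_pM2l _ `|l|) ?normr_gt0 // -normrM lw chiE; case: ifP=> h.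
  by rewrite subrr normr0 mulr_ge0 // ltW // invr_gt0.
 rewrite subr0 normr1 ler_pdivlMr // mul1r ltW // ltNge; by rewrite h.
have wn l : `|w l| <= n%:R^-1.
 have [l0|l0] := eqVneq l 0; first by rewrite /w l0 !mul0r normr0.
 rewrite -(@ler_pM2l _ `|l|) ?normr_gt0 // -normrM lw chiE; case: ifP=> h.
  by rewrite subrr normr0 mulr_ge0 // ltW // invr_gt0.
 by rewrite subr0 normr1 ler_pdivlMr // mul1r ltW // ltNge h.
have blw : bm (fun l : R => l * w l).
 rewrite (_ : (fun l : R => l * w l) = fun l => 1 - chi n%:R l); last by apply/funext.
 by apply: bmB=> //; exact: bm_cst.
have -> : 1 - ec n = fn D (fun l => l * w l).
 rewrite (_ : (fun l : R => l * w l) = fun l => 1 - chi n%:R l); last by apply/funext.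
 by rewrite fnB ?fn1 //; exact: bm_cst.
apply: opn_le; first by rewrite divr_ge0 ?addr_ge0 ?mulr_ge0 ?opn_ge0 // ltW.
move=> x; rewrite opM; set y := fn (perturb D T) f x.
have [hy Dy] : op_dom (perturb D T) y /\ perturb D T y = fn (perturb D T) (fun l => l * f l) x.
 exact: fn_dom.
have [_ h1] := fn_dom hD y bw blw; have [_ h2] := fn_fc_dom hD bw hy.
rewrite -h1 h2.
have -> : D y = fn (perturb D T) (fun l => l * f l) x - T y by rewrite -Dy; change (D y = D y + T y - T y); rewrite addrK.
have wo : opn (fn D w) <= n%:R^-1 by apply: fn_opn=> //; rewrite ltW // invr_gt0.
apply: le_trans (opnP _ _) _; rewrite [leRHS]mulrAC mulrC.
apply: ler_pM; rewrite ?opn_ge0 ?nm_ge0 //.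
apply: le_trans (nmB _ _) _; rewrite mulrDl; apply: lerD.
 apply: le_trans (opnP _ _) _; apply: ler_wpM2r; first exact: nm_ge0.
 exact: fn_opn.
apply: le_trans (opnP _ _) _; rewrite -mulrA; apply: ler_wpM2l; first exact: opn_ge0.
apply: le_trans (opnP _ _) _; apply: ler_wpM2r; first exact: nm_ge0.
exact: fn_opn.
Qed.

(** [cut n T - T] need not be small in norm, but every term of it has a factor [1 - E_n] at an end,
    and in [res_id] that factor meets a resolvent, where [op_cut] gives [O(1/n)]. *)
Lemma cut_res T n : sa T -> (0 < n)%N ->
 res_near (4 * (opn T * ((1 + opn T) / n%:R))) (perturb D T) (perturb D (cut n T)).
Proof.
move=> sT n0; have hT := dsa_perturb hD sT; have sC := sa_cut n sT; have hC := dsa_perturb hD sC.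
have [c1 b1] := cf_opn hT; have [c2 b2] := cf_opn hC.
have [e1 e2] := res_id hT (saB sC sT); rewrite perturb_perturb [T + _]addrC subrK in e1 e2.
pose u S := (1 + opn S * 1) / n%:R.
have cu S : sa S -> opn ((1 - ec n) * fn (perturb D S) (@cf R)) <= u S /\ opn ((1 - ec n) * fn (perturb D S) (@bf R)) <= u S.
 move=> sS; split; apply: op_cut=> //; try exact: bm_cf; try exact: bm_bf; try exact: bm_lbf; try exact: bf_le1.
  by move=> l; rewrite ger0_norm ?cf_ge0 ?cf_le1.
 by move=> l; rewrite lbfE ger0_norm ?subr_ge0 ?cf_le1 // lerBlDr lerDl cf_ge0.
have uT : u (cut n T) <= u T by rewrite /u ler_pM2r ?invr_gt0 ?ltr0n // lerD2l !mulr1 cut_opn.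
have [k1 k2] := cu _ sT; have [k3 k4] := cu _ sC.
have key (X Y : bop K) : sa X -> opn X <= 1 -> opn Y <= 1 -> opn ((1 - ec n) * X) <= u (cut n T) ->
  opn ((1 - ec n) * Y) <= u T -> opn (X * (cut n T - T) * Y) <= 2 * (opn T * u T).
 move=> sX x y hX hY.
 have -> : X * (cut n T - T) * Y = - (X * (1 - ec n) * (T * (ec n * Y)) + X * (T * ((1 - ec n) * Y))).
  rewrite -opprB mulrN mulNr (_ : T - cut n T = (1 - ec n) * T * ec n + T * (1 - ec n)).
  by rewrite mulrDr mulrDl !mulrA.
 by rewrite /cut !mulrBl mul1r mulrBr mulr1 [RHS]addrC addrA subrK.
 rewrite opnN; apply: le_trans (opnD _ _) _; rewrite mulr_natl mulr2n; apply: lerD.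
  apply: opnM_le; rewrite mulrC; apply: ler_pM; rewrite ?opn_ge0 //.
   apply: opnM_le; rewrite ler_piMr ?opn_ge0 //.
   by apply: opnM_le; rewrite mulr_ile1 ?opn_ge0 ?ec_opn.
  by rewrite -opn_adj adjM sX (projC (ec_proj n)).1 (le_trans hX).
 apply: opnM_le; apply: le_trans (_ : 1 * opn (T * ((1 - ec n) * Y)) <= _).
  by apply: ler_wpM2r; rewrite ?opn_ge0.
 by rewrite mul1r; apply: opnM_le; apply: ler_wpM2l; rewrite ?opn_ge0.
have sc : sa (fn (perturb D (cut n T)) (@cf R)) by apply: fn_sa=> //; exact: bm_cf.
have sb : sa (fn (perturb D (cut n T)) (@bf R)) by apply: fn_sa=> //; exact: bm_bf.
have -> : 4 * (opn T * ((1 + opn T) / n%:R)) = 2 * (opn T * u T) + 2 * (opn T * u T) by rewrite /u mulr1; ring.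
by split; rewrite ?e1 ?e2 ?opnN; [apply: le_trans (opnD _ _) _|apply: le_trans (opnB _ _) _];
 apply: lerD; exact: key.
Qed.

(** The index [n0] depends on [T] only through the bound [a]; along a path this makes the
    convergence uniform in the parameter. *)
Lemma heat_conv t a e : 0 < t -> 0 <= a -> 0 < e -> exists n0, forall n T, (n0 <= n)%N ->
 sa T -> opn T <= a ->
 opn (fn (perturb D (cut n T)) (gs t) - fn (perturb D T) (gs t)) <= e /\
 opn (fn (perturb D (cut n T)) (fun l => l * gs t l) - fn (perturb D T) (fun l => l * gs t l)) <= e.
Proof.
move=> t0 a0 e0; have [[_ hg] [_ hl]] := rcont_heat t0.
have [d1 p1 k1] := hg _ e0; have [d2 p2 k2] := hl _ e0.
pose d := Num.min d1 d2; have d0 : 0 < d by rewrite lt_min p1.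
have [n0 hn] := nat_gt (4 * (a * (1 + a)) / d); exists n0.+1=> n T nn sT Ta.
have np : (0 < n)%N by exact: leq_trans nn.
have nr : 0 < n%:R :> R by rewrite ltr0n.
have near : res_near d (perturb D T) (perturb D (cut n T)).
 apply: res_near_le (cut_res sT np); rewrite !mulrA ler_pdivrMr // (mulrC d) -ler_pdivrMr //.
 apply: (@le_trans _ _ n0%:R); last by rewrite ler_nat ltnW.
 apply: le_trans (ltW hn); rewrite ler_pM2r ?invr_gt0 // -mulrA ler_pM2l //.
 by apply: ler_pM; rewrite ?opn_ge0 ?addr_ge0 ?opn_ge0 ?lerD2l.
have hT := dsa_perturb hD sT; have hC := dsa_perturb hD (sa_cut n sT).
by split; [apply: k1|apply: k2]=> //; apply: res_near_le near; rewrite /d ge_min lexx ?orbT.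
Qed.
End Corner.
Lemma bm_gse (t : R) : 0 < t -> bm (gs t). Proof. by move=> t0; exact/bm_gs/ltW. Qed.

Record C1path p q (A A' : R -> bop K) : Prop := MkC1path {
 c1_sa : forall t, p <= t <= q -> sa (A t) /\ inN (A t) ;
 c1_sa' : forall t, p <= t <= q -> sa (A' t) /\ inN (A' t) ;
 c1_d : forall t, p <= t <= q -> forall e, 0 < e -> exists2 d, 0 < d & forall s, p <= s <= q ->
  `|s - t| <= d -> opn (A s - A t - rso (s - t) (A' t)) <= e * `|s - t| ;
 c1_c : forall t, p <= t <= q -> forall e, 0 < e -> exists2 d, 0 < d & forall s, p <= s <= q ->
  `|s - t| <= d -> opn (A' s - A' t) <= e }.

Lemma opn_dist S T : `|opn S - opn T| <= opn (S - T).
Proof.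
have h1 := opnD (S - T) T; have h2 := opnD (T - S) S; rewrite !subrK (opn_bc T) in h1 h2.
by rewrite ler_norml; apply/andP; split; lra.
Qed.

Section Path.
Variables (p q : R) (A A' : R -> bop K).
Hypotheses (pq : p < q) (cA : C1path p q A A').

Lemma c1_lip t : p <= t <= q -> exists2 d, 0 < d & forall s, p <= s <= q -> `|s - t| <= d ->
 opn (A s - A t) <= (1 + opn (A' t)) * `|s - t|.
Proof.
move=> ht; have [d d0 h] := c1_d cA ht ltr01; exists d=> // s hs sd.
have -> : A s - A t = A s - A t - rso (s - t) (A' t) + rso (s - t) (A' t) by rewrite subrK.
apply: le_trans (opnD _ _) _; have := h s hs sd; have := opnR (s - t) (A' t); lra.
Qed.

Lemma c1_cont t : p <= t <= q -> forall e, 0 < e -> exists2 d, 0 < d & forall s, p <= s <= q ->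
 `|s - t| <= d -> opn (A s - A t) <= e.
Proof.
move=> ht e e0; have [d d0 h] := c1_lip ht.
have c0 : 0 < 1 + opn (A' t) by rewrite ltr_pwDl ?opn_ge0.
exists (Order.min d (e / (1 + opn (A' t)))); first by rewrite lt_min d0 divr_gt0.
move=> s hs; rewrite le_min=> /andP[sd se]; apply: le_trans (h s hs sd) _.
by rewrite mulrC -ler_pdivlMr.
Qed.

Lemma c1_bd : exists2 a, 0 <= a & forall t, p <= t <= q -> opn (A t) <= a /\ opn (A' t) <= a.
Proof.
have [|a1 p1 h1] := @within_bd (fun t => opn (A t)) p q (ltW pq).
 apply: within_ed=> t ht e e0; have [d d0 h] := c1_cont ht e0.
 by exists d=> // s hs sd; apply: le_trans (opn_dist _ _) _; exact: h.
have [|a2 p2 h2] := @within_bd (fun t => opn (A' t)) p q (ltW pq).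
 apply: within_ed=> t ht e e0; have [d d0 h] := c1_c cA ht e0.
 by exists d=> // s hs sd; apply: le_trans (opn_dist _ _) _; exact: h.
exists (a1 + a2) => [|t ht]; first exact: addr_ge0.
by have := h1 t ht; have := h2 t ht; split; lra.
Qed.
End Path.

(** * The one-form and its approximate potentials *)

Section Form.
Variables (D : operator K) (e : R).
Hypotheses (hD : dsa D) (aD : aff D) (e0 : 0 < e).
Hypothesis th : forall s, 0 < s -> fp (fn D (gs s)).

Definition phi X T : R := tr (X * fn (perturb D T) (gs e)).

Lemma theta_bd t a : 0 < t -> 0 <= a -> exists2 M, 0 <= M & forall T, sa T -> inN T -> opn T <= a ->
 fp (fn (perturb D T) (gs t)) /\ ft (fn (perturb D T) (gs t)) <= M.
Proof.
move=> t0 a0; have [M hM] := theta_stable t0 hD aD a0 th; exists M=> //.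
have [||| f1 f2] := hM 0; [exact: sa0|exact: inN0|by rewrite opn0 |].
exact: le_trans (ft_ge0 f1) f2.
Qed.

Lemma gs_sq T : sa T -> fn (perturb D T) (gs e) = fn (perturb D T) (gs (e / 2)) * fn (perturb D T) (gs (e / 2)).
Proof.
move=> sT; have hT := dsa_perturb hD sT; have b : bm (gs (e / 2)) by apply: bm_gse; rewrite divr_gt0.
by rewrite fnM //; congr fn; apply/funext=> l; exact: gs_half.
Qed.

(** The heat operator is the square of the one at time [e/2]: [tr_sq_diff] needs only norm closeness
    of the roots, together with the uniform trace bound from [theta_bd]. *)
Lemma phi_diff a : 0 <= a -> exists2 M, 0 <= M & forall X X' T T' r, inN X -> inN X' ->
 sa T -> inN T -> opn T <= a -> sa T' -> inN T' -> opn T' <= a ->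
 opn (fn (perturb D T) (gs (e / 2)) - fn (perturb D T') (gs (e / 2))) <= r ->
 `|phi X T - phi X' T'| <= M * (opn (X - X') + opn X' * r).
Proof.
move=> a0; have e20 : 0 < e / 2 by rewrite divr_gt0.
have [M M0 hM] := theta_bd e20 a0; exists (2 * M); first by rewrite mulr_ge0.
move=> X X' T T' r hX hX' sT hT Ta sT' hT' T'a hr.
have b1 S : sa S -> opn (fn (perturb D S) (gs (e / 2))) <= 1.
 move=> sS; apply: fn_opn=> //; [exact: dsa_perturb|exact: bm_gse|move=> l].
 by rewrite ger0_norm ?gs_le1 ?(ltW (gs_gt0 _ _)) ?(ltW e20).
have [f1 l1] := hM T sT hT Ta; have [f2 l2] := hM T' sT' hT' T'a.
have n1 := b1 T sT; have n2' := b1 T' sT'.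
rewrite /phi !gs_sq //; set u := fn _ _ in f1 l1 n1 hr *; set v := fn _ _ in f2 l2 n2' hr *.
have [tu _] := fp_tc f1; have hu := tc_inN tu.
have tuu : tc (u * u) by exact: tcM.
have -> : X * (u * u) = (X - X') * (u * u) + X' * (u * u) by rewrite -mulrDl subrK.
rewrite trD; [|by apply: tcM=> //; exact: inNB|exact: tcM].
rewrite -addrA; apply: le_trans (ler_normD _ _) _; rewrite mulrDr; apply: lerD.
 rewrite mulrA; apply: le_trans (tr_bd _ f1) _; first by apply: inNM=> //; exact: inNB.
 have h1 : opn ((X - X') * u) <= opn (X - X') by apply: opnM_le; rewrite ler_piMr ?opn_ge0.
 have := ler_pM (opn_ge0 _) (ft_ge0 f1) h1 l1; have := mulr_ge0 (opn_ge0 (X - X')) M0; lra.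
apply: le_trans (tr_sq_diff hX' f1 f2 n1 n2') _.
have -> : 2 * M * (opn X' * r) = opn X' * (r * (2 * M)) by lra.
apply: ler_wpM2l; first exact: opn_ge0.
by apply: ler_pM; rewrite ?addr_ge0 ?opn_ge0 ?ft_ge0 //; lra.
Qed.

Lemma phi_cont p q A A' : p < q -> C1path p q A A' ->
 {within `[p, q]%classic, continuous (fun t => phi (A' t) (A t))}.
Proof.
move=> pq cA; have [a a0 ha] := c1_bd pq cA.
have [M M0 hM] := phi_diff a0.
apply: within_ed=> t ht r r0.
pose m := r / (2 * (M + 1) * (a + 1)).
have m0 : 0 < m by rewrite divr_gt0 // !mulr_gt0 //; lra.
have e20 : 0 < e / 2 by rewrite divr_gt0.
have [d1 d10 h1] := heat_lip e20 m0.
have [d2 d20 h2] := c1_cont pq cA ht d10.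
have [d3 d30 h3] := c1_c cA ht m0.
exists (Order.min d2 d3); first by rewrite lt_min d20.
move=> s hs; rewrite le_min=> /andP[s1 s2].
have [[sS hS] [sS' hS']] := (c1_sa cA hs, c1_sa' cA hs).
have [[sT hT] [sT' hT']] := (c1_sa cA ht, c1_sa' cA ht).
have [[as1 as2] [at1 at2]] := (ha s hs, ha t ht).
apply: le_trans (hM _ _ _ _ m hS' hT' sS hS as1 sT hT at1 _) _; first by apply: h1=> //; exact: h2.
have := h3 s hs s2=> k.
have : opn (A' s - A' t) + opn (A' t) * m <= (a + 1) * m by have := ler_wpM2r (ltW m0) at2; lra.
move=> k2; have k3 := ler_wpM2l M0 k2; apply: le_trans k3 _.
have -> : r = 2 * (M + 1) * (a + 1) * m by rewrite /m mulrC divfK // gt_eqF // !mulr_gt0 //; lra.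
have am : 0 <= (a + 1) * m by rewrite mulr_ge0 ?(ltW m0) //; lra.
rewrite -(mulrA (2 * (M + 1))); apply: ler_wpM2r=> //; lra.
Qed.

Section Antiderivative.
Variables (h : R -> R) (c0 C : R).
Hypotheses (bh : bm h) (C0 : 0 <= C) (c00 : 0 <= c0).
Let g l := c0 * gs e l.
Hypotheses (h1 : forall l m, `|h l - h m| <= C * `|l - m|) (g1 : forall l m, `|g l - g m| <= C * `|l - m|).
Hypotheses (gC : forall l, `|g l| <= C) (hg : forall l m, `|h m - h l - g l * (m - l)| <= C * (m - l) ^+ 2).

Definition JJ n T : R := tr (ec D n * fn (perturb D (cut D n T)) h).

(** On the range of [E_n] the unbounded [D + E_n T E_n] coincides with this bounded operator, and
    both commute with [E_n]. Klein's inequality for bounded operators thus reaches [JJ]. *)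
Let M0 n T := fn D (fun l => l * chi n%:R l) + cut D n T.

Lemma corner_fn n T f : sa T -> bm f ->
 ec D n * fn (perturb D (cut D n T)) f = ec D n * fn (evr (M0 n T)) f /\
 ec D n * M0 n T = M0 n T * ec D n /\ sa (M0 n T).
Proof.
move=> sT bf; have sC := sa_cut hD aD th n sT; have hC := dsa_perturb hD sC.
have [e1 e2] := cut_e hD aD th n T.
have bc := bm_chi n%:R; have bl := bm_clip n%:R.
have sM : sa (M0 n T) by apply: saD=> //; exact: fn_sa.
have eM : ec D n * M0 n T = M0 n T * ec D n by rewrite /M0 mulrDr mulrDl e1 e2; congr (_ + _); exact: fn_commute.
split=> //; have hM := dsa_every sM.
have -> : ec D n * fn (evr (M0 n T)) f = fn (evr (M0 n T)) f * ec D n.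
 apply: fn_inter=> // x _; split=> //.
 by change (M0 n T (ec D n x) = ec D n (M0 n T x)); rewrite -!opM eM.
apply: fn_inter=> // x hx; split=> //.
change (M0 n T (ec D n x) = ec D n (D x + cut D n T x)).
have [_ h2] := fn_fc_dom hD bc hx; have [_ h3] := fn_dom hD x bc bl.
rewrite op_add /M0 opD -!opM e1 e2; congr (_ + _).
by rewrite /ec -h2 h3 fnM // ; congr (fn D _ x); apply/funext=> l; rewrite -mulrA; congr (_ * _); rewrite chiE; case: ifP; rewrite ?mulr1 ?mulr0.
Qed.

(** Klein's inequality for [M0 n T] and [M0 n T'] with [e = E_n]: the derivative of [JJ n] is the
    compressed one-form, and the remainder is quadratic with a constant that may depend on [n]. *)
Lemma JJ_diff n T T' : sa T -> inN T -> sa T' -> inN T' ->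
 `|JJ n T' - JJ n T - c0 * phi (cut D n (T' - T)) (cut D n T)| <=
 C * opn (T' - T) ^+ 2 * ft (ec D n).
Proof.
move=> sT hT sT' hT'.
have bg : bm g by apply: bmZ; exact: bm_gse.
have [E1 [E2 E3]] := corner_fn n sT bh; have [E1' [E2' E3']] := corner_fn n sT' bh.
have [G1 _] := corner_fn n sT bg.
have fE := ec_fp hD aD th n; have hE := inN_ec hD aD th n; have pE := ec_proj hD aD th n.
have [tE _] := fp_tc fE.
have hM (S : bop K) : inN S -> inN (M0 n S).
 move=> hS; apply: inND; last exact: (inN_cut hD aD th).
 by apply: inN_fn=> //; exact: bm_clip.
have hF (S : bop K) f : sa S -> inN S -> bm f -> inN (fn (perturb D (cut D n S)) f).
 move=> sS hS bf; apply: inN_fn=> //; first by apply: dsa_perturb=> //; exact: (sa_cut hD aD th).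
 by apply: affil_perturb=> //; exact: (inN_cut hD aD th).
have := klein bh bg C0 h1 g1 gC hg E3 E3' (hM T hT) (hM T' hT') pE fE E2 E2'.
have -> : M0 n T' - M0 n T = cut D n (T' - T) by rewrite (cutB hD aD th) /M0; move: (fn D _) => u; rewrite opprD addrACA subrr add0r.
rewrite !mulrBr -E1 -E1' (mulrA (ec D n)) -G1=> k.
have [k1 k2] := cut_e hD aD th n (T' - T).
have eq1 : tr (ec D n * fn (perturb D (cut D n T)) g * cut D n (T' - T)) = c0 * phi (cut D n (T' - T)) (cut D n T).
 rewrite (ec_comm hD aD th n sT bg) -mulrA k1.
 have bge := bm_gse e0; have sC := sa_cut hD aD th n sT; have hT2 := dsa_perturb hD sC.
 have hC := inN_cut hD aD th n hT.
 have hCC : inN (cut D n (T' - T)) by apply: (inN_cut hD aD th); exact: inNB.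
 have [M _ hB] := theta_bd e0 (opn_ge0 (cut D n T)).
 have [fG _] := hB _ sC hC (lexx _); have [tG _] := fp_tc fG.
 rewrite /g fnZ // rsoMl trR; last exact: tcMr.
 by rewrite /phi (tr_comm hCC tG).
rewrite -eq1 /JJ -!trB; first last.
- by apply: tcMr=> //; exact: hF.
- by apply: tcMr=> //; exact: hF.
- by rewrite -mulrA; apply: tcMr=> //; apply: inNM; [exact: hF|apply: (inN_cut hD aD th); exact: inNB].
- by apply: tcB; apply: tcMr=> //; exact: hF.
apply: le_trans k _; apply: ler_wpM2r; first exact: ft_ge0.
apply: ler_wpM2l=> //; rewrite ler_pXn2r ?nnegrE ?opn_ge0 //; exact: cut_opn.
Qed.

(** The quadratic remainder of [JJ_diff] and the first-order remainder of the path combine to the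
    derivative of [JJ n (A t)]; the fundamental theorem does the rest. *)
Lemma JJ_int n p q A A' : p < q -> C1path p q A A' ->
 JJ n (A q) - JJ n (A p) =
 c0 * \int[lebesgue_measure]_(t in `[p, q]) phi (cut D n (A' t)) (cut D n (A t)).
Proof.
move=> pq cA.
have cC : C1path p q (cut D n \o A) (cut D n \o A').
 split=> t ht /=.
 - by have [s1 s2] := c1_sa cA ht; split; [exact: (sa_cut hD aD th)|exact: (inN_cut hD aD th)].
 - by have [s1 s2] := c1_sa' cA ht; split; [exact: (sa_cut hD aD th)|exact: (inN_cut hD aD th)].
 - move=> r r0; have [d d0 hd] := c1_d cA ht r0; exists d=> // s hs sd.
  rewrite -(cutR hD aD th) -!(cutB hD aD th); apply: le_trans (cut_opn hD aD th _ _) _; exact: hd.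
 move=> r r0; have [d d0 hd] := c1_c cA ht r0; exists d=> // s hs sd.
 rewrite -(cutB hD aD th); apply: le_trans (cut_opn hD aD th _ _) _; exact: hd.
have cphi := phi_cont pq cC.
have mI : measurable (`[p, q]%classic : set R) by exact: measurable_itv.
rewrite -RintegralZl //; last exact: within_int.
rewrite (@ftc_within (fun t => JJ n (A t)) (fun t => c0 * phi (cut D n (A' t)) (cut D n (A t)))) //.
 apply: within_ed=> t ht r r0.
 have r1 : 0 < r / (c0 + 1) by rewrite divr_gt0 // ltr_wpDl.
 have /subspace_continuousP/(_ t) := cphi; rewrite /= in_itv /= => /(_ ht)/cvgrPdist_le/(_ _ r1).
 rewrite near_withinE=> /nbhs_ballP[d d0 hd].
 have dp : 0 < d by exact: d0.
 exists (d / 2); first by rewrite divr_gt0.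
 move=> s hs sd; rewrite -mulrBr normrM (ger0_norm c00) distrC.
 have := hd s _ _; rewrite /= in_itv /= => /(_ _ hs) k.
 have bs : ball t d s by rewrite /ball /= distrC; apply: le_lt_trans sd _; rewrite gtr_pMr // invf_lt1 // ltr1n.
 have {}k := k bs.
 apply: le_trans (ler_wpM2l c00 k) _; rewrite mulrA ler_pdivrMr ?ltr_wpDl // mulrC mulrDr mulr1 lerDl ltW //.
move=> t ht r r0.
have [[sT hT] [sT' hT']] := (c1_sa cA ht, c1_sa' cA ht).
have [d1 d10 hd1] := c1_lip pq cA ht.
set B := 1 + opn (A' t) in hd1; have B0 : 0 <= B by rewrite addr_ge0 ?opn_ge0.
have fE := ec_fp hD aD th n; have F0 := ft_ge0 fE; set F := ft (ec D n) in F0.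
have sC := sa_cut hD aD th n sT; have hC := inN_cut hD aD th n hT.
have [M M0' hM] := theta_bd e0 (opn_ge0 (cut D n (A t))).
have [fG lG] := hM _ sC hC (lexx _).
(* [c1] and [c2] are chosen so that the error of the path and the quadratic error each amount to at
   most half of [r |s - t|]. *)
pose c1 := 2 * (c0 * M + 1); have c10 : 0 < c1 by rewrite mulr_gt0 // ltr_wpDl // mulr_ge0.
have [d2 d20 hd2] := c1_d cA ht (divr_gt0 r0 c10).
pose c2 := 2 * (C * B ^+ 2 * F + 1).
have c20 : 0 < c2 by rewrite mulr_gt0 // ltr_wpDl // !mulr_ge0 // sqr_ge0.
exists (Order.min d1 (Order.min d2 (r / c2))); first by rewrite !lt_min d10 d20 divr_gt0.
move=> s hs; rewrite !le_min=> /and3P[s1 s2 s3].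
have [sS hS] := c1_sa cA hs.
have k1 := JJ_diff n sT hT sS hS.
have k2 := hd1 s hs s1; have k3 := hd2 s hs s2.
set J := JJ n (A s) - JJ n (A t) in k1 *.
have hX : inN (cut D n (A s - A t)) by apply: (inN_cut hD aD th); exact: inNB.
have hX' : inN (cut D n (A' t)) by exact: (inN_cut hD aD th).
have [tG _] := fp_tc fG.
have E : phi (cut D n (A s - A t)) (cut D n (A t)) - (s - t) * phi (cut D n (A' t)) (cut D n (A t)) =
  tr (cut D n (A s - A t - rso (s - t) (A' t)) * fn (perturb D (cut D n (A t))) (gs e)).
 rewrite (cutB hD aD th n (A s - A t)) (cutR hD aD th) [in RHS]mulrBl rsoMl /phi -trR; last exact: tcM.
 by rewrite -trB //; [exact: tcM|apply: tcR; exact: tcM].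
have k4 : `|phi (cut D n (A s - A t)) (cut D n (A t)) - (s - t) * phi (cut D n (A' t)) (cut D n (A t))| <=
  r / c1 * `|s - t| * M.
 rewrite E; apply: le_trans (tr_bd _ fG) _.
  by apply: (inN_cut hD aD th); apply: inNB; [exact: inNB|exact: inNR].
 apply: ler_pM=> //; rewrite ?opn_ge0 ?ft_ge0 //.
 by apply: le_trans (cut_opn hD aD th _ _) _.
have -> : J - (s - t) * (c0 * phi (cut D n (A' t)) (cut D n (A t))) =
 (J - c0 * phi (cut D n (A s - A t)) (cut D n (A t))) +
 c0 * (phi (cut D n (A s - A t)) (cut D n (A t)) - (s - t) * phi (cut D n (A' t)) (cut D n (A t))) by lra.
apply: le_trans (ler_normD _ _) _; rewrite [in X in _ + X]normrM (ger0_norm c00).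
have k5 := ler_wpM2l c00 k4.
have z0 := normr_ge0 (s - t); set z := `|s - t| in k2 k3 k4 k5 z0 s3 *.
have k6 : C * opn (A s - A t) ^+ 2 * F <= C * (B * z) ^+ 2 * F.
 apply: ler_wpM2r=> //; apply: ler_wpM2l=> //; rewrite ler_pXn2r ?nnegrE ?opn_ge0 ?mulr_ge0 //.
have k7 : C * (B * z) ^+ 2 * F <= r / 2 * z.
 have -> : C * (B * z) ^+ 2 * F = (C * B ^+ 2 * F) * z * z by rewrite exprMn !expr2; lra.
 apply: ler_wpM2r=> //.
 have : z * c2 <= r by rewrite -ler_pdivlMr.
 by rewrite /c2; have := z0; lra.
have k8 : c0 * (r / c1 * z * M) <= r / 2 * z.
 have -> : c0 * (r / c1 * z * M) = c0 * M * (r / c1) * z by lra.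
 apply: ler_wpM2r=> //; rewrite mulrA ler_pdivrMr // /c1.
 have -> : r / 2 * (2 * (c0 * M + 1)) = r * (c0 * M + 1) by lra.
 by lra.
by move: k1 k5 k6 k7 k8; set a1 := C * opn (A s - A t) ^+ 2 * F; lra.
Qed.

(** [X - E X E = X (1 - E) + (1 - E) X E]. In each term, after a cyclic move for the second, [1 - E]
    stands next to a heat operator at time [e/2], where [op_cut] gives [O(1/n)]; the remaining heat
    factor supplies the trace. *)
Lemma cut_tr_bd a : 0 <= a -> exists2 M, 0 <= M & forall n X T, (0 < n)%N -> inN X -> sa T -> inN T ->
 opn T <= a -> `|phi (cut D n X) T - phi X T| <= opn X * M / n%:R.
Proof.
move=> a0; have e20 : 0 < e / 2 by rewrite divr_gt0.
have [M M0' hM] := theta_bd e20 a0.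
have bg := bm_gse e20.
pose c := (1 + (e / 2)^-1).
have lg l : `|l * gs (e / 2) l| <= c by exact: lgs_bd.
have blg : bm (fun l : R => l * gs (e / 2) l) by exact: bm_lgs.
have c0' : 0 <= c by rewrite addr_ge0 // invr_ge0 ltW.
exists (2 * (c + a) * M); first by rewrite !mulr_ge0 // addr_ge0.
move=> n X T n0 hX sT hT Ta; have hDT := dsa_perturb hD sT.
have nn : 0 < n%:R :> R by rewrite ltr0n.
have g1' l : `|gs (e / 2) l| <= 1 by rewrite ger0_norm ?gs_le1 ?(ltW (gs_gt0 _ _)) ?(ltW e20).
have hoc := op_cut hD aD th sT n0 bg blg c0' ler01 lg g1'.
have [f1 l1] := hM T sT hT Ta; have b1 : opn (fn (perturb D T) (gs (e / 2))) <= 1 by apply: fn_opn.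
rewrite /phi !gs_sq //; set u := fn _ _ in hoc f1 l1 b1 *.
have su : sa u by exact: fn_sa.
have [tu _] := fp_tc f1; have hu := tc_inN tu.
have tuu : tc (u * u) by exact: tcM.
have hE := inN_ec hD aD th n; have hE1 : inN (1 - ec D n) by apply: inNB=> //; exact: inN1.
have pE := ec_proj hD aD th n.
have hC := inN_cut hD aD th n hX.
have h2 : opn ((1 - ec D n) * u) <= (c + a) / n%:R by apply: le_trans hoc _; rewrite ler_pM2r ?invr_gt0 // lerD2l mulr1.
have h3 : opn (u * (1 - ec D n)) <= (c + a) / n%:R by rewrite -opn_adj adjM su (projC pE).1.
rewrite -trB; [|exact: tcM|exact: tcM].
have -> : cut D n X * (u * u) - X * (u * u) =
  - ((X * ((1 - ec D n) * u)) * u + ((1 - ec D n) * (X * ec D n * u)) * u).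
 rewrite /cut; move: (ec D n) => E; rewrite !(mulrBl, mulrBr, mul1r, mulr1) !mulrA.
 by apply: bop_ext=> x; apply: ip_ext=> z; rewrite !(opB, opN, opD, ipE); lra.
have t1 : tc (X * ((1 - ec D n) * u) * u) by apply: tcM=> //; apply: inNM=> //; exact: inNM.
have t2' : tc (X * ec D n * u) by apply: tcM=> //; exact: inNM.
have t2 : tc ((1 - ec D n) * (X * ec D n * u) * u) by apply: tcMr=> //; exact: tcM.
rewrite trN ?trD //; last exact: tcD.
have E2 : tr ((1 - ec D n) * (X * ec D n * u) * u) = tr ((u * (1 - ec D n)) * (X * ec D n) * u) by rewrite -(tr_comm hu (tcM hE1 t2')) !mulrA.
rewrite normrN E2; apply: le_trans (ler_normD _ _) _.
have k1 : `|tr (X * ((1 - ec D n) * u) * u)| <= opn X * ((c + a) / n%:R) * M.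
 apply: le_trans (tr_bd _ f1) _; first by apply: inNM=> //; exact: inNM.
 apply: ler_pM; rewrite ?opn_ge0 ?ft_ge0 //; apply: opnM_le.
 by apply: ler_wpM2l; rewrite ?opn_ge0.
have k2 : `|tr ((u * (1 - ec D n)) * (X * ec D n) * u)| <= ((c + a) / n%:R) * opn X * M.
 apply: le_trans (tr_bd _ f1) _; first by apply: inNM; exact: inNM.
 apply: ler_pM; rewrite ?opn_ge0 ?ft_ge0 //; apply: opnM_le.
 apply: ler_pM; rewrite ?opn_ge0 //; apply: opnM_le.
 by apply: le_trans (ler_wpM2l (opn_ge0 X) (ec_opn hD aD th n)) _; rewrite mulr1.
lra.
Qed.

(** The compression is removed in two moves, each uniform in the path parameter: first from the
    operator by [heat_conv], then from the tangent vector by [cut_tr_bd]. The constants of [JJ_diff]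
    that grow with [n] no longer occur. *)
Lemma JJ_cvg p q A A' : p < q -> C1path p q A A' ->
 JJ n (A q) - JJ n (A p) @[n --> \oo] -->
 c0 * \int[lebesgue_measure]_(t in `[p, q]) phi (A' t) (A t).
Proof.
move=> pq cA; have [a a0 ha] := c1_bd pq cA.
have e20 : 0 < e / 2 by rewrite divr_gt0.
have [M1 p1 hM1] := phi_diff a0; have [M2 p2 hM2] := cut_tr_bd a0.
apply/cvgrPdist_le=> r r0.
have qp : 0 < q - p by rewrite subr_gt0.
pose r1 := r / ((c0 + 1) * (q - p)).
have c01 : 0 < c0 + 1 by rewrite ltr_wpDl.
have r10 : 0 < r1 by rewrite divr_gt0 // mulr_gt0.
have r12 : 0 < r1 / 2 by exact: divr_gt0 r10 (ltr0Sn _ 1).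
pose r2 := r1 / (2 * (M1 * a + 1)).
have m1 : 0 < 2 * (M1 * a + 1) by rewrite mulr_gt0 // ltr_wpDl // mulr_ge0.
have r20 : 0 < r2 by rewrite divr_gt0.
have [n0 hn] := heat_conv hD aD th e20 a0 r20.
have [n1 hn1] := nat_gt (a * M2 / (r1 / 2)).
exists (n0 + n1.+1)%N=> // n /= nn.
have nn0 : (n0 <= n)%N by apply: leq_trans nn; exact: leq_addr.
have nn1 : (n1 < n)%N by apply: leq_trans nn; exact: leq_addl.
have np : (0 < n)%N by exact: leq_trans nn1.
have nr : 0 < n%:R :> R by rewrite ltr0n.
rewrite (JJ_int n pq cA) -mulrBr normrM (ger0_norm c00) distrC.
have cC : C1path p q (cut D n \o A) (cut D n \o A').
 split=> t ht /=.
 - by have [s1 s2] := c1_sa cA ht; split; [exact: (sa_cut hD aD th)|exact: (inN_cut hD aD th)].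
 - by have [s1 s2] := c1_sa' cA ht; split; [exact: (sa_cut hD aD th)|exact: (inN_cut hD aD th)].
 - move=> x x0; have [d d0 hd] := c1_d cA ht x0; exists d=> // s hs sd.
  rewrite -(cutR hD aD th) -!(cutB hD aD th); apply: le_trans (cut_opn hD aD th _ _) _; exact: hd.
 move=> x x0; have [d d0 hd] := c1_c cA ht x0; exists d=> // s hs sd.
 rewrite -(cutB hD aD th); apply: le_trans (cut_opn hD aD th _ _) _; exact: hd.
have k : `|\int[lebesgue_measure]_(t in `[p, q]) phi (cut D n (A' t)) (cut D n (A t)) -
  \int[lebesgue_measure]_(t in `[p, q]) phi (A' t) (A t)| <= r1 * (q - p).
 apply: int_diff_bd=> //; [exact: (phi_cont pq cC)|exact: (phi_cont pq cA)|move=> t ht].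
 have [[sT hT] [sT' hT']] := (c1_sa cA ht, c1_sa' cA ht).
 have [at1 at2] := ha t ht.
 have sC := sa_cut hD aD th n sT; have hC := inN_cut hD aD th n hT.
 have sC' := sa_cut hD aD th n sT'; have hC' := inN_cut hD aD th n hT'.
 have x1 : `|phi (cut D n (A' t)) (cut D n (A t)) - phi (cut D n (A' t)) (A t)| <= r1 / 2.
  apply: le_trans (hM1 _ _ _ _ r2 hC' hC' sC hC _ sT hT at1 _) _.
  - by apply: le_trans at1; exact: (cut_opn hD aD th).
  - by have [] := hn n (A t) nn0 sT at1.
  rewrite subrr opn0 add0r.
  have y1 : opn (cut D n (A' t)) <= a by apply: le_trans at2; exact: (cut_opn hD aD th).
  have y2 := ler_wpM2l p1 (ler_wpM2r (ltW r20) y1); apply: le_trans y2 _.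
  have -> : r1 / 2 = (M1 * a + 1) * r2 by rewrite /r2; field; rewrite gt_eqF // ltr_wpDl // mulr_ge0.
  by rewrite mulrA ler_wpM2r ?(ltW r20) // lerDl.
 have x2 : `|phi (cut D n (A' t)) (A t) - phi (A' t) (A t)| <= r1 / 2.
  apply: le_trans (hM2 n _ _ np hT' sT hT at1) _.
  rewrite ler_pdivrMr // (mulrC (r1 / 2)) -ler_pdivrMr //.
  apply: (@le_trans _ _ (a * M2 / (r1 / 2))).
   by rewrite ler_pM2r ?invr_gt0 //; exact: ler_wpM2r.
  by apply: le_trans (ltW hn1) _; rewrite ler_nat ltnW.
 apply: le_trans (ler_distD (phi (cut D n (A' t)) (A t)) _ _) _.
 by rewrite [leRHS]splitr; exact: lerD.
apply: le_trans (ler_wpM2l c00 k) _.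
have -> : r = (c0 + 1) * (r1 * (q - p)) by rewrite /r1; field; rewrite !gt_eqF.
by apply: ler_wpM2r; rewrite ?lerDl // mulr_ge0 // ltW.
Qed.
End Antiderivative.
End Form.

(** * The Gaussian antiderivative and the function k *)

Section Gaussian.
Local Notation mu := (@lebesgue_measure R).
Implicit Types a b t : R.
Definition sqpi : R := Num.sqrt pi.
Lemma sqpi_gt0 : 0 < sqpi. Proof. by rewrite sqrtr_gt0 pi_gt0. Qed.
Definition gaussN (x : R) : R := \int[mu]_(t in `]-oo, x]) gauss_fun t.
(** Half of the error function: odd, with limits 1/2 and -1/2. *)
Definition Phi (x : R) : R := (gaussN x - gaussN 0) / sqpi.

Lemma gauss_int (A : set R) : measurable A -> mu.-integrable A (EFin \o @gauss_fun R).
Proof. by move=> mA; apply: (integrableS (E := setT)) => //; exact: integrableT_gauss. Qed.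

Lemma Phi_derive (x : R) : is_derive x 1 Phi (gauss_fun x / sqpi).
Proof.
have [d1 d2] : derivable gaussN x 1 /\ derive1 gaussN x = gauss_fun x.
 apply: (@continuous_FTC1 R (@gauss_fun R) -oo%O x (x + 1)) => //; first by rewrite ltrDl.
 - by apply: gauss_int; exact: measurable_itv.
 - by first [done | rewrite ltBSide | rewrite /Order.lt /=].
 exact: continuous_gauss_fun.
have h : is_derive x 1 gaussN (gauss_fun x) by rewrite -d2 derive1E; exact: DeriveDef.
have -> : Phi = (sqpi^-1 \*: (gaussN - cst (gaussN 0))) by apply/funext=> y; rewrite /Phi /= mulrC.
have h2 := is_deriveZ (sqpi^-1) (is_deriveB h (is_derive_cst (gaussN 0) x 1)).
by apply: (is_derive_eq h2); rewrite subr0 [RHS]mulrC.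
Qed.

Lemma Phi0 : Phi 0 = 0. Proof. by rewrite /Phi subrr mul0r. Qed.

Lemma PhiN (x : R) : Phi (- x) = - Phi x.
Proof.
pose f (y : R) := Phi y + Phi (- y).
have df (y : R) : is_derive y 1 f 0.
 have h1 := Phi_derive y; have h2 := Phi_derive (- y).
 have h3 : is_derive y 1 (Phi \o -%R) (gauss_fun (- y) / sqpi * -1) by exact: is_derive1_comp.
 have -> : f = Phi + (Phi \o -%R) by [].
 by apply: is_derive_eq; rewrite /gauss_fun sqrrN mulrN1 subrr.
have := @is_derive_0_is_cst R f x 0 df; rewrite /f oppr0 Phi0; lra.
Qed.

Lemma Phi_ge (x : R) : 0 <= x -> Phi x = gauss_integral_proof.integral0_gauss x / sqpi.
Proof.
move=> x0; rewrite /Phi /gaussN; congr (_ / _).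
rewrite Rintegral_itvB //; first by rewrite Rintegral_itv_obnd_cbnd //; apply: gauss_int; exact: measurable_itv.
by apply: gauss_int; exact: measurable_itv.
Qed.

Lemma Phi_cvg : Phi x @[x --> +oo] --> (2^-1 : R).
Proof.
have h : @gauss_integral_proof.integral0_gauss R x @[x --> +oo] --> sqpi / 2.
 have : Num.sqrt (@gauss_integral_proof.integral0_gauss R x ^+ 2) @[x --> +oo] --> Num.sqrt (pi / 4 : R).
  apply: continuous_cvg; [exact: sqrt_continuous|exact: gauss_integral_proof.cvg_integral0_gauss_sqr].
 have -> : Num.sqrt (pi / 4 : R) = sqpi / 2.
  rewrite sqrtrM ?pi_ge0 // sqrtrV // (_ : 4 = 2 ^+ 2 :> R); last by rewrite expr2 -natrM.
  by rewrite sqrtr_sqr ger0_norm.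
 rewrite (_ : (fun _ => Num.sqrt _) = @gauss_integral_proof.integral0_gauss R) //.
 by apply/funext=> r; rewrite sqrtr_sqr ger0_norm // gauss_integral_proof.integral0_gauss_ge0.
have h2 : gauss_integral_proof.integral0_gauss x / sqpi @[x --> +oo] --> (2^-1 : R).
 have -> : 2^-1 = sqpi / 2 / sqpi :> R by field; rewrite gt_eqF // sqpi_gt0.
 by apply: cvgMl.
apply: cvg_trans h2; apply: near_eq_cvg; near=> x; apply/esym/Phi_ge.
by near: x; apply: nbhs_pinfty_ge; rewrite num_real.
Unshelve. all: by end_near. Qed.

Lemma gs_derive_t (l t : R) : is_derive t 1 (fun s => gs s l) (- l ^+ 2 * gs t l).
Proof.
have h := is_deriveZ (- l ^+ 2) (is_derive_id t (1 : R)).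
have h2 := is_derive1_comp (is_derive_expR ((- l ^+ 2 \*: id) t)) h.
have -> : (fun s => gs s l) = expR \o (- l ^+ 2 \*: id) by apply/funext=> s; rewrite /gs /= /GRing.scale /= mulNr mulNr mulrC.
apply: (is_derive_eq h2); have E : - l ^+ 2 * t = - t * l ^+ 2 by lra.
by change (expR (- l ^+ 2 * t) * (- l ^+ 2 * 1) = - l ^+ 2 * gs t l); rewrite E mulr1 mulrC.
Qed.

Lemma gs_derive (t l : R) : is_derive l 1 (gs t) (- (2 * t) * (l * gs t l)).
Proof.
have h := is_deriveZ (- t) (is_deriveX 2 (is_derive_id l (1 : R))).
have h2 := is_derive1_comp (is_derive_expR ((- t \*: id ^+ 2) l)) h.
have -> : gs t = expR \o (- t \*: id ^+ 2) by [].
by apply: (is_derive_eq h2); rewrite /gs /GRing.scale /= expr1 mulr1; lra.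
Qed.

Section Heat.
Variable e : R.
Hypothesis e0 : 0 < e.
(** The scaling by the square root of [e] makes its derivative [sqrt(e/pi) exp(-e l^2)], the density
    of the one-form with its normalization. *)
Definition hh (l : R) : R := Phi (Num.sqrt e * l).
Definition cc : R := Num.sqrt (e / pi).
Lemma cc_ge0 : 0 <= cc. Proof. exact: sqrtr_ge0. Qed.

Lemma hh_derive (l : R) : is_derive l 1 hh (cc * gs e l).
Proof.
have h1 := Phi_derive (Num.sqrt e * l).
have h2 : is_derive l 1 (Num.sqrt e \*: id) (Num.sqrt e) by apply: is_derive_eq; rewrite /GRing.scale /= mulr1.
have -> : hh = Phi \o (Num.sqrt e \*: id) by [].
have -> : cc * gs e l = gauss_fun (Num.sqrt e * l) / sqpi * Num.sqrt e.
 rewrite /gauss_fun exprMn sqr_sqrtr ?(ltW e0) // -mulNr -/(gs e l) /cc.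
 by rewrite sqrtrM ?(ltW e0) // sqrtrV ?pi_ge0 // -/sqpi; lra.
exact: is_derive1_comp.
Qed.

Lemma mvt (f df : R -> R) a b : (forall x : R, is_derive x 1 f (df x)) ->
 exists2 c, `|c - a| <= `|b - a| & f b - f a = df c * (b - a).
Proof.
move=> hf.
have cf : continuous f by move=> x; apply: differentiable_continuous; apply/derivable1_diffP; exact: ex_derive.
have main (u v : R) : u <= v -> exists2 c, u <= c <= v & f v - f u = df c * (v - u).
 move=> uv; have [|c] := MVT_segment uv (fun (x : R) _ => hf x); first exact: continuous_subspaceT.
 by rewrite in_itv /=; exists c.
case: (leP a b) => ab.
 have [c /andP[c1 c2] ce] := main _ _ ab; exists c=> //.
 by rewrite !ger0_norm ?subr_ge0 // lerD2r.
have [c /andP[c1 c2] ce] := main _ _ (ltW ab); exists c; last by lra.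
by rewrite !ler0_norm ?subr_le0 ?(ltW ab) // lerN2 lerD2r.
Qed.

(** A single constant for all the hypotheses of [klein]: the first term bounds [cc gs], and the
    second its derivative through [lgs_bd]. *)
Definition CC : R := cc + 2 * e * cc * (1 + e^-1) + 1.
Lemma CC_bds : [/\ 0 <= CC, cc <= CC & 2 * e * cc * (1 + e^-1) <= CC].
Proof.
have h1 := cc_ge0; have h2 : 0 <= 2 * e * cc * (1 + e^-1).
 by rewrite !mulr_ge0 ?addr_ge0 ?invr_ge0 ?(ltW e0).
by rewrite /CC; split; lra.
Qed.

Lemma hh_lip (l m : R) : `|hh l - hh m| <= CC * `|l - m|.
Proof.
have [c _ ->] := mvt m l hh_derive; rewrite normrM; apply: ler_wpM2r=> //.
have [_ h _] := CC_bds; apply: le_trans h.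
rewrite ger0_norm ?mulr_ge0 ?cc_ge0 ?(ltW (gs_gt0 _ _)) // ler_piMr ?cc_ge0 // gs_le1 // ltW //.
Qed.

Lemma cgs_lip (l m : R) : `|cc * gs e l - cc * gs e m| <= CC * `|l - m|.
Proof.
rewrite -mulrBr; have [c _ ->] := mvt m l (gs_derive e).
rewrite !normrM mulrA; apply: ler_wpM2r=> //.
have [_ _ h] := CC_bds; apply: le_trans h.
rewrite normrN normrM (ger0_norm cc_ge0) (ger0_norm (ltW e0)) ger0_norm // -normrM.
have -> : cc * (2 * e * `|c * gs e c|) = 2 * e * cc * `|c * gs e c| by lra.
by apply: ler_wpM2l; [rewrite !mulr_ge0 ?cc_ge0 ?(ltW e0)|exact: lgs_bd].
Qed.

Lemma cgs_bd (l : R) : `|cc * gs e l| <= CC.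
Proof.
have [_ h _] := CC_bds; apply: le_trans h.
by rewrite ger0_norm ?mulr_ge0 ?cc_ge0 ?(ltW (gs_gt0 _ _)) // ler_piMr ?cc_ge0 // gs_le1 // ltW.
Qed.

Lemma hh_taylor (l m : R) : `|hh m - hh l - cc * gs e l * (m - l)| <= CC * (m - l) ^+ 2.
Proof.
have [c c1 ->] := mvt l m hh_derive; rewrite -mulrBl normrM -(sqn (m - l)) expr2 mulrA.
apply: ler_wpM2r=> //; apply: le_trans (cgs_lip _ _) _; apply: ler_wpM2l=> //.
by have [] := CC_bds.
Qed.

Lemma heat_cont (l : R) : {within `[e, +oo[%classic, continuous (fun t => l * gs t l / Num.sqrt t)}.
Proof.
apply: continuous_in_subspaceT=> t; rewrite inE /= in_itv /= andbT=> et.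
have t0 : 0 < t := lt_le_trans e0 et.
apply: cvgM; last by apply: cvgV; [rewrite gt_eqF // sqrtr_gt0|exact: sqrt_continuous].
apply: cvgM; first exact: cvg_cst.
have : {for t, continuous (fun s => gs s l)}.
 have hd := gs_derive_t l t; apply: differentiable_continuous.
 by apply/derivable1_diffP; exact: ex_derive.
by [].
Qed.

(** An antiderivative in [t] is [2 sqrt(pi) Phi(sqrt(t) l)], which tends to [sqrt(pi)] at infinity
    for [l > 0]. This ties the eta integrand to the potential's function [hh]. *)
Lemma heat_int (l : R) : 0 < l ->
 (\int[mu]_(t in `[e, +oo[) (l * gs t l / Num.sqrt t)%:E = (2 * sqpi * (2^-1 - hh l))%:E)%E.
Proof.
move=> l0; pose F t : R := 2 * sqpi * Phi (Num.sqrt t * l).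
have dF t : 0 < t -> is_derive t 1 F (l * gs t l / Num.sqrt t).
 move=> t0; have s0 : 0 < Num.sqrt t by rewrite sqrtr_gt0.
 have h1 := Phi_derive (Num.sqrt t * l).
 have h0 := is_derive1_sqrt t0.
 have h2 : is_derive t 1 (l \*: @Num.sqrt R) (l * (2 * Num.sqrt t)^-1) by exact: (is_deriveZ l h0).
 have h3 : is_derive t 1 (Phi \o (l \*: @Num.sqrt R)) (gauss_fun (Num.sqrt t * l) / sqpi * (l * (2 * Num.sqrt t)^-1)) by apply: is_derive1_comp h2; rewrite /= /GRing.scale /= mulrC.
 have -> : F = (2 * sqpi) \*: (Phi \o (l \*: @Num.sqrt R)) by apply/funext=> y; rewrite /F /= /GRing.scale /= (mulrC l).
 apply: (is_derive_eq (is_deriveZ (2 * sqpi) h3)).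
 rewrite /GRing.scale /= /gauss_fun exprMn sqr_sqrtr ?(ltW t0) // -mulNr -/(gs t l).
 by field; rewrite !gt_eqF ?sqpi_gt0.
have cF t : 0 < t -> {for t, continuous F} by move=> /dF d; apply: differentiable_continuous; apply/derivable1_diffP; exact: ex_derive.
rewrite (@ge0_continuous_FTC2y R _ F e (2 * sqpi * 2^-1)).
- by rewrite -EFinB /F -/(hh l) mulrBr.
- by move=> t _; rewrite !mulr_ge0 ?invr_ge0 ?sqrtr_ge0 ?(ltW l0) ?(ltW (gs_gt0 _ _)).
- exact: heat_cont.
- rewrite /F; apply: cvgMr; apply: (cvg_comp _ _ _ Phi_cvg).
 apply/cvgryPge=> A; near=> t.
 have t0 : 0 <= t by near: t; apply: nbhs_pinfty_ge; rewrite num_real.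
 have tA : (`|A| / l) ^+ 2 <= t by near: t; apply: nbhs_pinfty_ge; rewrite num_real.
 apply: le_trans (ler_norm A) _; rewrite -ler_pdivrMr //.
 have q0 : 0 <= `|A| / l by rewrite divr_ge0 // ltW.
 by rewrite -(ger0_norm q0) -sqrtr_sqr ler_sqrt.
- by move=> t et; have ? := dF t (lt_trans e0 et); exact: ex_derive.
- by apply: cvg_at_right_filter; exact: cF.
- move=> t; rewrite in_itv /= andbT=> et; have ? := dF t (lt_trans e0 et).
 by rewrite derive1E derive_val.
Unshelve. all: by end_near. Qed.

Definition kk (l : R) : R := pos01 l - 2^-1 - hh l.
Definition kap (l : R) : R := 2^-1 - hh `|l|.
Definition k0 (l : R) : R := Num.sg l * kap l.

Lemma hhN (l : R) : hh (- l) = - hh l. Proof. by rewrite /hh mulrN PhiN. Qed.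
Lemma hh0 : hh 0 = 0. Proof. by rewrite /hh mulr0 Phi0. Qed.

Lemma kap_bd (l : R) : 0 <= kap l <= 2^-1.
Proof.
rewrite /kap; have [->|l0] := eqVneq l 0.
 by rewrite normr0 hh0 subr0 lexx invr_ge0 ler0n.
have p0 : 0 < `|l| by rewrite normr_gt0.
apply/andP; split.
 have : (0 <= \int[mu]_(t in `[e, +oo[) (`|l| * gs t `|l| / Num.sqrt t)%:E)%E.
  apply: integral_ge0=> t _; rewrite lee_fin.
  by rewrite !mulr_ge0 ?invr_ge0 ?sqrtr_ge0 ?(ltW (gs_gt0 _ _)).
 by rewrite heat_int // lee_fin pmulr_rge0 // mulr_gt0 // sqpi_gt0.
rewrite gerBl /hh Phi_ge; last by rewrite mulr_ge0 ?sqrtr_ge0.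
by rewrite divr_ge0 ?gauss_integral_proof.integral0_gauss_ge0 // ltW // sqpi_gt0.
Qed.

Lemma kkE (l : R) : kk l = 2^-1 * \1_[set 0] l + k0 l.
Proof.
rewrite /kk /k0 /kap /pos01 indE; have [->|l0] := eqVneq l 0.
 by rewrite lexx mem_set //= sgr0 mul0r hh0; lra.
rewrite memNset; last by move/eqP: l0.
case: (ltgtP l 0) => h.
- by rewrite ltr0_sg // ltr0_norm // hhN; lra.
- by rewrite gtr0_sg // gtr0_norm //; lra.
by move: l0; rewrite h eqxx.
Qed.

Lemma k0_norm (l : R) : l != 0 -> `|k0 l| = kap l.
Proof.
by move=> l0; have /andP[a _] := kap_bd l; rewrite normrM normr_sg l0 mul1r ger0_norm.
Qed.

Lemma heat_int_abs (l : R) :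
 (\int[mu]_(t in `[e, +oo[) (`|l| * gs t l / Num.sqrt t)%:E = (2 * sqpi * `|k0 l|)%:E)%E.
Proof.
have gN t : gs t l = gs t `|l| by rewrite /gs sqn.
have [->|l0] := eqVneq l 0.
 rewrite /k0 sgr0 mul0r normr0 mulr0; apply: integral0_eq=> t _.
 by rewrite !mul0r.
rewrite k0_norm //; under eq_integral do rewrite gN.
by rewrite heat_int // normr_gt0.
Qed.

Lemma heat_integrable (l : R) :
 mu.-integrable `[e, +oo[ (EFin \o (fun t => l * gs t l / Num.sqrt t)).
Proof.
apply/integrableP; split.
 apply/measurable_EFinP; apply: subspace_continuous_measurable_fun; first exact: measurable_itv.
 exact: heat_cont.
under eq_integral=> t ht.
 rewrite /= !normrM (ger0_norm (ltW (gs_gt0 _ _))) normfV (ger0_norm (sqrtr_ge0 t)); over.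
by rewrite heat_int_abs ltry.
Qed.

Lemma heat_Rint (l : R) : \int[mu]_(t in `[e, +oo[) (l * gs t l / Num.sqrt t) = 2 * sqpi * k0 l.
Proof.
have E (x : R) : 0 < x -> \int[mu]_(t in `[e, +oo[) (x * gs t x / Num.sqrt t) = 2 * sqpi * kap x by move=> x0; rewrite /Rintegral heat_int //= /kap gtr0_norm.
rewrite /k0; case: (ltgtP l 0) => h.
- rewrite ltr0_sg // mulN1r mulrN.
 have -> : kap l = kap (- l) by rewrite /kap normrN.
 rewrite -E ?oppr_gt0 // -[RHS]mulN1r -RintegralZl //; last exact: heat_integrable.
 by apply: eq_Rintegral=> t _; rewrite /gs sqrrN; lra.
- by rewrite gtr0_sg // mul1r E.
by rewrite h sgr0 mul0r mulr0; under eq_Rintegral do rewrite !mul0r; rewrite Rintegral_cst //= mul0r.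
Qed.

(** With [w = z / sqrt(2)] and [t >= e] one has [exp(-t z^2) <= exp(-e z^2/2) exp(-t w^2)].
    Integrating bounds [kap z] by a Gaussian times [sqrt(2) kap w], and [kap w <= 1/2]. Hence
    [kk(D)] is trace class. *)
Lemma kk_gs (l : R) : `|kk l| <= gs (e / 2) l.
Proof.
rewrite kkE indE; have [->|l0] := eqVneq l 0.
 rewrite mem_set // /k0 sgr0 mul0r addr0 mulr1 /gs expr0n mulr0 expR0 ger0_norm ?invr_ge0 //.
 by rewrite invf_le1 // ler1n.
rewrite memNset; last by move/eqP: l0.
rewrite mulr0 add0r k0_norm //.
have [z z0 E] : exists2 z, 0 < z & (forall t, gs t l = gs t z) /\ kap l = kap z by exists `|l|; rewrite ?normr_gt0 // /kap normr_id; split=> // t; rewrite /gs sqn.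
case: E=> E ->; rewrite {}E.
have s20 : 0 < Num.sqrt 2 :> R by rewrite sqrtr_gt0.
have [w w0 zw] : exists2 w, 0 < w & z = Num.sqrt 2 * w by exists (z / Num.sqrt 2); rewrite ?divr_gt0 // mulrC divfK // gt_eqF.
have w2 : z ^+ 2 = 2 * w ^+ 2 by rewrite zw exprMn sqr_sqrtr.
have le1 : ((2 * sqpi * kap z)%:E <= (gs (e / 2) z * Num.sqrt 2)%:E * (2 * sqpi * kap w)%:E)%E.
 have kE (x : R) : 0 < x -> (2 * sqpi * kap x)%:E = (\int[mu]_(t in `[e, +oo[) (x * gs t x / Num.sqrt t)%:E)%E by move=> x0; rewrite heat_int // /kap gtr0_norm.
 have mI (x : R) : measurable_fun `[e, +oo[%classic (fun t => (x * gs t x / Num.sqrt t)%:E).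
  apply/measurable_EFinP; apply: subspace_continuous_measurable_fun; first exact: measurable_itv.
  exact: heat_cont.
 have nn (x : R) : 0 < x -> forall t, `[e, +oo[%classic t -> (0 <= (x * gs t x / Num.sqrt t)%:E)%E.
  move=> x0 t _; rewrite lee_fin.
  by rewrite mulr_ge0 ?invr_ge0 ?sqrtr_ge0 // mulr_ge0 ?(ltW (gs_gt0 _ _)) // ltW.
 have c0 : (0 <= (gs (e / 2) z * Num.sqrt 2)%:E)%E by rewrite lee_fin mulr_ge0 ?(ltW (gs_gt0 _ _)) ?sqrtr_ge0.
 rewrite (kE z z0) (kE w w0).
 rewrite -(ge0_integralZl mu (measurable_itv _) (mI w) (nn w w0) c0).
 apply: ge0_le_integral=> //.
 - exact: nn.
 - exact: mI.
 - by apply: measurable_funeM; exact: mI.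
 move=> t; rewrite /= in_itv /= andbT=> et; rewrite -EFinM lee_fin.
 rewrite [X in X * gs t z]zw [leRHS]mulrA; apply: ler_wpM2r; first by rewrite invr_ge0 sqrtr_ge0.
 have gg : gs t z <= gs (e / 2) z * gs t w.
  rewrite /gs -expRD ler_expR w2.
  have : 0 <= (t - e) * w ^+ 2 by rewrite mulr_ge0 ?sqr_ge0 // subr_ge0.
  lra.
 have -> : gs (e / 2) z * Num.sqrt 2 * (w * gs t w) = Num.sqrt 2 * w * (gs (e / 2) z * gs t w) by lra.
 by apply: ler_wpM2l=> //; rewrite mulr_ge0 // ltW.
move: le1; rewrite -EFinM lee_fin=> le1.
have /andP[_ kw] := kap_bd w; have g0 := gs_gt0 (e / 2) z; have p0 := sqpi_gt0.
have s2 : Num.sqrt 2 <= 2 :> R.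
 rewrite -[leRHS]ger0_norm // -sqrtr_sqr ler_sqrt ?exprn_ge0 //; by rewrite -natrX ler_nat.
have : gs (e / 2) z * Num.sqrt 2 * (2 * sqpi * kap w) <= gs (e / 2) z * 2 * (2 * sqpi * 2^-1).
 apply: ler_pM; rewrite ?mulr_ge0 ?(ltW g0) ?(ltW p0) ?sqrtr_ge0 //; first by have /andP[] := kap_bd w.
  by rewrite ler_pM2l.
 by rewrite ler_pM2l // mulr_gt0.
move=> h; have h2 := le_trans le1 h.
rewrite -(@ler_pM2l _ (2 * sqpi)) ?mulr_gt0 //; apply: le_trans h2 _; lra.
Qed.

Lemma bm_hh : bm hh.
Proof.
split.
 apply: cmf=> l; apply: differentiable_continuous; apply/derivable1_diffP.
 by have ? := hh_derive l; exact: ex_derive.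
exists 2^-1=> l; have /andP[a b] := kap_bd l; rewrite /kap in a b.
have h : `|hh l| = `|hh `|l| | by case: (ltgtP l 0) => h; rewrite ?h ?normr0 // ?(ltr0_norm h) ?(gtr0_norm h) ?hhN ?normrN.
by rewrite h ler_norml; apply/andP; split; lra.
Qed.

Lemma bm_kk : bm kk.
Proof. by apply: bmB; [apply: bmB; [exact: bm_pos01|exact: bm_cst] | exact: bm_hh]. Qed.
End Heat.
End Gaussian.
Lemma gs_split (e t l : R) : gs t l = gs (t - e / 2) l * gs (e / 2) l.
Proof. by rewrite /gs -expRD; congr expR; lra. Qed.

(** * Fubini's theorem for the eta integral *)

Section FubiniHeat.
Local Notation mu := (@lebesgue_measure R).
Variables (m : {measure set R -> \bar R}) (e : R).
Hypotheses (mT : (m setT < +oo)%E) (e0 : 0 < e).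
(** The missing factor [exp(-e l^2/2)] is put into the measure [m], which makes it finite; for
    [t >= e] the exponent left over is still at least [e/2]. *)
Let u (t l : R) : R := l * gs (t - e / 2) l.
(** The function [1/sqrt(t)] on [[e, +oo[], extended by 0. The maximum changes nothing there and
    keeps the denominator away from 0, so that [q] is measurable everywhere. *)
Let q (t : R) : R := (Order.max (Num.sqrt t) (Num.sqrt e))^-1 * \1_(`[e, +oo[%classic) t.

Let qE (t : R) : q t = if t \in `[e, +oo[%classic then (Num.sqrt t)^-1 else 0.
Proof.
rewrite /q indE; case: ifP=> h; rewrite ?mulr0 // mulr1.
move: h; rewrite mem_setE in_itv /= andbT=> h.
by rewrite max_l // ler_sqrt // (le_trans (ltW e0)).
Qed.

Let q_ge0 t : 0 <= q t.
Proof. by rewrite qE; case: ifP=> // _; rewrite invr_ge0 sqrtr_ge0. Qed.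

Let mq : measurable_fun setT q.
Proof.
apply: measurable_funM.
 apply: (@mf_inv _ _ _ _ (Num.sqrt e)); first by rewrite sqrtr_gt0.
  by move=> t; rewrite le_max lexx orbT.
 apply: measurable_maxr; last exact: measurable_cst.
 by apply: cmf; exact: sqrt_continuous.
by apply: measurable_indic; exact: measurable_itv.
Qed.

Let f (z : R * R) : \bar R := (u z.1 z.2 * q z.1)%:E.

Let mf : measurable_fun setT f.
Proof.
apply/measurable_EFinP; apply: measurable_funM; last by apply: measurableT_comp=> //; exact: measurable_fst.
apply: measurable_funM; first exact: measurable_snd.
apply: measurableT_comp=> //; apply: measurable_funM.
 apply: measurable_funN; apply: measurable_funB; [exact: measurable_fst|exact: measurable_cst].
by apply: measurable_funX; exact: measurable_snd.
Qed.

Let m' : {finite_measure set R -> \bar R} := mfrestr measurableT mT.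
Let mE (g : R -> \bar R) : (\int[m']_x g x = \int[m]_x g x)%E.
Proof.
apply: eq_measure_integral=> A mA _.
by change (mfrestr measurableT mT A = m A); rewrite /mfrestr /mrestr setIT.
Qed.

Let qint (g : R -> R) : 
 (\int[mu]_t (g t * q t)%:E = \int[mu]_(t in `[e, +oo[) (g t / Num.sqrt t)%:E)%E.
Proof.
rewrite [RHS]integral_mkcond; apply: eq_integral=> t _.
by rewrite /patch qE; case: ifP; rewrite ?mulr0.
Qed.

Let inner_abs (l : R) : (\int[mu]_t `|f (t, l)| = ((gs (e / 2) l)^-1 * (2 * sqpi * `|k0 e l|))%:E)%E.
Proof.
have g0 := gs_gt0 (e / 2) l.
have mI : measurable_fun `[e, +oo[%classic (fun t => (`|l| * gs t l / Num.sqrt t)%:E).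
 apply/measurable_EFinP.
 have -> : (fun t => `|l| * gs t l / Num.sqrt t) = (fun t => Num.sg l * (l * gs t l / Num.sqrt t)) by apply/funext=> t; rewrite normrEsg !mulrA.
 apply: measurable_funM; first exact: measurable_cst.
 apply: subspace_continuous_measurable_fun; first exact: measurable_itv.
 exact: heat_cont.
have nn t : `[e, +oo[%classic t -> (0 <= (`|l| * gs t l / Num.sqrt t)%:E)%E by move=> _; rewrite lee_fin !mulr_ge0 ?invr_ge0 ?sqrtr_ge0 ?(ltW (gs_gt0 _ _)).
have c0 : (0 <= ((gs (e / 2) l)^-1)%:E)%E by rewrite lee_fin invr_ge0 ltW.
rewrite EFinM -(heat_int_abs e0 l) -(ge0_integralZl mu (measurable_itv _) mI nn c0).
transitivity (\int[mu]_t (`|u t l| * q t)%:E)%E.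
 by apply: eq_integral=> t _; rewrite /f /= normrM (ger0_norm (q_ge0 t)).
rewrite (qint (fun t => `|u t l|)); apply: eq_integral=> t _; rewrite -EFinM; congr EFin.
rewrite /u normrM (ger0_norm (ltW (gs_gt0 _ _))) (gs_split e t) mulrA; congr (_ / _).
by field; rewrite gt_eqF.
Qed.

Let kq (l : R) : R := k0 e l / gs (e / 2) l.
Let kq1 l : `|kq l| <= 1.
Proof.
have g0 := gs_gt0 (e / 2) l; rewrite /kq normrM normfV (gtr0_norm g0) ler_pdivrMr // mul1r.
have [->|l0] := eqVneq l 0; first by rewrite /k0 sgr0 mul0r normr0 ltW // gs_gt0.
have := kk_gs e0 l; rewrite kkE // indE memNset; last by move/eqP: l0.
by rewrite mulr0 add0r.
Qed.

Let bkq : bm kq.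
Proof.
split; last by exists 1.
have b1 : measurable_fun setT (k0 e).
 have -> : k0 e = fun l => kk e l - 2^-1 * \1_[set 0] l by apply/funext=> l; rewrite kkE // addrAC subrr add0r.
 case: (bmB (bm_kk e0) (bmZ 2^-1 (bm_ind (measurable_set1 (0 : R))))) => + _; exact.
apply: measurable_funM=> //; have -> : (fun l => (gs (e / 2) l)^-1) = (fun l => expR (e / 2 * l ^+ 2)).
 by apply/funext=> l; rewrite /gs -expRN mulNr opprK.
apply: measurableT_comp=> //; apply: measurable_funM; first exact: measurable_cst.
by apply: measurable_funX; exact: measurable_id.
Qed.

Let imf : (mu \x m')%E.-integrable setT f.
Proof.
(* Integrating in [t] first gives [|k0|] divided by the Gaussian weight; [kk_gs] says exactly that
   this quotient is bounded. *)
apply: (@integrable21ltyP _ _ _ _ R mu m' f mf).2; under eq_integral do rewrite inner_abs.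
rewrite mE.
have E l : (gs (e / 2) l)^-1 * (2 * sqpi * `|k0 e l|) = 2 * sqpi * `|kq l| by rewrite /kq normf_div (gtr0_norm (gs_gt0 _ _)); lra.
under eq_integral do rewrite E.
have b : bm (fun l => 2 * sqpi * `|kq l|).
 apply: bmZ; split; last by exists 1=> l; rewrite normr_id.
 by case: bkq=> + _; move=> ?; exact: measurableT_comp.
have /integrableP[_] := bm_int mT b.
under eq_integral do rewrite /= ger0_norm ?mulr_ge0 ?(ltW sqpi_gt0) //.
by [].
Qed.

Let F t : (\int[m']_l f (t, l) = ((\int[m]_l u t l) * q t)%:E)%E.
Proof.
rewrite mE; case: (boolP (t \in `[e, +oo[%classic)) => ht; last first.
 under eq_integral do rewrite /f /= qE (negbTE ht) mulr0.
 by rewrite integral0 qE (negbTE ht) mulr0.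
move: ht; rewrite mem_setE in_itv /= andbT=> et.
have t2 : 0 < t - e / 2 by have := e0; lra.
have bu : bm (u t) by exact: bm_lgs.
have iu := bm_int mT bu.
rewrite /f /=; under eq_integral do rewrite EFinM.
rewrite integralZr // [RHS]EFinM; congr (_ * _)%E.
by rewrite /Rintegral fineK //; exact: integrable_fin_num.
Qed.

Let G l : (\int[mu]_t f (t, l) = (2 * sqpi * kq l)%:E)%E.
Proof.
have g0 := gs_gt0 (e / 2) l.
rewrite /f /= (qint (fun t => u t l)).
have iH := heat_integrable e0 l.
have -> : (\int[mu]_(t in `[e, +oo[) (u t l / Num.sqrt t)%:E =
  \int[mu]_(t in `[e, +oo[) (((gs (e / 2) l)^-1)%:E * (l * gs t l / Num.sqrt t)%:E))%E.
 apply: eq_integral=> t _; rewrite -EFinM; congr EFin.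
 by rewrite /u (gs_split e t) !mulrA; congr (_ / _); field; rewrite gt_eqF.
rewrite integralZl //.
have -> : (\int[mu]_(t in `[e, +oo[) (l * gs t l / Num.sqrt t)%:E = (2 * sqpi * k0 e l)%:E)%E by rewrite -(heat_Rint e0 l) /Rintegral fineK //; exact: integrable_fin_num.
by rewrite -EFinM; congr EFin; rewrite /kq; lra.
Qed.

Lemma fubini_heat :
 mu.-integrable `[e, +oo[ (EFin \o (fun t => (\int[m]_l u t l) / Num.sqrt t)) /\
 \int[mu]_(t in `[e, +oo[) ((\int[m]_l u t l) / Num.sqrt t) = 2 * sqpi * \int[m]_l (k0 e l / gs (e / 2) l).
Proof.
have FG := Fubini imf; have iF := integrable_fubini_F imf.
have E : fubini_F m' f = (EFin \o (fun t => (\int[m]_l u t l) / Num.sqrt t)) \_ `[e, +oo[%classic.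
 apply/funext=> t; rewrite /fubini_F F /patch qE; case: ifP; rewrite ?mulr0 //.
have i1 : mu.-integrable `[e, +oo[ (EFin \o (fun t => (\int[m]_l u t l) / Num.sqrt t)) by apply/integrable_mkcond; [exact: measurable_itv|rewrite -E].
split=> //; apply: EFin_inj.
rewrite /Rintegral fineK; last exact: integrable_fin_num.
rewrite integral_mkcond -E /fubini_F FG.
transitivity (\int[m']_l (2 * sqpi * kq l)%:E)%E; first by apply: eq_integral=> l _; exact: G.
have b : bm (fun l => 2 * sqpi * kq l) by exact: bmZ.
rewrite mE -[LHS]fineK; last exact: (integrable_fin_num measurableT (bm_int mT b)).
by congr EFin; rewrite -bint_Z.
Qed.
End FubiniHeat.

Section Eta.
Local Notation mu := (@lebesgue_measure R).
Variables (D : operator K) (e : R).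
Hypotheses (hD : dsa D) (aD : aff D) (e0 : 0 < e).
Hypothesis th : forall s, 0 < s -> fp (fn D (gs s)).

Lemma tc_lgs (t : R) : 0 < t -> tc (fn D (fun l => l * gs t l)).
Proof.
move=> t0; have t2 : 0 < t / 2 by rewrite divr_gt0.
have b1 := bm_gse t2.
have b2 : bm (fun l : R => l * gs (t / 2) l) by exact: bm_lgs.
have -> : (fun l : R => l * gs t l) = (fun l => (l * gs (t / 2) l) * gs (t / 2) l) by apply/funext=> l; rewrite (gs_half t) mulrA.
rewrite -fnM //; apply: tcM; first exact: inN_fn.
by have [] := fp_tc (th t2).
Qed.

Lemma tc_kk : tc (fn D (kk e)).
Proof.
have e2 : 0 < e / 2 by rewrite divr_gt0.
exact: (tc_fn hD aD (bm_kk e0) (bm_gse e2) (kk_gs e0) (th e2)).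
Qed.

Lemma fp_ker : fp (fn D \1_[set 0]).
Proof.
apply: (fp_fn_le hD aD (bm_ind (measurable_set1 _)) (bm_gse ltr01) _ (th ltr01)).1=> l.
rewrite indE; case: ifP=> h; rewrite ?lexx ?ler01 ?(ltW (gs_gt0 _ _)) //.
by move/set_mem: h=> ->; rewrite /gs expr0n mulr0 expR0 lexx.
Qed.

(** The trace measure with weight [exp(-e l^2/2)] turns the traces for all [t >= e] into integrals
    against one finite measure, and [fubini_heat] exchanges the integrations. The kernel is
    subtracted because the odd part [k0] of [kk] vanishes at 0. *)
Lemma eta_formula :
 mu.-integrable `[e, +oo[ (EFin \o (fun t => tr (fn D (fun l => l * gs t l)) / Num.sqrt t)) /\
 \int[mu]_(t in `[e, +oo[) (tr (fn D (fun l => l * gs t l)) / Num.sqrt t) =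
  2 * sqpi * (tr (fn D (kk e)) - 2^-1 * ft (fn D \1_[set 0])).
Proof.
have e2 : 0 < e / 2 by rewrite divr_gt0.
have bg := bm_gse e2; have g0 l : 0 <= gs (e / 2) l by rewrite ltW // gs_gt0.
have [m [mT _ hm]] := trace_measure hD aD bg g0 (th e2).
have E t : e <= t -> tr (fn D (fun l => l * gs t l)) = \int[m]_l (l * gs (t - e / 2) l).
 move=> et; have t2 : 0 < t - e / 2 by have := e0; lra.
 have bu : bm (fun l : R => l * gs (t - e / 2) l) by exact: bm_lgs.
 rewrite -(hm _ bu).2; congr (tr (fn D _)); apply/funext=> l.
 by rewrite (gs_split e t); lra.
have [i1 i2] := fubini_heat mT e0.
have inv_gs : bm (fun l : R => \1_[set 0] l / gs (e / 2) l : R).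
 have -> : (fun l : R => \1_[set 0] l / gs (e / 2) l) = (\1_[set 0] : R -> R).
  apply/funext=> l; rewrite indE; case: ifP=> h; last by rewrite mul0r.
  by move/set_mem: h=> ->; rewrite /gs expr0n mulr0 expR0 divr1.
 by apply: bm_ind; exact: measurable_set1.
have gv l : gs (e / 2) l != 0 by rewrite gt_eqF // gs_gt0.
have bk : bm (fun l => kk e l / gs (e / 2) l).
 split.
  have -> : (fun l => kk e l / gs (e / 2) l) = (fun l => kk e l * expR (e / 2 * l ^+ 2)) by apply/funext=> l; rewrite /gs -expRN mulNr opprK.
  apply: measurable_funM; first by case: (bm_kk e0).
  apply: measurableT_comp=> //; apply: measurable_funM; first exact: measurable_cst.
  by apply: measurable_funX; exact: measurable_id.
 exists 1=> l; rewrite normf_div (ger0_norm (g0 l)) ler_pdivrMr ?gs_gt0 // mul1r.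
 exact: kk_gs.
have trk : tr (fn D (kk e)) = \int[m]_l (kk e l / gs (e / 2) l).
 rewrite -(hm _ bk).2; congr (tr (fn D _)); apply/funext=> l.
 by rewrite mulrC divfK.
have trz : ft (fn D \1_[set 0]) = \int[m]_l (\1_[set 0] l / gs (e / 2) l).
 rewrite -(hm _ inv_gs).2 -(fp_tc fp_ker).2; congr (tr (fn D _)); apply/funext=> l.
 by rewrite mulrC divfK.
split.
 move: i1; apply: eq_integrable; first exact: measurable_itv.
 by move=> t; rewrite inE /= in_itv /= andbT=> et; rewrite /= E.
rewrite trk trz -(bint_Z mT 2^-1 inv_gs) -bint_B //; last exact: bmZ.
transitivity (\int[mu]_(t in `[e, +oo[) ((\int[m]_l (l * gs (t - e / 2) l)) / Num.sqrt t)).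
 by apply: eq_Rintegral=> t; rewrite inE /= in_itv /= andbT=> et; rewrite E.
rewrite i2; congr (_ * _); apply: eq_Rintegral=> l _.
by rewrite kkE // mulrDl mulrA addrC addKr.
Qed.
End Eta.

(** * The limit of the compressions across a spectral gap *)

Section Gap.
Local Notation mu := (@lebesgue_measure R).
Variables (D : operator K) (e c : R) (T : bop K).
Hypotheses (hD : dsa D) (aD : aff D) (e0 : 0 < e) (c0 : 0 < c).
Hypothesis th : forall s, 0 < s -> fp (fn D (gs s)).
Hypotheses (sT : sa T) (hT : inN T).
Let DT := perturb D T.
Let Dn n := perturb D (cut D n T).
Hypothesis gap : fn DT \1_(`](- c), c[%classic) = 0.

Let hDT : dsa DT. Proof. exact: dsa_perturb. Qed.
Let sC n : sa (cut D n T). Proof. exact: (sa_cut hD aD th). Qed.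
Let hC n : inN (cut D n T). Proof. exact: (inN_cut hD aD th). Qed.
Let hDn n : dsa (Dn n). Proof. exact: dsa_perturb. Qed.
Let aDn n : aff (Dn n). Proof. exact: affil_perturb. Qed.
Let aDT : aff DT. Proof. exact: affil_perturb. Qed.

Lemma fn_gap D' d f g : dsa D' -> fn D' \1_(`](- d), d[%classic) = 0 -> bm f -> bm g ->
 (forall l, d <= `|l| -> f l = g l) -> fn D' f = fn D' g.
Proof.
move=> hD' gd bf bg fg; pose i : R -> R := \1_(`](- d), d[%classic).
have bi : bm i by apply: bm_ind; exact: measurable_itv.
have E k : bm k -> fn D' k = fn D' (fun l => k l * (1 - i l)).
 move=> bk; rewrite -fnM ?fnB ?fn1 ?gd ?subr0 ?mulr1 //; first exact: bm_cst.
 by apply: bmB=> //; exact: bm_cst.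
rewrite (E f) // (E g) //; congr fn; apply/funext=> l.
rewrite /i indE; case: ifPn; rewrite ?subrr ?mulr0 // mem_setE in_itv /= -ltr_norml -leNgt=> h.
by rewrite fg.
Qed.

Lemma th_perturb S t : sa S -> inN S -> 0 < t -> fp (fn (perturb D S) (gs t)).
Proof. by move=> sS hS t0; have [M _ hM] := theta_bd hD aD e0 th t0 (opn_ge0 S); case: (hM S sS hS (lexx _)). Qed.

(** On a vector in the spectral subspace of [(-c/2, c/2)] for [D_n] the heat form is at least
    [exp(-c^2/4)], whereas for [D + T] it is at most [exp(-c^2)]. Norm convergence of the heat
    operators contradicts this for large [n] unless the vector is 0. *)
Lemma gap_cut : exists n0, forall n, (n0 <= n)%N -> fn (Dn n) \1_(`](- (c / 2)), (c / 2)[%classic) = 0.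
Proof.
pose r := (expR (- (c ^+ 2 / 4)) - expR (- c ^+ 2)) / 2.
have lt : expR (- c ^+ 2) < expR (- (c ^+ 2 / 4)) by rewrite ltr_expR ltrN2; have := exprn_gt0 2 c0; lra.
have r0 : 0 < r by rewrite divr_gt0 // subr_gt0.
have [n0 hn] := heat_conv hD aD th ltr01 (opn_ge0 T) r0.
exists n0=> n nn; have [h1 _] := hn n T nn sT (lexx _).
have mI : measurable (`](- (c / 2)), (c / 2)[%classic : set R) by exact: measurable_itv.
have mJ : measurable (`](- c), c[%classic : set R) by exact: measurable_itv.
have bi : bm (\1_(`](- (c / 2)), (c / 2)[%classic) : R -> R) by exact: bm_ind.
have bj : bm (\1_(`](- c), c[%classic) : R -> R) by exact: bm_ind.
have bg := bm_gse (ltr01 : 0 < 1 :> R).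
apply: bop_ext=> y; rewrite op0; set i := \1_ _ in bi *; set x := fn (Dn n) i y.
have ex : fn (Dn n) i x = x by exact: (proj_idem _ (fn_proj (hDn n) mI)).
have lo1 : expR (- (c ^+ 2 / 4)) * ip x x <= ip (fn (Dn n) (gs 1) x) x.
 have bz : bm (fun l => expR (- (c ^+ 2 / 4)) * i l) by exact: bmZ.
 have := loE x (fn_lo (hDn n) bz bg _); rewrite fnZ // opR ipZl ex; apply=> l.
 rewrite /i indE; case: ifPn; rewrite ?mulr0 ?(ltW (gs_gt0 _ _)) // mem_setE in_itv /= -ltr_norml=> h.
 rewrite !mulr1 /gs ler_expR mulN1r lerN2 -sqn.
 have -> : c ^+ 2 / 4 = (c / 2) ^+ 2 by rewrite expr_div_n -natrX.
 by rewrite ler_pXn2r ?nnegrE // ?ltW // divr_gt0.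
have hi1 : ip (fn DT (gs 1) x) x <= expR (- c ^+ 2) * ip x x.
 pose k l := gs 1 l * (1 - \1_(`](- c), c[%classic) l).
 have bk : bm k by apply: bmM=> //; apply: bmB=> //; exact: bm_cst.
 have -> : fn DT (gs 1) = fn DT k.
  apply: (fn_gap hDT gap) => // l; rewrite leNgt ltr_norml=> /negP h.
  by rewrite /k indE memNset ?subr0 ?mulr1 //=; rewrite in_itv /=.
 have := loE x (fn_lo hDT bk (bm_cst (expR (- c ^+ 2))) _); rewrite fn_cst // opR op1 ipZl; apply=> l.
 rewrite /k indE; case: ifPn; rewrite ?subrr ?mulr0 ?expR_ge0 // mem_setE in_itv /= -ltr_norml -leNgt=> h.
 rewrite subr0 mulr1 /gs ler_expR mulN1r lerN2 -[leRHS]sqn.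
 by rewrite ler_pXn2r ?nnegrE // ltW.
have := ler_norm (ip ((fn (Dn n) (gs 1) - fn DT (gs 1)) x) x).
move=> h2; have h3 := le_trans h2 (sa_abs_le _ _); rewrite opB ipBl in h3.
have h4 : opn (fn (Dn n) (gs 1) - fn DT (gs 1)) * ip x x <= r * ip x x by apply: ler_wpM2r=> //; exact: ip_ge0.
apply: ipxx_eq0; apply/eqP; rewrite eq_le ip_ge0 andbT leNgt; apply/negP=> q0.
have : (expR (- (c ^+ 2 / 4)) - expR (- c ^+ 2)) * ip x x <= r * ip x x by lra.
by rewrite ler_pM2r //; move: lt; rewrite /r; lra.
Qed.

(** [l exp(-t l^2)] is split as [l exp(-t l^2/2)] times the square of [exp(-t l^2/4)]: the first
    factor converges in norm and the square carries the trace. *)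
Lemma lgs_conv (t : R) : 0 < t ->
 tr (fn (Dn n) (fun l => l * gs t l)) @[n --> \oo] --> tr (fn DT (fun l => l * gs t l)).
Proof.
move=> t0; have t2 : 0 < t / 2 by rewrite divr_gt0.
have t4 : 0 < t / 2 / 2 by rewrite divr_gt0.
pose b l : R := l * gs (t / 2) l; pose w (l : R) := gs (t / 2 / 2) l.
have bw : bm w by exact: bm_gse.
have bl : bm b by exact: bm_lgs.
have E D' : dsa D' -> fn D' (fun l => l * gs t l) = fn D' b * (fn D' w * fn D' w).
 move=> hD'; rewrite !fnM //; last exact: bmM.
 by congr fn; apply/funext=> l; rewrite /b /w -gs_half (gs_half t) mulrA.
have [M M0 hM] := theta_bd hD aD e0 th t4 (opn_ge0 T).
have w1 D' : dsa D' -> opn (fn D' w) <= 1.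
 move=> hD'; apply: fn_opn=> // l.
 by rewrite ger0_norm ?gs_le1 ?(ltW (gs_gt0 _ _)) ?(ltW t4).
set B := opn (fn DT b); have B0 : 0 <= B := opn_ge0 _.
apply/cvgrPdist_le=> r r0.
pose r1 := r / (M * (1 + 2 * B) + 1).
have k0 : 0 < M * (1 + 2 * B) + 1 by rewrite ltr_wpDl // mulr_ge0 // addr_ge0 // mulr_ge0.
have r10 : 0 < r1 by rewrite divr_gt0.
have [n0 hn] := heat_conv hD aD th t2 (opn_ge0 T) r10.
have [n1 hn1] := heat_conv hD aD th t4 (opn_ge0 T) r10.
exists (n0 + n1)%N=> // n /= nn.
have nn0 : (n0 <= n)%N by apply: leq_trans nn; exact: leq_addr.
have nn1 : (n1 <= n)%N by apply: leq_trans nn; exact: leq_addl.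
have [_ k1] := hn n T nn0 sT (lexx _); have [k2 _] := hn1 n T nn1 sT (lexx _).
have [f1 l1] := hM _ (sC n) (hC n) (cut_opn hD aD th n T).
have [f2 l2] := hM T sT hT (lexx _).
rewrite distrC !E //; set x := fn (Dn n) b; set y := fn DT b.
have hx : inN x by exact: inN_fn.
have hy : inN y by exact: inN_fn.
move: f1 l1 f2 l2 k2 (w1 _ (hDn n)) (w1 _ hDT); rewrite -/w -/(Dn n) -/DT.
set u := fn (Dn n) w; set v := fn DT w=> f1 l1 f2 l2 k2 u1 v1.
have [tu _] := fp_tc f1; have hu := tc_inN tu.
have [tv _] := fp_tc f2; have hv := tc_inN tv.
have tuu : tc (u * u) by exact: tcM.
have tvv : tc (v * v) by exact: tcM.
have -> : x * (u * u) = (x - y) * (u * u) + y * (u * u) by rewrite -mulrDl subrK.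
rewrite trD; [|by apply: tcM=> //; exact: inNB|exact: tcM].
rewrite -addrA; apply: le_trans (ler_normD _ _) _.
have a1 : `|tr ((x - y) * (u * u))| <= r1 * M.
 rewrite mulrA; apply: le_trans (tr_bd _ f1) _; first by apply: inNM=> //; exact: inNB.
 apply: ler_pM; rewrite ?opn_ge0 ?ft_ge0 //.
 by apply: opnM_le; rewrite -[leRHS]mulr1; apply: ler_pM (opn_ge0 _) (opn_ge0 _) k1 u1.
have a2 : `|tr (y * (u * u)) - tr (y * (v * v))| <= B * (r1 * (M + M)).
 apply: le_trans (tr_sq_diff hy f1 f2 u1 v1) _; apply: ler_wpM2l=> //.
 by apply: ler_pM; rewrite ?opn_ge0 ?addr_ge0 ?ft_ge0 // lerD.
have -> : r = (M * (1 + 2 * B) + 1) * r1 by rewrite /r1 mulrC divfK // gt_eqF.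
apply: le_trans (lerD a1 a2) _.
have -> : (M * (1 + 2 * B) + 1) * r1 = r1 * M + B * (r1 * (M + M)) + r1 by ring.
by rewrite lerDl ltW.
Qed.

(** With a gap the kernels vanish and [tr(kk)] is the eta integral alone. The integrand converges
    for each [t]; the gap common to all large [n] provides a decay in [t] that does not depend on
    [n], so dominated convergence applies. *)
Lemma trk_cvg : tr (fn (Dn n) (kk e)) @[n --> \oo] --> tr (fn DT (kk e)).
Proof.
have [n0 hn0] := gap_cut.
have c2 : 0 < c / 2 by rewrite divr_gt0.
have e4 : 0 < e / 2 / 2 by rewrite !divr_gt0.
have [M M0 hM] := theta_bd hD aD e0 th e4 (opn_ge0 T).
have kfor D' d : dsa D' -> aff D' -> (forall s, 0 < s -> fp (fn D' (gs s))) -> 0 < d ->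
  fn D' \1_(`](- d), d[%classic) = 0 ->
  mu.-integrable `[e, +oo[ (EFin \o (fun t => tr (fn D' (fun l => l * gs t l)) / Num.sqrt t)) /\
  tr (fn D' (kk e)) = (2 * sqpi)^-1 * \int[mu]_(t in `[e, +oo[) (tr (fn D' (fun l => l * gs t l)) / Num.sqrt t).
 move=> hD' aD' th' d0 gd; have [i1 ->] := eta_formula hD' aD' e0 th'; split=> //.
 have -> : fn D' \1_[set 0] = 0.
  rewrite (fn_gap hD' gd (bm_ind (measurable_set1 _)) (bm_cst 0)) ?fn0 // => l dl.
  rewrite indE memNset //= => l0; move: dl; rewrite l0 normr0 leNgt d0 //.
 by rewrite fp0.2 mulr0 subr0 mulrA mulVf ?mul1r // gt_eqF // mulr_gt0 // sqpi_gt0.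
have gapT := kfor DT c hDT aDT (fun s s0 => th_perturb sT hT s0) c0 gap.
have thn n s : 0 < s -> fp (fn (Dn n) (gs s)) by exact: th_perturb.
have gapn := fun n (nn : (n0 <= n)%N) => kfor (Dn n) (c / 2) (hDn n) (@aDn n) (@thn n) c2 (hn0 n nn).
pose F n t := tr (fn (Dn (n + n0)%N) (fun l => l * gs t l)) / Num.sqrt t.
(* The dominating function is a multiple of the scalar heat integrand at [l = c/2], already known to
   be integrable; the exponential in [B] restores the part [3e/4] of the time spent on boundedness
   and on the trace. *)
pose B := M * (1 + (e / 2)^-1) * expR (3 * e * c ^+ 2 / 16) / (c / 2).
have dom n t : `[e, +oo[%classic t -> `|F n t| <= B * ((c / 2) * gs t (c / 2) / Num.sqrt t).
 rewrite /= in_itv /= andbT=> et; have t0 := lt_le_trans e0 et.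
 have s0 : 0 < Num.sqrt t by rewrite sqrtr_gt0.
 set m := (n + n0)%N; have gm := hn0 m (leq_addl n n0).
 have bt := bm_gse t0; have be2 : bm (gs (e / 2)) by apply: bm_gse; rewrite divr_gt0.
 have be4 := bm_gse e4.
 rewrite /F normrM normfV (gtr0_norm s0) mulrA ler_pM2r ?invr_gt0 //.
 have [f1 l1] := hM _ (sC m) (hC m) (cut_opn hD aD th m T).
 pose i (l : R) : R := 1 - \1_(`](- (c / 2)), (c / 2)[%classic) l.
 have bi : bm i by apply: bmB; [exact: bm_cst|apply: bm_ind; exact: measurable_itv].
 have i01 l : i l = if c / 2 <= `|l| then 1 else 0.
  rewrite /i indE mem_setE in_itv /= -ltr_norml ltNge.
  by case: (c / 2 <= `|l|) => /=; rewrite ?subrr ?subr0.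
 have blt : bm (fun l : R => l * gs t l) by exact: bm_lgs.
 have -> : fn (Dn m) (fun l => l * gs t l) = fn (Dn m) (fun l => l * gs t l * i l).
  apply: (fn_gap (hDn m) gm) => //; first exact: bmM.
  by move=> l h; rewrite i01 h mulr1.
 (* The time [t] is divided: [e/2] bounds the factor [l], [e/4] supplies the trace, and the
    remaining [t - 3e/4] yields decay because [|l| >= c/2] on the spectrum. *)
 pose C := (1 + (e / 2)^-1) * expR (- (t - 3 * e / 4) * (c / 2) ^+ 2).
 have C0 : 0 <= C by rewrite mulr_ge0 ?expR_ge0 // addr_ge0 // invr_ge0 divr_ge0 // ltW.
 have bd l : `|l * gs t l * i l| <= C * gs (e / 2 / 2) l.
  rewrite i01; case: ifP=> h; last by rewrite mulr0 normr0 mulr_ge0 // ltW // gs_gt0.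
  rewrite mulr1.
  have -> : l * gs t l = (l * gs (e / 2) l) * (gs (t - 3 * e / 4) l * gs (e / 2 / 2) l).
   rewrite -[RHS]mulrA; congr (_ * _); rewrite /gs -!expRD; congr expR; lra.
  rewrite normrM [X in _ * X]ger0_norm; last by rewrite mulr_ge0 // ltW // gs_gt0.
  rewrite mulrA; apply: ler_wpM2r; first by rewrite ltW // gs_gt0.
  apply: ler_pM; rewrite ?(ltW (gs_gt0 _ _)) //; first by apply: lgs_bd; rewrite divr_gt0.
  rewrite /gs ler_expR !mulNr lerN2; apply: ler_wpM2l; first by have := e0; lra.
  by rewrite -[leRHS]sqn ler_pXn2r ?nnegrE // ltW.
 have fC : fp (fn (Dn m) (fun l => C * gs (e / 2 / 2) l)) by rewrite fnZ //; exact: (fpR C0 f1).1.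
 have := tr_fn_bd (hDn m) (@aDn m) (bmM blt bi) (bmZ C be4) bd fC.
 rewrite fnZ // (fpR C0 f1).2=> h; apply: le_trans h _.
 apply: (@le_trans _ _ (C * M)); first exact: ler_wpM2l.
 rewrite /B mulrA divfK ?gt_eqF // /C.
 have -> : gs t (c / 2) = expR (- (t - 3 * e / 4) * (c / 2) ^+ 2) * expR (- (3 * e * c ^+ 2 / 16)) by rewrite /gs -expRD; congr expR; rewrite expr_div_n; lra.
 set z1 := expR (- _ * _); rewrite expRN; set z2 := expR _.
 have z20 : z2 != 0 by rewrite gt_eqF // expR_gt0.
 have -> : M * (1 + (e / 2)^-1) * z2 * (z1 / z2) = (1 + (e / 2)^-1) * z1 * M by field; rewrite z20 /= gt_eqF.
 exact: lexx.
have idom : mu.-integrable `[e, +oo[ (EFin \o (fun t => B * ((c / 2) * gs t (c / 2) / Num.sqrt t))).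
 pose g1 (t : R) : R := (c / 2) * gs t (c / 2) / Num.sqrt t.
 have -> : (EFin \o (fun t : R => B * g1 t)) = (fun t : R => (B%:E * (EFin \o g1) t)%E) by apply/funext=> t /=; rewrite EFinM.
 by apply: integrableZl; [exact: measurable_itv|exact: heat_integrable].
have meas D' : mu.-integrable `[e, +oo[ (EFin \o (fun t => tr (fn D' (fun l => l * gs t l)) / Num.sqrt t)) ->
  measurable_fun `[e, +oo[%classic (fun t => tr (fn D' (fun l => l * gs t l)) / Num.sqrt t) by move=> /integrableP[] /measurable_EFinP.
have lim t : `[e, +oo[%classic t -> F n t @[n --> \oo] --> tr (fn DT (fun l => l * gs t l)) / Num.sqrt t.
 rewrite /= in_itv /= andbT=> et; have t0 := lt_le_trans e0 et.
 have lc := lgs_conv t0.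
 have lc1 : (fun n => tr (fn (Dn (n + n0)%N) (fun l => l * gs t l))) @ \oo --> tr (fn DT (fun l => l * gs t l)) by rewrite (cvg_shiftn n0 (fun n => tr (fn (Dn n) (fun l => l * gs t l)))).
 exact: (cvgMl lc1).
have mF n : measurable_fun `[e, +oo[%classic (F n) by apply: meas; exact: (gapn _ (leq_addl n n0)).1.
have [_ cv] := @Rdct R _ _ mu `[e, +oo[%classic F _ _ (measurable_itv _) mF (meas _ gapT.1) lim idom dom.
rewrite gapT.2 -(cvg_shiftn n0) /=.
have -> : (fun n => tr (fn (Dn (n + n0)%N) (kk e))) = (fun n => (2 * sqpi)^-1 * \int[mu]_(t in `[e, +oo[) F n t) by apply/funext=> n; rewrite (gapn _ (leq_addl n n0)).2.
by apply: cvgMr.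
Qed.
(** On the complement of the range of [E_n] the compressed perturbation vanishes, so [1 - E_n]
    intertwines [D] with [D_n]. *)
Lemma corner_compl n f : bm f -> fn (Dn n) f * (1 - ec D n) = fn D f * (1 - ec D n).
Proof.
move=> bf; have cc1 : (1 - ec D n) * fn D f = fn D f * (1 - ec D n).
 by rewrite mulrBl mulrBr mul1r mulr1 /ec fn_commute //; exact: bm_chi.
rewrite -cc1; apply/esym; apply: fn_inter=> // x hx.
have [h1 h2] := fn_fc_dom hD (bm_chi n%:R) hx.
have hd : op_dom D ((1 - ec D n) x) by rewrite opB op1; exact: (domB hD).
split=> //; have [_ e2] := cut_e hD aD th n T.
change (D ((1 - ec D n) x) + cut D n T ((1 - ec D n) x) = (1 - ec D n) (D x)).
by rewrite -opM mulrBr mulr1 e2 subrr op0 addr0 !opB !op1 (dopB hD) // h2.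
Qed.

(** Split [S_n S_T - 1] by the spectral projections of [D_n] for [[-n, n]] and of [D + T] for
    [[-r, r]]. The outer parts are [O(1/n)] and [O(1/r)] by [sg_sylvester]. In the inner part the
    gap gives the lower constant [c], and only [E_n T (1 - E_n)] acts, which is [O(1/n)] on low
    spectrum of [D + T]. *)
Lemma PP_conv : opn (PP (Dn n) - PP DT) @[n --> \oo] --> (0 : R).
Proof.
have bs := bm_sg.
pose Sn n := fn (Dn n) sg; pose ST := fn DT sg; pose X n := Sn n * ST - 1.
have opX n : opn (PP (Dn n) - PP DT) <= opn (X n).
 have -> : PP (Dn n) - PP DT = rso 2^-1 (Sn n * (- X n)).
  rewrite /X opprB mulrBr mulr1 mulrA sg_sq // mul1r /Sn /ST !fn_sg // /rso.
  rewrite -[LHS]half_bop; congr (_ *: _); apply: bop_ext=> x; apply: ip_ext=> z.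
  by rewrite !(opE, opR, ipE); lra.
 apply: le_trans (opnR _ _) _; rewrite ger0_norm //.
 apply: (@le_trans _ _ (2^-1 * (1 * opn (X n)))); last by have := opn_ge0 (X n); lra.
 apply: ler_wpM2l=> //; apply: opnM_le; rewrite opnN.
 by apply: ler_wpM2r; [exact: opn_ge0|exact: sg_opn].
set a := opn T; have a0 : 0 <= a by exact: opn_ge0.
have dT n : opn (T - cut D n T) <= 2 * a.
 apply: le_trans (opnB _ _) _; have := cut_opn hD aD th n T; rewrite -/a; lra.
have eDT n : DT = perturb (Dn n) (T - cut D n T) by rewrite perturb_perturb addrC subrK.
have sd n : sa (T - cut D n T) by exact: saB.
have syl n B1 B2 c1 c2 := @sg_sylvester (Dn n) (T - cut D n T) B1 B2 c1 c2 (hDn n) (sd n).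
pose e' n := fn (Dn n) (chi n%:R); pose er r := fn DT (chi r).
have m0 (r : R) : measurable (~` `[- r, r]%classic) by apply: measurableC; exact: measurable_itv.
have out (r l : R) : (~` `[- r, r]%classic) l -> r <= `|l| by rewrite /= in_itv /= -ler_norml=> /negP; rewrite -ltNge=> /ltW.
have u1 D' : dsa D' -> fn D' \1_setT = 1 by move=> h; rewrite -(fn1 h); congr fn; apply/funext=> l; rewrite indicT.
have bnd n r : (0 < n)%N -> 0 < r -> opn (X n) <= 4 * a / n%:R + 4 * a / r + 2 / c * (a * ((r + a) / n%:R)).
 move=> n0 r0; have nn : 0 < n%:R :> R by rewrite ltr0n.
 have i1 : opn ((1 - e' n) * X n) <= 4 * a / n%:R.
  have := syl n (~` `[- n%:R, n%:R]%classic) setT n%:R 0 (ltW nn) (lexx _) (m0 _) measurableT (out _) (fun l _ => normr_ge0 l).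
  rewrite -eDT u1 // !mulr1 -chiC // addr0=> h; rewrite ler_pdivlMr //.
  apply: le_trans h _; apply: (@le_trans _ _ (2 * opn (T - cut D n T))); last by have := dT n; lra.
  apply: ler_wpM2l=> //; apply: opnM_le; rewrite -[leRHS]mul1r.
  by apply: ler_wpM2r; [exact: opn_ge0|rewrite (chiC _ (hDn n)); apply: proj_opn; exact: (fn_proj (hDn n) (m0 _))].
 have pe' : opn (e' n) <= 1 by apply: proj_opn; exact: (fn_proj (hDn n) (measurable_itv _)).
 have i2 : opn (e' n * X n * (1 - er r)) <= 4 * a / r.
  have := syl n `[- n%:R, n%:R]%classic (~` `[- r, r]%classic) 0 r (lexx _) (ltW r0) (measurable_itv _) (m0 _) (fun l _ => normr_ge0 l) (out _).
  rewrite -eDT -chiC // add0r=> h; rewrite ler_pdivlMr //.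
  apply: le_trans h _; apply: (@le_trans _ _ (2 * opn (T - cut D n T))); last by have := dT n; lra.
  apply: ler_wpM2l=> //; apply: opnM_le; rewrite -[leRHS]mulr1.
  apply: ler_pM; rewrite ?opn_ge0 //.
   apply: opnM_le; rewrite -[leRHS]mul1r.
   by apply: ler_wpM2r; [exact: opn_ge0|exact: pe'].
  by rewrite (chiC r hDT); apply: proj_opn; exact: (fn_proj hDT (m0 r)).
 pose B2 : set R := `[- r, r]%classic `&` ~` `](- c), c[%classic.
 have mB2 : measurable B2 by apply: measurableI; [exact: measurable_itv|apply: measurableC; exact: measurable_itv].
 have cB2 l : B2 l -> c <= `|l| by move=> [_]; rewrite /= in_itv /= -ltr_norml=> /negP; rewrite -leNgt.
 have eB2 : er r = fn DT \1_B2.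
  apply: (fn_gap hDT gap) => [||l cl]; [exact: bm_chi|exact: bm_ind|].
  rewrite /chi -indM (indE (~` _)) mem_set ?mulr1 //= in_itv /= -ltr_norml.
  by apply/negP; rewrite -leNgt.
 have i3 : opn (e' n * X n * er r) <= 2 / c * (a * ((r + a) / n%:R)).
  have := syl n `[- n%:R, n%:R]%classic B2 0 c (lexx _) (ltW c0) (measurable_itv _) mB2 (fun l _ => normr_ge0 l) cB2.
  rewrite -eDT -eB2 add0r=> h.
  have -> : 2 / c * (a * ((r + a) / n%:R)) = 2 * (a * ((r + a) / n%:R)) / c by ring.
  rewrite ler_pdivlMr //; apply: le_trans h _; apply: ler_wpM2l=> //.
  (* Off the range of [E_n] the operator [D_n] is [D], which has no spectrum in [[-n, n]] there. *)
  have ee : e' n = e' n * ec D n.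
   apply/eqP; rewrite -subr_eq0 -[X in X - _]mulr1 -mulrBr corner_compl; last exact: bm_chi.
   by rewrite mulrBr mulr1 -/(ec D n) (ec_proj hD aD th n).2 subrr.
  rewrite -/(e' n) ee -[X in opn X]mulrA.
  have -> : e' n * ec D n * ((T - cut D n T) * er r) = e' n * (ec D n * (T * ((1 - ec D n) * er r))).
   rewrite -!mulrA; congr (_ * _); rewrite mulrA mulrBr (cut_e hD aD th n T).1 /cut.
   by rewrite -[X in X - _]mulr1 -mulrBr -!mulrA.
  apply: opnM_le; rewrite -[leRHS]mul1r; apply: ler_pM; rewrite ?opn_ge0 //.
  apply: opnM_le; rewrite -[leRHS]mul1r; apply: ler_pM; rewrite ?opn_ge0 //.
   exact: (ec_opn hD aD th).
  apply: opnM_le; apply: ler_wpM2l=> //.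
  have := op_cut hD aD th sT n0 (bm_chi r) _ (ltW r0) ler01; rewrite mulr1; apply.
  - by split; [case: (bm_clip r)|exists r=> l; rewrite chiE; case: ifP; rewrite ?mulr1 ?mulr0 ?normr0 ?(ltW r0)].
  - by move=> l; rewrite chiE; case: ifP; rewrite ?mulr1 ?mulr0 ?normr0 ?(ltW r0).
  - by move=> l; rewrite chiE; case: ifP; rewrite ?normr1 ?normr0 ?ler01.
 have -> : X n = (1 - e' n) * X n + e' n * X n * (1 - er r) + e' n * X n * er r by rewrite -addrA -mulrDr subrK mulr1 -mulrDl subrK mul1r.
 apply: le_trans (opnD _ _) _; apply: lerD=> //.
 by apply: le_trans (opnD _ _) _; apply: lerD.
apply/cvgrPdist_le=> d d0.
(* Makes [4 a / r] at most [d/3]; with [r] fixed, the terms in [1/n] are then brought below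
   [d/2]. *)
pose r : R := 1 + 12 * a / d.
have r0 : 0 < r by rewrite ltr_pwDl // divr_ge0 // ?mulr_ge0 // ltW.
have i0 : 0 <= c^-1 by rewrite invr_ge0 ltW.
pose k := 4 * a + 2 / c * (a * (r + a)).
have k0 : 0 <= k.
 apply: addr_ge0; first exact: mulr_ge0.
 by apply: mulr_ge0; [exact: mulr_ge0|apply: mulr_ge0=> //; apply: addr_ge0=> //; exact: ltW].
have [n0 hn0] := nat_gt (2 * k / d); exists n0.+1=> // n /= nn.
rewrite sub0r normrN ger0_norm ?opn_ge0 //; apply: le_trans (opX n) _.
have n1 : (0 < n)%N by apply: leq_trans nn.
have n2 : 0 < n%:R :> R by rewrite ltr0n.
apply: le_trans (bnd n r n1 r0) _.
have b1 : 4 * a / r <= d / 3.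
 rewrite ler_pdivrMr // /r mulrDr mulr1.
 have -> : d / 3 * (12 * a / d) = 4 * a by field; rewrite gt_eqF.
 by rewrite lerDr divr_ge0 // ltW.
have b2 : k / n%:R <= d / 2.
 rewrite ler_pdivrMr //; have : 2 * k / d <= n%:R.
  by apply: ltW; apply: lt_le_trans hn0 _; rewrite ler_nat ltnW.
 by rewrite ler_pdivrMr // mulrC; lra.
have -> : 4 * a / n%:R + 4 * a / r + 2 / c * (a * ((r + a) / n%:R)) = k / n%:R + 4 * a / r by rewrite /k; ring.
by lra.
Qed.

(** [h = pos01 - 1/2 - k], and the functions of [D_n] and [D] agree off [E_n], so [JJ n T - JJ n 0]
    equals [tr(P_n - P)] minus the change of [tr k]. Each part converges, the first to the index by
    [index_lim]. *)
Lemma gap_formula : JJ D (hh e) n T - JJ D (hh e) n 0 @[n --> \oo] -->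
 codim_index (hdot K) tau (PP D) (PP DT) - tr (fn DT (kk e)) + tr (fn D (kk e)).
Proof.
have bp := bm_pos01; have bh := bm_hh e0; have bk := bm_kk e0.
have tP n : tc (PP (Dn n) - PP D).
 have -> : PP (Dn n) - PP D = (PP (Dn n) - PP D) * ec D n.
  apply/eqP; rewrite -subr_eq0 -[X in X - _]mulr1 -mulrBr mulrBl corner_compl // subrr //.
 apply: tcM; first by apply: inNB; exact: inN_fn.
 by case: (fp_tc (ec_fp hD aD th n)).
have thn n s : 0 < s -> fp (fn (Dn n) (gs s)) by move=> s0; exact: (th_perturb (sC n) (hC n) s0).
have tkn n : tc (fn (Dn n) (kk e)) by exact: (tc_kk (hDn n) (@aDn n) e0 (thn n)).
have tk : tc (fn D (kk e)) by exact: tc_kk.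
have tec n : tc (ec D n) by case: (fp_tc (ec_fp hD aD th n)).
have E n : JJ D (hh e) n T - JJ D (hh e) n 0 = tr (PP (Dn n) - PP D) - tr (fn (Dn n) (kk e)) + tr (fn D (kk e)).
 have ce0 : cut D n 0 = 0 by rewrite /cut mulr0 mul0r.
 rewrite /JJ ce0 perturb0 -trB; [|exact: (tcMr (inN_fn (hDn n) (@aDn n) bh) (tec n))|exact: (tcMr (inN_fn hD aD bh) (tec n))].
 have hE D' : dsa D' -> fn D' (hh e) = PP D' - rso 2^-1 1 - fn D' (kk e).
  move=> h'; rewrite /PP -(fn_cst h') -!fnB //;
   try exact: (bmB bp (bm_cst _)); try exact: (bm_cst (2^-1 : R)).
  by congr fn; apply/funext=> l; rewrite /kk; ring.
 have -> : ec D n * fn (perturb D (cut D n T)) (hh e) - ec D n * fn D (hh e) = fn (Dn n) (hh e) - fn D (hh e).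
  have c1 := ec_comm hD aD th n sT bh; have c2 := corner_compl n bh.
  rewrite c1 /ec [X in _ - X]fn_commute //; last exact: bm_chi.
  rewrite -/(ec D n) -/(Dn n); apply/eqP; rewrite -subr_eq0 -mulrBl; apply/eqP.
  have : (fn (Dn n) (hh e) - fn D (hh e)) * (1 - ec D n) = 0 by rewrite mulrBl c2 subrr.
  by rewrite mulrBr mulr1=> h; rewrite -opprB h oppr0.
 rewrite !hE // -trB // -trD //; last exact: tcB.
 congr tr; bop_lra.
under eq_fun do rewrite E.
apply: cvgD; last exact: cvg_cst.
apply: cvgB; last exact: trk_cvg.
apply: index_lim=> //.
- exact: PP_proj.
- exact: PP_proj.
- by move=> n; exact: PP_proj.
- exact: inN_fn.
- exact: inN_fn.
- by move=> n; exact: inN_fn.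
- exact: cmp_P.
- exact: PP_conv.
Qed.
End Gap.

(** * The potential and the index *)

Section Potential.
Local Notation mu := (@lebesgue_measure R).
Variable e : R.
Hypothesis e0 : 0 < e.

Lemma C1_lin S X : sa S -> inN S -> sa X -> inN X ->
 C1path 0 1 (fun s : R => S + rso s X) (fun=> X).
Proof.
move=> sS hS sX hX; split=> [t _|//|t _ r r0|t _ r r0].
- by split; [apply: saD=> //; exact: saR|apply: inND=> //; exact: inNR].
- exists 1=> // s _ _.
 have -> : S + rso s X - (S + rso t X) - rso (s - t) X = 0 by bop_lra.
 by rewrite opn0 mulr_ge0 // ltW.
- by exists 1=> // s _ _; rewrite subrr opn0 ltW.
Qed.

(** The integral of the one-form along the segment from [D] to [D + T], which by [JJ_WW] is the
    limit of [JJ n T - JJ n 0]. *)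
Definition WW D T : R := cc e * \int[mu]_(s in `[0, 1]) phi D e T (rso s T).

Section Base.
Variable D : operator K.
Hypotheses (hD : dsa D) (aD : aff D).
Hypothesis th : forall s, 0 < s -> fp (fn D (gs s)).

Lemma JJ_path (p q : R) A A' : p < q -> C1path p q A A' ->
 JJ D (hh e) n (A q) - JJ D (hh e) n (A p) @[n --> \oo] -->
 cc e * \int[mu]_(t in `[p, q]) phi D e (A' t) (A t).
Proof.
have [C0 _ _] := CC_bds e0.
exact: (JJ_cvg hD aD e0 th (bm_hh e0) C0 (cc_ge0 e0) (hh_lip e0) (cgs_lip e0) (cgs_bd e0) (hh_taylor e0)).
Qed.

Lemma JJ_WW T : sa T -> inN T ->
 JJ D (hh e) n T - JJ D (hh e) n 0 @[n --> \oo] --> WW D T.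
Proof.
move=> sT hT; have := JJ_path ltr01 (C1_lin (@sa0 _ K) (inN0) sT hT).
rewrite /WW rso1 rso0 !add0r.
by under eq_Rintegral do rewrite add0r.
Qed.

(** Both sides are limits of [JJ n (A q) - JJ n (A p)], in which only the end points occur. *)
Lemma WW_path (p q : R) A A' : p < q -> C1path p q A A' ->
 cc e * \int[mu]_(t in `[p, q]) phi D e (A' t) (A t) = WW D (A q) - WW D (A p).
Proof.
move=> pq cA; have [s1 h1] := c1_sa cA (introT andP (conj (lexx p) (ltW pq))).
have [s2 h2] := c1_sa cA (introT andP (conj (ltW pq) (lexx q))).
have lim := cvgB (JJ_WW s2 h2) (JJ_WW s1 h1).
apply: (cvg_unique _ (JJ_path pq cA)) => //.
change (JJ D (hh e) n (A q) - JJ D (hh e) n (A p) @[n --> \oo] --> WW D (A q) - WW D (A p)).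
suff -> : (fun n => JJ D (hh e) n (A q) - JJ D (hh e) n (A p)) =
 (fun n => JJ D (hh e) n (A q) - JJ D (hh e) n 0 - (JJ D (hh e) n (A p) - JJ D (hh e) n 0)) by exact: lim.
by apply/funext=> n; ring.
Qed.

(** Changing the base point changes the potential by a constant: the segment from [S] to [S + T] is
    one more path. *)
Lemma WW_shift S T : sa S -> inN S -> sa T -> inN T ->
 WW (perturb D S) T = WW D (S + T) - WW D S.
Proof.
move=> sS hS sT hT; have cl := C1_lin sS hS sT hT.
have := WW_path ltr01 cl; rewrite rso1 rso0 addr0=> <-.
by congr (_ * _); apply: eq_Rintegral=> s _; rewrite /phi perturb_perturb.
Qed.

Lemma th_pert S : sa S -> inN S -> forall s, 0 < s -> fp (fn (perturb D S) (gs s)).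
Proof.
move=> sS hS s s0; have [M M0 hM] := theta_bd hD aD e0 th s0 (opn_ge0 S).
by case: (hM S sS hS (lexx _)).
Qed.
End Base.

Lemma WW_gap D T (c : R) : dsa D -> aff D -> (forall s, 0 < s -> fp (fn D (gs s))) ->
 sa T -> inN T -> 0 < c -> fn (perturb D T) \1_(`](- c), c[%classic) = 0 ->
 WW D T = codim_index (hdot K) tau (PP D) (PP (perturb D T))
     - tr (fn (perturb D T) (kk e)) + tr (fn D (kk e)).
Proof.
move=> hD aD th sT hT c0 gap.
exact: (cvg_unique _ (JJ_WW hD aD th sT hT) (gap_formula hD aD e0 c0 th sT hT gap)).
Qed.

Lemma codim_same P : proj P -> inN P -> codim_index (hdot K) tau P P = 0.
Proof. by move=> pP hP; rewrite -(index_tc pP pP hP hP) subrr ?tr0 //; exact: tc0. Qed.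

(* Replacing D by D + sgn(D) opens the spectral gap (-1, 1) without changing
 the projection on the nonnegative part. *)
Lemma gap_open D : dsa D -> let S := fn D sg in
 PP (perturb D S) = PP D /\ fn (perturb D S) \1_(`](- 1), 1[%classic) = 0.
Proof.
move=> hD; have bs := bm_sg.
split; rewrite /PP (fn_perturb hD bs).
- congr fn; apply/funext=> l; rewrite /pos01 sgE.
 by case: (lerP 0 l) => h; [rewrite ifT //; lra|rewrite ifF //; apply/negbTE; rewrite -ltNge; lra].
- exact: bm_pos01.
- rewrite -(fn0 hD); congr fn; apply/funext=> l; rewrite indE memNset //= in_itv /= sgE.
 by move=> /andP[]; case: (lerP 0 l) => h; lra.
- by apply: bm_ind; exact: measurable_itv.
Qed.

(** Let [V] be the sign of [D + T]. Both [D -> D + T + V] and [D + T -> D + T + V] end at an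
    operator with a gap, so [WW_gap] applies to each. The second index vanishes because [V] leaves
    the nonnegative projection unchanged, and subtracting removes the trace at [D + T + V]. *)
Lemma WW_index0 D T : dsa D -> aff D -> (forall s, 0 < s -> fp (fn D (gs s))) ->
 sa T -> inN T ->
 WW D T = codim_index (hdot K) tau (PP D) (PP (perturb D T))
     - tr (fn (perturb D T) (kk e)) + tr (fn D (kk e)).
Proof.
move=> hD aD th sT hT.
have hDT : dsa (perturb D T) by exact: dsa_perturb.
have aDT : aff (perturb D T) by exact: affil_perturb.
have thT := th_pert hD aD th sT hT.
have sV : sa (fn (perturb D T) sg) by apply: fn_sa=> //; exact: bm_sg.
have hV : inN (fn (perturb D T) sg) by apply: inN_fn=> //; exact: bm_sg.
have [eP gap] := gap_open hDT.
have := WW_gap hDT aDT thT sV hV ltr01 gap.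
rewrite (WW_shift hD aD th sT hT sV hV).
have gap' := gap; rewrite perturb_perturb in gap'.
rewrite (WW_gap hD aD th (saD sT sV) (inND hT hV) ltr01 gap') -perturb_perturb eP.
rewrite codim_same; [|exact: PP_proj|by apply: inN_fn=> //; exact: bm_pos01].
lra.
Qed.

Lemma WW_index D S T : dsa D -> aff D -> (forall s, 0 < s -> fp (fn D (gs s))) ->
 sa S -> inN S -> sa T -> inN T ->
 WW D T - WW D S = codim_index (hdot K) tau (PP (perturb D S)) (PP (perturb D T))
     - tr (fn (perturb D T) (kk e)) + tr (fn (perturb D S) (kk e)).
Proof.
move=> hD aD th sS hS sT hT.
have sX : sa (T - S) by exact: saB.
have hX : inN (T - S) by exact: inNB.
have := WW_shift hD aD th sS hS sX hX; rewrite [S + _]addrC subrK=> <-.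
rewrite (WW_index0 (dsa_perturb hD sS) (affil_perturb aD hS) (th_pert hD aD th sS hS) sX hX).
by rewrite perturb_perturb [S + _]addrC subrK.
Qed.
End Potential.

(** * Pieces of a path: integrals and derivatives *)

Section Pieces.
Local Notation mu := (@lebesgue_measure R).

Lemma near_within (I : set R) (t : R) (Q : R -> Prop) :
 (\forall s \near within I (nbhs t), Q s) <->
 exists2 d : R, 0 < d & forall s, I s -> `|s - t| < d -> Q s.
Proof.
split=> [/nbhs_normP[d d0 h]|[d d0 h]]; first by exists d=> // s Is st; apply: (h s) => //=; rewrite distrC.
by apply/nbhs_normP; exists d=> // s /= st Is; apply: h=> //; rewrite distrC.
Qed.

(** [op_deriv] is two-sided and may take its default value at the ends of a piece; two points do not
    affect the integral. *)
Lemma int_open (g h : R -> R) p q : p < q -> mu.-integrable `[p, q] (EFin \o h) ->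
 (forall t, p < t < q -> g t = h t) ->
 mu.-integrable `[p, q] (EFin \o g) /\
 \int[mu]_(t in `[p, q]) g t = \int[mu]_(t in `[p, q]) h t.
Proof.
move=> pq ih gh.
have E t : t \in `]p, q[%classic -> g t = h t by rewrite inE /= in_itv /= => /gh.
have io : mu.-integrable `]p, q[ (EFin \o h) by apply: integrableS ih=> //; exact: subset_itv_oo_cc.
have mo : measurable_fun `]p, q[ g.
 apply: (eq_measurable_fun h) => [t|]; first by move=> /E ->.
 by apply/measurable_EFinP; case/integrableP: io.
have ic : mu.-integrable `[p, q] (EFin \o g).
 apply/integrableP; split; first by apply/measurable_EFinP; exact: measurable_fun_itv_cc mo.
 have ma : measurable_fun `]p, q[ (fun t => `|(g t)%:E|%E) by apply/measurableT_comp=> //; exact/measurable_EFinP.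
 rewrite (integral_itv_bndoo true false ma).
 have -> : (\int[mu]_(z in `]p, q[) `|(g z)%:E| = \int[mu]_(z in `]p, q[) `|(h z)%:E|)%E by apply: eq_integral=> t /E ->.
 by case/integrableP: io.
have e1 := integral_itv_bndoo true false ((measurable_EFinP _ _).2 mo).
have e2 := integral_itv_bndoo true false (measurable_int mu io).
split; [exact: ic|rewrite /Rintegral e1 e2].
by congr fine; apply: eq_integral=> t /E /= ->.
Qed.

Lemma int_glue (g : R -> R) p q r : p < q -> q < r ->
 mu.-integrable `[p, q] (EFin \o g) -> mu.-integrable `[q, r] (EFin \o g) ->
 mu.-integrable `[p, r] (EFin \o g) /\
 \int[mu]_(t in `[p, r]) g t = \int[mu]_(t in `[p, q]) g t + \int[mu]_(t in `[q, r]) g t.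
Proof.
move=> pq qr i1 i2.
have i3 : mu.-integrable `]q, r] (EFin \o g) by apply: integrableS i2=> //; exact: subset_itv_oc_cc.
have eU : `[p, r]%classic = `[p, q] `|` `]q, r] :> set R by apply: itv_bndbnd_setU; rewrite bnd_simp ltW.
have dj : [disjoint `[p, q]%classic & (`]q, r]%classic : set R)].
 apply/disj_setPS=> t [] /=; rewrite !in_itv /= => /andP[_ h1] /andP[h2 _].
 by move: (le_lt_trans h1 h2); rewrite ltxx.
have [m1 b1] := integrableP _ _ _ i1; have [m3 b3] := integrableP _ _ _ i3.
have mU : measurable_fun (`[p, q] `|` `]q, r]) (EFin \o g) by apply/measurable_funU.
have ip : mu.-integrable `[p, r] (EFin \o g).
 rewrite eU; apply/integrableP; split=> //.
 rewrite ge0_integral_setU //; first exact: lte_add_pinfty.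
 exact: measurableT_comp.
split=> //; rewrite eU Rintegral_setU // -?eU //; congr (_ + _).
by rewrite Rintegral_itv_obnd_cbnd.
Qed.

Lemma partition_ind (Q : R -> R -> Prop) a b s :
 (forall p q r, p < q -> q < r -> Q p q -> Q q r -> Q p r) ->
 a < b -> itv_partition a b s ->
 (forall i, (i < size s)%N -> Q (nth b (a :: s) i) (nth b (a :: s) i.+1)) -> Q a b.
Proof.
move=> tQ; elim: s a=> [|z s IH] a ab hs hQ.
 by move: ab; rewrite (itv_partition_nil hs) ltxx.
have [/= /andP[az pz] lz] := hs; have hz : itv_partition z b s by split.
have Qz := hQ 0%N isT; case: (eqVneq z b) => [zb|zb].
 by move: Qz; rewrite /= zb.
have zltb : z < b by rewrite lt_neqAle zb (itv_partition_le hz).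
by apply: (tQ a z b) => //; apply: IH=> // i si; exact: (hQ i.+1).
Qed.

Section Derivative.
Variables (p q : R) (A : R -> K -> K) (F : R -> bop K).
Hypotheses (pq : p < q) (AF : forall t, p <= t <= q -> A t = F t).
Hypothesis FN : forall t, p <= t <= q -> sa (F t) /\ inN (F t).

(** A sequence tending to [t] inside the interval without meeting it: from the right, or from the
    left when [t = q]. It serves one-sided derivatives and interior ones alike. *)
Lemma approach t : p <= t <= q -> exists u : nat -> R, forall n,
 [/\ p <= u n <= q, u n != t & `|u n - t| <= (q - p) / n.+1%:R].
Proof.
move=> /andP[pt tq]; have [lt|] := ltP t q; last first.
 move=> qt; exists (fun n => q - (q - p) / n.+1%:R) => n.
 have -> : t = q by apply/eqP; rewrite eq_le tq qt.
 have n0 : 0 < n.+1%:R :> R by rewrite ltr0n.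
 have h1 : 0 < (q - p) / n.+1%:R by rewrite divr_gt0 // subr_gt0.
 have h2 : (q - p) / n.+1%:R <= q - p by rewrite ler_pdivrMr // ler_peMr ?ler1n // subr_ge0 ltW.
 move: h1 h2; set y := _ / _=> h1 h2.
 split; [by apply/andP; split; lra|by rewrite lt_eqF //; lra|].
 by rewrite addrAC subrr add0r normrN gtr0_norm.
exists (fun n => t + (q - t) / n.+1%:R) => n.
have n0 : 0 < n.+1%:R :> R by rewrite ltr0n.
have h1 : 0 < (q - t) / n.+1%:R by rewrite divr_gt0 // subr_gt0.
have h2 : (q - t) / n.+1%:R <= q - t by rewrite ler_pdivrMr // ler_peMr ?ler1n // subr_ge0 ltW.
move: h1 h2; set y := _ / _=> h1 h2.
split; [by apply/andP; split; lra|by rewrite gt_eqF //; lra|].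
by rewrite addrAC subrr add0r gtr0_norm // /y ler_pM2r ?invr_gt0 //; lra.
Qed.

Lemma deriv_quot t B (u : nat -> R) : p <= t <= q -> is_op_deriv `[p, q]%classic A t B ->
 (forall n, [/\ p <= u n <= q, u n != t & `|u n - t| <= (q - p) / n.+1%:R]) ->
 forall r : R, 0 < r -> exists n0, forall n, (n0 <= n)%N -> forall x,
  nm (rso (u n - t)^-1 (F (u n) - F t) x - B x) <= r * nm x.
Proof.
move=> ht dB hu r r0; have /near_within[d d0 h] := dB r r0.
have [n0 hn] := nat_gt ((q - p) / d); exists n0=> n nn x.
have [un ut ud] := hu n; have n1 : 0 < n.+1%:R :> R by rewrite ltr0n.
have lt : `|u n - t| < d.
 apply: le_lt_trans ud _; rewrite ltr_pdivrMr // mulrC -ltr_pdivrMr //.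
 by apply: lt_le_trans hn _; rewrite ler_nat leqW.
have [_ /(_ x)] := h (u n) un lt.
have k0 : u n - t != 0 by rewrite subr_eq0.
have e1 : (A (u n) - A t - (u n - t)%:C *: B) x =
  rs (u n - t) (rso (u n - t)^-1 (F (u n) - F t) x - B x).
 rewrite opR /rs scalerBr scalerA -rmorphM mulfV // scale1r opB -(AF un) -(AF ht) //.
by rewrite e1 !normE nmZ -rmorphM lecR [r * _]mulrC -mulrA ler_pM2l ?normr_gt0.
Qed.

(** The derivative is given as a bare function. As a limit of difference quotients it is linear,
    bounded, self-adjoint and, by strong closedness, in [N]. *)
Lemma deriv_bop t B : p <= t <= q -> is_op_deriv `[p, q]%classic A t B ->
 exists G : bop K, [/\ (G : K -> K) = B, sa G & inN G].
Proof.
move=> ht dB; have [u hu] := approach ht; have hq := deriv_quot ht dB hu.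
set Q := fun n => rso (u n - t)^-1 (F (u n) - F t).
have cB x : cv (fun n => Q n x) (B x).
 apply/cvP=> r r0; have k0 : 0 < nm x + 1 by rewrite ltr_wpDl ?nm_ge0.
 have [n0 h] := hq (r / (nm x + 1)) (divr_gt0 r0 k0); exists n0=> n nn.
 apply: le_lt_trans (h n nn x) _; rewrite mulrAC ltr_pdivrMr // ltr_pM2l //; lra.
have linB : linear B.
 move=> k x y; apply: (cv_uniq (cB _)); have := cvD (cvZ k (cB x)) (cB y).
 by congr (cv _ _); apply/funext=> n; rewrite !opX.
have [n0 h] := hq 1 ltr01.
have bB x : nm (B x) <= (opn (Q n0) + 1) * nm x.
 have -> : B x = Q n0 x - (Q n0 x - B x) by rewrite subKr.
 apply: le_trans (nmB _ _) _; rewrite mulrDl; apply: lerD; first exact: opnP.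
 exact: h.
exists (mkbop (bounded_lin linB bB)).
have sc : scv Q (mkbop (bounded_lin linB bB)) by move=> x; exact: cB.
have hQ n : sa (Q n) /\ inN (Q n).
 have [un _ _] := hu n; have [s1 i1] := FN un; have [s2 i2] := FN ht.
 by split; [apply: saR; exact: saB|apply: inNR; exact: inNB].
split=> //; first by apply: scv_sa sc=> n; exact: (hQ n).1.
by apply: inN_scv sc=> n; exact: (hQ n).2.
Qed.

(** At interior points a derivative relative to the piece is one relative to the whole line, and
    difference quotients along one sequence show that it is unique. *)
Lemma op_derivE t B : p < t < q -> is_op_deriv `[p, q]%classic A t B -> op_deriv A t = B.
Proof.
move=> /andP[pt tq] dB; have ht : p <= t <= q by rewrite !ltW.
have [u hu] := approach ht; apply: xget_unique.
 move=> r r0; apply/near_within; have /near_within[d d0 h] := dB r r0.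
 exists (Num.min d (Num.min (t - p) (q - t))) => [|s _].
  by rewrite !lt_min d0 !subr_gt0 pt tq.
 rewrite !lt_min=> /and3P[h1 h2 h3]; apply: h=> //=; rewrite in_itv /=.
 by move: h2 h3; rewrite !ltr_norml; lra.
move=> B' dB'; have dB2 : is_op_deriv `[p, q]%classic A t B'.
 move=> r r0; have /near_within[d d0 h] := dB' r r0.
 by apply/near_within; exists d=> // s _; exact: h.
have hB := deriv_quot ht dB hu; have hB' := deriv_quot ht dB2 hu.
apply/funext=> x; apply/eqP; rewrite -subr_eq0; apply/eqP; apply: nm_eq0.
apply/eqP; rewrite eq_le nm_ge0 andbT; apply/ler_addgt0Pr=> r r0; rewrite add0r.
have k0 : 0 < 2 * (nm x + 1) by have := nm_ge0 x; lra.
have [n1 h1] := hB _ (divr_gt0 r0 k0); have [n2 h2] := hB' _ (divr_gt0 r0 k0).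
have := h1 _ (leq_addr n2 n1) x; have := h2 _ (leq_addl n1 n2) x.
set y := rso _ _ x=> a2 a1.
have -> : B' x - B x = (y - B x) - (y - B' x) by rewrite opprB [RHS]addrC addrA subrK.
apply: le_trans (nmB _ _) _; apply: le_trans (lerD a1 a2) _.
have -> : r / (2 * (nm x + 1)) * nm x + r / (2 * (nm x + 1)) * nm x = r * (nm x / (nm x + 1)) by field; rewrite gt_eqF //; have := nm_ge0 x; lra.
apply: ler_piMr; first exact: ltW.
by rewrite ler_pdivrMr ?mul1r; have := nm_ge0 x; lra.
Qed.

Lemma piece_C1 : op_C1 `[p, q]%classic A ->
 exists2 F', C1path p q F F' & forall t, p < t < q -> op_deriv A t = F' t.
Proof.
move=> [B [dB cB]].
have inI t : p <= t <= q -> `[p, q]%classic t by rewrite /= in_itv.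
have [|F' hF] := @choice _ _ (fun t (G : bop K) => p <= t <= q -> [/\ (G : K -> K) = B t, sa G & inN G]).
 move=> t; have [ht|ht] := pselect (p <= t <= q); last by exists 0=> /ht.
 by have [G hG] := deriv_bop ht (dB t (inI t ht)); exists G.
exists F'; last first.
 move=> t tpq; have ht : p <= t <= q by case/andP: tpq=> *; rewrite !ltW.
 by have [-> _ _] := hF t ht; apply: op_derivE=> //; apply: dB; exact: inI.
split=> //.
- by move=> t /hF[].
- move=> t ht r r0; have /near_within[d d0 h] := dB t (inI t ht) r r0.
 exists (d / 2) => [|s hs sd]; first by rewrite divr_gt0.
 have sd' : `|s - t| < d by apply: le_lt_trans sd _; lra.
 have := h s (inI s hs) sd'; rewrite (AF hs) (AF ht); have [<- _ _] := hF t ht=> hl.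
 by have /opn_leE[] : opnorm_le (F s - F t - rso (s - t) (F' t) : bop K) (r * `|s - t|) by exact: hl.
- move=> t ht r r0; have /near_within[d d0 h] := cB t (inI t ht) r r0.
 exists (d / 2) => [|s hs sd]; first by rewrite divr_gt0.
 have sd' : `|s - t| < d by apply: le_lt_trans sd _; lra.
 have := h s (inI s hs) sd'; have [<- _ _] := hF t ht; have [<- _ _] := hF s hs=> hl.
 by have /opn_leE[] : opnorm_le (F' s - F' t : bop K) r by exact: hl.
Qed.
End Derivative.
End Pieces.

Lemma sapE (T : K -> K) : self_adjoint_part (hdot K) N T ->
 exists G : bop K, [/\ T = G, sa G & inN G].
Proof.
move=> [NT aT]; have [bN _ _] := HN.
by exists (mkbop (bN _ NT)); split=> //; apply/is_adjointE.
Qed.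

Definition opcont p q (F : R -> bop K) :=
 forall t, p <= t <= q -> forall r, 0 < r -> exists2 d, 0 < d &
  forall s, p <= s <= q -> `|s - t| <= d -> opn (F s - F t) <= r.

Lemma cont_glue (F : R -> bop K) p q r : p < q -> q < r -> opcont p q F -> opcont q r F -> opcont p r F.
Proof.
move=> pq qr c1 c2 t /andP[pt tr] w w0; have [tq|qt|tq] := ltgtP t q.
- have [|d d0 h] := c1 t _ w w0; first by rewrite pt ltW.
 exists (Num.min d (q - t)) => [|u /andP[pu _]]; first by rewrite lt_min d0 subr_gt0.
 rewrite le_min=> /andP[ud]; rewrite ler_norml=> /andP[_ uq].
 by apply: (h u _ ud); rewrite pu; lra.
- have [|d d0 h] := c2 t _ w w0; first by rewrite tr ltW.
 exists (Num.min d (t - q)) => [|u /andP[_ ur]]; first by rewrite lt_min d0 subr_gt0.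
 rewrite le_min=> /andP[ud]; rewrite ler_norml=> /andP[uq _].
 by apply: (h u _ ud); rewrite ur andbT; lra.
- have [|d d0 h] := c1 t _ w w0; first by rewrite pt tq lexx.
 have [|d' d0' h'] := c2 t _ w w0; first by rewrite tr tq lexx.
 exists (Num.min d d') => [|u /andP[pu ur]]; first by rewrite lt_min d0.
 rewrite le_min=> /andP[ud ud']; have [uq|qu] := leP u q.
  by apply: (h u _ ud); rewrite pu.
 by apply: (h' u _ ud'); rewrite ur ltW.
Qed.

Lemma path_ex a b A : piecewise_C1_path (hdot K) N a b A ->
 exists F : R -> bop K, forall t, a <= t <= b -> [/\ A t = F t, sa (F t) & inN (F t)].
Proof.
move=> [_ hA _].
have [|F hF] := @choice _ _ (fun t (G : bop K) => a <= t <= b -> [/\ A t = G, sa G & inN G]).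
 move=> t; have [ht|ht] := pselect (a <= t <= b); last by exists 0=> /ht.
 by have [|G hG] := sapE (hA t _); [rewrite in_itv|exists G].
by exists F.
Qed.

(** * Assembly: path integrals and spectral flow *)

Section Assembly.
Local Notation mu := (@lebesgue_measure R).
Variables (D : operator K) (e : R).
Hypotheses (hD : dsa D) (aD : aff D) (e0 : 0 < e).
Hypothesis th : forall s, 0 < s -> fp (fn D (gs s)).

Lemma cc_gt0 : 0 < cc e.
Proof. by rewrite /cc sqrtr_gt0 divr_gt0 // pi_gt0. Qed.

Lemma heatE T : sa T -> heat (hdot K) e (perturb D T) = fn (perturb D T) (gs e).
Proof. by move=> sT; apply: funcalcE; [exact: dsa_perturb|exact: bm_gse]. Qed.

Lemma transformE T : sa T -> bounded_transform (hdot K) (perturb D T) = fn (perturb D T) FT.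
Proof. by move=> sT; apply: funcalcE; [exact: dsa_perturb|exact: bm_FT]. Qed.

(** The bounded transform keeps the sign, including the value at 0, so the nonnegative projection of
    [F_D] is that of [D]. *)
Lemma nonneg_transform T : sa T ->
 nonneg_proj (hdot K) (bounded_transform (hdot K) (perturb D T)) = PP (perturb D T).
Proof.
move=> sT; have hT := dsa_perturb hD sT; have bF := bm_FT; have bp := bm_pos01.
rewrite transformE //; rewrite [LHS](funcalcE (dsa_every (fn_sa hT bF)) bp) fn_every //.
congr (bfun (fn _ _)); apply/funext => l; rewrite /pos01 /= /FT.
by rewrite pmulr_lge0 // invr_gt0; exact: HT_gt0.
Qed.

Lemma trace_heat X T : sa X -> inN X -> sa T -> inN T ->
 tc (X * fn (perturb D T) (gs e)) /\
 op_trace (hdot K) N tau ((X : K -> K) \o heat (hdot K) e (perturb D T)) = (phi D e X T)%:C.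
Proof.
move=> sX hX sT hT; have fT := th_pert e0 hD aD th sT hT e0.
rewrite heatE //; split; first by apply: tcM=> //; case: (fp_tc fT).
exact: (ctr_sandwich sX hX fT).
Qed.

Section Path.
Variables (a b : R) (A : R -> K -> K) (F : R -> bop K).
Hypothesis pA : piecewise_C1_path (hdot K) N a b A.
Hypothesis AF : forall t, a <= t <= b -> [/\ A t = F t, sa (F t) & inN (F t)].
Let f t : R[i] := op_trace (hdot K) N tau (op_deriv A t \o heat (hdot K) e (perturb D (A t))).

Lemma path_facts : [/\
 opcont a b F,
 mu.-integrable `[a, b] (EFin \o (fun t => complex.Re (f t))),
 \int[mu]_(t in `[a, b]) complex.Re (f t) = (WW e D (F b) - WW e D (F a)) / cc e,
 mu.-integrable `[a, b] (EFin \o (fun t => complex.Im (f t))) &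
 \int[mu]_(t in `[a, b]) complex.Im (f t) = 0].
Proof.
have [ab _ [s [hs hC]]] := pA.
have ar (x y z c : R) : (y - x) / c + (z - y) / c = (z - x) / c by ring.
(* These statements are additive over adjacent intervals, so they pass from the pieces of the
   partition to the whole path. The imaginary part is carried along because the integrals are
   complex. *)
pose Q (p q : R) := [/\
 opcont p q F,
 mu.-integrable `[p, q] (EFin \o (fun t => complex.Re (f t))),
 \int[mu]_(t in `[p, q]) complex.Re (f t) = (WW e D (F q) - WW e D (F p)) / cc e,
 mu.-integrable `[p, q] (EFin \o (fun t => complex.Im (f t))) &
 \int[mu]_(t in `[p, q]) complex.Im (f t) = 0].
apply: (partition_ind (Q := Q) _ ab hs) => [p q r pq qr|i si].
- move=> [c1 i1 e1 j1 f1] [c2 i2 e2 j2 f2].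
 have [i3 e3] := int_glue pq qr i1 i2; have [j3 f3] := int_glue pq qr j1 j2.
 split; [exact: cont_glue pq qr c1 c2|exact: i3|rewrite e3 e1 e2; exact: ar|exact: j3|by rewrite f3 f1 f2 addr0].
set p := nth b (a :: s) i; set q := nth b (a :: s) i.+1.
have pq : p < q by have [hp _] := hs; apply: (pathP b hp).
have ap : a <= p by apply: itv_partition_nth_ge hs; rewrite ltnW.
have qb : q <= b by apply: itv_partition_nth_le hs.
have sub t : p <= t <= q -> a <= t <= b by move=> /andP[h1 h2]; rewrite (le_trans ap h1) (le_trans h2 qb).
have AF' t : p <= t <= q -> A t = F t by move=> /sub /AF[].
have FN t : p <= t <= q -> sa (F t) /\ inN (F t) by move=> /sub /AF[].
have [F' cF dF] := piece_C1 pq AF' FN (hC i si).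
have fE t : p < t < q -> f t = (phi D e (F' t) (F t))%:C.
 move=> tpq; have ht : p <= t <= q by case/andP: tpq=> *; rewrite !ltW.
 have [s1 h1] := FN t ht; have [s2 h2] := c1_sa' cF ht.
 by rewrite /f dF // AF' //; case: (trace_heat s2 h2 s1 h1).
have ip := within_int (phi_cont hD aD e0 th pq cF).
have [i1 e1] := int_open (g := fun t => complex.Re (f t)) pq ip (fun t ht => congr1 (@complex.Re R) (fE t ht)).
have [j1 f1] := int_open (g := fun t => complex.Im (f t)) (h := fun=> 0) pq (integrable0 _ _)
 (fun t ht => congr1 (@complex.Im R) (fE t ht)).
split=> //; first exact: c1_cont pq cF.
- by rewrite e1 -(WW_path e0 hD aD th pq cF) mulrAC divff ?mul1r // gt_eqF // cc_gt0.
- by rewrite f1 Rintegral_cst ?mul0r //; exact: measurable_itv.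
Qed.

Lemma integrand_int : cintegrable `[a, b]%classic f /\
 cint `[a, b]%classic f = ((WW e D (F b) - WW e D (F a)) / cc e)%:C.
Proof. by have [_ i1 e1 j1 f1] := path_facts; split=> //; rewrite /cint e1 f1. Qed.

Lemma alpha_int : cintegrable `[a, b]%classic (alpha_along (hdot K) N tau e D A) /\
 cint `[a, b]%classic (alpha_along (hdot K) N tau e D A) = (WW e D (F b) - WW e D (F a))%:C.
Proof.
have [_ i1 e1 j1 f1] := path_facts; have mI : measurable (`[a, b]%classic : set R) by exact: measurable_itv.
have ER : (fun t => complex.Re (alpha_along (hdot K) N tau e D A t)) = (fun t => cc e * complex.Re (f t)) by apply/funext=> t; rewrite -ReZ.
have EI : (fun t => complex.Im (alpha_along (hdot K) N tau e D A t)) = (fun t => cc e * complex.Im (f t)) by apply/funext=> t; rewrite -ImZ.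
have iZ (g : R -> R) : mu.-integrable `[a, b] (EFin \o g) -> mu.-integrable `[a, b] (EFin \o (fun t => cc e * g t)).
 move=> ig; have -> : EFin \o (fun t => cc e * g t) = (fun t => (cc e)%:E * (EFin \o g) t)%E.
  by apply/funext=> t; rewrite /= EFinM.
 exact: integrableZl.
split; [by split; rewrite ?ER ?EI; exact: iZ|].
rewrite /cint ER EI.
by rewrite !RintegralZl // e1 f1 mulr0 mulrC divfK // gt_eqF // cc_gt0.
Qed.

Let trk T := tr (fn (perturb D T) (kk e)).

(** By [WW_index] each essential codimension is the increment of the single function [V = WW + trk],
    so the sum telescopes to the same value for every admissible partition. *)
Lemma spectral_flowE : spectral_flow (hdot K) N tau a b (fun t => bounded_transform (hdot K) (perturb D (A t))) =
 WW e D (F b) + trk (F b) - (WW e D (F a) + trk (F a)).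
Proof.
have [ab _ _] := pA; have [cF _ _ _ _] := path_facts.
pose V t := WW e D (F t) + trk (F t).
have ar (w1 w2 i t1 t2 : R) : w2 - w1 = i - t2 + t1 -> i = w2 + t2 - (w1 + t1) by move=> ?; lra.
have cV p q : a <= p <= b -> a <= q <= b ->
  codim_index (hdot K) tau (nonneg_proj (hdot K) (bounded_transform (hdot K) (perturb D (A p))))
   (nonneg_proj (hdot K) (bounded_transform (hdot K) (perturb D (A q)))) = V q - V p.
 move=> /AF[-> s1 h1] /AF[-> s2 h2]; rewrite !nonneg_transform //.
 exact: (ar _ _ _ _ _ (WW_index e0 hD aD th s1 h1 s2 h2)).
apply: xget_unique.
- have bF := bm_FT; split; [|split].
 + move=> t; rewrite in_itv /= => /AF[-> sT hT]; have h' := dsa_perturb hD sT.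
  have aT := affil_perturb aD hT; have hF : inN (fn (perturb D (F t)) FT) by exact: inN_fn.
  rewrite transformE //; split.
   by split=> //; apply/is_adjointE; exact: fn_sa.
  split=> //; exists (fn (perturb D (F t)) FT : K -> K).
  have hc := cmp_ideal (cmp_cf h' aT (th_pert e0 hD aD th sT hT)).
  by split.
 + move=> t; rewrite /= in_itv /= => ht r r0; have [d d0 h] := cF t ht r r0.
  have [-> sT hT] := AF ht; apply/near_within; exists d=> // s; rewrite /= in_itv /= => hs sd.
  have [-> sS hS] := AF hs; rewrite !transformE //.
  apply/(opn_leE (fn (perturb D (F s)) FT - fn (perturb D (F t)) FT)); split; first exact: ltW.
  have := bounded_transform_lip (dsa_perturb hD sT) (saB sS sT).
  rewrite perturb_perturb [F t + _]addrC subrK=> h2; apply: le_trans h2 (h s hs (ltW sd)).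
 (* The trivial partition is already fine enough: any two of the projections differ by a compact
    element, so their distance modulo the ideal is 0. *)
 + exists [:: b]; split; first exact: itv_partition1.
   move=> [|//] _ /= t u; rewrite !in_itv /= => /AF[-> sT hT] /AF[-> sU hU].
   rewrite !nonneg_transform //.
   exists ((PP (perturb D (F t)) - PP (perturb D (F u)) : bop K) : K -> K).
    apply: cmp_ideal; have := cmp_P (dsa_perturb hD sU) (affil_perturb aD hU) (th_pert e0 hD aD th sU hU) (saB sT sU) (inNB hT hU).
    by rewrite perturb_perturb [F u + _]addrC subrK.
   exists 0; first by rewrite invr_gt0.
   rewrite subrr; split=> // x; rewrite [X in `|X|](_ : _ = 0) ?normr0 ?mul0r //.
  by rewrite big_nat1 /= cV ?lexx ?(ltW ab).
(* Uniqueness of the value, which the choice operator in [spectral_flow] requires. *)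
- move=> r [_ [_ [s [hs _ ->]]]].
 rewrite (eq_big_nat _ _ (F2 := fun i => V (nth b (a :: s) i.+1) - V (nth b (a :: s) i))).
  by rewrite telescope_sumr // (itv_partition_nth_size _ hs).
 move=> i /andP[_ si]; apply: cV.
  by rewrite (itv_partition_nth_ge (ltnW _) hs) // (itv_partition_nth_le (ltnW _) hs).
 by rewrite (itv_partition_nth_ge _ hs) // (itv_partition_nth_le _ hs).
Qed.
End Path.
End Assembly.

(** * The truncated eta invariant *)

Section EtaInvariant.
Local Notation mu := (@lebesgue_measure R).
Variables (D : operator K) (e : R).
Hypotheses (hD : dsa D) (aD : aff D) (e0 : 0 < e).
Hypothesis th : forall s, 0 < s -> fp (fn D (gs s)).

Lemma ker_projE : ker_proj (hdot K) D = fn D \1_[set 0].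
Proof.
apply: proj_on_eq=> [|x]; first exact: (fn_proj hD (measurable_set1 _)).
exact: ker_fn.
Qed.

(** The factor [2 sqrt(pi)] of [eta_formula] against the normalization [1/sqrt(pi)] leaves 2;
    equivalently [tr k] is half of eta plus half of the kernel trace. *)
Lemma trunc_etaE : trunc_eta_convergent (hdot K) N tau e D /\
 trunc_eta (hdot K) N tau e D = (2 * (tr (fn D (kk e)) - 2^-1 * ft (fn D \1_[set 0])))%:C.
Proof.
pose g (t : R) := tr (fn D (fun l => l * gs t l)) / Num.sqrt t.
have dE t : 0 < t -> dheat (hdot K) t D = fn D (fun l => l * gs t l).
 move=> t0; apply: funcalcE=> //; exact: bm_lgs.
have E t : t \in `[e, +oo[%classic -> trunc_eta_integrand (hdot K) N tau D t = (g t)%:C.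
 rewrite inE /= in_itv /= andbT=> et; have t0 := lt_le_trans e0 et.
 rewrite /trunc_eta_integrand dE // /g rmorphM; congr (_ * _); apply: ctr_sa.
  apply: fn_sa=> //; exact: bm_lgs.
 exact: (tc_lgs hD aD e0 th t0).
have [ig eg] := eta_formula hD aD e0 th.
split.
 split=> [t et|]; first by rewrite dE ?(lt_le_trans e0 et) //; exact: (tc_lgs hD aD e0 th (lt_le_trans e0 et)).
 split.
  by apply: eq_integrable ig=> [|t ht]; [exact: measurable_itv|rewrite /= E].
 by apply: (eq_integrable _ (cst 0)) => [|t ht|]; [exact: measurable_itv|rewrite /= E|exact: integrable0].
have r1 : \int[mu]_(t in `[e, +oo[) complex.Re (trunc_eta_integrand (hdot K) N tau D t) = \int[mu]_(t in `[e, +oo[) g t by apply: eq_Rintegral=> t /E ->.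
have r2 : \int[mu]_(t in `[e, +oo[) complex.Im (trunc_eta_integrand (hdot K) N tau D t) = \int[mu]_(t in `[e, +oo[) 0 by apply: eq_Rintegral=> t /E ->.
rewrite /trunc_eta /cint r1 r2.
rewrite Rintegral_cst ?mul0r; last exact: measurable_itv.
rewrite eg -[_ +i* 0]/(_%:C) -rmorphM; congr (_%:C).
by rewrite -/(sqpi) [2 * sqpi]mulrC -mulrA mulKf // gt_eqF // sqpi_gt0.
Qed.
End EtaInvariant.

End Semifinite.

Theorem corollary8p10 (R : realType)
    (H : completeNormedModType R[i]) (dot : {dot H for Num.conj})
    (N : set (H -> H)) (tau : (H -> H) -> \bar R)
    (B : completeNormedModType R[i]) (mul : B -> B -> B) (star : B -> B)
    (rho : B -> H -> H) (D0 : operator H) (e : R)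
    (Hhilbert : hilbert_space dot)
    (HN : von_neumann_algebra dot N) (Hpredual : separable_predual dot N)
    (Htau : fns_trace dot N tau)
    (HB : banach_star_algebra mul star)
    (Hmodule : theta_summable_module dot N tau mul star rho D0)
    (He : 0 < e) :
  [/\ (* alpha^e is well defined on D0 + N_sa *)
      (forall A X : H -> H, self_adjoint_part dot N A ->
         self_adjoint_part dot N X ->
         trace_class dot N tau (X \o heat dot e (perturb D0 A))),
      (* its integral depends only on the end points of the path *)
      (forall (a b a' b' : R) (A A' : R -> H -> H),
         piecewise_C1_path dot N a b A -> piecewise_C1_path dot N a' b' A' ->
         A a = A' a' -> A b = A' b' ->
         [/\ cintegrable `[a, b]%classic (alpha_along dot N tau e D0 A),
             cintegrable `[a', b']%classic (alpha_along dot N tau e D0 A') &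
             cint `[a, b]%classic (alpha_along dot N tau e D0 A) =
             cint `[a', b']%classic (alpha_along dot N tau e D0 A')]) &
      (* the spectral flow formula *)
      (forall (a b : R) (A : R -> H -> H), piecewise_C1_path dot N a b A ->
         let D t := perturb D0 (A t) in
         let integrand t :=
           op_trace dot N tau (op_deriv A t \o heat dot e (D t)) in
         [/\ cintegrable `[a, b]%classic integrand,
             trunc_eta_convergent dot N tau e (D a),
             trunc_eta_convergent dot N tau e (D b),
             trace_class dot N tau
               (ker_proj dot (D b) - ker_proj dot (D a)) &
             (spectral_flow dot N tau a b
                (fun t => bounded_transform dot (D t)))%:C =
             (Num.sqrt (e / pi))%:C * cint `[a, b]%classic integrand
             + 2^-1 * trunc_eta dot N tau e (D b) - 2^-1 * trunc_eta dot N tau e (D a)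
             + 2^-1 * op_trace dot N tau
                        (ker_proj dot (D b) - ker_proj dot (D a))])].
Proof.
(* The bundle unfolds to the given space and form, so the hypotheses transfer by conversion. *)
pose K := Hilb Hhilbert; have hD : @dsa R K D0 := module_self_adjoint Hmodule.
have aD : affiliated (hdot K) N D0 := module_affiliated Hmodule.
have hN : von_neumann_algebra (hdot K) N := HN; have hT : fns_trace (hdot K) N tau := Htau.
have th s : 0 < s -> @fp R K N tau (fn (K := K) D0 (gs s)).
 move=> s0; have bg := bm_gse hN hT s0; split.
  by apply: (pN_fn hN hT hD aD bg) => l; exact: ltW (gs_gt0 hN hT _ _).
 by have := module_theta Hmodule s0; rewrite /heat (funcalcE (K := K) hD bg).
have bopE (F G : bop K) : (F : K -> K) = G -> F = G by move=> h; apply: bop_ext=> x; rewrite h.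
split.
- move=> A X /(sapE hN hT)[F [-> sF hF]] /(sapE hN hT)[G [-> sG hG]].
 have [+ _] := trace_heat hN hT hD aD He th sG hG sF hF.
 by rewrite [heat _ _ _](heatE hN hT hD aD He th sF).
- move=> a b a' b' A A' pA pA' Aa Ab.
 have [F AF] := path_ex hN hT pA; have [F' AF'] := path_ex hN hT pA'.
 have [i1 ->] := alpha_int hN hT hD aD He th pA AF.
 have [i2 ->] := alpha_int hN hT hD aD He th pA' AF'.
 have ab : a <= b by case: pA=> /ltW.
 have ab' : a' <= b' by case: pA'=> /ltW.
 have [+ _ _] := AF a (introT andP (conj (lexx a) ab)).
 have [+ _ _] := AF' a' (introT andP (conj (lexx a') ab')).
 have [+ _ _] := AF b (introT andP (conj ab (lexx b))).
 have [+ _ _] := AF' b' (introT andP (conj ab' (lexx b'))).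
 rewrite Aa Ab=> -> /bopE <- -> /bopE <-; by split.
move=> a b A pA D integrand; have [F AF] := path_ex hN hT pA.
have ab : a <= b by case: pA=> /ltW.
have [ea s1 ha] := AF a (introT andP (conj (lexx a) ab)).
have [eb s2 hb] := AF b (introT andP (conj ab (lexx b))).
have [i1 c1] := integrand_int hN hT hD aD He th pA AF.
have eta T : @sa R K T -> @inN R K N T -> _ := fun sT iT => trunc_etaE hN hT (dsa_perturb hD sT) (affil_perturb hN hT aD iT) He (th_pert hN hT He hD aD th sT iT).
have ker T : @sa R K T -> @inN R K N T -> _ := fun sT iT => fp_ker hN hT (dsa_perturb hD sT) (affil_perturb hN hT aD iT) He (th_pert hN hT He hD aD th sT iT).
have [ka1 ka2] := eta _ s1 ha; have [kb1 kb2] := eta _ s2 hb.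
have fa := ker _ s1 ha; have fb := ker _ s2 hb.
have [ta tra] := fp_tc hN hT fa; have [tb trb] := fp_tc hN hT fb.
have kerp T : @sa R K T -> @inN R K N T -> _ := fun sT iT => ker_projE hN hT (dsa_perturb hD sT) (affil_perturb hN hT aD iT) He (th_pert hN hT He hD aD th sT iT).
rewrite /D ea eb [ker_proj _ (perturb D0 (F a))](kerp _ s1 ha) [ker_proj _ (perturb D0 (F b))](kerp _ s2 hb).
have bk : bm (\1_[set 0] : R -> R) by apply: bm_ind; exact: measurable_set1.
have tk := tcB hN hT tb ta.
have sk := saB (fn_sa (dsa_perturb hD s2) bk) (fn_sa (dsa_perturb hD s1) bk).
have kE := ctr_sa hN hT sk tk.
rewrite (trB hN hT tb ta) tra trb in kE.
split=> //.
rewrite [spectral_flow _ _ _ _ _ _](spectral_flowE hN hT hD aD He th pA AF) c1 ka2 kb2.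
have -> : op_trace dot N tau _ = _ := kE.
have h2 : 2^-1 = (2^-1 : R)%:C :> R[i] by rewrite fmorphV rmorph_nat.
(* The kernel traces subtracted inside the two eta terms cancel against the kernel term of the
   formula, leaving the increment of [WW + trk]. *)
have ar (c w1 w2 k1 k2 f1 f2 : R) : c != 0 -> (w2 + k2 - (w1 + k1))%:C = c%:C * ((w2 - w1) / c)%:C
  + 2^-1 * (2 * (k2 - 2^-1 * f2))%:C - 2^-1 * (2 * (k1 - 2^-1 * f1))%:C + 2^-1 * (f2 - f1)%:C :> R[i].
 move=> c0; rewrite h2 -!rmorphM -rmorphD -rmorphB -rmorphD [c * _]mulrC divfK //.
 by congr (_%:C); lra.
by apply: ar; rewrite gt_eqF // (cc_gt0 hN hT hD aD He th).
Qed.
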